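(* Let $M$ be a Riemannian manifold with boundary and of bounded geometry, with bounded geometry constants $R_1,R_2,R_3$ and $(C_K')_{K}$. There is $r_m>0$ and, for each $0<r<r_m$, there are constants $C_K>0$ ($K\in\mathbb{N}$) and $M_f\in\mathbb{N}$, all depending only on the bounded geometry constants (and on $r$), such that there exists a covering of $M$ by sets $\{U(x_i,r)\}_{i\in I}$, $I\subset\mathbb{Z}$, with the following properties: 1. For $i\ge0$: $x_i\in\partial M$ and $U(x_i,r)=Z(x_i,r,\tfrac{2R_2}{3})$. For $i<0$: $x_i\in M-N(\tfrac{R_2}{2})$ and $U(x_i,r)=B(x_i,r)$. 2. If $s<r_m$ and $x\in M$, then $B(x,s)\cap U(x_i,r)\neq\emptyset$ for at most $M_f$ of the $x_i$. 3. $\{U(x_i,r/2)\}_{i\in I}$ is a covering of $M$, too (where $U(x_i,r/2)$ is $Z(x_i,\tfrac r2,\tfrac{2R_2}{3})$ for $i\ge0$ and $B(x_i,\tfrac r2)$ for $i<0$). Moreover, to this covering a subordinate partition of unity $\{\varphi_i\}_{i\in I}$ exists such that in normal coordinates $$|D^\alpha\varphi_i|\le C_K\qquad\text{for all } i\in I \text{ and all } |\alpha|\le K .$$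
   Context: Notation. $(M^m,g)$ is a Riemannian manifold of fixed dimension $m$ with (possibly empty) boundary $\partial M$; $\nu$ is the unit inward normal field along $\partial M$; $d$ is the Riemannian distance; $B(x,r)=\{y\in M: d(x,y)<r\}$ for $x\in M$. $K:\partial M\times[0,\infty)\to M$, $K(x',t)=\exp^M_{x'}(t\nu_{x'})$ is the normal geodesic flow (where defined). For $p\in\partial M$, $Z(p,r_1,r_2)=K(B_{\partial M}(p,r_1)\times[0,r_2))$, where $B_{\partial M}(p,r_1)$ is the open metric ball in $\partial M$ with the induced Riemannian metric. $N(s)=K(\partial M\times[0,s])$ for $s\ge0$. In coordinates, $g_{ij}=g(\partial_i,\partial_j)$, $(g^{ij})$ is the inverse matrix, $D^\alpha$ is the partial derivative for the multi-index $\alpha$, $|\alpha|=\sum\alpha_i$. $B(0,r)$ denotes the open ball in Euclidean space (or in a tangent space). Charts. For $x\in M-\partial M$ and $r_3>0$ sufficiently small, identifying $T_xM$ with $\mathbb{R}^m$ via an orthonormal basis, the chart $\kappa_x:B(0,r_3)\to M$, $v\mapsto\exp^M_x(v)$, gives Gaussian coordinates of radius $r_3$. For $x'\in\partial M$, identifying $T_{x'}\partial M$ with $\mathbb{R}^{m-1}$ via an orthonormal basis, and $r_1,r_2>0$ small enough for injectivity, the chart $\kappa_{x'}:B(0,r_1)\times[0,r_2)\to M$, $(v,t)\mapsto\exp^M_y(t\nu_y)$ with $y=\exp^{\partial M}_{x'}(v)$, gives normal collar coordinates of width $(r_1,r_2)$. Normal coordinates (normal charts) are either of these. Bounded geometry.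 $M$ has bounded geometry if: (N) there is $r_C>0$ such that $\partial M\times[0,r_C)\to M$, $(x,t)\mapsto\exp_x(t\nu_x)$, is a diffeomorphism onto its image; (IC) the injectivity radius $r_{inj}(\partial M)$ is positive; (I) there is $r_i>0$ such that if $r\le r_i$ then for $x\in M-N(r)$ the exponential map is a diffeomorphism on $B(0,r)\subset T_xM$ onto its image; (B1) there exist $0<R_1\le r_{inj}(\partial M)$, $0<R_2\le r_C$, $0<R_3\le r_i$ and constants $C'_K>0$ (one for each $K$) such that in all normal collar coordinates of width $(r_1,r_2)$ with $r_1\le R_1$, $r_2\le R_2$ and all Gaussian coordinates of radius $r_3\le R_3$ one has $|D^\alpha g_{ij}|\le C'_K$ and $|D^\alpha g^{ij}|\le C'_K$ for all $|\alpha|\le K$. The numbers $R_1,R_2,R_3,C'_K$ are the bounded geometry constants of $M$. ''In normal coordinates'' in the claim means: in every normal chart $\kappa$ with width $(r_1,r_2)\le(R_1,R_2)$, respectively radius $r_3\le R_3$, the bound holds for $D^\alpha(\varphi_i\circ\kappa)$. *)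

(* Defs.v *)
From HB Require Import structures.
From mathcomp Require Import all_boot all_order all_algebra.
From mathcomp Require Import all_classical all_reals all_analysis.
Import Order.TTheory GRing.Theory Num.Theory.
Import numFieldNormedType.Exports.

Set Implicit Arguments.
Unset Strict Implicit.
Unset Printing Implicit Defensive.

Local Open Scope classical_set_scope.
Local Open Scope ring_scope.

(** * Calculus on subsets of R^n *)

(* Derivatives are taken along increments that stay in the set [S], so that
   they are two-sided in the interior of [S] and one-sided at the boundary of
   a half-space or at the end-points of an interval. *)
Definition increments {R : realType} {V : lmodType R} (S : set V) (x v : V) :
    set_system R :=
  within [set h : R | S (x + h *: v)] 0^'.

Definition diff_quotient {R : realType} {V : lmodType R} (f : V -> R)
    (x v : V) (h : R) : R :=
  h^-1 * (f (x + h *: v) - f x).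

Definition has_dderiv {R : realType} {V : lmodType R} (S : set V) (v : V)
    (f : V -> R) (x : V) : Prop :=
  cvg (diff_quotient f x v @ increments S x v).

Definition dderiv {R : realType} {V : lmodType R} (S : set V) (v : V)
    (f : V -> R) (x : V) : R :=
  lim (diff_quotient f x v @ increments S x v).

Definition ebase {R : realType} {n : nat} (i : 'I_n) : 'rV[R]_n :=
  delta_mx 0 i.

Definition pderiv {R : realType} {n : nat} (S : set 'rV[R]_n) (i : 'I_n)
    (f : 'rV[R]_n -> R) : 'rV[R]_n -> R :=
  dderiv S (ebase i) f.

Definition pderivs {R : realType} {n : nat} (S : set 'rV[R]_n) (s : seq 'I_n)
    (f : 'rV[R]_n -> R) : 'rV[R]_n -> R :=
  foldr (pderiv S) f s.

Definition Dalpha {R : realType} {n : nat} (S : set 'rV[R]_n)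
    (alpha : 'I_n -> nat) (f : 'rV[R]_n -> R) : 'rV[R]_n -> R :=
  pderivs S (flatten [seq nseq (alpha i) i | i <- enum 'I_n]) f.

Definition order_of {n : nat} (alpha : 'I_n -> nat) : nat :=
  (\sum_(i < n) alpha i)%N.

(* Meant for [S] relatively open in R^n or in a half-space of R^n. *)
Definition smooth_on {R : realType} {n : nat} (S : set 'rV[R]_n)
    (f : 'rV[R]_n -> R) : Prop :=
  forall s : seq 'I_n,
    {within S, continuous (pderivs S s f)} /\
    forall (i : 'I_n) x, S x -> has_dderiv S (ebase i) (pderivs S s f) x.

(* Row [i] is the partial derivative of [f] in the direction [i], hence a
   tangent vector with coordinates [v] is mapped to [v *m jac S f x]. *)
Definition jac {R : realType} {n p : nat} (S : set 'rV[R]_n)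
    (f : 'rV[R]_n -> 'rV[R]_p) (x : 'rV[R]_n) : 'M[R]_(n, p) :=
  \matrix_(i < n, k < p) pderiv S i (fun y => f y 0 k) x.

Definition bform {R : realType} {n : nat} (g : 'M[R]_n) (v w : 'rV[R]_n) : R :=
  (v *m g *m w^T) 0 0.

Definition enorm {R : realType} {n : nat} (v : 'rV[R]_n) : R :=
  Num.sqrt (bform 1%:M v v).

Definition eball {R : realType} {n : nat} (r : R) : set 'rV[R]_n :=
  [set v | enorm v < r].

(* R^(n+1) = R^n x R, with the last coordinate as the second factor. *)
Definition base {R : realType} {n : nat} (z : 'rV[R]_n.+1) : 'rV[R]_n :=
  col' ord_max z.

Definition height {R : realType} {n : nat} (z : 'rV[R]_n.+1) : R :=
  z 0 ord_max.

Definition ext {R : realType} {n : nat} (y : 'rV[R]_n) (t : R) : 'rV[R]_n.+1 :=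
  \row_j (if unlift ord_max j is Some k then y 0 k else t).

Definition half_space {R : realType} {n : nat} : set 'rV[R]_n.+1 :=
  [set z | 0 <= height z].

Definition cylinder {R : realType} {n : nat} (r1 r2 : R) : set 'rV[R]_n.+1 :=
  [set z | enorm (base z) < r1 /\ 0 <= height z < r2].

(** * Charts, smooth maps and diffeomorphisms *)

(* [cmap] matters on [cdom] only, and [cinv] on the image of [cdom] only. *)
Record chart (R : realType) (T : Type) (n : nat) := Chart {
  cdom : set T;
  cmap : T -> 'rV[R]_n;
  cinv : 'rV[R]_n -> T }.

Definition rel_open {T : topologicalType} (X A : set T) : Prop :=
  exists2 O : set T, open O & A = X `&` O.

Definition is_chart {R : realType} {T : topologicalType} {n : nat}
    (c : chart R T n.+1) : Prop :=
  [/\ open (cdom c),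
      rel_open half_space (cmap c @` cdom c),
      (forall x, cdom c x -> cinv c (cmap c x) = x),
      {within cdom c, continuous (cmap c)}
    & {within cmap c @` cdom c, continuous (cinv c)}].

Definition points {R : realType} {T : Type} {n : nat} {J : Type}
    (A : J -> chart R T n) : set T :=
  \bigcup_(j in [set: J]) cdom (A j).

Definition smooth_map {R : realType} {T T' : topologicalType} {n p : nat}
    {J J' : Type} (A : J -> chart R T n) (B : J' -> chart R T' p)
    (D : set T) (f : T -> T') : Prop :=
  {within D, continuous f} /\
  forall (i : J) (j : J') (k : 'I_p),
    smooth_on (cmap (A i) @` (cdom (A i) `&` D `&` f @^-1` cdom (B j)))
      (fun y => cmap (B j) (f (cinv (A i) y)) 0 k).

Definition diffeo_onto_image {R : realType} {T T' : topologicalType}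
    {n p : nat} {J J' : Type} (A : J -> chart R T n) (B : J' -> chart R T' p)
    (D : set T) (f : T -> T') : Prop :=
  [/\ f @` D `<=` points B,
      smooth_map A B D f,
      rel_open (points B) (f @` D)
    & exists g : T' -> T,
        (forall x, D x -> g (f x) = x) /\ smooth_map B A (f @` D) g].

Definition euclidean (R : realType) (n : nat) : unit -> chart R 'rV[R]_n n :=
  fun=> Chart setT id id.

Definition half_cylinder_chart {R : realType} {T : Type} {n : nat}
    (c : chart R T n) : chart R (T * R) n.+1 :=
  Chart [set p | cdom c p.1 /\ 0 <= p.2]
        (fun p => ext (cmap c p.1) p.2)
        (fun z => (cinv c (base z), height z)).

(** * Riemannian manifolds with boundary *)

(* An atlas, with the matrix of the metric in the coordinates of each chart.
   The points of the manifold are those of the domains of the charts; they may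
   form a proper subset of [T], so that the boundary of a manifold is described
   on the same type [T]. *)
Record rmfd (R : realType) (T : Type) (n : nat) := RMfd {
  idx : Type;
  ch : idx -> chart R T n;
  met : idx -> 'rV[R]_n -> 'M[R]_n }.

Definition coord_set {R : realType} {T : Type} {n : nat} (M : rmfd R T n)
    (i : idx M) : set 'rV[R]_n :=
  cmap (ch i) @` cdom (ch i).

Definition met_at {R : realType} {T : Type} {n : nat} (M : rmfd R T n)
    (i : idx M) (x : T) : 'M[R]_n :=
  met i (cmap (ch i) x).

Definition transition {R : realType} {T : Type} {n : nat} (M : rmfd R T n)
    (i j : idx M) (y : 'rV[R]_n) : 'rV[R]_n :=
  cmap (ch j) (cinv (ch i) y).

Definition riemannian_manifold {R : realType} {T : topologicalType} {n : nat}
    (M : rmfd R T n.+1) : Prop :=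
  [/\ hausdorff_space T /\ @second_countable T,
      points (@ch _ _ _ M) = setT,
      (forall i : idx M, is_chart (ch i)),
      (forall i j : idx M,
        let S := cmap (ch i) @` (cdom (ch i) `&` cdom (ch j)) in
        (forall k, smooth_on S (fun y => transition i j y 0 k)) /\
        (forall y, S y ->
           met i y = jac S (transition i j) y *m met j (transition i j y)
                     *m (jac S (transition i j) y)^T))
    & (forall i : idx M,
        [/\ (forall a b, smooth_on (coord_set i) (fun y => met i y a b)),
            (forall y, coord_set i y -> (met i y)^T = met i y)
          & (forall y v, coord_set i y -> v != 0 -> 0 < bform (met i y) v v)])].

Definition boundary {R : realType} {T : Type} {n : nat} (M : rmfd R T n.+1) :
    set T :=
  [set x | exists i : idx M, cdom (ch i) x /\ height (cmap (ch i) x) = 0].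

Definition boundary_chart {R : realType} {T : Type} {n : nat}
    (c : chart R T n.+1) : chart R T n :=
  Chart [set x | cdom c x /\ height (cmap c x) = 0]
        (fun x => base (cmap c x))
        (fun y => cinv c (ext y 0)).

(* The boundary, with the induced metric. *)
Definition bdry {R : realType} {T : Type} {n : nat} (M : rmfd R T n.+1) :
    rmfd R T n :=
  RMfd (fun i : idx M => boundary_chart (ch i))
       (fun i y => row' ord_max (col' ord_max (met i (ext y 0)))).

(** * Curves, distance and geodesics *)

Definition unit_itv {R : realType} : set R^o := [set t : R | 0 <= t <= 1].

Definition coord_curve {R : realType} {T : Type} {n : nat} (M : rmfd R T n)
    (i : idx M) (c : R -> T) (k : 'I_n) : R^o -> R :=
  fun t => cmap (ch i) (c t) 0 k.

Definition velocity {R : realType} {T : Type} {n : nat} (M : rmfd R T n)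
    (i : idx M) (c : R -> T) (t : R) : 'rV[R]_n :=
  \row_k dderiv unit_itv (1 : R^o) (coord_curve i c k) t.

Definition C1_arc {R : realType} {T : topologicalType} {n : nat}
    (M : rmfd R T n) (c : R -> T) : Prop :=
  {within unit_itv, continuous c} /\
  forall t : R, unit_itv t -> points (@ch _ _ _ M) (c t) /\
    forall i : idx M, cdom (ch i) (c t) -> forall k,
      has_dderiv unit_itv (1 : R^o) (coord_curve i c k) t /\
      velocity i c s 0 k @[s --> within unit_itv (nbhs t)]
        --> velocity i c t 0 k.

(* The value does not depend on the chart [i] around [c t]. *)
Definition speed {R : realType} {T : Type} {n : nat} (M : rmfd R T n)
    (c : R -> T) (t : R) : R :=
  xget 0 [set s | exists i : idx M, cdom (ch i) (c t) /\
    s = Num.sqrt (bform (met_at i (c t)) (velocity i c t) (velocity i c t))].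

(* [joined M x y l]: some piecewise C^1 curve of length [l] joins x to y. *)
Inductive joined {R : realType} {T : topologicalType} {n : nat}
    (M : rmfd R T n) (x : T) : T -> \bar R -> Prop :=
| joined_refl : joined M x x 0%E
| joined_arc (c : R -> T) (l : \bar R) :
    joined M x (c 0) l -> C1_arc M c ->
    joined M x (c 1)
      (l + \int[lebesgue_measure]_(t in `[0%R, 1%R]) (speed M c t)%:E)%E.

(* +oo between distinct connected components. *)
Definition rdist {R : realType} {T : topologicalType} {n : nat}
    (M : rmfd R T n) (x y : T) : \bar R :=
  ereal_inf [set l | joined M x y l].

Definition rball {R : realType} {T : topologicalType} {n : nat}
    (M : rmfd R T n) (x : T) (r : R) : set T :=
  [set y | points (@ch _ _ _ M) y /\ (rdist M x y < r%:E)%E].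

Definition christoffel {R : realType} {T : Type} {n : nat} (M : rmfd R T n)
    (i : idx M) (y : 'rV[R]_n) (k a b : 'I_n) : R :=
  let dg c p q := pderiv (coord_set i) c (fun z => met i z p q) y in
  2^-1 * \sum_(l < n) invmx (met i y) k l * (dg a b l + dg b a l - dg l a b).

Definition geodesic {R : realType} {T : topologicalType} {n : nat}
    (M : rmfd R T n) (c : R -> T) : Prop :=
  {within unit_itv, continuous c} /\
  forall t : R, unit_itv t -> points (@ch _ _ _ M) (c t) /\
    forall i : idx M, cdom (ch i) (c t) -> forall k,
      let vk : R^o -> R := fun s => velocity i c s 0 k in
      [/\ has_dderiv unit_itv (1 : R^o) (coord_curve i c k) t,
          has_dderiv unit_itv (1 : R^o) vk t
        & dderiv unit_itv (1 : R^o) vk t +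
          \sum_(a < n) \sum_(b < n) christoffel i (cmap (ch i) (c t)) k a b
            * velocity i c t 0 a * velocity i c t 0 b = 0].

(* [exp_to i x v y]: the exponential map is defined at the tangent vector of
   coordinates [v] at [x] in the chart [i], and has value [y]. *)
Definition exp_to {R : realType} {T : topologicalType} {n : nat}
    (M : rmfd R T n) (i : idx M) (x : T) (v : 'rV[R]_n) (y : T) : Prop :=
  cdom (ch i) x /\
  exists c : R -> T, [/\ geodesic M c, c 0 = x, velocity i c 0 = v & c 1 = y].

(* The rows of [E] are the coordinates of an orthonormal basis of T_x M. *)
Definition frame {R : realType} {T : Type} {n : nat} (M : rmfd R T n)
    (i : idx M) (x : T) (E : 'M[R]_n) : Prop :=
  cdom (ch i) x /\ E *m met_at i x *m E^T = 1%:M.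

(** * Normal geodesic flow and normal charts *)

Definition unit_inward_normal {R : realType} {T : Type} {n : nat}
    (M : rmfd R T n.+1) (i : idx M) (x : T) (nu : 'rV[R]_n.+1) : Prop :=
  [/\ cdom (ch i) x /\ height (cmap (ch i) x) = 0,
      bform (met_at i x) nu nu = 1,
      (forall j : 'I_n, bform (met_at i x) nu (ebase (lift ord_max j)) = 0)
    & 0 < height nu].

(* [Kflow M x t y]: K(x, t) is defined and equal to y. *)
Definition Kflow {R : realType} {T : topologicalType} {n : nat}
    (M : rmfd R T n.+1) (x : T) (t : R) (y : T) : Prop :=
  exists (i : idx M) (nu : 'rV[R]_n.+1),
    unit_inward_normal i x nu /\ exp_to i x (t *: nu) y.

Definition Nset {R : realType} {T : topologicalType} {n : nat}
    (M : rmfd R T n.+1) (s : R) : set T :=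
  [set y | exists x t, [/\ boundary M x, 0 <= t <= s & Kflow M x t y]].

Definition Zset {R : realType} {T : topologicalType} {n : nat}
    (M : rmfd R T n.+1) (p : T) (r1 r2 : R) : set T :=
  [set y | exists x t, [/\ rball (bdry M) p r1 x, 0 <= t < r2 & Kflow M x t y]].

(* [kappa] is the exponential map at [x] on the ball of radius [r], read in the
   orthonormal basis [E], and is a diffeomorphism onto its image. *)
Definition exp_chart {R : realType} {T : topologicalType} {n : nat}
    (M : rmfd R T n) (i : idx M) (x : T) (E : 'M[R]_n) (r : R)
    (kappa : 'rV[R]_n -> T) : Prop :=
  (forall v, eball r v -> exp_to i x (v *m E) (kappa v)) /\
  diffeo_onto_image (euclidean R n) (@ch _ _ _ M) (eball r) kappa.

Definition exp_diffeo {R : realType} {T : topologicalType} {n : nat}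
    (M : rmfd R T n) (x : T) (r : R) : Prop :=
  forall (i : idx M) E, frame i x E -> exists kappa, exp_chart i x E r kappa.

Definition inj_radius_at {R : realType} {T : topologicalType} {n : nat}
    (M : rmfd R T n) (x : T) : \bar R :=
  ereal_sup [set r%:E | r in [set r : R | 0 < r /\ exp_diffeo M x r]].

Definition inj_radius {R : realType} {T : topologicalType} {n : nat}
    (M : rmfd R T n) : \bar R :=
  ereal_inf [set inj_radius_at M x | x in points (@ch _ _ _ M)].

Definition gaussian_chart {R : realType} {T : topologicalType} {n : nat}
    (M : rmfd R T n.+1) (r3 : R) (kappa : 'rV[R]_n.+1 -> T) : Prop :=
  exists (x : T) (i : idx M) E,
    [/\ ~ boundary M x, frame i x E & exp_chart i x E r3 kappa].

Definition collar_chart {R : realType} {T : topologicalType} {n : nat}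
    (M : rmfd R T n.+1) (r1 r2 : R) (kappa : 'rV[R]_n.+1 -> T) : Prop :=
  exists (x : T) (i : idx (bdry M)) E,
    [/\ frame i x E,
        (forall z, cylinder r1 r2 z ->
           exists y, exp_to i x (base z *m E) y /\ Kflow M y (height z) (kappa z))
      & diffeo_onto_image (euclidean R n.+1) (@ch _ _ _ M)
          (cylinder r1 r2) kappa].

(* [kappa], with domain [D], is a normal chart of width at most [(R1, R2)],
   respectively of radius at most [R3]. *)
Definition normal_chart {R : realType} {T : topologicalType} {n : nat}
    (M : rmfd R T n.+1) (R1 R2 R3 : R) (D : set 'rV[R]_n.+1)
    (kappa : 'rV[R]_n.+1 -> T) : Prop :=
  (exists r1 r2, [/\ 0 < r1 <= R1, 0 < r2 <= R2, D = cylinder r1 r2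
                   & collar_chart M r1 r2 kappa]) \/
  (exists r3, [/\ 0 < r3 <= R3, D = eball r3 & gaussian_chart M r3 kappa]).

(* The matrix (g_ij) in the coordinates [kappa]; the value does not depend on
   the auxiliary chart [i] around [kappa z]. *)
Definition metric_in {R : realType} {T : Type} {n : nat} (M : rmfd R T n)
    (D : set 'rV[R]_n) (kappa : 'rV[R]_n -> T) (z : 'rV[R]_n) : 'M[R]_n :=
  xget 0 [set G | exists i : idx M, cdom (ch i) (kappa z) /\
    let J := jac D (fun y => cmap (ch i) (kappa y)) z in
    G = J *m met_at i (kappa z) *m J^T].

(** * Bounded geometry *)

Definition bounded_geometry {R : realType} {T : topologicalType} {n : nat}
    (M : rmfd R T n.+1) (R1 R2 R3 : R) (C' : nat -> R) : Prop :=
  exists rC ri : R,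
  [/\ 0 < rC /\
      (exists K : T * R -> T,
         (forall x t, boundary M x -> 0 <= t < rC -> Kflow M x t (K (x, t))) /\
         diffeo_onto_image
           (fun i : idx (bdry M) => half_cylinder_chart (ch i)) (@ch _ _ _ M)
           [set p | boundary M p.1 /\ 0 <= p.2 < rC] K),
      (0 < inj_radius (bdry M))%E,
      0 < ri /\
      (forall r x, 0 < r <= ri -> ~ Nset M r x -> exp_diffeo M x r),
      [/\ 0 < R1 /\ (R1%:E <= inj_radius (bdry M))%E,
          0 < R2 <= rC, 0 < R3 <= ri & forall K, 0 < C' K]
    & forall D kappa, normal_chart M R1 R2 R3 D kappa ->
      forall (K : nat) alpha, (order_of alpha <= K)%N ->
      forall z, D z -> forall a b,
        `|Dalpha D alpha (fun y => metric_in M D kappa y a b) z| <= C' K /\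
        `|Dalpha D alpha (fun y => invmx (metric_in M D kappa y) a b) z|
           <= C' K].

(** * Coverings and partitions of unity *)

Definition covers {T I : Type} (U : I -> set T) : Prop :=
  \bigcup_(i in [set: I]) U i = setT.

Definition Uset {R : realType} {T : topologicalType} {n : nat}
    (M : rmfd R T n.+1) (R2 : R) (I : set int) (x : I -> T) (r : R) (i : I) :
    set T :=
  if 0 <= \val i then Zset M (x i) r (2 * R2 / 3) else rball M (x i) r.

Definition partition_of_unity {R : realType} {T : topologicalType} {n : nat}
    (M : rmfd R T n) (I : choiceType) (U : I -> set T) (phi : I -> T -> R) :
    Prop :=
  [/\ (forall i (j : idx M),
         smooth_on (coord_set j) (fun y => phi i (cinv (ch j) y))),
      (forall i y, 0 <= phi i y <= 1),
      (forall i, closure [set y | phi i y != 0] `<=` U i),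
      (forall y : T, exists2 V : set T, nbhs y V &
         finite_set [set i | V `&` closure [set z | phi i z != 0] !=set0])
    & (forall y, \sum_(i \in [set: I]) phi i y = 1)].

(* Main.v *)
(** The estimates avoid all differential equations except for the uniqueness of geodesics.
    In a normal chart the bounds on [g] and its inverse make the Euclidean and the
    Riemannian length of vectors comparable, with a constant [L] that depends on [C' 0] only.
    So a curve of length [l] starting well inside a chart moves its coordinates by at most
    [L * l], and segments in the chart give curves of comparable length.  For maximal
    [e]-separated nets in the boundary and off the collar, with [e] a small multiple of
    [r], this yields the coverings, and counting cells of a grid in one chart bounds their
    multiplicity.

    A change of coordinates [F] between normal charts is an isometry of metrics with
    bounded derivatives: its first derivatives are bounded, and the transformation law of
    the Christoffel symbols expresses its second derivatives through the first ones and
    the metrics, so that all derivatives are bounded inductively.  Hence bump functions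
    transplanted from the charts have bounded derivatives in every normal chart, and so
    have their quotients by their locally finite sum, which is at least 1. *)

Require Import Defs.
From mathcomp Require Import all_boot all_order all_algebra.
From mathcomp Require Import all_classical all_reals all_analysis.
From mathcomp Require Import ring lra.
Import Order.TTheory GRing.Theory Num.Theory numFieldNormedType.Exports.
Set Implicit Arguments.
Unset Strict Implicit.
Unset Printing Implicit Defensive.
Local Open Scope classical_set_scope.
Local Open Scope ring_scope.

(** * Differentiation along sets that are open in an orthant *)

(** Every constant has to be fixed before the manifold is given. Hence the quantitative lemmas have
    the form [exists A, forall ...], and a bound is a statement at a single point that depends on
    germs only. The data of bounded geometry bound the derivatives of multi-indices, taken in one
    fixed order; symmetry of mixed derivatives turns them into bounds for all iterated derivatives,
    the form that inductions need. Derivatives are one-sided at the boundary. The calculus is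
    therefore made for sets relatively open in an orthant, which covers balls, cylinders and the
    images of atlas charts at once. The exponential map and the normal flow are relations: some
    geodesic with the given initial data ends at the point. Uniqueness of geodesics makes them
    single-valued; this identifies the centres of charts and turns flow lines into vertical lines of
    collar charts. Curves are never reversed. Inside a chart a short connection is turned around at
    the cost of [L ^+ 2], and reading a length in coordinates costs another [L]. In the count of
    overlaps such factors accumulate up to [L ^+ 5]; this dictates the size of [rmax]. *)

Definition orth {R : realType} {n : nat} (P : pred 'I_n) : set 'rV[R]_n :=
  [set z | forall k, P k -> 0 <= z 0 k].

Definition bx {R : realType} {n : nat} (x : 'rV[R]_n) (d : R) : set 'rV[R]_n :=
  [set y | forall k, `|y 0 k - x 0 k| < d].

(** Relatively open in some orthant: [xpred0] gives open sets of the whole space, [pred1 ord_max]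
    those of the half-space. Near each point the set contains a product of intervals, so coordinates
    may be changed one at a time without leaving it. *)
Definition good {R : realType} {n : nat} (S : set 'rV[R]_n) : Prop :=
  exists P : pred 'I_n, S `<=` orth P /\
    forall x, S x -> exists2 d : R, 0 < d & orth P `&` bx x d `<=` S.

Lemma nbhs_bx (R : realType) n (x : 'rV[R]_n) (d : R) : 0 < d -> nbhs x (bx x d).
Proof.
move=> d0; apply/nbhs_ballP; exists d => //= y xy k.
by have := xy.2 0 k; rewrite -ball_normE /= distrC.
Qed.

Lemma nbhs_bxP (R : realType) n (x : 'rV[R]_n) (A : set 'rV[R]_n) :
  nbhs x A -> exists2 d : R, 0 < d & bx x d `<=` A.
Proof.
move=> /nbhs_ballP[e /= e0 eA]; exists e => // y xy; apply: eA; split=> // i k.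
by rewrite -ball_normE /= distrC ord1; exact: xy.
Qed.

Lemma bxx (R : realType) n (x : 'rV[R]_n) (d : R) : 0 < d -> bx x d x.
Proof. by move=> d0 k; rewrite subrr normr0. Qed.

Lemma bx_le (R : realType) n (x : 'rV[R]_n) (d e : R) : d <= e -> bx x d `<=` bx x e.
Proof. by move=> de y xy k; exact: lt_le_trans (xy k) de. Qed.

Lemma within_contP (R : realType) n (S : set 'rV[R]_n) (f : 'rV[R]_n -> R) :
  {within S, continuous f} <->
  forall x, S x -> forall e : R, 0 < e -> exists2 d : R, 0 < d &
    forall y, S y -> bx x d y -> `|f y - f x| < e.
Proof.
rewrite subspace_continuousP; split=> H x Sx.
  move=> e e0; have /cvgrPdist_lt /(_ e e0) /nbhs_bxP[d d0 dH] := H x Sx.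
  by exists d => // y Sy xy; rewrite distrC; exact: dH.
apply/cvgrPdist_lt => e e0; have [d d0 dH] := H x Sx e e0.
apply: filterS (nbhs_bx x d0) => y xy Sy /=.
by rewrite distrC; exact: dH.
Qed.

(* Derivatives at 0 of a function of a real variable along a filter finer than
   the punctured neighbourhoods of 0. *)
Definition der {R : realType} (G : set_system R) (u : R -> R) (l : R) : Prop :=
  h^-1 * (u h - u 0) @[h --> G] --> l.

Definition punct {R : realType} (G : set_system R) : Prop :=
  forall A : set R, dnbhs (0 : R) A -> G A.

Lemma punct_neq0 (R : realType) (G : set_system R) : punct G -> \forall h \near G, h != 0.
Proof. by move=> G0; apply: G0; exact: withinT. Qed.

Lemma punct_id (R : realType) (G : set_system R) : punct G -> h @[h --> G] --> (0 : R).
Proof. by move=> G0 A A0; apply: G0; exact: cvg_within A0. Qed.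

Lemma der_near (R : realType) (G : set_system R) (u v : R -> R) (l : R) :
  Filter G -> (\forall h \near G, u h = v h) -> u 0 = v 0 -> der G u l -> der G v l.
Proof.
move=> FG uv uv0; rewrite /der; apply: cvg_trans; apply: near_eq_cvg.
by apply: filterS uv => h /= ->; rewrite uv0.
Qed.

Lemma der_cst (R : realType) (G : set_system R) (c : R) : Filter G -> der G (fun=> c) 0.
Proof.
move=> FG; rewrite /der; under eq_fun do rewrite subrr mulr0.
exact: cvg_cst.
Qed.

Lemma der_id (R : realType) (G : set_system R) : Filter G -> punct G -> der G id 1.
Proof.
move=> FG G0; rewrite /der; apply: (@cvg_trans _ ((fun=> 1 : R) @ G)); last exact: cvg_cst.
apply: near_eq_cvg; apply: filterS (punct_neq0 G0) => h h0.
by rewrite subr0 mulVf.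
Qed.

Lemma derD (R : realType) (G : set_system R) (u v : R -> R) (l m : R) :
  Filter G -> der G u l -> der G v m -> der G (fun h => u h + v h) (l + m).
Proof.
move=> FG ul vm; rewrite /der.
have -> : (fun h => h^-1 * (u h + v h - (u 0 + v 0))) =
  (fun h => h^-1 * (u h - u 0) + h^-1 * (v h - v 0)) by apply/funext => h; ring.
exact: cvgD.
Qed.

Lemma derZ (R : realType) (G : set_system R) (c : R) (u : R -> R) (l : R) :
  Filter G -> der G u l -> der G (fun h => c * u h) (c * l).
Proof.
move=> FG ul; rewrite /der.
have -> : (fun h => h^-1 * (c * u h - c * u 0)) =
  (fun h => c * (h^-1 * (u h - u 0))) by apply/funext => h; ring.
exact: cvgMl_tmp.
Qed.

Lemma der_sum (R : realType) (G : set_system R) (I : Type) (r : seq I)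
    (u : I -> R -> R) (l : I -> R) :
  Filter G -> (forall i, der G (u i) (l i)) ->
  der G (fun h => \sum_(i <- r) u i h) (\sum_(i <- r) l i).
Proof.
move=> FG ul; elim: r => [|i r IH].
  under eq_fun do rewrite big_nil; rewrite big_nil; exact: der_cst.
under eq_fun do rewrite big_cons; rewrite big_cons; exact: derD.
Qed.

Lemma sum_cvg (R : realType) (I T : Type) (r : seq I) (G : set_system T)
    (u : I -> T -> R) (l : I -> R) : Filter G -> (forall i, u i @ G --> l i) ->
  (\sum_(i <- r) u i h) @[h --> G] --> \sum_(i <- r) l i.
Proof.
move=> FG ul; elim: r => [|i r IH].
  under eq_fun do rewrite big_nil; rewrite big_nil; exact: cvg_cst.
under eq_fun do rewrite big_cons; rewrite big_cons; exact: cvgD.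
Qed.

Lemma der_cvg (R : realType) (G : set_system R) (u : R -> R) (l : R) :
  Filter G -> punct G -> der G u l -> u @ G --> u 0.
Proof.
move=> FG G0 ul.
have H : (u 0 + h * (h^-1 * (u h - u 0))) @[h --> G] --> u 0 + 0 * l.
  by apply: cvgD; [exact: cvg_cst|apply: cvgM => //; exact: punct_id].
rewrite mul0r addr0 in H; apply: cvg_trans H; apply: near_eq_cvg.
apply: filterS (punct_neq0 G0) => h h0.
by rewrite mulrA divff // mul1r addrC subrK.
Qed.

Lemma derM (R : realType) (G : set_system R) (u v : R -> R) (l m : R) :
  Filter G -> punct G -> der G u l -> der G v m ->
  der G (fun h => u h * v h) (l * v 0 + u 0 * m).
Proof.
move=> FG G0 ul vm; rewrite /der.
have -> : (fun h => h^-1 * (u h * v h - (u 0 * v 0))) =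
  (fun h => h^-1 * (u h - u 0) * v h + u 0 * (h^-1 * (v h - v 0))) by apply/funext => h; ring.
apply: cvgD; last exact: cvgMl_tmp.
by apply: cvgM => //; exact: der_cvg vm.
Qed.

Lemma der_unique (R : realType) (G : set_system R) (u : R -> R) (l m : R) :
  ProperFilter G -> der G u l -> der G u m -> l = m.
Proof. by move=> FG ul um; exact: cvg_unique ul um. Qed.

Lemma punct_incr (R : realType) (V : lmodType R) (S : set V) x v :
  punct (increments S x v).
Proof. by move=> A A0; exact: cvg_within A0. Qed.

Lemma incr_in (R : realType) (V : lmodType R) (S : set V) x v :
  \forall h \near increments S x v, S (x + h *: v).
Proof. by apply: withinT. Qed.

Global Instance incr_filter (R : realType) (V : lmodType R) (S : set V) x v :
  Filter (increments S x v).
Proof. exact: within_filter. Qed.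

Lemma diffqE (R : realType) (V : lmodType R) (S : set V) x v (f : V -> R) l :
  (diff_quotient f x v @ increments S x v --> l) =
  der (increments S x v) (fun h => f (x + h *: v)) l.
Proof. by rewrite /der /diff_quotient scale0r addr0. Qed.

Lemma incr_proper_of (R : realType) (V : lmodType R) (S : set V) x v :
  (forall e : R, 0 < e -> exists h, [/\ h != 0, `|h| < e & S (x + h *: v)]) ->
  ProperFilter (increments S x v).
Proof.
move=> H; split; last exact: incr_filter.
rewrite /increments /within /= /dnbhs /within /= => /nbhs_ballP[e /= e0 eH].
have [h [h0 he Sh]] := H e e0.
by apply: (eH h) => //; rewrite -ball_normE /= sub0r normrN.
Qed.

Lemma ebaseE (R : realType) n (i k : 'I_n) : (ebase i : 'rV[R]_n) 0 k = (k == i)%:R.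
Proof. by rewrite /ebase mxE eqxx. Qed.

Lemma orth_ebase (R : realType) n (P : pred 'I_n) (x : 'rV[R]_n) i (h : R) :
  orth P x -> 0 <= h -> orth P (x + h *: ebase i).
Proof.
move=> Px h0 k Pk; rewrite !mxE addr_ge0 ?Px // mulr_ge0 //.
Qed.

Lemma bx_ebase (R : realType) n (x : 'rV[R]_n) i (h d : R) :
  `|h| < d -> bx x d (x + h *: ebase i).
Proof.
move=> hd k; have -> : (x + h *: ebase i) 0 k - x 0 k = h * (k == i)%:R.
  by rewrite !mxE eqxx /= addrAC subrr add0r.
case: eqP => _; rewrite /= ?mulr1 ?mulr0 ?normr0 //.
exact: le_lt_trans (normr_ge0 h) hd.
Qed.

(** Positive steps in a coordinate direction never leave an orthant, so small ones stay in [S].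
    Limits along the increments are therefore unique, even at boundary points. *)
Lemma good_incr_proper (R : realType) n (S : set 'rV[R]_n) x i : good S -> S x ->
  ProperFilter (increments S x (ebase i)).
Proof.
move=> [P [SP /(_ _)]] H Sx; have [d d0 dS] := H _ Sx.
apply: incr_proper_of => e e0; exists (Num.min e d / 2).
have m0 : 0 < Num.min e d by rewrite lt_min e0.
have h0 : 0 < Num.min e d / 2 by rewrite divr_gt0.
rewrite gt_eqF // ger0_norm ?ltW //; split=> //.
  by rewrite ltr_pdivrMr // (le_lt_trans (_ : _ <= e)) ?ge_min ?lexx // ltr_pMr // ltr1n.
apply: dS; split; first by apply: orth_ebase; [exact: SP|exact: ltW].
apply: bx_ebase; rewrite ger0_norm ?ltW //.
by rewrite ltr_pdivrMr // (le_lt_trans (_ : _ <= d)) ?ge_min ?lexx ?orbT // ltr_pMr // ltr1n.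
Qed.

Lemma pderivP (R : realType) n (S : set 'rV[R]_n) (f : 'rV[R]_n -> R) x i :
  good S -> S x -> has_dderiv S (ebase i) f x ->
  der (increments S x (ebase i)) (fun h => f (x + h *: ebase i)) (pderiv S i f x).
Proof. by move=> gS Sx; rewrite /has_dderiv -diffqE => /cvg_ex[l Hl]; rewrite /pderiv /dderiv;
 have PF := good_incr_proper i gS Sx; rewrite (cvg_lim _ Hl).
Qed.

Lemma pderiv_der (R : realType) n (S : set 'rV[R]_n) (f : 'rV[R]_n -> R) x i l :
  good S -> S x ->
  der (increments S x (ebase i)) (fun h => f (x + h *: ebase i)) l ->
  has_dderiv S (ebase i) f x /\ pderiv S i f x = l.
Proof.
move=> gS Sx; rewrite -diffqE => Hl; split; first by apply/cvg_ex; exists l.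
have PF := good_incr_proper i gS Sx.
by rewrite /pderiv /dderiv (cvg_lim _ Hl).
Qed.

(** * Mean value theorem, differentiability and chain rule *)

Definition C1on {R : realType} {n : nat} (S : set 'rV[R]_n) (f : 'rV[R]_n -> R) : Prop :=
  [/\ {within S, continuous f},
      (forall i x, S x -> has_dderiv S (ebase i) f x)
    & forall i, {within S, continuous (pderiv S i f)}].

(** Where the line stays in [S] on both sides of [t], the derivative relative to [S] is an ordinary
    two-sided one, to which the mean value theorem applies. *)
Lemma is_derive_line (R : realType) n (S : set 'rV[R]_n) (f : 'rV[R]_n -> R) z k (t : R) :
  good S -> (\forall s \near t, S (z + s *: ebase k)) ->
  has_dderiv S (ebase k) f (z + t *: ebase k) ->
  is_derive t 1 (fun s => f (z + s *: ebase k)) (pderiv S k f (z + t *: ebase k)).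
Proof.
move=> gS nS dd.
have St : S (z + t *: ebase k) by exact: (nbhs_singleton nS).
have := pderivP gS St dd; rewrite -diffqE /diff_quotient => H.
have H2 : (fun h => h^-1 *: (f (z + (h *: 1 + t) *: ebase k) - f (z + t *: ebase k))) @ 0^'
   --> pderiv S k f (z + t *: ebase k).
  have -> : (fun h : R => h^-1 *: (f (z + (h *: 1 + t) *: ebase k) - f (z + t *: ebase k)))
   = (fun h : R => h^-1 * (f (z + t *: ebase k + h *: ebase k) - f (z + t *: ebase k))).
    by apply/funext => h; rewrite scalerDl [h%:A]mulr1 addrAC addrA.
  move=> A /H /= /=; rewrite /increments /within /= => HA.
  have nS' : \forall h \near (0:R)^', S (z + t *: ebase k + h *: ebase k).
    suff nS1 : \forall h \near (0:R), S (z + t *: ebase k + h *: ebase k) by exact: cvg_within nS1.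
    have : (t + h) @[h --> (0:R)] --> t + 0 by apply: cvgD; [exact: cvg_cst|exact: cvg_id].
    have nS0 : nbhs (t + 0) [set s | S (z + s *: ebase k)] by rewrite addr0.
    move=> Hc; have : \forall h \near (0:R), S (z + (t + h) *: ebase k) := Hc _ nS0.
    apply: filterS => h /=.
    by rewrite scalerDl addrA.
  have HA' : \forall h \near (0:R)^', S (z + t *: ebase k + h *: ebase k) ->
      A (h^-1 * (f (z + t *: ebase k + h *: ebase k) - f (z + t *: ebase k))) := HA.
    have : \forall h \near (0:R)^',
      A (h^-1 * (f (z + t *: ebase k + h *: ebase k) - f (z + t *: ebase k))).
      by apply: filterS2 HA' nS' => h /= H1 H3; exact: H1.
    by [].
split; first by apply/cvg_ex; eexists; exact: H2.
by rewrite /derive (cvg_lim _ H2).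
Qed.

Lemma orth_line (R : realType) n (P : pred 'I_n) (z : 'rV[R]_n) k (t s : R) :
  orth P z -> orth P (z + t *: ebase k) -> 0 <= s <= 1 ->
  orth P (z + (s * t) *: ebase k).
Proof.
move=> Pz Pt /andP[s0 s1] j Pj; have := Pz j Pj; have := Pt j Pj.
rewrite !mxE eqxx /=; case: (j == k); rewrite ?(mulr1, mulr0, addr0) // => H1 H2.
by nra.
Qed.

Lemma bx_line (R : realType) n (x z : 'rV[R]_n) k (t s d : R) :
  bx x d z -> bx x d (z + t *: ebase k) -> 0 <= s <= 1 ->
  bx x d (z + (s * t) *: ebase k).
Proof.
move=> Pz Pt /andP[s0 s1] j; have := Pz j; have := Pt j.
rewrite !mxE eqxx /=; case: (j == k); rewrite ?(mulr1, mulr0, addr0) //.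
move=> ha hb; pose m := Num.max `|z 0 j + t - x 0 j| `|z 0 j - x 0 j|.
apply: (@le_lt_trans _ _ m); last by rewrite gt_max ha.
have : `|z 0 j + t - x 0 j| <= m by rewrite le_max lexx.
have : `|z 0 j - x 0 j| <= m by rewrite le_max lexx orbT.
by rewrite !ler_norml => /andP[a1 a2] /andP[b1 b2]; apply/andP; split; nra.
Qed.

(* [u] will be a combination of values of functions along coordinate lines, as needed
   for double differences. *)
Lemma mvt01 (R : realType) (u du : R -> R) :
  (forall s : R, 0 < s < 1 -> is_derive s 1 u (du s)) ->
  (forall s : R, 0 <= s <= 1 -> forall e : R, 0 < e -> exists2 d : R, 0 < d &
     forall r, 0 <= r <= 1 -> `|r - s| < d -> `|u r - u s| < e) ->
  exists2 s : R, 0 < s < 1 & u 1 - u 0 = du s.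
Proof.
move=> H1 H2.
have D (s : R) : s \in `]0, 1[%R -> is_derive s 1 u (du s) by rewrite in_itv /=; exact: H1.
have C : {within `[0, 1], continuous u}.
  apply/subspace_continuousP => s /=; rewrite in_itv /= => s01.
  apply/cvgrPdist_lt => e e0; have [d d0 dH] := H2 s s01 e e0.
  apply/nbhs_ballP; exists d => //= r; rewrite -ball_normE /= => sr.
  rewrite in_itv /= => r01; rewrite distrC; apply: dH => //.
  by rewrite distrC.
have [s s01 E] := @MVT R u du 0 1 ltr01 D C.
exists s; first by move: s01; rewrite in_itv.
by rewrite E subr0 mulr1.
Qed.

Lemma sub_line_in (R : realType) n (P : pred 'I_n) (x z : 'rV[R]_n) k (t s d : R) :
  orth P z -> orth P (z + t *: ebase k) ->
  bx x d z -> bx x d (z + t *: ebase k) -> 0 < s < 1 ->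
  \forall r \near s, (orth P `&` bx x d) (z + (r * t) *: ebase k).
Proof.
move=> Pz Pt bz bt s01.
have : \forall r \near s, 0 < r < 1.
  by apply: (@near_in_itvoo R 0 1); rewrite in_itv.
apply: filterS => r /andP[r0 r1]; have r01 : 0 <= r <= 1 by rewrite !ltW.
by split; [exact: orth_line|exact: bx_line].
Qed.

Lemma is_derive_scale (R : realType) (u : R -> R) (t s l : R) :
  is_derive (s * t) 1 u l -> is_derive s 1 (fun r => u (r * t)) (t * l).
Proof.
move=> H; have h1 : is_derive s 1 (fun r : R => r * t) t.
  by apply: is_derive_eq; rewrite ?scaler0 ?addr0 ?add0r /GRing.scale /= ?mulr1.
by rewrite [t * l]mulrC; exact: (@is_derive1_comp R u (fun r => r * t) s l t).
Qed.

Lemma line_cont (R : realType) n (S : set 'rV[R]_n) (f : 'rV[R]_n -> R) P (x z : 'rV[R]_n) k (t d : R) :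
  {within S, continuous f} -> orth P `&` bx x d `<=` S ->
  orth P z -> orth P (z + t *: ebase k) ->
  bx x d z -> bx x d (z + t *: ebase k) ->
  forall s : R, 0 <= s <= 1 -> forall e : R, 0 < e -> exists2 d : R, 0 < d &
     forall r, 0 <= r <= 1 -> `|r - s| < d ->
     `|f (z + (r * t) *: ebase k) - f (z + (s * t) *: ebase k)| < e.
Proof.
move=> /within_contP cf dS Pz Pt bz bt s s01 e e0.
have inS r : 0 <= r <= 1 -> S (z + (r * t) *: ebase k).
  by move=> r01; apply: dS; split; [exact: orth_line|exact: bx_line].
have [d' d'0 H] := cf _ (inS s s01) e e0.
have t1 : 0 < `|t| + 1 by rewrite ltr_wpDl.
exists (d' / (`|t| + 1)); first by rewrite divr_gt0.
move=> r r01 rs; apply: H; first exact: inS.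
move=> j; rewrite !mxE eqxx /= opprD addrACA subrr add0r -mulrBl -mulrBl normrM normrM.
have -> : `|(j == k)%:R : R| = (j == k)%:R by case: (j == k); rewrite ?normr1 ?normr0.
move: rs; rewrite ltr_pdivlMr // => rs.
have := normr_ge0 (r - s); have := normr_ge0 t.
by case: (j == k) => h1 h2 /=; rewrite ?mulr1 ?mulr0 //; nra.
Qed.

Lemma mvt_line (R : realType) n (S : set 'rV[R]_n) f P (x z : 'rV[R]_n) k (t d : R) :
  good S -> C1on S f -> orth P `&` bx x d `<=` S ->
  orth P z -> orth P (z + t *: ebase k) ->
  bx x d z -> bx x d (z + t *: ebase k) ->
  exists xi, [/\ orth P xi, bx x d xi &
    f (z + t *: ebase k) - f z = pderiv S k f xi * t].
Proof.
move=> gS [cf df _] dS Pz Pt bz bt.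
have [||s s01 E] := @mvt01 R (fun s => f (z + (s * t) *: ebase k))
   (fun s => t * pderiv S k f (z + (s * t) *: ebase k)).
- move=> s s01; have := sub_line_in Pz Pt bz bt s01 => nS.
  have s01' : 0 <= s <= 1 by move: s01 => /andP[? ?]; rewrite !ltW.
  (* The parameter neighbourhood is transported from [s] to [s * t] by dividing by [t]; the
     degenerate segment is therefore treated apart. *)
  have [->|t0] := eqVneq t 0.
    rewrite mul0r; under eq_fun do rewrite mulr0 scale0r; exact: is_derive_cst.
  apply: (@is_derive_scale R (fun r => f (z + r *: ebase k))).
  apply: is_derive_line => //; last first.
    by apply: df; apply: dS; split; [exact: orth_line|exact: bx_line].
  have H : (r / t) @[r --> s * t] --> s * t / t by apply: cvgMr_tmp; exact: cvg_id.
  rewrite mulfK // in H; have : \forall r \near s * t,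
    (orth P `&` bx x d) (z + ((r / t) * t) *: ebase k) := H _ nS.
  apply: filterS => r /=.
  by rewrite divfK // => ?; exact: dS.
- exact: line_cont dS Pz Pt bz bt.
exists (z + (s * t) *: ebase k); have s01' : 0 <= s <= 1 by move: s01 => /andP[? ?]; rewrite !ltW.
split; [exact: orth_line|exact: bx_line|].
by move: E; rewrite mul1r mul0r scale0r addr0 => ->; rewrite mulrC.
Qed.

(** The staircase from [y'] at [j = 0] to [y] at [j = n], replacing one coordinate per step. Boxes
    and orthants are products, so all its corners stay in them. *)
Definition stair {R : realType} {n : nat} (y y' : 'rV[R]_n) (j : nat) : 'rV[R]_n :=
  \row_k (if (k < j)%N then y 0 k else y' 0 k).

Lemma stairS (R : realType) n (y y' : 'rV[R]_n) (k : 'I_n) :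
  stair y y' k.+1 = stair y y' k + (y 0 k - y' 0 k) *: ebase k.
Proof.
apply/rowP => j; rewrite !mxE eqxx /= ltnS leq_eqVlt.
have [->|jk] := eqVneq j k; first by rewrite eqxx ltnn /= mulr1 addrC subrK.
by rewrite mulr0 addr0 -val_eqE /= in jk *; rewrite (negbTE jk).
Qed.

Lemma mvt_stair (R : realType) n (S : set 'rV[R]_n) f P (x : 'rV[R]_n) d y y' :
  good S -> C1on S f -> orth P `&` bx x d `<=` S ->
  orth P y -> orth P y' -> bx x d y -> bx x d y' ->
  exists xi : 'I_n -> 'rV[R]_n, (forall k, orth P (xi k) /\ bx x d (xi k)) /\
    f y - f y' = \sum_k pderiv S k f (xi k) * (y 0 k - y' 0 k).
Proof.
move=> gS cf dS Py Py' by_ by'.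
have Ps j : orth P (stair y y' j).
  by move=> k Pk; rewrite mxE; case: ifP => _; [exact: Py|exact: Py'].
have bs j : bx x d (stair y y' j).
  by move=> k; rewrite mxE; case: ifP => _; [exact: by_|exact: by'].
have H (k : 'I_n) : exists xi, [/\ orth P xi, bx x d xi &
    f (stair y y' k.+1) - f (stair y y' k) = pderiv S k f xi * (y 0 k - y' 0 k)].
  have := Ps k.+1; have := bs k.+1; rewrite stairS => b1 b2.
  exact: mvt_line dS _ _ _ _.
have [xi Hxi] := choice H; exists xi; split; first by move=> k; have [] := Hxi k.
transitivity (f (stair y y' n) - f (stair y y' 0)).
  congr (f _ - f _); apply/rowP => k; rewrite mxE ?ltn_ord //.
rewrite -(telescope_sumr (fun j => f (stair y y' j))) // big_mkord.
by apply: eq_bigr => k _; have [_ _ ->] := Hxi k.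
Qed.

Lemma near_forall_fin (R : realType) n (I : finType) (S : set 'rV[R]_n)
    (Q : I -> 'rV[R]_n -> Prop) (x : 'rV[R]_n) :
  (forall i, exists2 d : R, 0 < d & forall y, S y -> bx x d y -> Q i y) ->
  exists2 d : R, 0 < d & forall y, S y -> bx x d y -> forall i, Q i y.
Proof.
move=> H; have [d Hd] := choice (fun i => let: ex_intro2 d d0 dH := H i in ex_intro _ d (conj d0 dH)).
exists (\big[Num.min/1]_i d i).
  by apply: lt_bigmin => // i _; have [] := Hd i.
move=> y Sy xy i; have [_] := Hd i; apply => //.
by apply: bx_le xy; exact: bigmin_le.
Qed.

(** The intermediate points of the staircase tend to [x], so continuity of the partial derivatives
    makes [f] differentiable in the total sense, also at the boundary. *)
Lemma total_diff (R : realType) n (S : set 'rV[R]_n) f x :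
  good S -> C1on S f -> S x -> forall e : R, 0 < e -> exists2 d : R, 0 < d &
  forall y, S y -> bx x d y ->
  `|f y - f x - \sum_k pderiv S k f x * (y 0 k - x 0 k)|
     <= e * \sum_k `|y 0 k - x 0 k|.
Proof.
move=> gS C1 Sx e e0; have [cf df cdf] := C1.
have [P [SP gd]] := gS; have [d1 d10 d1S] := gd x Sx.
have [d2 d20 d2H] := @near_forall_fin R n 'I_n S
  (fun k y => `|pderiv S k f y - pderiv S k f x| < e) x
  (fun k => (within_contP _ _).1 (cdf k) x Sx e e0).
exists (Num.min d1 d2); first by rewrite lt_min d10.
move=> y Sy xy.
have xy1 : bx x d1 y by apply: bx_le xy; rewrite ge_min lexx.
have xy2 : bx x d2 y by apply: bx_le xy; rewrite ge_min lexx orbT.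
have dS : orth P `&` bx x (Num.min d1 d2) `<=` S.
  by move=> z [Pz bz]; apply: d1S; split=> //; apply: bx_le bz; rewrite ge_min lexx.
have [|xi [Hxi ->]] := mvt_stair gS C1 dS (SP _ Sy) (SP _ Sx) xy.
  by apply: bxx; rewrite lt_min d10.
rewrite -sumrB mulr_sumr; apply: le_trans (ler_norm_sum _ _ _) _.
apply: ler_sum => k _; rewrite -mulrBl normrM ler_wpM2r //.
have [Pk bk] := Hxi k; apply/ltW/d2H; first exact: dS.
by apply: bx_le bk; rewrite ge_min lexx orbT.
Qed.

(** The inner map is only required to have derivatives along the filter [G]. The same statement thus
    serves for partial derivatives of compositions and for velocities of curves read in charts. *)
Lemma der_chain (R : realType) (G : set_system R) p (S : set 'rV[R]_p)
    (f : 'rV[R]_p -> R) (g : R -> 'rV[R]_p) (l : 'I_p -> R) :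
  Filter G -> punct G -> good S -> C1on S f -> S (g 0) ->
  (\forall h \near G, S (g h)) ->
  (forall k, der G (fun h => g h 0 k) (l k)) ->
  der G (fun h => f (g h)) (\sum_k pderiv S k f (g 0) * l k).
Proof.
move=> FG G0 gS C1 S0 nS dg.
pose L h := \sum_k pderiv S k f (g 0) * (h^-1 * (g h 0 k - g 0 0 k)).
have HL : L @ G --> \sum_k pderiv S k f (g 0) * l k.

  by apply: sum_cvg => k; apply: cvgMl_tmp; exact: dg.
have HN : (\sum_k `|h^-1 * (g h 0 k - g 0 0 k)|) @[h --> G] --> \sum_k `|l k|.
  by apply: sum_cvg => k; apply: cvg_norm; exact: dg.
rewrite /der; have -> : (fun h => h^-1 * (f (g h) - f (g 0))) =
  (fun h => L h + (h^-1 * (f (g h) - f (g 0)) - L h)) by apply/funext => h; ring.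
rewrite -[X in _ --> X]addr0; apply: cvgD => //.
apply/cvgrPdist_lt => e e0.
have N0 : 0 <= \sum_k `|l k| by apply: sumr_ge0.
set N := \sum_k `|l k| in HN N0.
(* [N] is the limit of the sum of the absolute difference quotients, which is eventually below
   [N + 1]; with this tolerance the remainder is at most [e / 2]. *)
have e1 : 0 < e / (2 * (N + 1)) by rewrite divr_gt0 // mulr_gt0 // ltr_wpDl.
have [d d0 dH] := total_diff gS C1 S0 e1.
have nb : \forall h \near G, bx (g 0) d (g h).
  have : forall k, \forall h \near G, `|g h 0 k - g 0 0 k| < d.
    move=> k; have /cvgrPdist_lt/(_ d d0) := der_cvg FG G0 (dg k).
    by apply: filterS => h; rewrite distrC.
  by move=> /filter_forall.
have nN : \forall h \near G, \sum_k `|h^-1 * (g h 0 k - g 0 0 k)| < N + 1.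
  by apply: (cvgr_lt N HN); rewrite ltrDl.
near=> h.
have h0 : h != 0 by near: h; exact: punct_neq0.
have Hd := dH (g h) (near nS h _) (near nb h _).
rewrite sub0r normrN.
have -> : h^-1 * (f (g h) - f (g 0)) - L h =
  h^-1 * (f (g h) - f (g 0) - \sum_k pderiv S k f (g 0) * (g h 0 k - g 0 0 k)).
  rewrite [RHS]mulrBr; congr (_ - _); rewrite mulr_sumr; apply: eq_bigr => k _; ring.
rewrite normrM; apply: le_lt_trans (_ : `|h^-1| * (e / (2 * (N + 1)) * \sum_k `|g h 0 k - g 0 0 k|) < _).
  by rewrite ler_wpM2l //; apply: Hd => //; near: h.
have -> : `|h^-1| * (e / (2 * (N + 1)) * \sum_k `|g h 0 k - g 0 0 k|) =
   e / (2 * (N + 1)) * \sum_k `|h^-1 * (g h 0 k - g 0 0 k)|.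
  rewrite mulrCA; congr (_ * _); rewrite mulr_sumr; apply: eq_bigr => k _; by rewrite normrM.
apply: lt_trans (_ : e / (2 * (N + 1)) * (N + 1) < _).
  by rewrite ltr_pM2l //; near: h.
have N1 : N + 1 != 0 by rewrite gt_eqF // ltr_wpDl.
have -> : e / (2 * (N + 1)) * (N + 1) = e / 2 by field.
by rewrite ltr_pdivrMr // ltr_pMr // ltr1n.
Unshelve. all: by end_near. Qed.

(** * Smooth functions and bounds for their derivatives *)

(** A derivative relative to a set depends on the set too, so two germs agree only if the domains
    coincide near the point as well as the functions on them. *)
Definition same_germ {R : realType} {V : normedModType R} (S : set V) (f : V -> R)
    (S' : set V) (f' : V -> R) (x : V) : Prop :=
  \forall y \near x, (S y <-> S' y) /\ (S y -> f y = f' y).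

Lemma near_line (R : realType) (V : normedModType R) (x v : V) (Q : V -> Prop) :
  (\forall y \near x, Q y) -> \forall h \near (0 : R)^', Q (x + h *: v).
Proof.
move=> nQ; suff nS1 : \forall h \near (0:R), Q (x + h *: v) by exact: cvg_within nS1.
have Hc : (x + h *: v) @[h --> (0:R)] --> x + (0 : R) *: v.
  by apply: cvgD; [exact: cvg_cst|apply: cvgZr_tmp; exact: cvg_id].
have nQ' : nbhs (x + (0 : R) *: v) Q by rewrite scale0r addr0.
exact: (Hc _ nQ').
Qed.

Lemma dderiv_germ (R : realType) (V : normedModType R) (S S' : set V) v f f' x :
  S x -> same_germ S f S' f' x ->
  diff_quotient f x v @ increments S x v = diff_quotient f' x v @ increments S' x v.
Proof.
move=> Sx sg; have fx : f x = f' x by have [_ /(_ Sx)] := nbhs_singleton sg.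
have nl := near_line v sg.
apply/predeqP => A; split=> H.
- have H1 : \forall h \near (0:R)^', S (x + h *: v) -> A (diff_quotient f x v h) := H.
  suff : \forall h \near (0:R)^', S' (x + h *: v) -> A (diff_quotient f' x v h) by [].
  apply: filterS2 H1 nl => h H1 [SS' ff'] /SS' Sh.
  by rewrite /diff_quotient -fx -ff' //; exact: H1.
- have H1 : \forall h \near (0:R)^', S' (x + h *: v) -> A (diff_quotient f' x v h) := H.
  suff : \forall h \near (0:R)^', S (x + h *: v) -> A (diff_quotient f x v h) by [].
  apply: filterS2 H1 nl => h H1 [SS' ff'] Sh.
  by rewrite /diff_quotient fx ff' //; apply: H1; exact/SS'.
Qed.

Lemma has_dderiv_germ (R : realType) (V : normedModType R) (S S' : set V) v f f' x :
  S x -> same_germ S f S' f' x -> has_dderiv S v f x -> has_dderiv S' v f' x.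
Proof. by move=> Sx sg; rewrite /has_dderiv (dderiv_germ v Sx sg). Qed.

Lemma pderiv_germ1 (R : realType) n (S S' : set 'rV[R]_n) i f f' x :
  S x -> same_germ S f S' f' x -> pderiv S i f x = pderiv S' i f' x.
Proof. by move=> Sx sg; rewrite /pderiv /dderiv (dderiv_germ _ Sx sg). Qed.

Lemma pderiv_germ (R : realType) n (S S' : set 'rV[R]_n) i f f' x :
  same_germ S f S' f' x -> same_germ S (pderiv S i f) S' (pderiv S' i f') x.
Proof.
move=> sg; have := nbhs_interior sg; apply: filterS => y sgy.
split; first by have [] := nbhs_singleton sgy.
by move=> Sy; exact: pderiv_germ1.
Qed.

Lemma same_germ_on (R : realType) n (S : set 'rV[R]_n) f f' x :
  (forall y, S y -> f y = f' y) -> same_germ S f S f' x.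
Proof. by move=> H; apply: (@filterE _ (nbhs x) (nbhs_filter x)) => y; split=> // /H. Qed.

Lemma pderivs_rcons (R : realType) n (S : set 'rV[R]_n) s i f :
  pderivs S (rcons s i) f = pderivs S s (pderiv S i f).
Proof. by rewrite /pderivs foldr_rcons. Qed.

Definition cont_at {R : realType} {n : nat} (S : set 'rV[R]_n) (f : 'rV[R]_n -> R) x :=
  f @ within S (nbhs x) --> f x.

Lemma within_cont_atP (R : realType) n (S : set 'rV[R]_n) (f : 'rV[R]_n -> R) :
  {within S, continuous f} <-> forall x, S x -> cont_at S f x.
Proof. exact: subspace_continuousP. Qed.

Lemma cont_at_germ (R : realType) n (S S' : set 'rV[R]_n) f f' x :
  S x -> same_germ S f S' f' x -> cont_at S f x -> cont_at S' f' x.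
Proof.
move=> Sx sg; have fx : f x = f' x by have [_ /(_ Sx)] := nbhs_singleton sg.
rewrite /cont_at -fx => H A /H H1.
have H2 : \forall y \near x, S y -> A (f y) := H1.
suff : \forall y \near x, S' y -> A (f' y) by [].
apply: filterS2 H2 sg => y H2 [SS' ff'] /SS' Sy.
by rewrite -ff' //; exact: H2.
Qed.

(** [smooth_on] speaks of all lists of directions at once. The product and chain rules mix a
    function with its derivatives and call for an induction on a finite order; [smooth_onP] links
    the two. *)
Fixpoint Ck {R : realType} {n : nat} (S : set 'rV[R]_n) (k : nat) (f : 'rV[R]_n -> R) : Prop :=
  (forall x, S x -> cont_at S f x) /\
  match k with
  | 0 => True
  | k'.+1 => (forall i x, S x -> has_dderiv S (ebase i) f x) /\
             (forall i, Ck S k' (pderiv S i f))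
  end.

Lemma CkS (R : realType) n (S : set 'rV[R]_n) k f : Ck S k.+1 f -> Ck S k f.
Proof.
elim: k f => [|k IH] f; first by case.
move=> [cf [df ckf]]; split=> //; split=> // i; apply: IH; exact: ckf.
Qed.

Lemma Ck_C1on (R : realType) n (S : set 'rV[R]_n) k f : Ck S k.+1 f -> C1on S f.
Proof.
move=> [cf [df ckf]]; split=> //; first exact/within_cont_atP.
by move=> i; apply/within_cont_atP; case: k ckf => [|k] /(_ i) [].
Qed.

Lemma smooth_onP (R : realType) n (S : set 'rV[R]_n) f :
  smooth_on S f <-> forall k, Ck S k f.
Proof.
split=> [sf k|Hf s].
  have : forall s, Ck S k (pderivs S s f).
    elim: k => [|k IH] s; first by split=> //; apply/within_cont_atP; have [] := sf s.
    have [cs ds] := sf s; split; first exact/within_cont_atP.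
    by split=> // i; exact: (IH (i :: s)).
  exact: (fun H => H [::]).
elim/last_ind: s f Hf => [|s i IH] f Hf /=.
  by have [cf [df _]] := Hf 1%N; split=> //; exact/within_cont_atP.
by rewrite pderivs_rcons; apply: IH => k; have [_ [_ H]] := Hf k.+1; exact: H.
Qed.

(** Membership in the class is a property of germs. This is what lets coordinate expressions be
    studied through an auxiliary atlas chart around each point. *)
Lemma Ck_local (R : realType) n (S : set 'rV[R]_n) k f :
  (forall x, S x -> exists S' f', [/\ S' x, same_germ S' f' S f x & Ck S' k f']) ->
  Ck S k f.
Proof.
elim: k f => [|k IH] f H; split=> //.
- by move=> x Sx; have [S' [f' [S'x sg [cf _]]]] := H x Sx; apply: cont_at_germ sg (cf _ _).
- by move=> x Sx; have [S' [f' [S'x sg [cf _]]]] := H x Sx; apply: cont_at_germ sg (cf _ _).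
split.
  move=> i x Sx; have [S' [f' [S'x sg [_ [df _]]]]] := H x Sx.
  exact: has_dderiv_germ S'x sg (df i x S'x).
move=> i; apply: IH => x Sx; have [S' [f' [S'x sg [_ [_ ck]]]]] := H x Sx.
by exists S', (pderiv S' i f'); split=> //; [exact: pderiv_germ|exact: ck].
Qed.

Lemma smooth_local (R : realType) n (S : set 'rV[R]_n) f :
  (forall x, S x -> exists S' f', [/\ S' x, same_germ S' f' S f x & smooth_on S' f']) ->
  smooth_on S f.
Proof.
move=> H; apply/smooth_onP => k; apply: Ck_local => x Sx.
by have [S' [f' [? ? /smooth_onP/(_ k) ?]]] := H x Sx; exists S', f'.
Qed.

Lemma Ck_eq (R : realType) n (S : set 'rV[R]_n) k f g :
  (forall x, S x -> f x = g x) -> Ck S k f -> Ck S k g.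
Proof. by move=> fg ck; apply: Ck_local => x Sx; exists S, f; split=> //; exact: same_germ_on. Qed.

Lemma smooth_eq (R : realType) n (S : set 'rV[R]_n) f g :
  (forall x, S x -> f x = g x) -> smooth_on S f -> smooth_on S g.
Proof. by move=> fg /smooth_onP ck; apply/smooth_onP => k; exact: Ck_eq (ck k). Qed.

Lemma smooth_sub (R : realType) n (S S' : set 'rV[R]_n) f :
  (forall x, S' x -> \forall y \near x, S y <-> S' y) ->
  smooth_on S f -> smooth_on S' f.
Proof.
move=> SS' sf; apply: smooth_local => x S'x; exists S, f; split=> //.
  by have H := nbhs_singleton (SS' x S'x); apply/H.
by apply: filterS (SS' x S'x) => y H; split.
Qed.

Lemma smooth_cont (R : realType) n (S : set 'rV[R]_n) f :
  smooth_on S f -> {within S, continuous f}.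
Proof. by move=> /(_ [::]) []. Qed.

Lemma smooth_dd (R : realType) n (S : set 'rV[R]_n) f i x :
  smooth_on S f -> S x -> has_dderiv S (ebase i) f x.
Proof. by move=> /(_ [::]) [_]; exact. Qed.

Lemma smooth_pderiv (R : realType) n (S : set 'rV[R]_n) f i :
  smooth_on S f -> smooth_on S (pderiv S i f).
Proof. by move=> sf s; have := sf (rcons s i); rewrite pderivs_rcons. Qed.

Lemma smooth_pderivs (R : realType) n (S : set 'rV[R]_n) f s :
  smooth_on S f -> smooth_on S (pderivs S s f).
Proof. by move=> sf; elim: s => //= i s; exact: smooth_pderiv. Qed.

Lemma smooth_C1 (R : realType) n (S : set 'rV[R]_n) f : smooth_on S f -> C1on S f.
Proof. by move=> /smooth_onP/(_ 1%N)/Ck_C1on. Qed.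

Lemma cont_at_cst (R : realType) n (S : set 'rV[R]_n) (c : R) x : cont_at S (fun=> c) x.
Proof. exact: cvg_cst. Qed.

Lemma cont_atD (R : realType) n (S : set 'rV[R]_n) f g x :
  cont_at S f x -> cont_at S g x -> cont_at S (fun z => f z + g z) x.
Proof. exact: cvgD. Qed.

Lemma cont_atM (R : realType) n (S : set 'rV[R]_n) f g x :
  cont_at S f x -> cont_at S g x -> cont_at S (fun z => f z * g z) x.
Proof. exact: cvgM. Qed.

Lemma cont_atV (R : realType) n (S : set 'rV[R]_n) f x :
  f x != 0 -> cont_at S f x -> cont_at S (fun z => (f z)^-1) x.
Proof. by move=> f0 cf; exact: cvgV. Qed.

Lemma cont_at_comp (R : realType) n p (S : set 'rV[R]_n) (S' : set 'rV[R]_p)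
    (F : 'rV[R]_n -> 'rV[R]_p) h x :
  (forall y, S y -> S' (F y)) -> (forall k, cont_at S (fun z => F z 0 k) x) ->
  cont_at S' h (F x) -> cont_at S (fun z => h (F z)) x.
Proof.
move=> SS' cF ch A /ch A'; have : \forall y \near F x, S' y -> A (h y) := A'.
move=> /nbhs_bxP[d d0 dH].
suff : \forall y \near x, S y -> A (h (F y)) by [].
have : forall k, \forall y \near x, S y -> `|F y 0 k - F x 0 k| < d.
  move=> k; have /cvgrPdist_lt/(_ d d0) H := cF k.
  have : \forall y \near x, S y -> `|F x 0 k - F y 0 k| < d := H.
  by apply: filterS => y; rewrite distrC.
move=> /filter_forall; apply: filterS => y Hy Sy; apply: dH; last exact: SS'.
by move=> k; exact: Hy.
Qed.

(** * Sums, products, inverses and compositions of smooth functions *)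

Lemma pderivD (R : realType) n (S : set 'rV[R]_n) f g i x : good S -> S x ->
  has_dderiv S (ebase i) f x -> has_dderiv S (ebase i) g x ->
  has_dderiv S (ebase i) (fun z => f z + g z) x /\
  pderiv S i (fun z => f z + g z) x = pderiv S i f x + pderiv S i g x.
Proof.
move=> gS Sx df dg; apply: pderiv_der => //.
by apply: derD; exact: pderivP.
Qed.

Lemma pderivM (R : realType) n (S : set 'rV[R]_n) f g i x : good S -> S x ->
  has_dderiv S (ebase i) f x -> has_dderiv S (ebase i) g x ->
  has_dderiv S (ebase i) (fun z => f z * g z) x /\
  pderiv S i (fun z => f z * g z) x = pderiv S i f x * g x + f x * pderiv S i g x.
Proof.
move=> gS Sx df dg; apply: pderiv_der => //.
have := derM (incr_filter S x (ebase i)) (@punct_incr _ _ S x (ebase i))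
  (pderivP gS Sx df) (pderivP gS Sx dg).
by rewrite scale0r addr0.
Qed.

Lemma pderiv_cst (R : realType) n (S : set 'rV[R]_n) (c : R) i x : good S -> S x ->
  has_dderiv S (ebase i) (fun=> c) x /\ pderiv S i (fun=> c) x = 0.
Proof. by move=> gS Sx; apply: pderiv_der => //; exact: der_cst. Qed.

Lemma pderiv_coord (R : realType) n (S : set 'rV[R]_n) (k i : 'I_n) x : good S -> S x ->
  has_dderiv S (ebase i) (fun z => z 0 k) x /\ pderiv S i (fun z => z 0 k) x = (k == i)%:R.
Proof.
move=> gS Sx; apply: pderiv_der => //.
have FI := incr_filter S x (ebase i).
have H := derD FI (der_cst (x 0 k) FI)
  (@derZ _ _ (k == i)%:R _ _ FI (der_id FI (@punct_incr _ _ S x (ebase i)))).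
rewrite add0r mulr1 in H; apply: der_near H => //.
  by apply: nearW => h; rewrite !mxE eqxx mulrC.
by rewrite !mxE mul0r mulr0.
Qed.

Lemma derV (R : realType) (G : set_system R) (u : R -> R) (l : R) :
  Filter G -> punct G -> u 0 != 0 -> der G u l ->
  der G (fun h => (u h)^-1) (- l * ((u 0)^-1 * (u 0)^-1)).
Proof.
move=> FG G0 u0 ul; rewrite /der.
have cu := der_cvg FG G0 ul.
have H : (- (h^-1 * (u h - u 0)) * ((u h)^-1 * (u 0)^-1)) @[h --> G] -->
    - l * ((u 0)^-1 * (u 0)^-1).
  apply: cvgM; first exact: cvgN.
  by apply: cvgM; [exact: cvgV|exact: cvg_cst].
apply: cvg_trans H; apply: near_eq_cvg.
have nu : \forall h \near G, u h != 0 by exact: cvgr_neq0 cu u0.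
apply: filterS2 (punct_neq0 G0) nu => h h0 uh; field.
by rewrite h0 uh u0.
Qed.

Lemma pderivV (R : realType) n (S : set 'rV[R]_n) f i x : good S -> S x -> f x != 0 ->
  has_dderiv S (ebase i) f x ->
  has_dderiv S (ebase i) (fun z => (f z)^-1) x /\
  pderiv S i (fun z => (f z)^-1) x = - pderiv S i f x * ((f x)^-1 * (f x)^-1).
Proof.
move=> gS Sx f0 df; apply: pderiv_der => //.
have := derV _ (@punct_incr _ _ S x (ebase i)) _ (pderivP gS Sx df).
by rewrite scale0r addr0; exact.
Qed.

Lemma pderiv_comp (R : realType) n p (S : set 'rV[R]_n) (S' : set 'rV[R]_p)
    (F : 'rV[R]_n -> 'rV[R]_p) h i x :
  good S -> good S' -> S x -> (forall y, S y -> S' (F y)) -> C1on S' h ->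
  (forall k, has_dderiv S (ebase i) (fun z => F z 0 k) x) ->
  has_dderiv S (ebase i) (fun z => h (F z)) x /\
  pderiv S i (fun z => h (F z)) x =
    \sum_k pderiv S' k h (F x) * pderiv S i (fun z => F z 0 k) x.
Proof.
move=> gS gS' Sx SS' C1h dF; apply: pderiv_der => //.
have := @der_chain R (increments S x (ebase i)) p S' h (fun t => F (x + t *: ebase i))
  (fun k => pderiv S i (fun z => F z 0 k) x) _ (@punct_incr _ _ S x (ebase i)) gS' C1h.
rewrite scale0r addr0; apply; first exact: SS'.
  by apply: filterS (incr_in S x (ebase i)) => t /SS'.
by move=> k; exact: (pderivP gS Sx (dF k)).
Qed.

Lemma Ck_cst (R : realType) n (S : set 'rV[R]_n) k (c : R) : good S -> Ck S k (fun=> c).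
Proof.
move=> gS; elim: k c => [|k IH] c; split=> //; try by move=> x _; exact: cont_at_cst.
split=> [i x Sx|i]; first by have [] := pderiv_cst c i gS Sx.
by apply: Ck_eq (IH 0) => x Sx; have [] := pderiv_cst c i gS Sx.
Qed.

Lemma CkD (R : realType) n (S : set 'rV[R]_n) k f g : good S -> Ck S k f -> Ck S k g ->
  Ck S k (fun z => f z + g z).
Proof.
move=> gS; elim: k f g => [|k IH] f g; first by move=> [cf _] [cg _]; split=> // x Sx; exact: cont_atD (cf x Sx) (cg x Sx).
move=> [cf [df kf]] [cg [dg kg]]; split; first by move=> x Sx; exact: cont_atD (cf x Sx) (cg x Sx).
have H i x Sx := pderivD gS Sx (df i x Sx) (dg i x Sx).
split=> [i x Sx|i]; first by have [] := H i x Sx.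
by apply: Ck_eq (IH _ _ (kf i) (kg i)) => x Sx; have [_ ->] := H i x Sx.
Qed.

Lemma CkM (R : realType) n (S : set 'rV[R]_n) k f g : good S -> Ck S k f -> Ck S k g ->
  Ck S k (fun z => f z * g z).
Proof.
move=> gS; elim: k f g => [|k IH] f g; first by move=> [cf _] [cg _]; split=> // x Sx; exact: cont_atM (cf x Sx) (cg x Sx).
move=> /[dup] Kf [cf [df kf]] /[dup] Kg [cg [dg kg]]; split; first by move=> x Sx; exact: cont_atM (cf x Sx) (cg x Sx).
have H i x Sx := pderivM gS Sx (df i x Sx) (dg i x Sx).
split=> [i x Sx|i]; first by have [] := H i x Sx.
apply: Ck_eq (CkD gS (IH _ _ (kf i) (CkS Kg)) (IH _ _ (CkS Kf) (kg i))) => x Sx.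
by have [_ ->] := H i x Sx.
Qed.

Lemma Ck_sum (R : realType) n (S : set 'rV[R]_n) k (I : Type) (r : seq I) (f : I -> 'rV[R]_n -> R) :
  good S -> (forall i, Ck S k (f i)) -> Ck S k (fun z => \sum_(i <- r) f i z).
Proof.
move=> gS kf; elim: r => [|i r IH].
  by apply: Ck_eq (Ck_cst k 0 gS) => x _; rewrite big_nil.
by apply: Ck_eq (CkD gS (kf i) IH) => x _; rewrite big_cons.
Qed.

Lemma Ck_coord (R : realType) n (S : set 'rV[R]_n) k (j : 'I_n) : good S -> Ck S k (fun z => z 0 j).
Proof.
move=> gS; have cj x : S x -> cont_at S (fun z => z 0 j) x.
  by move=> _; apply: cvg_within_filter; exact: coord_continuous.
case: k => [|k]; split=> //; split=> [i x Sx|i]; first by have [] := pderiv_coord j i gS Sx.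
by apply: Ck_eq (Ck_cst k (j == i)%:R gS) => x Sx; have [] := pderiv_coord j i gS Sx.
Qed.

Lemma CkV (R : realType) n (S : set 'rV[R]_n) k f : good S -> (forall x, S x -> f x != 0) ->
  Ck S k f -> Ck S k (fun z => (f z)^-1).
Proof.
move=> gS f0; elim: k => [|k IH]; first by move=> [cf _]; split=> // x Sx; exact: cont_atV (f0 x Sx) (cf x Sx).
move=> /[dup] Kf [cf [df kf]]; split; first by move=> x Sx; exact: cont_atV (f0 x Sx) (cf x Sx).
have H i x Sx := pderivV gS Sx (f0 x Sx) (df i x Sx).
split=> [i x Sx|i]; first by have [] := H i x Sx.
have V := IH (CkS Kf).
apply: Ck_eq (CkM gS (CkM gS (Ck_cst k (-1) gS) (kf i)) (CkM gS V V)) => x Sx.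
by have [_ ->] := H i x Sx; rewrite mulN1r.
Qed.

Lemma Ck_comp (R : realType) n p (S : set 'rV[R]_n) (S' : set 'rV[R]_p)
    (F : 'rV[R]_n -> 'rV[R]_p) k h :
  good S -> good S' -> (forall y, S y -> S' (F y)) ->
  (forall j, Ck S k (fun z => F z 0 j)) -> Ck S' k h -> Ck S k (fun z => h (F z)).
Proof.
move=> gS gS' SS'; elim: k h => [|k IH] h KF.
  move=> [ch _]; split=> // x Sx; apply: cont_at_comp SS' _ (ch _ (SS' _ Sx)) => j.
  by have [cF _] := KF j; exact: cF.
move=> /[dup] Kh [ch [dh kh]]; split.
  move=> x Sx; apply: cont_at_comp SS' _ (ch _ (SS' _ Sx)) => j.
  by have [cF _] := KF j; exact: cF.
have dF i x (Sx : S x) j : has_dderiv S (ebase i) (fun z => F z 0 j) x by have [_ [dF _]] := KF j; exact: dF.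
have H i x Sx := pderiv_comp gS gS' Sx SS' (Ck_C1on Kh) (dF i x Sx).
split=> [i x Sx|i]; first by have [] := H i x Sx.
have K j : Ck S k (fun z => pderiv S' j h (F z) * pderiv S i (fun z => F z 0 j) z).
  apply: CkM => //; last by have [_ [_ ]] := KF j; exact.
  by apply: IH; [move=> j'; exact: CkS|exact: kh].
by apply: Ck_eq (Ck_sum (index_enum _) gS K) => x Sx; have [_ ->] := H i x Sx.
Qed.

Lemma smooth_cst (R : realType) n (S : set 'rV[R]_n) (c : R) : good S -> smooth_on S (fun=> c).
Proof. by move=> gS; apply/smooth_onP => k; exact: Ck_cst. Qed.

Lemma smoothD (R : realType) n (S : set 'rV[R]_n) f g : good S ->
  smooth_on S f -> smooth_on S g -> smooth_on S (fun z => f z + g z).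
Proof. by move=> gS /smooth_onP kf /smooth_onP kg; apply/smooth_onP => k; exact: CkD. Qed.

Lemma smoothM (R : realType) n (S : set 'rV[R]_n) f g : good S ->
  smooth_on S f -> smooth_on S g -> smooth_on S (fun z => f z * g z).
Proof. by move=> gS /smooth_onP kf /smooth_onP kg; apply/smooth_onP => k; exact: CkM. Qed.

Lemma smooth_sum (R : realType) n (S : set 'rV[R]_n) (I : Type) (r : seq I) (f : I -> 'rV[R]_n -> R) :
  good S -> (forall i, smooth_on S (f i)) -> smooth_on S (fun z => \sum_(i <- r) f i z).
Proof. by move=> gS kf; apply/smooth_onP => k; apply: Ck_sum => // i; exact: ((smooth_onP _ _).1 (kf i)). Qed.

Lemma smooth_prod (R : realType) n (S : set 'rV[R]_n) (I : Type) (r : seq I) (f : I -> 'rV[R]_n -> R) :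
  good S -> (forall i, smooth_on S (f i)) -> smooth_on S (fun z => \prod_(i <- r) f i z).
Proof.
move=> gS kf; elim: r => [|i r IH].
  by apply: smooth_eq (smooth_cst 1 gS) => x _; rewrite big_nil.
by apply: smooth_eq (smoothM gS (kf i) IH) => x _; rewrite big_cons.
Qed.

Lemma smooth_coord (R : realType) n (S : set 'rV[R]_n) (j : 'I_n) : good S -> smooth_on S (fun z => z 0 j).
Proof. by move=> gS; apply/smooth_onP => k; exact: Ck_coord. Qed.

Lemma smoothV (R : realType) n (S : set 'rV[R]_n) f : good S -> (forall x, S x -> f x != 0) ->
  smooth_on S f -> smooth_on S (fun z => (f z)^-1).
Proof. by move=> gS f0 /smooth_onP kf; apply/smooth_onP => k; exact: CkV. Qed.

Lemma smooth_comp (R : realType) n p (S : set 'rV[R]_n) (S' : set 'rV[R]_p)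
    (F : 'rV[R]_n -> 'rV[R]_p) h :
  good S -> good S' -> (forall y, S y -> S' (F y)) ->
  (forall j, smooth_on S (fun z => F z 0 j)) -> smooth_on S' h -> smooth_on S (fun z => h (F z)).
Proof.
move=> gS gS' SS' kF /smooth_onP kh; apply/smooth_onP => k.
by apply: Ck_comp SS' _ (kh k) => // j; have /smooth_onP := kF j.
Qed.

(** All iterated partial derivatives up to order [k], in every order of differentiation, are bounded
    by one constant at the single point [x]. A partial derivative of a function bounded to order
    [k.+1] is then bounded to order [k] with the same constant. *)
Fixpoint bnd {R : realType} {n : nat} (S : set 'rV[R]_n) (k : nat) (A : R)
    (f : 'rV[R]_n -> R) (x : 'rV[R]_n) : Prop :=
  `|f x| <= A /\
  match k with
  | 0 => True
  | k'.+1 => forall i, bnd S k' A (pderiv S i f) x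
  end.

Lemma bnd_germ (R : realType) n (S S' : set 'rV[R]_n) k A f f' x :
  S x -> same_germ S f S' f' x -> bnd S k A f x -> bnd S' k A f' x.
Proof.
elim: k f f' => [|k IH] f f' Sx sg [fA H].
  by split=> //; have [_ <-] := nbhs_singleton sg.
split; first by have [_ <-] := nbhs_singleton sg.
by move=> i; apply: IH (H i) => //; exact: pderiv_germ.
Qed.

Lemma bnd_eq (R : realType) n (S : set 'rV[R]_n) k A f g x :
  (forall y, S y -> f y = g y) -> S x -> bnd S k A f x -> bnd S k A g x.
Proof. by move=> fg Sx; apply: bnd_germ => //; exact: same_germ_on. Qed.

Lemma bnd_le (R : realType) n (S : set 'rV[R]_n) k A B f x :
  A <= B -> bnd S k A f x -> bnd S k B f x.
Proof.
move=> AB; elim: k f => [|k IH] f [fA H]; split; rewrite ?(le_trans fA) //.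
by move=> i; apply: IH; exact: H.
Qed.

Lemma bndS (R : realType) n (S : set 'rV[R]_n) k A f x : bnd S k.+1 A f x -> bnd S k A f x.
Proof.
elim: k f => [|k IH] f [fA H]; first by split.
by split=> // i; apply: IH; exact: H.
Qed.

Lemma bnd_pred (R : realType) n (S : set 'rV[R]_n) k A f x : bnd S k A f x -> bnd S k.-1 A f x.
Proof. by case: k => // k; exact: bndS. Qed.

Lemma bnd_ge0 (R : realType) n (S : set 'rV[R]_n) k A f x : bnd S k A f x -> 0 <= A.
Proof. by case: k => [|k] [H _]; exact: le_trans (normr_ge0 _) H. Qed.

Lemma bnd_cst (R : realType) n (S : set 'rV[R]_n) k (c : R) x : good S -> S x ->
  bnd S k `|c| (fun=> c) x.
Proof.
move=> gS Sx; have H0 : forall k (A : R), 0 <= A -> bnd S k A (fun=> 0) x.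
  elim=> [|j IH] A A0; first by split=> //; rewrite normr0.
  split; first by rewrite normr0.
  by move=> i; apply: bnd_eq (IH A A0) => // y Sy; have [] := pderiv_cst 0 i gS Sy.
case: k => [|k]; split=> // i.
by apply: bnd_eq (H0 k _ (normr_ge0 c)) => // y Sy; have [] := pderiv_cst c i gS Sy.
Qed.

Lemma bndD (R : realType) n (S : set 'rV[R]_n) k A B f g x : good S -> S x ->
  smooth_on S f -> smooth_on S g ->
  bnd S k A f x -> bnd S k B g x -> bnd S k (A + B) (fun z => f z + g z) x.
Proof.
move=> gS Sx; elim: k f g => [|k IH] f g sf sg [fA HA] [gB HB].
  by split=> //; apply: le_trans (ler_normD _ _) _; exact: lerD.
split; first by apply: le_trans (ler_normD _ _) _; exact: lerD.
move=> i; apply: bnd_eq (IH _ _ (smooth_pderiv i sf) (smooth_pderiv i sg) (HA i) (HB i)) => // y Sy.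
by have [_ ->] := pderivD gS Sy (@smooth_dd _ _ _ _ i _ sf Sy) (@smooth_dd _ _ _ _ i _ sg Sy).
Qed.

(** Each application of the product rule doubles the number of terms, whence the factor [2 ^+ k]. *)
Lemma bndM (R : realType) n (S : set 'rV[R]_n) k A B f g x : good S -> S x ->
  smooth_on S f -> smooth_on S g ->
  bnd S k A f x -> bnd S k B g x -> bnd S k (2 ^+ k * (A * B)) (fun z => f z * g z) x.
Proof.
move=> gS Sx; elim: k f g => [|k IH] f g sf sg.
  by move=> [fA HA] [gB HB]; split=> //; rewrite mul1r normrM; exact: ler_pM.
move=> /[dup] bf [fA HA] /[dup] bg [gB HB].
have A0 := bnd_ge0 bf; have B0 := bnd_ge0 bg.
split.
  rewrite normrM; apply: le_trans (_ : A * B <= _); first exact: ler_pM.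
  by rewrite ler_peMl ?mulr_ge0 // exprn_ege1 // ler1n.
move=> i; have -> : 2 ^+ k.+1 * (A * B) = 2 ^+ k * (A * B) + 2 ^+ k * (A * B) by rewrite exprS; ring.
have := bndD gS Sx (smoothM gS (smooth_pderiv i sf) sg) (smoothM gS sf (smooth_pderiv i sg))
  (IH _ _ (smooth_pderiv i sf) sg (HA i) (bndS bg))
  (IH _ _ sf (smooth_pderiv i sg) (bndS bf) (HB i)).
apply: bnd_eq => // y Sy.
by have [_ ->] := pderivM gS Sy (@smooth_dd _ _ _ _ i _ sf Sy) (@smooth_dd _ _ _ _ i _ sg Sy).
Qed.

Lemma bnd_sum (R : realType) n (S : set 'rV[R]_n) k A (I : Type) (r : seq I)
    (f : I -> 'rV[R]_n -> R) x : good S -> S x ->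
  (forall i, smooth_on S (f i)) -> (forall i, bnd S k A (f i) x) ->
  bnd S k (A * (size r)%:R) (fun z => \sum_(i <- r) f i z) x.
Proof.
move=> gS Sx sf bf; elim: r => [|i r IH].
  rewrite mulr0; have := bnd_cst k 0 gS Sx; rewrite normr0.
  by apply: bnd_eq => // y _; rewrite big_nil.
rewrite /= -natr1 mulrDr mulr1 addrC.
apply: bnd_eq (bndD gS Sx (sf i) (smooth_sum r gS sf) (bf i) IH) => // y _.
by rewrite big_cons.
Qed.

(** The derivative of [1 / f] is [- f'] times the square of [1 / f], so each order follows from the
    preceding one, starting from [1 / f <= 1]. The constant is chosen before [S], [f] and [x]. *)
Lemma bndV (R : realType) n k (A : R) : exists B : R,
  forall (S : set 'rV[R]_n) f x, good S -> S x -> smooth_on S f ->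
  (forall y, S y -> 1 <= f y) -> bnd S k A f x -> bnd S k B (fun z => (f z)^-1) x.
Proof.
have V1 (S : set 'rV[R]_n) (f : 'rV[R]_n -> R) x : (forall y, S y -> 1 <= f y) -> S x -> `|(f x)^-1| <= 1.
  move=> f1 Sx; have fx := f1 x Sx; have f0 : 0 < f x by exact: lt_le_trans ltr01 fx.
  by rewrite normfV (ger0_norm (ltW f0)) invf_le1.
elim: k => [|k [B IH]].
  by exists 1 => S f x gS Sx sf f1 _; split=> //; exact: V1 f1 Sx.
pose B' := 2 ^+ k * (2 ^+ k * (`|-1| * A) * (2 ^+ k * (B * B))).
exists (Num.max 1 B') => S f x gS Sx sf f1 /[dup] bf [fA HA].
split; first by rewrite le_max (V1 _ _ _ f1 Sx).
have f0 y : S y -> f y != 0 by move=> Sy; rewrite gt_eqF // (lt_le_trans ltr01) // f1.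
have sV := smoothV gS f0 sf.
move=> i; apply: (@bnd_le _ _ _ _ B'); first by rewrite le_max lexx orbT.
have bV := IH S f x gS Sx sf f1 (bndS bf).
have := bndM gS Sx (smoothM gS (smooth_cst (-1) gS) (smooth_pderiv i sf)) (smoothM gS sV sV)
  (bndM gS Sx (smooth_cst (-1) gS) (smooth_pderiv i sf) (bnd_cst k (-1) gS Sx) (HA i))
  (bndM gS Sx sV sV bV bV).
apply: bnd_eq => // y Sy.
by have [_ ->] := pderivV gS Sy (f0 y Sy) (@smooth_dd _ _ _ _ i _ sf Sy); rewrite mulN1r.
Qed.

(** A derivative of the composition is a sum of products of a partial derivative of [h], composed
    with [F], and a partial derivative of [F]; the first factor is a composition again, bounded by
    the induction hypothesis. *)
Lemma bnd_comp (R : realType) n p k (A J : R) : exists B : R,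
  forall (S : set 'rV[R]_n) (S' : set 'rV[R]_p) (F : 'rV[R]_n -> 'rV[R]_p) h x,
  good S -> good S' -> S x -> (forall y, S y -> S' (F y)) ->
  (forall j, smooth_on S (fun z => F z 0 j)) -> smooth_on S' h ->
  bnd S' k A h (F x) -> (forall j i, bnd S k.-1 J (pderiv S i (fun z => F z 0 j)) x) ->
  bnd S k B (fun z => h (F z)) x.
Proof.
elim: k => [|k [B IH]].
  by exists A => S S' F h x gS gS' Sx SS' sF sh [hA _] _; split.
pose B' := 2 ^+ k * (B * J) * (size (index_enum 'I_p))%:R.
exists (Num.max A B') => S S' F h x gS gS' Sx SS' sF sh [hA HA] bJ.
split; first by rewrite le_max hA.
move=> i; apply: (@bnd_le _ _ _ _ B'); first by rewrite le_max lexx orbT.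
have sC j : smooth_on S (fun z => pderiv S' j h (F z)).
  exact: smooth_comp SS' sF (smooth_pderiv j sh).
have bC j : bnd S k B (fun z => pderiv S' j h (F z)) x.
  apply: IH gS gS' Sx SS' sF (smooth_pderiv j sh) (HA j) _ => j' i'.
  by apply: bnd_pred; exact: bJ.
have := bnd_sum (index_enum 'I_p) gS Sx
  (fun j => smoothM gS (sC j) (smooth_pderiv i (sF j)))
  (fun j => bndM gS Sx (sC j) (smooth_pderiv i (sF j)) (bC j) (bJ j i)).
apply: bnd_eq => // y Sy.
by have [_ ->] := pderiv_comp gS gS' Sy SS' (smooth_C1 sh) (fun j => @smooth_dd _ _ _ _ i _ (sF j) Sy).
Qed.

Lemma bnd_pderivs (R : realType) n (S : set 'rV[R]_n) k A f x s :
  bnd S k A f x -> (size s <= k)%N -> `|pderivs S s f x| <= A.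
Proof.
elim/last_ind: s k f => [|s i IH] k f; first by case: k => [|k] [].
rewrite size_rcons pderivs_rcons; case: k => // k [_ H] sk.
by apply: IH (H i) _.
Qed.

Lemma pderivs_bnd (R : realType) n (S : set 'rV[R]_n) k A f x :
  (forall s, (size s <= k)%N -> `|pderivs S s f x| <= A) -> bnd S k A f x.
Proof.
elim: k f => [|k IH] f H; first by split=> //; exact: (H [::]).
split; first exact: (H [::]).
by move=> i; apply: IH => s sk; rewrite -pderivs_rcons; apply: H; rewrite size_rcons.
Qed.

(** The limiting argument for mixed derivatives: [D t / t ^+ 2] is a value of [U] and a value of [V]
    at points that tend to [x] with [t], so continuity forces the two values at [x] to coincide. *)
Lemma double_diff_limit (R : realType) n (S : set 'rV[R]_n) x (U V : 'rV[R]_n -> R)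
    (D : R -> R) (d1 : R) : S x -> 0 < d1 ->
  {within S, continuous U} -> {within S, continuous V} ->
  (forall t, 0 < t -> t < d1 / 2 -> exists2 z, S z /\ bx x (2 * t) z & D t = t * (t * U z)) ->
  (forall t, 0 < t -> t < d1 / 2 -> exists2 z, S z /\ bx x (2 * t) z & D t = t * (t * V z)) ->
  U x = V x.
Proof.
move=> Sx d10 cU cV HU HV.
apply/eqP; rewrite -subr_eq0 -normr_le0; apply/ler_addgt0Pl => e e0.
rewrite addr0.
have e20 : 0 < e / 2 by rewrite divr_gt0.
have [d2 d20 H2] := (within_contP _ _).1 cU x Sx _ e20.
have [d3 d30 H3] := (within_contP _ _).1 cV x Sx _ e20.
pose m := Num.min d1 (Num.min d2 d3); have m0 : 0 < m by rewrite !lt_min d10 d20.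
pose t := m / 4; have t0 : 0 < t by rewrite divr_gt0.
have mt : m = 4 * t by rewrite /t; field.
have m1 : m <= d1 by rewrite /m !ge_min lexx.
have m2 : m <= d2 by rewrite /m !ge_min lexx orbT.
have m3 : m <= d3 by rewrite /m !ge_min lexx !orbT.
have td1 : t < d1 / 2 by lra.
have t2m : 2 * t <= m by lra.
have [z1 [Sz1 bz1] E1] := HU t t0 td1.
have [z2 [Sz2 bz2] E2] := HV t t0 td1.
have E12 : U z1 = V z2.
  have tn : t != 0 by rewrite gt_eqF.
  by apply: (mulfI tn); apply: (mulfI tn); rewrite -E1 -E2.
have := H2 z1 Sz1 (bx_le (le_trans t2m m2) bz1).
have := H3 z2 Sz2 (bx_le (le_trans t2m m3) bz2).
rewrite E12 !ltr_norml => /andP[? ?] /andP[? ?].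
by rewrite ler_norml; apply/andP; split; lra.
Qed.

(** Only positive increments enter the double difference, so the argument is valid at boundary
    points of the orthant too. It is what makes the order of differentiation in [Dalpha]
    immaterial. *)
Lemma schwarz (R : realType) n (S : set 'rV[R]_n) f i j x : good S -> smooth_on S f -> S x ->
  pderiv S i (pderiv S j f) x = pderiv S j (pderiv S i f) x.
Proof.
move=> gS sf Sx; have [->//|ij] := eqVneq i j.
have [P [SP gd]] := gS; have [d1 d10 d1S] := gd x Sx.
(* For all small t > 0 the double difference of f is t^2 times either mixed derivative at nearby points. *)
have key (a b : 'I_n) (t : R) : 0 < t -> t < d1 / 2 -> a != b -> exists2 z, S z /\ bx x (2 * t) z &
    f (x + t *: ebase a + t *: ebase b) - f (x + t *: ebase a) - f (x + t *: ebase b) + f x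
    = t * (t * pderiv S b (pderiv S a f) z).
  move=> t0 td ab.
  have inP (s r : R) : 0 <= s -> 0 <= r -> orth P (x + s *: ebase a + r *: ebase b).
    by move=> s0 r0; apply: orth_ebase => //; apply: orth_ebase => //; exact: SP.
  have inB (s r e : R) : `|s| < e -> `|r| < e -> bx x e (x + s *: ebase a + r *: ebase b).
    move=> se re k; rewrite !mxE eqxx /=.
    have -> : x 0 k + s * (k == a)%:R + r * (k == b)%:R - x 0 k = s * (k == a)%:R + r * (k == b)%:R by ring.
    have e0 : 0 < e by exact: le_lt_trans (normr_ge0 _) se.
    have [->|ka] := eqVneq k a; first by rewrite (negbTE ab) mulr1 mulr0 addr0.
    by case: (k == b); rewrite /= !(mulr0, mulr1, add0r) ?normr0.
  have td1 : t < d1 by lra.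
  have inS (s r : R) : 0 <= s <= t -> 0 <= r <= t -> S (x + s *: ebase a + r *: ebase b).
    move=> /andP[s0 st] /andP[r0 rt]; apply: d1S; split; first exact: inP.
    by apply: inB; rewrite ger0_norm // (le_lt_trans _ td1).
  have [sc sd scd] := smooth_C1 sf.
  have inS' s : 0 <= s <= t -> S (x + s *: ebase a).
    by move=> s0; have := inS s 0 s0; rewrite lexx ltW //= scale0r addr0; exact.
  pose u s := f (x + t *: ebase b + (s * t) *: ebase a) - f (x + (s * t) *: ebase a).
  have st (s : R) : 0 <= s <= 1 -> 0 <= s * t <= t.
    by move=> /andP[s0 s1]; apply/andP; split; nra.
  have D1 (s : R) : 0 < s < 1 -> is_derive s 1 u
     (t * (pderiv S a f (x + t *: ebase b + (s * t) *: ebase a) - pderiv S a f (x + (s * t) *: ebase a))).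
    move=> s01; rewrite mulrBr; apply: is_deriveB.
    - apply: (@is_derive_scale R (fun r => f (x + t *: ebase b + r *: ebase a))).
      have s01' : 0 <= s <= 1 by move: s01 => /andP[? ?]; rewrite !ltW.
      apply: is_derive_line => //; last first.
        by apply: sd; rewrite addrAC; apply: inS; [exact: st|rewrite lexx ltW].
      have : \forall r \near s * t, 0 < r < t.
        apply: (@near_in_itvoo R 0 t); rewrite in_itv /=; move: s01 => /andP[s0 s1].
        by rewrite mulr_gt0 //= gtr_pMl.
      apply: filterS => r /andP[r0 rt]; rewrite addrAC; apply: inS; by rewrite ?lexx !ltW.
    - apply: (@is_derive_scale R (fun r => f (x + r *: ebase a))).
      have s01' : 0 <= s <= 1 by move: s01 => /andP[? ?]; rewrite !ltW.
      apply: is_derive_line => //; last by apply: sd; apply: inS'; exact: st.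
      have : \forall r \near s * t, 0 < r < t.
        apply: (@near_in_itvoo R 0 t); rewrite in_itv /=; move: s01 => /andP[s0 s1].
        by rewrite mulr_gt0 //= gtr_pMl.
      by apply: filterS => r /andP[r0 rt]; apply: inS'; rewrite !ltW.
  have C1 (s : R) : 0 <= s <= 1 -> forall e : R, 0 < e -> exists2 d : R, 0 < d &
      forall r, 0 <= r <= 1 -> `|r - s| < d -> `|u r - u s| < e.
    move=> s01 e e0; have e20 : 0 < e / 2 by rewrite divr_gt0.
    have t00 : `|t| < d1 by rewrite ger0_norm ?ltW.
    have z00 : `|0 : R| < d1 by rewrite normr0.
    have tge : 0 <= t by exact: ltW.
    have p1 : orth P (x + t *: ebase b) by apply: orth_ebase => //; exact: SP.
    have p2 : orth P (x + t *: ebase b + t *: ebase a) by rewrite addrAC; exact: inP.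
    have b1 : bx x d1 (x + t *: ebase b) by exact: bx_ebase.
    have b2 : bx x d1 (x + t *: ebase b + t *: ebase a) by rewrite addrAC; exact: inB.
    have p3 : orth P (x + t *: ebase a) by apply: orth_ebase => //; exact: SP.
    have b3 : bx x d1 (x + t *: ebase a) by exact: bx_ebase.
    have [e1 e10 H1] := @line_cont R n S f P x (x + t *: ebase b) a t d1 sc d1S p1 p2 b1 b2 s s01 _ e20.
    have [e2 e20' H2] := @line_cont R n S f P x x a t d1 sc d1S (SP _ Sx) p3 (bxx x d10) b3 s s01 _ e20.
    exists (Num.min e1 e2); first by rewrite lt_min e10.
    move=> r r01; rewrite lt_min => /andP[re1 re2].
    have := H1 r r01 re1; have := H2 r r01 re2; rewrite /u.
    by rewrite !ltr_norml => /andP[? ?] /andP[? ?]; apply/andP; split; lra.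
  have [s s01 E] := mvt01 D1 C1.
  have s01' : 0 <= s <= 1 by move: s01 => /andP[? ?]; rewrite !ltW.
  have sst := st s s01'; have /andP[st0 st1] := sst.
  have tge : 0 <= t by exact: ltW.
  have z0 : orth P (x + (s * t) *: ebase a) by apply: orth_ebase => //; exact: SP.
  have bz0 (r e : R) : `|r| < e -> `|s * t| < e -> bx x e (x + (s * t) *: ebase a + r *: ebase b).
    by move=> re se; exact: inB.
  have t2 : `|t| < 2 * t by rewrite ger0_norm // ltr_pMl // ltr1n.
  have st2 : `|s * t| < 2 * t by rewrite (ger0_norm st0) (le_lt_trans st1) // ltr_pMl // ltr1n.
  have [||xi [Pxi bxi Exi]] := @mvt_line R n S (pderiv S a f) P x (x + (s * t) *: ebase a) b t (2 * t)
     gS (smooth_C1 (smooth_pderiv a sf)) _ z0 (inP _ _ st0 tge) _ (inB _ _ _ st2 t2).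
  - move=> z [Pz bz]; apply: d1S; split=> //; apply: bx_le bz.
    by rewrite mulrC -ler_pdivlMr // ltW.
  - by have := inB (s * t) 0 (2 * t) st2; rewrite normr0 scale0r addr0; apply; rewrite mulr_gt0.
  exists xi; last first.
    rewrite [pderiv S b _ _ * t]mulrC in Exi; rewrite -Exi.
    rewrite [X in _ = t * (pderiv S a f X - _)]addrAC -E /u !mul1r !mul0r !scale0r !addr0.
    rewrite [x + t *: ebase b + t *: ebase a]addrAC; lra.
  split=> //; apply: d1S; split=> //; apply: bx_le bxi.
  by rewrite mulrC -ler_pdivlMr // ltW.
have cm a b : {within S, continuous (pderiv S a (pderiv S b f))}.
  by apply: smooth_cont; do 2 apply: smooth_pderiv.
pose D t := f (x + t *: ebase i + t *: ebase j) - f (x + t *: ebase i) - f (x + t *: ebase j) + f x.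
apply: (@double_diff_limit R n S x (pderiv S i (pderiv S j f)) (pderiv S j (pderiv S i f)) D d1) => //.
- move=> t t0 td; have [z Hz E] := key j i t t0 td (contra_neq esym ij).
  by exists z => //; rewrite -E /D [x + t *: ebase j + t *: ebase i]addrAC; ring.
- by move=> t t0 td; have [z Hz E] := key i j t t0 td ij; exists z.
Qed.

(** * Positive definite forms, orthonormal frames, cut-off functions *)

Lemma bformE (R : realType) n (G : 'M[R]_n) v w :
  bform G v w = \sum_a \sum_b v 0 a * G a b * w 0 b.
Proof.
rewrite /bform mxE exchange_big; apply: eq_bigr => b _.
by rewrite mxE mulr_suml; apply: eq_bigr => a _; rewrite mxE.
Qed.

Lemma bformDl (R : realType) n (G : 'M[R]_n) u v w : bform G (u + v) w = bform G u w + bform G v w.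
Proof. by rewrite /bform !mulmxDl mxE. Qed.

Lemma bformDr (R : realType) n (G : 'M[R]_n) u v w : bform G u (v + w) = bform G u v + bform G u w.
Proof. by rewrite /bform linearD /= mulmxDr mxE. Qed.

Lemma bformZl (R : realType) n (G : 'M[R]_n) c v w : bform G (c *: v) w = c * bform G v w.
Proof. by rewrite /bform -!scalemxAl mxE. Qed.

Lemma bformZr (R : realType) n (G : 'M[R]_n) c v w : bform G v (c *: w) = c * bform G v w.
Proof. by rewrite /bform linearZ /= -scalemxAr mxE. Qed.

Lemma bformC (R : realType) n (G : 'M[R]_n) v w : G^T = G -> bform G v w = bform G w v.
Proof.
move=> GT; rewrite /bform -[LHS]/((v *m G *m w^T) 0 0).
have -> : (v *m G *m w^T) 0 0 = (v *m G *m w^T)^T 0 0 by rewrite [RHS]mxE.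
by rewrite !trmx_mul trmxK GT mulmxA.
Qed.

Lemma bform_mul (R : realType) n p (J : 'M[R]_(n, p)) (G : 'M[R]_p) v w :
  bform (J *m G *m J^T) v w = bform G (v *m J) (w *m J).
Proof. by rewrite /bform trmx_mul !mulmxA. Qed.

Definition spd {R : realType} {n : nat} (G : 'M[R]_n) : Prop :=
  G^T = G /\ forall v, v != 0 -> 0 < bform G v v.

Lemma spd_ge0 (R : realType) n (G : 'M[R]_n) v : spd G -> 0 <= bform G v v.
Proof.
move=> [_ G0]; have [->|v0] := eqVneq v 0; last exact/ltW/G0.
by rewrite -(scale0r (0 : 'rV[R]_n)) bformZl mul0r.
Qed.

Lemma bform_CS (R : realType) n (G : 'M[R]_n) v w : spd G ->
  bform G v w ^+ 2 <= bform G v v * bform G w w.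
Proof.
move=> sG; have [GT G0] := sG; have [->|w0] := eqVneq w 0.
  have z u : bform G u 0 = 0 by rewrite -(scale0r (0 : 'rV[R]_n)) bformZr mul0r.
  by rewrite !z expr0n mulr0.
have ww := G0 _ w0; pose c := bform G v w / bform G w w.
have := spd_ge0 (v - c *: w) sG; rewrite -scaleNr bformDl !bformDr !bformZl !bformZr (bformC w v GT).
set A := bform G v v; set B := bform G v w in c *; set D := bform G w w in ww c *.
have -> : A + - c * B + (- c * B + - c * (- c * D)) = A - B ^+ 2 / D.
  by rewrite /c; field; rewrite gt_eqF.
by rewrite subr_ge0 ler_pdivrMr.
Qed.

Lemma spd_unit (R : realType) n (G : 'M[R]_n) : spd G -> G \in unitmx.
Proof.
move=> [_ G0]; rewrite -row_free_unit -kermx_eq0; apply/eqP/row_matrixP => i.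
rewrite row0; apply/eqP; apply: contraT => /G0.
have -> : bform G (row i (kermx G)) (row i (kermx G)) = 0.
  by rewrite /bform -row_mul mulmx_ker row0 mul0mx mxE.
by rewrite ltxx.
Qed.

Lemma sum_sqr_le (R : realType) (I : finType) (v : I -> R) :
  (\sum_k `|v k|) ^+ 2 <= #|I|%:R * \sum_k v k ^+ 2.
Proof.
have H : \sum_i \sum_j (`|v i| * `|v j|) <= \sum_i \sum_(j : I) ((v i ^+ 2 + v j ^+ 2) / 2).
  apply: ler_sum => i _; apply: ler_sum => j _.
  rewrite -(real_normK (num_real (v i))) -(real_normK (num_real (v j))).
  by have := sqr_ge0 (`|v i| - `|v j|); rewrite sqrrB; lra.
have -> : (\sum_k `|v k|) ^+ 2 = \sum_i \sum_j (`|v i| * `|v j|).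
  by rewrite expr2 mulr_suml; apply: eq_bigr => i _; rewrite mulr_sumr.
apply: le_trans H _; rewrite le_eqVlt; apply/orP; left; apply/eqP.
have -> : \sum_i \sum_(j : I) (v i ^+ 2 + v j ^+ 2) / 2 =
   \sum_(i : I) (#|I|%:R * (v i ^+ 2 / 2) + (\sum_k v k ^+ 2) / 2).
  apply: eq_bigr => i _; under eq_bigr do rewrite mulrDl.
  by rewrite big_split /= sumr_const -mulr_suml mulr_natl.
rewrite big_split /= sumr_const -mulr_sumr -mulr_suml -[_ *+ #|I|]mulr_natl; lra.
Qed.

Lemma bform_upper (R : realType) n (G : 'M[R]_n) (C : R) v :
  (forall a b, `|G a b| <= C) -> bform G v v <= C * (\sum_k `|v 0 k|) ^+ 2.
Proof.
move=> GC; rewrite bformE expr2 mulr_suml mulr_sumr; apply: ler_sum => a _.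
rewrite mulr_sumr mulr_sumr; apply: ler_sum => b _.
apply: le_trans (ler_norm _) _; rewrite !normrM.
have -> : `|v 0 a| * `|G a b| * `|v 0 b| = `|G a b| * (`|v 0 a| * `|v 0 b|) by ring.
by rewrite ler_wpM2r // mulr_ge0.
Qed.

Lemma bform1E (R : realType) n (v : 'rV[R]_n) : bform 1%:M v v = \sum_k v 0 k ^+ 2.
Proof.
by rewrite /bform mulmx1 mxE; apply: eq_bigr => k _; rewrite mxE.
Qed.

(** Cauchy-Schwarz for [G], applied to [v] and [v *m invmx G], gives [q ^+ 2 <= bform G v v * bform
    (invmx G) v v] with [q] the squared Euclidean norm; the last factor is at most [C * (n * q)].
    Bounds on the inverse thus replace a bound on the least eigenvalue. *)
Lemma bform_lower (R : realType) n (G : 'M[R]_n) (C : R) (v : 'rV[R]_n) : spd G ->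
  (forall a b, `|invmx G a b| <= C) -> \sum_k v 0 k ^+ 2 <= n%:R * C * bform G v v.
Proof.
move=> sG GC; have [GT G0] := sG; have uG := spd_unit sG.
have [n0|n0] := posnP n.
  move: v {GC uG}; clear sG GT; subst n => v; rewrite big_ord0.
  by rewrite mul0r mul0r.
have C0 : 0 <= C by exact: le_trans (normr_ge0 _) (GC (Ordinal n0) (Ordinal n0)).
set q := \sum_k _; have q0 : 0 <= q by apply: sumr_ge0 => k _; exact: sqr_ge0.
have IT : (invmx G)^T = invmx G by rewrite trmx_inv GT.
have := bform_CS v (v *m invmx G) sG.
have -> : bform G v (v *m invmx G) = q.
  by rewrite /bform trmx_mul IT !mulmxA mulmxK // -/(bform 1%:M v v) /q -bform1E /bform mulmx1.
have -> : bform G (v *m invmx G) (v *m invmx G) = bform (invmx G) v v.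
  by rewrite /bform trmx_mul IT mulmxKV // mulmxA.
move=> H.
have H2 : bform (invmx G) v v <= C * (n%:R * q).
  apply: le_trans (bform_upper v GC) _; rewrite ler_wpM2l //; by have := sum_sqr_le (fun k => v 0 k); rewrite card_ord.
have g0 := spd_ge0 v sG.
have [->|qn] := eqVneq q 0; first by rewrite !mulr_ge0.
have qp : 0 < q by rewrite lt_neqAle eq_sym qn.
rewrite -(ler_pM2l qp) -expr2; apply: le_trans H _.
have -> : q * (n%:R * C * bform G v v) = bform G v v * (C * (n%:R * q)) by ring.
exact: ler_wpM2l.
Qed.

(** Gram-Schmidt by counting dimensions: fewer than [n] rows leave a nonzero vector that is
    [G]-orthogonal to all of them, and its normalization is added as a new row. *)
Lemma frame_step (R : realType) n (G : 'M[R]_n) k : spd G -> (k <= n)%N ->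
  exists E : 'M[R]_(k, n), E *m G *m E^T = 1%:M.
Proof.
move=> sG; have [GT G0] := sG.
elim: k => [_|k IH kn]; first by exists 0; apply/matrixP => -[].
have [E EE] := IH (ltnW kn).
have kn0 : kermx (G *m E^T) != 0.
  rewrite -mxrank_eq0 mxrank_ker subn_eq0 -ltnNge; apply: leq_ltn_trans kn.
  exact: rank_leq_col.
have [v [v0 vE]] : exists v : 'rV_n, v != 0 /\ v *m (G *m E^T) = 0.
  have [i ri] : exists i, row i (kermx (G *m E^T)) != 0.
    apply/existsP; rewrite -negb_forall; apply: contra kn0 => /forallP H.
    by apply/eqP/row_matrixP => i; rewrite row0; apply/eqP; have := H i.
  by exists (row i (kermx (G *m E^T))); split=> //; rewrite -row_mul mulmx_ker row0.
pose c := Num.sqrt (bform G v v); have c0 : 0 < c by rewrite sqrtr_gt0 G0.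
pose w := c^-1 *: v.
have wE : w *m G *m E^T = 0 by rewrite -mulmxA /w -scalemxAl vE scaler0.
exists (col_mx w E : 'M[R]_(1 + k, n)).
suff K : col_mx w E *m G *m (col_mx w E)^T = 1%:M :> 'M[R]_(1 + k) by exact: K.
rewrite mul_col_mx tr_col_mx mul_col_row wE EE.
have -> : E *m G *m w^T = 0.
  have -> : E *m G *m w^T = (w *m G *m E^T)^T by rewrite !trmx_mul trmxK GT mulmxA.
  by rewrite wE trmx0.
have -> : w *m G *m w^T = 1%:M.
  apply/matrixP => i j; rewrite !ord1 -/(bform G w w) bformZl bformZr mxE eqxx.
  have -> : bform G v v = c * c by rewrite -expr2 sqr_sqrtr ?spd_ge0.
  have -> : c^-1 * (c^-1 * (c * c)) = 1 by field; rewrite gt_eqF.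
  by [].
by rewrite -scalar_mx_block.
Qed.

Lemma frame_exists (R : realType) n (G : 'M[R]_n) : spd G ->
  exists E : 'M[R]_n, E *m G *m E^T = 1%:M.
Proof. by move=> sG; exact: frame_step. Qed.

Lemma spd_mul (R : realType) n p (J : 'M[R]_(n, p)) (J' : 'M[R]_(p, n)) (G : 'M[R]_p) :
  J *m J' = 1%:M -> spd G -> spd (J *m G *m J^T).
Proof.
move=> JJ [GT G0]; split; first by rewrite !trmx_mul trmxK GT mulmxA.
move=> v v0; rewrite bform_mul; apply: G0; apply: contra v0 => /eqP vJ.
by rewrite -[v]mulmx1 -JJ mulmxA vJ mul0mx.
Qed.

(** The functions [q(1/t) exp(-1/t)], extended by zero, form a family closed under differentiation.
    So the smoothness of [theta] at 0 reduces to one derivative for arbitrary [q]. *)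
Definition flat {R : realType} (q : {poly R}) (t : R) : R :=
  if 0 < t then q.[t^-1] * expR (- t^-1) else 0.

Definition flat_step {R : realType} (q : {poly R}) : {poly R} := 'X^2 * (q - q^`()).

(** The inequality [1 + u <= expR u] at [u = s / i], raised to the power [i]. *)
Lemma pow_expN (R : realType) (i : nat) (s : R) : 0 <= s -> s ^+ i * expR (- s) <= i%:R ^+ i.
Proof.
move=> s0; case: i => [|i]; first by rewrite !expr0 mul1r -expR0 ler_expR oppr_le0.
have i0 : (0 : R) < i.+1%:R by rewrite ltr0n.
have H : s / i.+1%:R <= expR (s / i.+1%:R).
  by apply: le_trans (expR_ge1Dx _); rewrite lerDr ler01.
have H2 : (s / i.+1%:R) ^+ i.+1 <= expR s.
  have -> : expR s = expR (s / i.+1%:R) ^+ i.+1.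
    by rewrite -expRM_natr; congr expR; field; rewrite gt_eqF.
  by apply: lerXn2r; rewrite ?nnegrE ?expR_ge0 // divr_ge0 // ltW.
rewrite expRN ler_pdivrMr ?expR_gt0 //.
by move: H2; rewrite expr_div_n ler_pdivrMr ?exprn_gt0 // mulrC.
Qed.

Lemma poly_expN (R : realType) (q : {poly R}) : exists C : R, forall s : R, 0 <= s ->
  `|q.[s] * expR (- s)| <= C.
Proof.
exists (\sum_(i < size q) `|q`_i| * i%:R ^+ i) => s s0.
rewrite horner_coef mulr_suml; apply: le_trans (ler_norm_sum _ _ _) _.
apply: ler_sum => i _; rewrite -mulrA normrM ler_wpM2l //.
by rewrite ger0_norm ?mulr_ge0 ?exprn_ge0 ?expR_ge0 //; exact: pow_expN.
Qed.

Lemma flat_derive (R : realType) (q : {poly R}) (t : R) :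
  is_derive t 1 (flat q) (flat (flat_step q) t).
Proof.
have [t0|t0|t0] := ltgtP t 0.
- rewrite [X in is_derive _ _ _ X]/flat (lt_gtF t0).
  apply: near_eq_is_derive (is_derive_cst (0 : R) t 1).
  have : \forall s \near t, s < 0 by apply: (@cvgr_lt _ _ (nbhs t) _ id t) => //; exact: cvg_id.
  by apply: filterS => s s0; rewrite /flat (lt_gtF s0).
- have tn : t != 0 by rewrite gt_eqF.
  rewrite [X in is_derive _ _ _ X]/flat t0.
  have D1 : is_derive t 1 (fun s : R => s^-1) (- t ^- 2).
    by have := @is_deriveV R id t 1 1 tn (is_derive_id t 1); rewrite /= /GRing.scale /= mulr1.
  have D2 : is_derive t 1 (fun s : R => q.[s^-1]) (- t ^- 2 * q^`().[t^-1]).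
    by rewrite mulrC; apply: (@is_derive1_comp R (fun s => q.[s]) (fun s => s^-1)); exact: is_derive_poly.
  have D3 : is_derive t 1 (fun s : R => expR (- s^-1)) (t ^- 2 * expR (- t^-1)).
    rewrite mulrC; apply: (@is_derive1_comp R expR (fun s => - s^-1)).
      by have := is_deriveN D1; rewrite opprK.

  have D4 := is_deriveM D2 D3.
  apply: (@near_eq_is_derive _ _ _ (fun s : R => q.[s^-1] * expR (- s^-1))).
  + have : \forall s \near t, 0 < s by apply: (@cvgr_gt _ _ (nbhs t) _ id t) => //; exact: cvg_id.
    by apply: filterS => s s0; rewrite /flat s0.
  + apply: is_derive_eq D4 _.
    rewrite /flat_step hornerM hornerXn hornerD hornerN /GRing.scale /= exprVn; ring.
- rewrite t0; rewrite [X in is_derive _ _ _ X]/flat ltxx.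
  (* One factor [h^-1] belongs to the difference quotient; the second one compensates a factor [h]
     put in front, which makes the quotient tend to 0. *)
  have [C HC] := poly_expN ('X^2 * q).
  have H : (fun h => h^-1 *: (flat q (h *: 1 + 0) - flat q 0)) @ (0 : R)^' --> (0 : R).
    rewrite /flat ltxx; apply/cvgrPdist_lt => e e0.
    have C0 : 0 <= C by exact: le_trans (normr_ge0 _) (HC 0 (lexx _)).
    have d0 : 0 < e / (C + 1) by rewrite divr_gt0 // ltr_wpDl.
    near=> h; rewrite sub0r normrN subr0 addr0 [h *: 1]mulr1.
    case h0 : (0 < h); last by rewrite scaler0 normr0.
    have hi : 0 <= h^-1 by rewrite invr_ge0 ltW.
    have := HC _ hi; rewrite hornerM hornerXn => H.
    have -> : h^-1 *: (q.[h^-1] * expR (- h^-1)) = h * (h^-1 ^+ 2 * q.[h^-1] * expR (- h^-1)).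
      by rewrite /GRing.scale /=; field; rewrite gt_eqF.
    rewrite normrM (ger0_norm (ltW h0)).
    apply: le_lt_trans (_ : h * C < _); first by rewrite ler_wpM2l // ltW.
    have hd : `|h| < e / (C + 1).
      by near: h; exact: dnbhs0_lt.
    rewrite (ger0_norm (ltW h0)) ltr_pdivlMr ?ltr_wpDl // in hd.
    by apply: le_lt_trans hd; rewrite mulrDr mulr1 lerDl ltW.
  split; first by apply/cvg_ex; exists 0.
  by rewrite /derive (cvg_lim _ H).
Unshelve. all: by end_near. Qed.

Definition smooth1 {R : realType} (c : R -> R) : Prop :=
  exists cs : nat -> R -> R, cs 0%N = c /\ forall k (t : R), is_derive t 1 (cs k) (cs k.+1 t).

Definition theta {R : realType} : R -> R := flat 1.

Lemma smooth1_theta (R : realType) : smooth1 (theta : R -> R).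
Proof.
exists (fun k => flat (iter k flat_step 1)); split=> // k t; exact: flat_derive.
Qed.

Lemma theta_gt0 (R : realType) (t : R) : 0 < t -> 0 < theta t.
Proof. by move=> t0; rewrite /theta /flat t0 hornerC mul1r expR_gt0. Qed.

Lemma theta_eq0 (R : realType) (t : R) : t <= 0 -> theta t = 0.
Proof. by move=> t0; rewrite /theta /flat ltNge t0. Qed.

Lemma theta_ge0 (R : realType) (t : R) : 0 <= theta t.
Proof. by case: (ltP 0 t) => [/theta_gt0/ltW|/theta_eq0 ->]. Qed.

Definition cut {R : realType} (a b t : R) : R :=
  theta (b - t) * (theta (b - t) + theta (t - a))^-1.

Lemma cut_den (R : realType) (a b t : R) : a < b -> 0 < theta (b - t) + theta (t - a).
Proof.
move=> ab; case: (ltP t b) => tb.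
  by rewrite ltr_pwDl ?theta_ge0 // theta_gt0 // subr_gt0.
by rewrite ltr_wpDl ?theta_ge0 // theta_gt0 // subr_gt0 (lt_le_trans ab).
Qed.

Lemma cut_ge0 (R : realType) (a b t : R) : a < b -> 0 <= cut a b t.
Proof. by move=> ab; rewrite mulr_ge0 ?theta_ge0 // invr_ge0 ltW // cut_den. Qed.

Lemma cut_le1 (R : realType) (a b t : R) : a < b -> cut a b t <= 1.
Proof. by move=> ab; rewrite ler_pdivrMr ?cut_den // mul1r lerDl theta_ge0. Qed.

Lemma cut_eq1 (R : realType) (a b t : R) : a < b -> t <= a -> cut a b t = 1.
Proof.
move=> ab ta; have t0 : theta (t - a) = 0 by rewrite theta_eq0 // subr_le0.
by have := cut_den t ab; rewrite /cut t0 addr0 => H; rewrite mulfV // gt_eqF.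
Qed.

Lemma cut_eq0 (R : realType) (a b t : R) : b <= t -> cut a b t = 0.
Proof. by move=> bt; rewrite /cut theta_eq0 ?mul0r // subr_le0. Qed.

(** * Multi-indices and lists of directions *)

Lemma pderivs_move (R : realType) n (S : set 'rV[R]_n) f i s1 s2 x :
  good S -> smooth_on S f -> S x ->
  pderivs S (i :: s1 ++ s2) f x = pderivs S (s1 ++ i :: s2) f x.
Proof.
move=> gS sf; elim: s1 x => [//|j s1 IH] x Sx.
have -> : pderivs S (i :: (j :: s1) ++ s2) f x =
  pderiv S i (pderiv S j (pderivs S (s1 ++ s2) f)) x by [].
rewrite schwarz //; last exact: smooth_pderivs.
have -> : pderivs S ((j :: s1) ++ i :: s2) f x = pderiv S j (pderivs S (s1 ++ i :: s2) f) x by [].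
apply: pderiv_germ1 => //; apply: same_germ_on => y Sy; exact: IH.
Qed.

Lemma pderivs_perm (R : realType) n (S : set 'rV[R]_n) f s t x :
  good S -> smooth_on S f -> S x -> perm_eq s t -> pderivs S s f x = pderivs S t f x.
Proof.
move=> gS sf; elim: s t x => [|i s IH] t x Sx.
  by rewrite perm_sym => /perm_nilP ->.
move=> ist; have it : i \in t by rewrite -(perm_mem ist) mem_head.
move: ist; case: (path.splitPr it) => t1 t2 ist.
have st : perm_eq s (t1 ++ t2).
  by rewrite -(perm_cons i) (perm_trans ist) // perm_catC /= perm_cons perm_catC.
rewrite -pderivs_move //= ; apply: pderiv_germ1 => //; apply: same_germ_on => y Sy; exact: IH.
Qed.

Lemma order_ofE n (alpha : 'I_n -> nat) :
  order_of alpha = size (flatten [seq nseq (alpha i) i | i <- enum 'I_n]).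
Proof.
rewrite size_flatten /shape -map_comp sumnE big_map big_enum /=.
by apply: eq_bigr => i _; rewrite size_nseq.
Qed.

Lemma perm_counts n (s : seq 'I_n) :
  perm_eq s (flatten [seq nseq (count_mem i s) i | i <- enum 'I_n]).
Proof.
rewrite perm_sym; apply/allP => j _ /=; apply/eqP.
rewrite count_flatten -map_comp sumnE big_map big_enum /= (bigD1 j) //=.
rewrite count_nseq /= eqxx mul1n big1 ?addn0 // => i ij.
by rewrite count_nseq /= (negbTE ij).
Qed.

(** Mixed derivatives commute, so every list of directions can be rearranged into the order that
    [Dalpha] uses for its multi-index of multiplicities. *)
Lemma Dalpha_bnd (R : realType) n (S : set 'rV[R]_n) k A f x :
  good S -> smooth_on S f -> S x ->
  (forall alpha, (order_of alpha <= k)%N -> `|Dalpha S alpha f x| <= A) -> bnd S k A f x.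
Proof.
move=> gS sf Sx H; apply: pderivs_bnd => s sk.
rewrite (pderivs_perm gS sf Sx (perm_counts s)).
by apply: H; rewrite order_ofE -(perm_size (perm_counts s)).
Qed.

Lemma bnd_Dalpha (R : realType) n (S : set 'rV[R]_n) k A f x alpha :
  bnd S k A f x -> (order_of alpha <= k)%N -> `|Dalpha S alpha f x| <= A.
Proof. by move=> bf; rewrite order_ofE; exact: bnd_pderivs. Qed.

Lemma smooth_det (R : realType) p n (S : set 'rV[R]_p) (A : 'rV[R]_p -> 'M[R]_n) :
  good S -> (forall a b, smooth_on S (fun z => A z a b)) -> smooth_on S (fun z => \det (A z)).
Proof.
move=> gS sA; apply: smooth_sum => // s; apply: smoothM => //; first exact: smooth_cst.
by apply: smooth_prod => // i.
Qed.

Lemma smooth_invmx (R : realType) p n (S : set 'rV[R]_p) (A : 'rV[R]_p -> 'M[R]_n) a b :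
  good S -> (forall a b, smooth_on S (fun z => A z a b)) ->
  (forall z, S z -> A z \in unitmx) -> smooth_on S (fun z => invmx (A z) a b).
Proof.
move=> gS sA uA.
apply: (@smooth_eq _ _ _ (fun z => (\det (A z))^-1 * ((-1) ^+ (b + a) * \det (row' b (col' a (A z)))))).
  by move=> z Sz; rewrite /invmx uA // mxE mxE.
apply: smoothM => //.
  apply: smoothV => //; last exact: smooth_det.
  by move=> z /uA; rewrite unitmxE unitfE.
apply: smoothM => //; first exact: smooth_cst.
apply: smooth_det => // i j; apply: smooth_eq (sA (lift b i) (lift a j)) => z _.
by rewrite !mxE.
Qed.

(** Caratheodory's form of the chain rule: the difference quotient of [c] at [u 0], completed by
    [c'], is continuous there, so values [u h = u 0] need no separate treatment. *)
Lemma der_smooth1 (R : realType) (G : set_system R) (c u : R -> R) (c' l : R) :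
  Filter G -> punct G -> is_derive (u 0) 1 c c' -> der G u l ->
  der G (fun h => c (u h)) (c' * l).
Proof.
move=> FG G0 dc ul.
pose q y := if y == u 0 then c' else (y - u 0)^-1 * (c y - c (u 0)).
have cu := der_cvg FG G0 ul.
have cq : q @ nbhs (u 0) --> q (u 0).
  have [dcv Ec] := dc.
  have H : (fun h => h^-1 *: (c (h *: 1 + u 0) - c (u 0))) @ (0 : R)^' --> c' by rewrite -Ec; exact: dcv.
  rewrite /q eqxx; apply/cvgrPdist_lt => e e0.
  have /cvgrPdist_lt/(_ e e0) H2 := H.
  have [d d0 dH] : exists2 d : R, 0 < d & forall h, `|h| < d -> h != 0 ->
     `|c' - h^-1 *: (c (h *: 1 + u 0) - c (u 0))| < e.
    have /nbhs_ballP[d /= d0 dH] := H2; exists d => // h hd h0.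
    by apply: dH => //; rewrite -ball_normE /= sub0r normrN.
  apply/nbhs_ballP; exists d => //= y; rewrite -ball_normE /= distrC => yd.
  case: eqP => [_|/eqP yu]; first by rewrite subrr normr0.
  have := dH (y - u 0) yd; rewrite subr_eq0 yu => /(_ isT).
  by rewrite [(y - u 0) *: 1]mulr1 subrK /GRing.scale /=.
have H : (q (u h) * (h^-1 * (u h - u 0))) @[h --> G] --> c' * l.
  apply: cvgM => //; have -> : c' = q (u 0) by rewrite /q eqxx.
  exact: cvg_comp cu cq.
rewrite /der; apply: cvg_trans H; apply: near_eq_cvg; apply: nearW => h.
rewrite /q; case: eqP => [->|/eqP yu]; first by rewrite !subrr !mulr0.
by generalize (h^-1) => h'; field; rewrite subr_eq0 yu.
Qed.

Lemma smooth_smooth1 (R : realType) n (S : set 'rV[R]_n) (c : R -> R) f :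
  good S -> smooth1 c -> smooth_on S f -> smooth_on S (fun z => c (f z)).
Proof.
move=> gS [cs [<- dcs]] /smooth_onP kf; apply/smooth_onP => k.
have : forall j, Ck S k (fun z => cs j (f z)); last exact.
have cc j y : {for y, continuous (cs j)}.
  apply: differentiable_continuous; apply/derivable1_diffP; exact: (@ex_derive _ _ _ _ _ _ _ (dcs j y)).
have ca j x : S x -> cont_at S (fun z => cs j (f z)) x.
  move=> Sx; have [cf _] := kf 0%N.
  by apply: cvg_comp (cf x Sx) _; exact: cc.
elim: k => [|k IH] j; first by split=> // x; exact: ca.
split; first by move=> x; exact: ca.
have H i x (Sx : S x) : has_dderiv S (ebase i) (fun z => cs j (f z)) x /\
    pderiv S i (fun z => cs j (f z)) x = cs j.+1 (f x) * pderiv S i f x.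
  have [_ [df _]] := kf 1%N.
  apply: pderiv_der => //.
  have := @der_smooth1 R (increments S x (ebase i)) (cs j) (fun h => f (x + h *: ebase i))
    (cs j.+1 (f x)) (pderiv S i f x) (incr_filter S x (ebase i)) (@punct_incr _ _ S x (ebase i)).
  have E0 : x + 0 *: ebase i = x by rewrite scale0r addr0.
  have dE : is_derive (f (x + 0 *: ebase i)) 1 (cs j) (cs j.+1 (f x)) by rewrite E0; exact: dcs.
  move=> /(_ dE); apply.
  exact: (pderivP gS Sx (df i x Sx)).
split=> [i x Sx|i]; first by have [] := H i x Sx.
have [_ [_ kf1]] := kf k.+1.
by apply: Ck_eq (CkM gS (IH j.+1) (kf1 i)) => x Sx; have [_ ->] := H i x Sx.
Qed.

Lemma smooth_cut (R : realType) n (S : set 'rV[R]_n) (a b : R) f :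
  good S -> a < b -> smooth_on S f -> smooth_on S (fun z => cut a b (f z)).
Proof.
move=> gS ab sf.
have s1 : smooth_on S (fun z => theta (b - f z)).
  apply: smooth_smooth1 => //; first exact: smooth1_theta.
  apply: smoothD => //; first exact: smooth_cst.
  by apply: smooth_eq (smoothM gS (smooth_cst (-1) gS) sf) => x _; rewrite mulN1r.
have s2 : smooth_on S (fun z => theta (f z - a)).
  apply: smooth_smooth1 => //; first exact: smooth1_theta.
  by apply: smoothD => //; exact: smooth_cst.
apply: smoothM => //; apply: smoothV => //; last exact: smoothD.
by move=> x _; rewrite gt_eqF // cut_den.
Qed.

Lemma goodT (R : realType) n : good [set: 'rV[R]_n].
Proof. by exists pred0; split=> // x _; exists 1. Qed.

Lemma pderiv_setT (R : realType) n (S : set 'rV[R]_n) i f x :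
  good S -> S x -> smooth_on setT f -> pderiv S i f x = pderiv setT i f x.
Proof.
move=> gS Sx sf; have := pderivP (i := i) (@goodT R n) (I : setT x) (smooth_dd (i := i) sf I).
move=> H; have [] // := @pderiv_der R n S f x i (pderiv setT i f x) gS Sx.
move=> A /H /= HA; have HA' : \forall h \near (0 : R)^', setT (x + h *: ebase i) ->
  A (h^-1 * (f (x + h *: ebase i) - f (x + 0 *: ebase i))) := HA.
suff : \forall h \near (0 : R)^', S (x + h *: ebase i) ->
  A (h^-1 * (f (x + h *: ebase i) - f (x + 0 *: ebase i))) by [].
by apply: filterS HA' => h H1 _; exact: H1.
Qed.

Lemma smooth_setT (R : realType) n (S : set 'rV[R]_n) f :
  good S -> smooth_on setT f -> smooth_on S f.
Proof.
move=> gS sf; apply: (@smooth_comp R n n S setT id f) => //; first exact: goodT.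
by move=> j; exact: smooth_coord.
Qed.

Lemma bnd_setT (R : realType) n (S : set 'rV[R]_n) k A f x :
  good S -> S x -> smooth_on setT f -> bnd setT k A f x -> bnd S k A f x.
Proof.
move=> gS Sx; elim: k f => [|k IH] f sf [fA H]; first by split.
split=> // i; have := IH _ (smooth_pderiv i sf) (H i).
by apply: bnd_eq => // y Sy; rewrite pderiv_setT.
Qed.

Lemma smooth_compact_bound (R : realType) n (Q : set 'rV[R]_n) f :
  compact Q -> smooth_on setT f -> exists A : R, forall x, Q x -> `|f x| <= A.
Proof.
move=> cQ sf; have [->|Q0] := eqVneq Q set0; first by exists 0.
have cf : {within Q, continuous (fun x => `|f x|)}.
  apply/within_cont_atP => x _; have := (within_cont_atP _ _).1 (smooth_cont sf) x I => H.
  apply: cvg_norm => A /H; rewrite /within /= => HA.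
  have HA' : \forall y \near x, setT y -> A (f y) := HA.
  suff : \forall y \near x, Q y -> A (f y) by [].
  by apply: filterS HA' => y Hy _; exact: Hy.
have [c _ Hc] := compact_EVT_max ((set0P _).1 Q0) cQ cf.
by exists `|f c| => x Qx; apply: Hc; rewrite inE.
Qed.

Lemma bnd_compact (R : realType) n (Q : set 'rV[R]_n) k f :
  compact Q -> smooth_on setT f -> exists A : R, forall x, Q x -> bnd setT k A f x.
Proof.
move=> cQ; elim: k f => [|k IH] f sf; have [A0 H0] := smooth_compact_bound cQ sf.
  by exists A0 => x Qx; split=> //; exact: H0.
have [A HA] := choice (fun i => IH _ (smooth_pderiv i sf)).
exists (\big[Num.max/A0]_i A i) => x Qx; split.
  by apply: le_trans (H0 x Qx) _; exact: bigmax_ge_id.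
by move=> i; apply: bnd_le (HA i x Qx); exact: le_bigmax.
Qed.

(** * Coordinate systems compatible with the atlas *)

Lemma good_rel_open (R : realType) n (P : pred 'I_n) (S : set 'rV[R]_n) :
  rel_open (orth P) S -> good S.
Proof.
move=> [U oU ->]; exists P; split; first by move=> x [].
move=> x [Px Ux]; have /nbhs_bxP[d d0 dO] : nbhs x U by exact: open_nbhs_nbhs.
by exists d => // y [Py xy]; split=> //; exact: dO.
Qed.

Lemma half_spaceE (R : realType) n : @half_space R n = orth (pred1 ord_max).
Proof.
by apply/seteqP; split=> z /=; [move=> z0 k /eqP -> | apply; exact: eqxx].
Qed.

Lemma near_preim (R : realType) n (T : topologicalType) (D : set 'rV[R]_n)
    (k : 'rV[R]_n -> T) (O : set T) x :
  {within D, continuous k} -> open O -> D x -> O (k x) ->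
  \forall y \near x, D y -> O (k y).
Proof.
move=> /subspace_continuousP ck oO Dx Ox.
by have := ck x Dx _ (open_nbhs_nbhs (conj oO Ox)).
Qed.

Lemma near_preimE (R : realType) n (T : topologicalType) (D : set 'rV[R]_n)
    (k : 'rV[R]_n -> T) (O : set T) x :
  {within D, continuous k} -> open O -> D x -> O (k x) ->
  \forall y \near x, D y <-> (D `&` k @^-1` O) y.
Proof.
move=> ck oO Dx Ox; apply: filterS (near_preim ck oO Dx Ox) => y H.
by split=> [Dy|[]//]; split=> //; exact: H.
Qed.

Lemma good_preim (R : realType) n (T : topologicalType) (D : set 'rV[R]_n)
    (k : 'rV[R]_n -> T) (O : set T) :
  good D -> {within D, continuous k} -> open O -> good (D `&` k @^-1` O).
Proof.
move=> [P [DP gd]] ck oO; exists P; split; first by move=> x [/DP].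
move=> x [Dx Ox]; have [d d0 dD] := gd x Dx.
have /nbhs_bxP[e e0 eH] := near_preim ck oO Dx Ox.
exists (Num.min d e); first by rewrite lt_min d0.
move=> y [Py xy].
have Dy : D y by apply: dD; split=> //; apply: bx_le xy; rewrite ge_min lexx.
by split=> //; apply: eH => //; apply: bx_le xy; rewrite ge_min lexx orbT.
Qed.

Lemma smooth_subset (R : realType) n (T : topologicalType) (D : set 'rV[R]_n)
    (k : 'rV[R]_n -> T) (O : set T) f :
  {within D, continuous k} -> open O ->
  smooth_on D f -> smooth_on (D `&` k @^-1` O) f.
Proof.
move=> ck oO; apply: smooth_sub => x [Dx Ox]; exact: near_preimE.
Qed.

Lemma jac_germ (R : realType) n p (S S' : set 'rV[R]_n) (F F' : 'rV[R]_n -> 'rV[R]_p) x :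
  S x -> (\forall y \near x, (S y <-> S' y) /\ (S y -> F y = F' y)) ->
  jac S F x = jac S' F' x.
Proof.
move=> Sx sg; apply/matrixP => i k; rewrite !mxE; apply: pderiv_germ1 => //.
by apply: filterS sg => y [SS' FF']; split=> // /FF' ->.
Qed.

Lemma jac_comp (R : realType) n p q (S : set 'rV[R]_n) (S' : set 'rV[R]_p)
    (F : 'rV[R]_n -> 'rV[R]_p) (G : 'rV[R]_p -> 'rV[R]_q) x :
  good S -> good S' -> S x -> (forall y, S y -> S' (F y)) ->
  (forall k, smooth_on S (fun z => F z 0 k)) ->
  (forall k, smooth_on S' (fun z => G z 0 k)) ->
  jac S (fun z => G (F z)) x = jac S F x *m jac S' G (F x).
Proof.
move=> gS gS' Sx SS' sF sG; apply/matrixP => i l; rewrite !mxE.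
have [_ ->] := @pderiv_comp R n p S S' F (fun z => G z 0 l) i x gS gS' Sx SS'
  (smooth_C1 (sG l)) (fun k => @smooth_dd _ _ _ _ i _ (sF k) Sx).
by apply: eq_bigr => k _; rewrite !mxE mulrC.
Qed.

Lemma jac_id (R : realType) n (S : set 'rV[R]_n) x : good S -> S x -> jac S id x = 1%:M.
Proof.
move=> gS Sx; apply/matrixP => i k; rewrite !mxE.
by have [_ ->] := pderiv_coord k i gS Sx; rewrite eq_sym.
Qed.

(* A coordinate system compatible with the atlas; [g] is the inverse of [k]. Both the
   normal charts and the charts of the atlas itself are of this kind. *)
Definition dchart {R : realType} {T : topologicalType} {n : nat} (M : rmfd R T n.+1)
    (D : set 'rV[R]_n.+1) (k : 'rV[R]_n.+1 -> T) (g : T -> 'rV[R]_n.+1) : Prop :=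
  [/\ good D /\ {within D, continuous k},
      (forall j a, smooth_on (D `&` k @^-1` cdom (ch j))
         (fun y => cmap (@ch _ _ _ M j) (k y) 0 a)),
      open (k @` D),
      (forall y, D y -> g (k y) = y)
    & (forall j a, smooth_on (coord_set j `&` cinv (ch j) @^-1` (k @` D))
         (fun y => g (cinv (@ch _ _ _ M j) y) 0 a))].

Lemma rm_chart (R : realType) (T : topologicalType) n (M : rmfd R T n.+1) (i : idx M) :
  riemannian_manifold M -> is_chart (ch i).
Proof. by move=> [_ _]. Qed.

Lemma rm_cover (R : realType) (T : topologicalType) n (M : rmfd R T n.+1) (x : T) :
  riemannian_manifold M -> exists i : idx M, cdom (ch i) x.
Proof.
move=> [_ pM _ _ _]; have : points (@ch _ _ _ M) x by rewrite pM.
by move=> [i _ xi]; exists i.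
Qed.

Lemma good_coord (R : realType) (T : topologicalType) n (M : rmfd R T n.+1) (i : idx M) :
  riemannian_manifold M -> good (coord_set i).
Proof.
move=> /(rm_chart i) [_ ro _ _ _]; apply: (@good_rel_open _ _ (pred1 ord_max)).
by rewrite -half_spaceE.
Qed.

Lemma cmap_img (R : realType) (T : topologicalType) n (M : rmfd R T n.+1) (i : idx M) (A : set T) :
  riemannian_manifold M ->
  cmap (ch i) @` (cdom (ch i) `&` A) = coord_set i `&` cinv (ch i) @^-1` A.
Proof.
move=> /(rm_chart i) [_ _ K _ _]; apply/seteqP; split=> y.
  by move=> [x [ix Ax] <-]; split; [exists x|rewrite /= K].
by move=> [[x ix <-]]; rewrite /= K // => Ax; exists x.
Qed.

Lemma dchart_atlas (R : realType) (T : topologicalType) n (M : rmfd R T n.+1) (i : idx M) :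
  riemannian_manifold M -> dchart M (coord_set i) (cinv (ch i)) (cmap (ch i)).
Proof.
move=> hM; have [oi _ K cm ci] := rm_chart i hM; have [_ _ _ tr _] := hM.
have E : cinv (ch i) @` coord_set i = cdom (ch i).
  apply/seteqP; split=> x; first by move=> [_ [y yi <-] <-]; rewrite K.
  by move=> xi; exists (cmap (ch i) x); [exists x|exact: K].
split.
- by split=> //; exact: good_coord.
- move=> j a; have [+ _] := tr i j; move=> /(_ a); rewrite cmap_img //; exact.
- by rewrite E.
- by move=> _ [x ix <-]; rewrite K.
- by move=> j a; have [+ _] := tr j i; move=> /(_ a); rewrite cmap_img // E.
Qed.

Lemma dchart_ginv (R : realType) (T : topologicalType) n (M : rmfd R T n.+1) D k g x :
  dchart M D k g -> (k @` D) x -> D (g x) /\ k (g x) = x.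
Proof. by move=> [_ _ _ K _] [y Dy <-]; rewrite K. Qed.

Lemma dchart_trans (R : realType) (T : topologicalType) n (M : rmfd R T n.+1) D k g D' k' g' a :
  riemannian_manifold M -> dchart M D k g -> dchart M D' k' g' ->
  smooth_on (D `&` k @^-1` (k' @` D')) (fun y => g' (k y) 0 a).
Proof.
move=> hM [[gD ck] sk ok K sg] [[gD' ck'] sk' ok' K' sg'].
apply: smooth_local => y0 [Dy0 Ay0].
have [j jy0] := rm_cover (k y0) hM; have [oj _ Kj cm ci] := rm_chart j hM.
pose S := (D `&` k @^-1` cdom (ch j)) `&` k @^-1` (k' @` D').
have ckj : {within D `&` k @^-1` cdom (ch j), continuous k}.
  by apply: continuous_subspaceW ck => y [].
have gDj : good (D `&` k @^-1` cdom (ch j)) by exact: good_preim.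
have gS : good S by exact: good_preim.
exists S, (fun y => g' (k y) 0 a); split=> //.
  have H := near_preim ck oj Dy0 jy0; apply: filterS H => y H; split=> //; split.
    by move=> [[Dy jy] Ay].
  by move=> [Dy Ay]; split=> //; split=> //; exact: H.
apply: (@smooth_eq _ _ _ (fun y => g' (cinv (ch j) (cmap (ch j) (k y))) 0 a)).
  by move=> y [[Dy jy] _]; rewrite Kj.
apply: (@smooth_comp R n.+1 n.+1 S (coord_set j `&` cinv (ch j) @^-1` (k' @` D'))
  (fun y => cmap (ch j) (k y)) (fun z => g' (cinv (ch j) z) 0 a)) => //.
- by apply: good_preim => //; exact: good_coord.
- by move=> y [[Dy jy] Ay]; split; [exists (k y)|rewrite /= Kj].
- by move=> b; apply: smooth_subset => //; exact: sk.
Qed.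

Definition trans_dom {R : realType} {T : Type} {n : nat} (D : set 'rV[R]_n) (k : 'rV[R]_n -> T)
    (D' : set 'rV[R]_n) (k' : 'rV[R]_n -> T) : set 'rV[R]_n := D `&` k @^-1` (k' @` D').

Lemma trans_good (R : realType) (T : topologicalType) n (M : rmfd R T n.+1) D k g D' k' g' :
  dchart M D k g -> dchart M D' k' g' -> good (trans_dom D k D' k').
Proof. by move=> [[gD ck] _ _ _ _] [_ _ ok' _ _]; exact: good_preim. Qed.

Lemma trans_near (R : realType) (T : topologicalType) n (M : rmfd R T n.+1) D k g D' k' g' x :
  dchart M D k g -> dchart M D' k' g' -> trans_dom D k D' k' x ->
  \forall y \near x, D y <-> trans_dom D k D' k' y.
Proof. by move=> [[gD ck] _ _ _ _] [_ _ ok' _ _] [Dx Ax]; exact: near_preimE. Qed.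

Lemma trans_in (R : realType) (T : topologicalType) n (M : rmfd R T n.+1) D k g D' k' g' x :
  dchart M D k g -> dchart M D' k' g' -> trans_dom D k D' k' x ->
  trans_dom D' k' D k (g' (k x)).
Proof.
move=> dc dc' [Dx Ax]; have [D'g kg] := dchart_ginv dc' Ax.
by split=> //; rewrite /= kg; exists x.
Qed.

Lemma jac_trans (R : realType) (T : topologicalType) n (M : rmfd R T n.+1)
    D k g D1 k1 g1 D2 k2 g2 x :
  riemannian_manifold M -> dchart M D k g -> dchart M D1 k1 g1 -> dchart M D2 k2 g2 ->
  trans_dom D k D1 k1 x -> (k2 @` D2) (k x) ->
  jac D (fun y => g2 (k y)) x =
    jac D (fun y => g1 (k y)) x *m jac D1 (fun y => g2 (k1 y)) (g1 (k x)).
Proof.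
move=> hM dc dc1 dc2 tx A2; have [Dx A1] := tx.
have gt := trans_good dc dc1; have gt12 := trans_good dc1 dc2.
have [[gD ck] sk ok K sg] := dc; have [[gD1 ck1] sk1 ok1 K1 sg1] := dc1.
have [_ _ ok2 K2 _] := dc2.
pose S := trans_dom D k D1 k1 `&` k @^-1` (k2 @` D2).
have ckt : {within trans_dom D k D1 k1, continuous k}.
  by apply: continuous_subspaceW ck => y [].
have gS : good S by exact: good_preim.
have Sx : S x by [].
have nS : \forall y \near x, D y <-> S y.
  apply: filterS2 (near_preim ck ok1 Dx A1) (near_preim ck ok2 Dx A2) => y H1 H2.
  by split=> [Dy|[[]]//]; split; [split=> //; exact: H1|exact: H2].
have t12 y : S y -> trans_dom D1 k1 D2 k2 (g1 (k y)).
  move=> [[Dy y1] y2]; have [D1y ky] := dchart_ginv dc1 y1.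
  by split=> //; rewrite /= ky.
have -> : jac D (fun y => g2 (k y)) x = jac S (fun y => g2 (k1 (g1 (k y)))) x.
  apply: jac_germ => //; apply: filterS nS => y DS; split=> // /DS[[_ y1] _].
  by have [_ ->] := dchart_ginv dc1 y1.
rewrite (@jac_comp R n.+1 n.+1 n.+1 S (trans_dom D1 k1 D2 k2) (fun y => g1 (k y)) (fun z => g2 (k1 z)) x) //.
- congr (_ *m _).
    by apply: jac_germ => //; apply: filterS nS => y DS; split=> //; apply: iff_sym.
  apply: jac_germ; first exact: t12.
  by apply: filterS (trans_near dc1 dc2 (t12 _ Sx)) => y DS; split=> //; apply: iff_sym.
- by move=> b; apply: smooth_subset => //; exact: (dchart_trans b hM dc dc1).
- by move=> b; exact: (dchart_trans b hM dc1 dc2).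
Qed.

Lemma jac_inv (R : realType) (T : topologicalType) n (M : rmfd R T n.+1)
    D k g D1 k1 g1 x :
  riemannian_manifold M -> dchart M D k g -> dchart M D1 k1 g1 ->
  trans_dom D k D1 k1 x ->
  jac D (fun y => g1 (k y)) x *m jac D1 (fun y => g (k1 y)) (g1 (k x)) = 1%:M.
Proof.
move=> hM dc dc1 tx; have [[gD ck] sk ok K sg] := dc; have [Dx A1] := tx.
rewrite -(jac_trans hM dc dc1 dc tx); last by exists x.
rewrite -(jac_id gD Dx); apply: jac_germ => //; apply: (@filterE _ (nbhs x) (nbhs_filter x)) => y; split=> // Dy.
by rewrite K.
Qed.

Lemma met_spd (R : realType) (T : topologicalType) n (M : rmfd R T n.+1) (i : idx M) y :
  riemannian_manifold M -> coord_set i y -> spd (met i y).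
Proof. by move=> [_ _ _ _ /(_ i)[_ sy po]] iy; split; [exact: sy|move=> v v0; exact: po]. Qed.

Lemma atlas_img (R : realType) (T : topologicalType) n (M : rmfd R T n.+1) (i : idx M) x :
  riemannian_manifold M -> cdom (ch i) x -> (cinv (ch i) @` coord_set i) x.
Proof. by move=> hM ix; have [_ _ K _ _] := rm_chart i hM; exists (cmap (ch i) x); [exists x|exact: K]. Qed.

(** [metric_in] selects its auxiliary chart by choice. The transformation law of the atlas metric
    and the chain rule for Jacobians show that every admissible chart gives the same matrix. *)
Lemma metric_inE (R : realType) (T : topologicalType) n (M : rmfd R T n.+1) D k g (j : idx M) z :
  riemannian_manifold M -> dchart M D k g -> D z -> cdom (ch j) (k z) ->
  metric_in M D k z = jac D (fun y => cmap (ch j) (k y)) z *m met_at j (k z) *m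
    (jac D (fun y => cmap (ch j) (k y)) z)^T.
Proof.
move=> hM dc Dz jz; rewrite /metric_in.
case: xgetP => [G _ [i [iz ->]]|/(_ (jac D (fun y => cmap (ch j) (k y)) z *m met_at j (k z) *m
    (jac D (fun y => cmap (ch j) (k y)) z)^T)) []]; last by exists j.
have dj := dchart_atlas j hM; have di := dchart_atlas i hM.
have tj : trans_dom D k (coord_set j) (cinv (ch j)) z by split=> //; exact: atlas_img.
have := jac_trans hM dc dj di tj (atlas_img hM iz) => ->.
have [_ _ _ tr _] := hM; have [_ Hm] := tr j i.
have [_ _ Kj _ _] := rm_chart j hM.
set z' := cmap (ch j) (k z).
have Sz : (cmap (ch j) @` (cdom (ch j) `&` cdom (ch i))) z' by exists (k z).
have := Hm z' Sz; rewrite /met_at -/z' => ->.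
have Et : transition j i z' = cmap (ch i) (k z) by rewrite /transition /z' Kj.
rewrite Et.
have -> : jac (cmap (ch j) @` (cdom (ch j) `&` cdom (ch i))) (transition j i) z' =
  jac (coord_set j) (fun y => cmap (ch i) (cinv (ch j) y)) z'.
  apply: jac_germ => //; rewrite cmap_img //.
  have [oi _ _ _ _] := rm_chart i hM; have [_ _ _ _ cj] := rm_chart j hM.
  have jz' : coord_set j z' by exists (k z).
  have iz' : cdom (ch i) (cinv (ch j) z') by rewrite /z' Kj.
  apply: filterS (near_preimE cj oi jz' iz') => y H; split=> //; exact: iff_sym.
by rewrite !trmx_mul !mulmxA.
Qed.

Lemma jac_atlas_unit (R : realType) (T : topologicalType) n (M : rmfd R T n.+1) D k g (j : idx M) z :
  riemannian_manifold M -> dchart M D k g -> D z -> cdom (ch j) (k z) ->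
  exists J', jac D (fun y => cmap (ch j) (k y)) z *m J' = 1%:M.
Proof.
move=> hM dc Dz jz; eexists.
by apply: (jac_inv hM dc (dchart_atlas j hM)); split=> //; exact: atlas_img.
Qed.

Lemma metric_in_spd (R : realType) (T : topologicalType) n (M : rmfd R T n.+1) D k g z :
  riemannian_manifold M -> dchart M D k g -> D z -> spd (metric_in M D k z).
Proof.
move=> hM dc Dz; have [j jz] := rm_cover (k z) hM.
rewrite (metric_inE hM dc Dz jz); have [J' JJ] := jac_atlas_unit hM dc Dz jz.
by apply: spd_mul JJ _; apply: met_spd => //; exists (k z).
Qed.

Lemma metric_in_smooth (R : realType) (T : topologicalType) n (M : rmfd R T n.+1) D k g a b :
  riemannian_manifold M -> dchart M D k g -> smooth_on D (fun z => metric_in M D k z a b).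
Proof.
move=> hM dc; have [[gD ck] sk ok K sg] := dc.
apply: smooth_local => z0 Dz0; have [j jz0] := rm_cover (k z0) hM.
have [oj _ Kj cm ci] := rm_chart j hM.
pose S := D `&` k @^-1` cdom (ch j).
have gS : good S by exact: good_preim.
have nS x : S x -> \forall y \near x, D y <-> S y by move=> [Dx jx]; exact: near_preimE.
exists S, (fun z => metric_in M D k z a b); split=> //.
  by apply: filterS (nS z0 (conj Dz0 jz0)) => y H; split=> //; exact: iff_sym.
have sJ c d : smooth_on S (fun z => jac D (fun y => cmap (ch j) (k y)) z c d).
  apply: smooth_eq (smooth_pderiv c (sk j d)) => x Sx; rewrite mxE.
  apply: pderiv_germ1 => //; apply: filterS (nS x Sx) => y H; split=> //; exact: iff_sym.
have sm c d : smooth_on S (fun z => met_at j (k z) c d).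
  have [_ _ _ _ /(_ j)[sm _ _]] := hM.
  apply: (@smooth_comp R n.+1 n.+1 S (coord_set j) (fun y => cmap (ch j) (k y)) (fun z => met j z c d)) => //.
  - exact: good_coord.
  - by move=> y [Dy jy]; exists (k y).
  - by move=> e; exact: sk.
apply: (@smooth_eq _ _ _ (fun z => \sum_c (\sum_d jac D (fun y => cmap (ch j) (k y)) z a d *
   met_at j (k z) d c) * jac D (fun y => cmap (ch j) (k y)) z b c)).
  move=> z [Dz jz]; rewrite (metric_inE hM dc Dz jz) [RHS]mxE; apply: eq_bigr => c _.
  by rewrite [(_^T) _ _]mxE; congr (_ * _); rewrite mxE.
apply: smooth_sum => // c; apply: smoothM => //; apply: smooth_sum => // d; exact: smoothM.
Qed.

Lemma metric_trans (R : realType) (T : topologicalType) n (M : rmfd R T n.+1)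
    D k g D' k' g' z :
  riemannian_manifold M -> dchart M D k g -> dchart M D' k' g' ->
  trans_dom D k D' k' z ->
  metric_in M D k z = jac D (fun y => g' (k y)) z *m metric_in M D' k' (g' (k z)) *m
    (jac D (fun y => g' (k y)) z)^T.
Proof.
move=> hM dc dc' tz; have [Dz Az] := tz; have [j jz] := rm_cover (k z) hM.
have [D'g kg] := dchart_ginv dc' Az.
have jz' : cdom (ch j) (k' (g' (k z))) by rewrite kg.
rewrite (metric_inE hM dc Dz jz) (metric_inE hM dc' D'g jz') kg.
rewrite (jac_trans hM dc dc' (dchart_atlas j hM) tz (atlas_img hM jz)).
by rewrite !trmx_mul !mulmxA.
Qed.

(** * Derivative bounds for coordinate changes *)

(* [F] pulls the metric [H] back to the metric [G]; [C] bounds the derivatives of both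
   metrics and of their inverses at [z] and [F z]. *)
Record isometry_at {R : realType} {n : nat} (C : nat -> R) (S S' : set 'rV[R]_n)
    (F : 'rV[R]_n -> 'rV[R]_n) (G H : 'rV[R]_n -> 'M[R]_n) (z : 'rV[R]_n) : Prop := {
  iso_good : good S /\ good S';
  iso_in : S z /\ forall y, S y -> S' (F y);
  iso_F : forall p, smooth_on S (fun y => F y 0 p);
  iso_G : forall a b, smooth_on S (fun y => G y a b);
  iso_H : forall a b, smooth_on S' (fun y => H y a b);
  iso_spdG : forall y, S y -> spd (G y);
  iso_spdH : forall y, S' y -> spd (H y);
  iso_eq : forall y, S y -> G y = jac S F y *m H (F y) *m (jac S F y)^T;
  iso_bG : forall k a b, bnd S k (C k) (fun y => G y a b) z;
  iso_bVG : forall k a b, bnd S k (C k) (fun y => invmx (G y) a b) z;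
  iso_bH : forall k a b, bnd S' k (C k) (fun y => H y a b) (F z);
  iso_bVH : forall k a b, bnd S' k (C k) (fun y => invmx (H y) a b) (F z) }.

Lemma bform_row (R : realType) n p (J : 'M[R]_(n, p)) (G : 'M[R]_p) a :
  bform G (row a J) (row a J) = (J *m G *m J^T) a a.
Proof.
rewrite /bform -row_mul; move: (J *m G) => A; rewrite !mxE.
by apply: eq_bigr => q _; rewrite !mxE.
Qed.

(** Row [a] of the Jacobian has squared [H]-length [G z a a], and the bound on the inverse of [H]
    controls its coordinates. From [t ^+ 2 <= B] follows [t <= 1 + B], which avoids a root in the
    constant. *)
Lemma iso_jac0 (R : realType) n (C : nat -> R) S S' F G H (z : 'rV[R]_n) a p :
  isometry_at C S S' F G H z ->
  `|pderiv S a (fun y => F y 0 p) z| <= 1 + n%:R * C 0%N * C 0%N.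
Proof.
case=> [[gS gS'] [Sz SS'] sF sG sH pG pH Eq bG bVG bH bVH].
pose v := row a (jac S F z).
have vE q : v 0 q = pderiv S a (fun y => F y 0 q) z by rewrite !mxE.
have H1 := bform_lower v (pH _ (SS' _ Sz)) (fun a b => proj1 (bVH 0%N a b)).
have Gaa : bform (H (F z)) v v = G z a a.
  by rewrite Eq // bform_row.
have G1 : G z a a <= C 0%N by apply: le_trans (ler_norm _) (proj1 (bG 0%N a a)).
have C0 : 0 <= C 0%N by exact: bnd_ge0 (bG 0%N a a).
rewrite Gaa in H1; rewrite -vE.
have H2 : v 0 p ^+ 2 <= n%:R * C 0%N * C 0%N.
  apply: le_trans (_ : \sum_q v 0 q ^+ 2 <= _).
    by rewrite (bigD1 p) //= lerDl; apply: sumr_ge0 => q _; exact: sqr_ge0.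
  by apply: le_trans H1 _; rewrite ler_wpM2l // mulr_ge0.
have : `|v 0 p| ^+ 2 <= n%:R * C 0%N * C 0%N by rewrite real_normK ?num_real.
set B := n%:R * _ * _ => H3; have := normr_ge0 (v 0 p); set t := `|_| in H3 *.
have B0 : 0 <= B by rewrite /B !mulr_ge0.
by move=> t0; nra.
Qed.

Lemma pderiv_sum (R : realType) n (S : set 'rV[R]_n) (I : Type) (r : seq I) (f : I -> 'rV[R]_n -> R) i x :
  good S -> S x -> (forall j, smooth_on S (f j)) ->
  pderiv S i (fun z => \sum_(j <- r) f j z) x = \sum_(j <- r) pderiv S i (f j) x.
Proof.
move=> gS Sx sf; elim: r => [|j r IH].
  rewrite big_nil -[RHS](proj2 (pderiv_cst 0 i gS Sx)).
  by apply: pderiv_germ1 => //; apply: same_germ_on => y _; rewrite big_nil.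
rewrite big_cons -IH.
have [_ <-] := pderivD gS Sx (@smooth_dd _ _ _ _ i _ (sf j) Sx) (@smooth_dd _ _ _ _ i _ (smooth_sum r gS sf) Sx).
by apply: pderiv_germ1 => //; apply: same_germ_on => y _; rewrite big_cons.
Qed.

Lemma leibniz3 (R : realType) (a b c a' b' c' : R) :
  (a' * b + a * b') * c + a * b * c' = a' * b * c + a * b * c' + a * c * b'.
Proof. by ring. Qed.

Definition jac_entry {R : realType} {n : nat} (S : set 'rV[R]_n) (F : 'rV[R]_n -> 'rV[R]_n) a p :=
  pderiv S a (fun y => F y 0 p).

Definition dHF {R : realType} {n : nat} (S' : set 'rV[R]_n) (F : 'rV[R]_n -> 'rV[R]_n)
    (H : 'rV[R]_n -> 'M[R]_n) r p q := fun z => pderiv S' r (fun y => H y p q) (F z).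

(** The derivative of [G a b] in direction [c], less the terms in which the derivative falls on [H].
    The two groups of terms that remain carry the second derivatives of [F]. *)
Definition isoE {R : realType} {n : nat} (S S' : set 'rV[R]_n) (F : 'rV[R]_n -> 'rV[R]_n)
    (G H : 'rV[R]_n -> 'M[R]_n) c a b := fun z =>
  pderiv S c (fun y => G y a b) z +
  (-1) * \sum_p \sum_q jac_entry S F a p z * jac_entry S F b q z * \sum_r dHF S' F H r p q z * jac_entry S F c r z.

(** The alternating sum of Christoffel symbols of the first kind. Second derivatives being
    symmetric, it isolates the second derivative of [F] in directions [c] and [a], contracted by [H]
    with row [b] of the Jacobian. *)
Definition isoB {R : realType} {n : nat} (S S' : set 'rV[R]_n) (F : 'rV[R]_n -> 'rV[R]_n)
    (G H : 'rV[R]_n -> 'M[R]_n) c a b := fun z =>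
  2^-1 * (isoE S S' F G H c a b z + isoE S S' F G H a c b z + (-1) * isoE S S' F G H b c a z).

(** The entries of [G^-1 J], which by [G = J H J^T] is the inverse of [H J^T] and so undoes the
    contraction in [isoB]. *)
Definition isoW {R : realType} {n : nat} (S : set 'rV[R]_n) (F : 'rV[R]_n -> 'rV[R]_n)
    (G : 'rV[R]_n -> 'M[R]_n) b p := fun z => \sum_d invmx (G z) b d * jac_entry S F d p z.

(* The transformation law of the Christoffel symbols: the second derivatives of an
   isometry are polynomials in its first derivatives and in the two metrics. *)
Lemma iso_second (R : realType) n (C : nat -> R) S S' F G H (z : 'rV[R]_n) c a p y :
  isometry_at C S S' F G H z -> S y ->
  pderiv S c (jac_entry S F a p) y = \sum_b isoB S S' F G H c a b y * isoW S F G b p y.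
Proof.
case=> [[gS gS'] [Sz SS'] sF sG sH pG pH Eq _ _ _ _] Sy.
have sj a' p' : smooth_on S (jac_entry S F a' p') by exact: smooth_pderiv.
pose hh p' q' := fun x => H (F x) p' q'.
have shh p' q' : smooth_on S (hh p' q').
  exact: (@smooth_comp R n n S S' F (fun y => H y p' q')).
have Gab a' b' x : S x -> G x a' b' = \sum_p' \sum_q' jac_entry S F a' p' x * hh p' q' x * jac_entry S F b' q' x.
  move=> Sx; rewrite (Eq x Sx) mxE exchange_big; apply: eq_bigr => q' _.
  rewrite [(_^T) _ _]mxE [X in _ * X]mxE mxE mulr_suml; apply: eq_bigr => p' _.
  by rewrite [X in X * _ * _]mxE.
pose B c' a' b' := \sum_p' \sum_q' pderiv S c' (jac_entry S F a' p') y * hh p' q' y * jac_entry S F b' q' y.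
have Bsym c' a' b' : B c' a' b' = B a' c' b'.
  by apply: eq_bigr => p' _; apply: eq_bigr => q' _; rewrite /jac_entry schwarz.
have HT x : S x -> forall p' q', hh p' q' x = hh q' p' x.
  by move=> Sx p' q'; have [E _] := pH _ (SS' _ Sx); rewrite /hh -[in LHS]E mxE.
have dhh c' p' q' : pderiv S c' (hh p' q') y = \sum_r dHF S' F H r p' q' y * jac_entry S F c' r y.
  by have [_ ->] := @pderiv_comp R n n S S' F (fun x => H x p' q') c' y gS gS' Sy SS'
    (smooth_C1 (sH p' q')) (fun k => @smooth_dd _ _ _ _ c' _ (sF k) Sy).
have dterm c' a' b' p' q' :
    pderiv S c' (fun x => jac_entry S F a' p' x * hh p' q' x * jac_entry S F b' q' x) y =
    pderiv S c' (jac_entry S F a' p') y * hh p' q' y * jac_entry S F b' q' y +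
    jac_entry S F a' p' y * hh p' q' y * pderiv S c' (jac_entry S F b' q') y +
    jac_entry S F a' p' y * jac_entry S F b' q' y * \sum_r dHF S' F H r p' q' y * jac_entry S F c' r y.
  have D1 := @pderivM R n S (jac_entry S F a' p') (hh p' q') c' y gS Sy (smooth_dd (sj _ _) Sy) (smooth_dd (shh _ _) Sy).
  have [_ ->] := @pderivM R n S (fun x => jac_entry S F a' p' x * hh p' q' x) (jac_entry S F b' q') c' y gS Sy
    (proj1 D1) (smooth_dd (sj _ _) Sy).
  have [_ ->] := D1; rewrite dhh; exact: leibniz3.
have dG c' a' b' : isoE S S' F G H c' a' b' y = B c' a' b' + B c' b' a'.
  rewrite /isoE.
  have -> : pderiv S c' (fun x => G x a' b') y =
     pderiv S c' (fun x => \sum_p' \sum_q' jac_entry S F a' p' x * hh p' q' x * jac_entry S F b' q' x) y.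
    by apply: pderiv_germ1 => //; apply: same_germ_on => x Sx; exact: Gab.
  have st p' q' : smooth_on S (fun x => jac_entry S F a' p' x * hh p' q' x * jac_entry S F b' q' x).
    by apply: smoothM => //; exact: smoothM.
  rewrite (@pderiv_sum R n S 'I_n) //; last by move=> p'; exact: smooth_sum.
  have -> : B c' b' a' = \sum_p' \sum_q' jac_entry S F a' p' y * hh p' q' y * pderiv S c' (jac_entry S F b' q') y.
    rewrite /B exchange_big; apply: eq_bigr => p' _; apply: eq_bigr => q' _.
    by rewrite (HT y Sy q' p'); ring.
  rewrite /B -big_split /= mulN1r -[LHS]/(_ - _) -sumrB; apply: eq_bigr => p' _.
  rewrite (@pderiv_sum R n S 'I_n) // -big_split /= -sumrB; apply: eq_bigr => q' _.
  by rewrite dterm addrK.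
have BE c' a' b' : isoB S S' F G H c' a' b' y = B c' a' b'.
  rewrite /isoB !dG (Bsym a' c' b') (Bsym b' c' a') (Bsym b' a' c').
  by move: (B c' a' b') (B c' b' a') (B a' b' c') => x1 x2 x3; field.
pose J := jac S F y; pose v : 'rV[R]_n := \row_p' pderiv S c (jac_entry S F a p') y.
have JE e1 e2 : J e1 e2 = jac_entry S F e1 e2 y by rewrite mxE.
have HJ : H (F y) *m J^T *m (invmx (G y) *m J) = 1%:M.
  apply: mulmx1C; rewrite -!mulmxA (mulmxA J) -(Eq y Sy) mulVmx //; exact/spd_unit/pG.
have vB : v *m (H (F y) *m J^T) = \row_b B c a b.
  apply/rowP => b; rewrite [RHS]mxE mulmxA mxE /B exchange_big; apply: eq_bigr => q' _.
  rewrite mxE [(_^T) _ _]mxE JE mulr_suml; apply: eq_bigr => p' _.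
  by rewrite mxE.
have : v = (\row_b B c a b) *m (invmx (G y) *m J) by rewrite -vB -mulmxA HJ mulmx1.
move=> E; have <- : v 0 p = pderiv S c (jac_entry S F a p) y by rewrite mxE.
rewrite E mxE; apply: eq_bigr => b _.
rewrite mxE BE; congr (_ * _); rewrite mxE /isoW; apply: eq_bigr => d _.
by rewrite JE.
Qed.

Lemma isometry_bound (R : realType) n (C : nat -> R) K : exists A : R,
  forall S S' F G H (z : 'rV[R]_n), isometry_at C S S' F G H z ->
  forall a p, bnd S K A (jac_entry S F a p) z.
Proof.
elim: K => [|K [A HA]].
  exists (1 + n%:R * C 0%N * C 0%N) => S S' F G H z iso a p; split=> //.
  exact: iso_jac0 iso.
have [B1 HB1] := @bnd_comp R n n K (C K.+1) A.
have [A2 HA2] : exists A2 : R, forall S S' F G H (z : 'rV[R]_n), isometry_at C S S' F G H z ->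
  forall c a p, bnd S K A2 (pderiv S c (jac_entry S F a p)) z.
  (* The constant is left open and read off from [bF], which follows the formula of [iso_second]
     term by term. It is composed of [A], [B1], values of [C] and powers of 2, and so does not
     depend on the isometry. *)
  eexists => S S' F G H z iso c a p.
  have bj := HA S S' F G H z iso.
  case: (iso) => [[gS gS'] [Sz SS'] sF sG sH pG pH Eq bG bVG bH bVH].
  have sj a' p' : smooth_on S (jac_entry S F a' p') by exact: smooth_pderiv.
  have sdH r p' q' : smooth_on S (dHF S' F H r p' q').
    by apply: (@smooth_comp R n n S S' F (pderiv S' r (fun y => H y p' q'))) => //; exact: smooth_pderiv.
  have bdH r p' q' : bnd S K B1 (dHF S' F H r p' q') z.
    apply: (HB1 S S' F (pderiv S' r (fun y => H y p' q'))) => //.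
    - exact: smooth_pderiv.
    - by have [_] := bH K.+1 p' q'; exact.
    - by move=> j i; apply: bnd_pred; exact: bj.
  have sV b d : smooth_on S (fun y => invmx (G y) b d).
    by apply: smooth_invmx => // x Sx; exact/spd_unit/pG.
  have s1 p' q' c' : smooth_on S (fun x => \sum_r dHF S' F H r p' q' x * jac_entry S F c' r x).
    by apply: smooth_sum => // r; exact: smoothM.
  have b1 p' q' c' := bnd_sum (index_enum 'I_n) gS Sz
    (fun r => smoothM gS (sdH r p' q') (sj c' r))
    (fun r => bndM gS Sz (sdH r p' q') (sj c' r) (bdH r p' q') (bj c' r)).
  have s2 a' b' c' p' q' : smooth_on S (fun x => jac_entry S F a' p' x * jac_entry S F b' q' x *
     \sum_r dHF S' F H r p' q' x * jac_entry S F c' r x).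
    by apply: smoothM => //; exact: smoothM.
  have b2 a' b' c' p' q' := bndM gS Sz (smoothM gS (sj a' p') (sj b' q')) (s1 p' q' c')
    (bndM gS Sz (sj a' p') (sj b' q') (bj a' p') (bj b' q')) (b1 p' q' c').
  have b3 a' b' c' := bnd_sum (index_enum 'I_n) gS Sz
    (fun p' => smooth_sum (index_enum 'I_n) gS (s2 a' b' c' p'))
    (fun p' => bnd_sum (index_enum 'I_n) gS Sz (s2 a' b' c' p') (b2 a' b' c' p')).
  have s3 a' b' c' := smooth_sum (index_enum 'I_n) gS
    (fun p' => smooth_sum (index_enum 'I_n) gS (s2 a' b' c' p')).
  have bE c' a' b' := bndD gS Sz (smooth_pderiv c' (sG a' b')) (smoothM gS (smooth_cst (-1) gS) (s3 a' b' c'))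
    (proj2 (bG K.+1 a' b') c')
    (bndM gS Sz (smooth_cst (-1) gS) (s3 a' b' c') (bnd_cst K (-1) gS Sz) (b3 a' b' c')).
  have sE c' a' b' : smooth_on S (isoE S S' F G H c' a' b').
    exact: smoothD gS (smooth_pderiv c' (sG a' b')) (smoothM gS (smooth_cst (-1) gS) (s3 a' b' c')).
  have sE3 c' a' b' := smoothD gS (smoothD gS (sE c' a' b') (sE a' c' b'))
    (smoothM gS (smooth_cst (-1) gS) (sE b' c' a')).
  have bB c' a' b' := bndM gS Sz (smooth_cst 2^-1 gS) (sE3 c' a' b') (bnd_cst K 2^-1 gS Sz)
    (bndD gS Sz (smoothD gS (sE c' a' b') (sE a' c' b')) (smoothM gS (smooth_cst (-1) gS) (sE b' c' a'))
      (bndD gS Sz (sE c' a' b') (sE a' c' b') (bE c' a' b') (bE a' c' b'))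
      (bndM gS Sz (smooth_cst (-1) gS) (sE b' c' a') (bnd_cst K (-1) gS Sz) (bE b' c' a'))).
  have sB c' a' b' : smooth_on S (isoB S S' F G H c' a' b').
    exact: smoothM gS (smooth_cst 2^-1 gS) (sE3 c' a' b').
  have sW b p' : smooth_on S (isoW S F G b p').
    by apply: smooth_sum => // d; exact: smoothM.
  have bW b p' := bnd_sum (index_enum 'I_n) gS Sz
    (fun d => smoothM gS (sV b d) (sj d p'))
    (fun d => bndM gS Sz (sV b d) (sj d p') (bVG K b d) (bj d p')).
  have bF := bnd_sum (index_enum 'I_n) gS Sz
    (fun b => smoothM gS (sB c a b) (sW b p))
    (fun b => bndM gS Sz (sB c a b) (sW b p) (bB c a b) (bW b p)).
  apply: bnd_eq bF => // y Sy; apply: esym; exact: iso_second iso Sy.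
exists (Num.max A A2) => S S' F G H z iso a p; split.
  by rewrite le_max; have /(_ a p) := HA S S' F G H z iso; case: (K) => [|K'] [-> _].
by move=> c; apply: bnd_le (HA2 S S' F G H z iso c a p); rewrite le_max lexx orbT.
Qed.

Definition bounded_metric {R : realType} {T : Type} {n : nat} (M : rmfd R T n)
    (C : nat -> R) (D : set 'rV[R]_n) (k : 'rV[R]_n -> T) : Prop :=
  forall K z a b, D z ->
    bnd D K (C K) (fun y => metric_in M D k y a b) z /\
    bnd D K (C K) (fun y => invmx (metric_in M D k y) a b) z.

Lemma trans_bound (R : realType) n (C : nat -> R) K : exists A : R,
  forall (T : topologicalType) (M : rmfd R T n.+1) D k g D' k' g' z,
  riemannian_manifold M -> dchart M D k g -> dchart M D' k' g' ->
  bounded_metric M C D k -> bounded_metric M C D' k' ->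
  trans_dom D k D' k' z ->
  forall a p, bnd (trans_dom D k D' k') K A (jac_entry (trans_dom D k D' k') (fun y => g' (k y)) a p) z.
Proof.
have [A HA] := @isometry_bound R n.+1 C K.
exists A => T M D k g D' k' g' z hM dc dc' bm bm' tz.
set S := trans_dom D k D' k'.
have gS : good S by exact: trans_good dc dc'.
have [Dz Az] := tz; have SD y : S y -> D y by case.
have nS y (Sy : S y) := trans_near dc dc' Sy.
have inD' y : S y -> D' (g' (k y)) by move=> [Dy Ay]; have [] := dchart_ginv dc' Ay.
have [[gD ck] _ _ _ _] := dc; have [[gD' ck'] _ ok' _ _] := dc'.
have sub f : smooth_on D f -> smooth_on S f by exact: smooth_subset.
have germ f : same_germ D f S f z by apply: filterS (nS z tz) => y H; split.
have subS C0 K' f : bnd D K' C0 f z -> bnd S K' C0 f z by apply: bnd_germ.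
apply: (HA S D' (fun y => g' (k y)) (metric_in M D k) (metric_in M D' k') z).
split=> //.
- by move=> p; exact: dchart_trans dc dc'.
- by move=> a b; apply: sub; exact: metric_in_smooth dc.
- by move=> a b; exact: metric_in_smooth dc'.
- by move=> y /SD Dy; exact: metric_in_spd dc Dy.
- by move=> y Dy; exact: metric_in_spd dc' Dy.
- move=> y Sy; rewrite (metric_trans hM dc dc' Sy).
  have -> : jac S (fun y => g' (k y)) y = jac D (fun y => g' (k y)) y; last by [].
  by apply: jac_germ => //; apply: filterS (nS y Sy) => x H; split=> //; apply: iff_sym.
- by move=> K' a b; apply: subS; have [] := bm K' z a b Dz.
- by move=> K' a b; apply: subS; have [] := bm K' z a b Dz.
- by move=> K' a b; have [] := bm' K' _ a b (inD' z tz).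
- by move=> K' a b; have [] := bm' K' _ a b (inD' z tz).
Qed.

(** * Curves, velocities and lengths *)

Notation ui R := (@unit_itv R) (only parsing).

Lemma ui_step (R : realType) (t e : R) : ui R t -> 0 < e ->
  exists h : R, [/\ h != 0, `|h| < e & ui R (t + h *: (1 : R^o))].
Proof.
move=> /andP[t0 t1] e0; have [t1'|t1'] := ltP t 1.
  pose h := Num.min e (1 - t) / 2.
  have m0 : 0 < Num.min e (1 - t) by rewrite lt_min e0 subr_gt0.
  have me : Num.min e (1 - t) <= e by rewrite ge_min lexx.
  have mt : Num.min e (1 - t) <= 1 - t by rewrite ge_min lexx orbT.
  exists h; have h0 : 0 < h by rewrite /h; lra.
  rewrite gt_eqF // ger0_norm ?ltW //; split=> //; first by rewrite /h; lra.
  by rewrite /unit_itv /= [h *: _]mulr1; apply/andP; split; rewrite /h; lra.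
pose h := - (Num.min e 1 / 2).
have m0 : 0 < Num.min e 1 by rewrite lt_min e0 ltr01.
have me : Num.min e 1 <= e by rewrite ge_min lexx.
have mt : Num.min e 1 <= 1 by rewrite ge_min lexx orbT.
exists h; have h0 : h < 0 by rewrite /h; lra.
rewrite lt_eqF // ltr0_norm //; split=> //; first by rewrite /h; lra.
by rewrite /unit_itv /= [h *: _]mulr1; apply/andP; split; rewrite /h; lra.
Qed.

Lemma ui_proper (R : realType) (t : R) : ui R t -> ProperFilter (increments (ui R) t (1 : R^o)).
Proof. by move=> ut; apply: incr_proper_of => e e0; exact: ui_step. Qed.

Lemma cderP (R : realType) (u : R -> R) (t : R) : ui R t ->
  has_dderiv (ui R) (1 : R^o) u t ->
  der (increments (ui R) t (1 : R^o)) (fun h => u (t + h *: (1 : R^o))) (dderiv (ui R) (1 : R^o) u t).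
Proof.
move=> ut; rewrite /has_dderiv -diffqE => /cvg_ex[l Hl]; rewrite /dderiv.
by have PF := ui_proper ut; rewrite (cvg_lim _ Hl).
Qed.

Lemma cder_der (R : realType) (u : R -> R) (t l : R) : ui R t ->
  der (increments (ui R) t (1 : R^o)) (fun h => u (t + h *: (1 : R^o))) l ->
  has_dderiv (ui R) (1 : R^o) u t /\ dderiv (ui R) (1 : R^o) u t = l.
Proof.
move=> ut; rewrite -diffqE => Hl; split; first by apply/cvg_ex; exists l.
have PF := ui_proper ut; by rewrite /dderiv (cvg_lim _ Hl).
Qed.

Lemma near_curve (R : realType) (T : topologicalType) (c : R -> T) (t : R) (O : set T) :
  {within ui R, continuous c} -> ui R t -> open O -> O (c t) ->
  \forall s \near (t : R^o), ui R s -> O (c s).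
Proof.
move=> /subspace_continuousP cc ut oO Ot.
exact: (cc t ut _ (open_nbhs_nbhs (conj oO Ot))).
Qed.

Lemma near_incr (R : realType) (t : R) (Q : R -> Prop) :
  (\forall s \near (t : R^o), ui R s -> Q s) ->
  \forall h \near increments (ui R) t (1 : R^o), Q (t + h *: (1 : R^o)).
Proof.
move=> nQ; have := @near_line R (R^o : normedModType R) t (1 : R^o) _ nQ.
by apply: filterS => h H ut; exact: H.
Qed.

Lemma near_curveN (R : realType) (T : topologicalType) (c : R -> T) (t : R) (Q : T -> Prop) :
  {within ui R, continuous c} -> ui R t -> (\forall x \near c t, Q x) ->
  \forall s \near (t : R^o), ui R s -> Q (c s).
Proof. by move=> /subspace_continuousP cc ut nQ; exact: (cc t ut _ nQ). Qed.

(** The velocity in an arbitrary coordinate map; [velocity i c t] is the case [g = cmap (ch i)].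
    Curves can thus be followed in normal charts, which are not members of the atlas. *)
Definition velc {R : realType} {T : Type} {n : nat} (g : T -> 'rV[R]_n) (c : R -> T) (t : R) : 'rV[R]_n :=
  \row_a dderiv (ui R) (1 : R^o) (fun s => g (c s) 0 a) t.

Definition hasvel {R : realType} {T : Type} {n : nat} (g : T -> 'rV[R]_n) (c : R -> T) (t : R) : Prop :=
  forall a, has_dderiv (ui R) (1 : R^o) (fun s => g (c s) 0 a) t.

Lemma vel_trans (R : realType) (T : topologicalType) n (M : rmfd R T n.+1) D k g D' k' g' (c : R -> T) (t : R) :
  riemannian_manifold M -> dchart M D k g -> dchart M D' k' g' ->
  ui R t -> {within ui R, continuous c} -> (k @` D) (c t) -> (k' @` D') (c t) ->
  hasvel g c t ->
  hasvel g' c t /\ velc g' c t = velc g c t *m jac D (fun y => g' (k y)) (g (c t)).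
Proof.
move=> hM dc dc' ut cc A A' hv.
pose S := trans_dom D k D' k'.
have gS : good S by exact: trans_good dc dc'.
have inS x : (k @` D) x -> (k' @` D') x -> S (g x) /\ k (g x) = x.
  by move=> Ax Ax'; have [Dg kg] := dchart_ginv dc Ax; split=> //; split=> //; rewrite /= kg.
have [Sg kgt] := inS _ A A'.
have [_ _ ok _ _] := dc; have [_ _ ok' _ _] := dc'.
have nA := near_incr (near_curve cc ut ok A).
have nA' := near_incr (near_curve cc ut ok' A').
have E0 : t + 0 *: (1 : R^o) = t by rewrite scale0r addr0.
have FI := incr_filter (ui R) t (1 : R^o).
have key a : der (increments (ui R) t (1 : R^o)) (fun h => g' (c (t + h *: (1 : R^o))) 0 a)
   (\sum_b pderiv S b (fun y => g' (k y) 0 a) (g (c t)) * velc g c t 0 b).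
  have := @der_chain R (increments (ui R) t (1 : R^o)) n.+1 S (fun y => g' (k y) 0 a)
    (fun h => g (c (t + h *: (1 : R^o)))) (fun b => velc g c t 0 b) FI (@punct_incr _ _ _ _ _) gS
    (smooth_C1 (dchart_trans a hM dc dc')).
  rewrite E0 => /(_ Sg) H.
  apply: der_near (H _ _) => //.
  - by apply: filterS2 nA nA' => h H1 H2; have [_ ->] := inS _ H1 H2.
  - by rewrite E0 kgt.
  - by apply: filterS2 nA nA' => h H1 H2; have [] := inS _ H1 H2.
  - by move=> b; rewrite mxE; apply: cderP => //; exact: hv.
have key' a := @cder_der R (fun s => g' (c s) 0 a) t _ ut (key a).
split; first by move=> a; have [] := key' a.
apply/rowP => a; rewrite !mxE; have [_ ->] := key' a.
apply: eq_bigr => b _; rewrite [X in _ = _ * X]mxE mulrC; congr (_ * _).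
apply: esym; apply: pderiv_germ1; first by case: Sg.
by apply: filterS (trans_near dc dc' Sg) => y H; split.
Qed.

Lemma dchart_gcont (R : realType) (T : topologicalType) n (M : rmfd R T n.+1) D k g x a :
  riemannian_manifold M -> dchart M D k g -> (k @` D) x ->
  (fun y => g y 0 a) @ nbhs x --> g x 0 a.
Proof.
move=> hM [[gD ck] sk ok K sg] Ax; have [j jx] := rm_cover x hM.
have [oj _ Kj cm ci] := rm_chart j hM.
have Sx : (coord_set j `&` cinv (ch j) @^-1` (k @` D)) (cmap (ch j) x).
  by split; [exists x|rewrite /= Kj].
have := (within_cont_atP _ _).1 (smooth_cont (sg j a)) _ Sx; rewrite /cont_at Kj // => H A /H HA.
have HA' : \forall y \near cmap (ch j) x, (coord_set j `&` cinv (ch j) @^-1` (k @` D)) y ->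
   A (g (cinv (ch j) y) 0 a) := HA.
have cmx : cmap (ch j) @ nbhs x --> cmap (ch j) x.
  move: (cm); rewrite continuous_open_subspace // => /(_ x); apply; exact/mem_set.
have H1 : \forall y \near x, (coord_set j `&` cinv (ch j) @^-1` (k @` D)) (cmap (ch j) y) ->
   A (g (cinv (ch j) (cmap (ch j) y)) 0 a) := cmx _ HA'.
have H2 : \forall y \near x, cdom (ch j) y by exact: open_nbhs_nbhs.
have H3 : \forall y \near x, (k @` D) y by exact: open_nbhs_nbhs.
suff : \forall y \near x, A (g y 0 a) by [].
apply: filterS3 H1 H2 H3 => y H1 jy Ay; rewrite -(Kj y jy); apply: H1.
by split; [exists y|rewrite /= Kj].
Qed.

Definition velcont {R : realType} {T : Type} {n : nat} (g : T -> 'rV[R]_n) (c : R -> T) (t : R) : Prop :=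
  forall a, velc g c s 0 a @[s --> within (ui R) (nbhs (t : R^o))] --> velc g c t 0 a.

Lemma velcont_trans (R : realType) (T : topologicalType) n (M : rmfd R T n.+1) D k g D' k' g' (c : R -> T) (t : R) :
  riemannian_manifold M -> dchart M D k g -> dchart M D' k' g' ->
  ui R t -> {within ui R, continuous c} -> (k @` D) (c t) -> (k' @` D') (c t) ->
  (forall s, ui R s -> (k @` D) (c s) -> hasvel g c s) -> velcont g c t -> velcont g' c t.
Proof.
move=> hM dc dc' ut cc A A' hv vc b.
pose S := trans_dom D k D' k'.
have gS : good S by exact: trans_good dc dc'.
have inS x : (k @` D) x -> (k' @` D') x -> S (g x).
  by move=> Ax Ax'; have [Dg kg] := dchart_ginv dc Ax; split=> //; rewrite /= kg.
have [_ _ ok _ _] := dc; have [_ _ ok' _ _] := dc'.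
have nA := near_curve cc ut ok A.
have nA' := near_curve cc ut ok' A'.
have velE s : ui R s -> (k @` D) (c s) -> (k' @` D') (c s) ->
   velc g' c s 0 b = \sum_a velc g c s 0 a * pderiv S a (fun y => g' (k y) 0 b) (g (c s)).
  move=> us As As'; have [_ ->] := vel_trans hM dc dc' us cc As As' (hv _ us As).
  rewrite mxE; apply: eq_bigr => a _; rewrite [X in _ * X]mxE; congr (_ * _).
  have Sg := inS _ As As'.
  apply: pderiv_germ1; first by case: Sg.
  by apply: filterS (trans_near dc dc' Sg) => y H; split.
have FW : Filter (within (ui R) (nbhs (t : R^o))) by exact: within_filter.
have H : (\sum_a velc g c s 0 a * pderiv S a (fun y => g' (k y) 0 b) (g (c s)))
    @[s --> within (ui R) (nbhs (t : R^o))] --> velc g' c t 0 b.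
  rewrite velE //; apply: sum_cvg => a; apply: cvgM; first exact: vc.
  have ss := smooth_pderiv a (dchart_trans b hM dc dc').
  have := (within_cont_atP _ _).1 (smooth_cont ss) _ (inS _ A A') => HC B /HC HB.
  have : \forall y \near g (c t), S y -> B (pderiv S a (fun y => g' (k y) 0 b) y) := HB.
  move=> /nbhs_bxP[d d0 dH].
  have cg : forall e, \forall x \near c t, `|g x 0 e - g (c t) 0 e| < d.
    move=> e; have /cvgrPdist_lt/(_ d d0) := dchart_gcont (a := e) hM dc A.
    by apply: filterS => x; rewrite distrC.
  have cgc : \forall s \near (t : R^o), ui R s -> forall e, `|g (c s) 0 e - g (c t) 0 e| < d.
    apply: (near_curveN cc ut (Q := fun x => forall e, `|g x 0 e - g (c t) 0 e| < d)).
    exact: filter_forall cg.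
  suff : \forall s \near (t : R^o), ui R s -> B (pderiv S a (fun y => g' (k y) 0 b) (g (c s))) by [].
  near=> s => us; apply: dH; first exact: (near cgc s _).
  by apply: inS; [exact: (near nA s _)|exact: (near nA' s _)].
apply: cvg_trans H; apply: near_eq_cvg.
suff : \forall s \near (t : R^o), ui R s ->
  \sum_a velc g c s 0 a * pderiv S a (fun y => g' (k y) 0 b) (g (c s)) = velc g' c s 0 b by [].
by apply: filterS2 nA nA' => s H1 H2 us; rewrite velE //; [exact: H1|exact: H2].
Unshelve. all: by end_near. Qed.

Lemma C1_dchart (R : realType) (T : topologicalType) n (M : rmfd R T n.+1) D k g (c : R -> T) (t : R) :
  riemannian_manifold M -> dchart M D k g -> C1_arc M c -> ui R t -> (k @` D) (c t) ->
  hasvel g c t /\ velcont g c t.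
Proof.
move=> hM dc [cc H] ut A; have [j jt] := rm_cover (c t) hM.
have dj := dchart_atlas j hM; have Aj := atlas_img hM jt.
have hj s : ui R s -> (cinv (ch j) @` coord_set j) (c s) -> hasvel (cmap (ch j)) c s.
  move=> us [y [x jx <-] E]; have [_ /(_ j) Hj] := H s us.
  have [_ _ Kj _ _] := rm_chart j hM; have js : cdom (ch j) (c s) by rewrite -E Kj.
  by move=> a; have [] := Hj js a.
split; first by have [] := vel_trans hM dj dc ut cc Aj A (hj t ut Aj).
apply: (velcont_trans hM dj dc ut cc Aj A hj) => a.
by have [_ /(_ j jt a)[]] := H t ut.
Qed.

(** The Riemannian norm of the velocity is invariant under changes of coordinates, so the chart
    chosen in [speed] may be replaced by any compatible one. *)
Lemma speedE (R : realType) (T : topologicalType) n (M : rmfd R T n.+1) D k g (c : R -> T) (t : R) :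
  riemannian_manifold M -> dchart M D k g -> ui R t -> {within ui R, continuous c} ->
  (k @` D) (c t) -> hasvel g c t ->
  speed M c t = Num.sqrt (bform (metric_in M D k (g (c t))) (velc g c t) (velc g c t)).
Proof.
move=> hM dc ut cc A hv; have [Dg kg] := dchart_ginv dc A.
have E (i : idx M) : cdom (ch i) (c t) ->
   bform (met_at i (c t)) (velocity i c t) (velocity i c t) =
   bform (metric_in M D k (g (c t))) (velc g c t) (velc g c t).
  move=> it; have di := dchart_atlas i hM.
  have [_ ve] := vel_trans hM dc di ut cc A (atlas_img hM it) hv.
  have -> : velocity i c t = velc (cmap (ch i)) c t by [].
  have igt : cdom (ch i) (k (g (c t))) by rewrite kg.
  by rewrite ve (metric_inE hM dc Dg igt) kg bform_mul.
rewrite /speed; case: xgetP => [s _ [i [it ->]]|H]; first by rewrite E.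
have [j jt] := rm_cover (c t) hM.
by case: (H (Num.sqrt (bform (met_at j (c t)) (velocity j c t) (velocity j c t)))); exists j.
Qed.

(** Continuity of the speed makes it integrable, so that lengths of arcs are handled as integrals of
    continuous functions. *)
Lemma speed_cont (R : realType) (T : topologicalType) n (M : rmfd R T n.+1) (c : R -> T) :
  riemannian_manifold M -> C1_arc M c ->
  forall t, ui R t -> speed M c s @[s --> within (ui R) (nbhs (t : R^o))] --> speed M c t.
Proof.
move=> hM C1 t ut; have [cc H] := C1; have [j jt] := rm_cover (c t) hM.
have dj := dchart_atlas j hM; have Aj := atlas_img hM jt.
have [[gS _] _ oj _ _] := dj.
have nA := near_curve cc ut oj Aj.
have hv s (us : ui R s) (As : (cinv (ch j) @` coord_set j) (c s)) := C1_dchart hM dj C1 us As.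
pose m y := metric_in M (coord_set j) (cinv (ch j)) y.
have FW : Filter (within (ui R) (nbhs (t : R^o))) by exact: within_filter.
have HQ : (\sum_a \sum_b velc (cmap (ch j)) c s 0 a * m (cmap (ch j) (c s)) a b * velc (cmap (ch j)) c s 0 b)
    @[s --> within (ui R) (nbhs (t : R^o))] -->
    \sum_a \sum_b velc (cmap (ch j)) c t 0 a * m (cmap (ch j) (c t)) a b * velc (cmap (ch j)) c t 0 b.
  have [_ vc] := hv t ut Aj.
  apply: sum_cvg => a; apply: sum_cvg => b; apply: cvgM; last exact: vc.
  apply: cvgM; first exact: vc.
  have [Sg _] := dchart_ginv dj Aj.
  have := (within_cont_atP _ _).1 (smooth_cont (metric_in_smooth a b hM dj)) _ Sg => HC B /HC HB.
  have : \forall y \near cmap (ch j) (c t), coord_set j y -> B (m y a b) := HB.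
  move=> /nbhs_bxP[d d0 dH].
  have cg : forall e, \forall x \near c t, `|cmap (ch j) x 0 e - cmap (ch j) (c t) 0 e| < d.
    move=> e; have /cvgrPdist_lt/(_ d d0) := dchart_gcont (a := e) hM dj Aj.
    by apply: filterS => x; rewrite distrC.
  have cgc : \forall s \near (t : R^o), ui R s -> forall e, `|cmap (ch j) (c s) 0 e - cmap (ch j) (c t) 0 e| < d.
    apply: (near_curveN cc ut (Q := fun x => forall e, `|cmap (ch j) x 0 e - cmap (ch j) (c t) 0 e| < d)).
    exact: filter_forall cg.
  suff : \forall s \near (t : R^o), ui R s -> B (m (cmap (ch j) (c s)) a b) by [].
  near=> s => us; apply: dH; first exact: (near cgc s _).
  have As : (cinv (ch j) @` coord_set j) (c s) by exact: (near nA s _).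
  by have [] := dchart_ginv dj As.
have se s : ui R s -> (cinv (ch j) @` coord_set j) (c s) -> speed M c s = Num.sqrt
    (\sum_a \sum_b velc (cmap (ch j)) c s 0 a * m (cmap (ch j) (c s)) a b * velc (cmap (ch j)) c s 0 b).
  by move=> us As; have [hs _] := hv s us As; rewrite (speedE hM dj us cc As hs) bformE.
rewrite se //.
have := @continuous_cvg _ _ _ _ FW _ Num.sqrt _ (@sqrt_continuous R _) HQ.
apply: cvg_trans; apply: near_eq_cvg.
suff : \forall s \near (t : R^o), ui R s -> Num.sqrt
    (\sum_a \sum_b velc (cmap (ch j)) c s 0 a * m (cmap (ch j) (c s)) a b * velc (cmap (ch j)) c s 0 b) = speed M c s by [].
by apply: filterS nA => s H1 us; rewrite se //; exact: H1.
Unshelve. all: by end_near. Qed.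

(** Induction along the unit interval: the supremum of the times up to which [P] holds belongs to
    them by the last premise and would be exceeded by the second one if it were below 1. *)
Lemma ui_ind (R : realType) (P : R -> Prop) : P 0 ->
  (forall t, 0 <= t < 1 -> (forall s, 0 <= s <= t -> P s) ->
     exists2 e : R, 0 < e & forall s, t < s < t + e -> s <= 1 -> P s) ->
  (forall t, 0 < t <= 1 -> (forall s, 0 <= s < t -> P s) -> P t) ->
  forall t, 0 <= t <= 1 -> P t.
Proof.
move=> P0 Ho Hc.
pose A : set R := [set t | 0 <= t <= 1 /\ forall s, 0 <= s <= t -> P s].
have A0 : A 0 by split; [rewrite lexx ler01|move=> s s0; have -> : s = 0 by apply/eqP; rewrite eq_le andbC].
have supA : has_sup A by split; [exists 0|exists 1 => t [/andP[]]].
have s0 : 0 <= sup A by exact: ub_le_sup (proj2 supA) _ A0.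
have s1 : sup A <= 1 by apply: ge_sup; [exists 0|move=> t [/andP[]]].
have below s : 0 <= s < sup A -> P s.
  move=> /andP[ss0 ss]; have e0 : 0 < sup A - s by rewrite subr_gt0.
  have [t [t01 Ht]] := sup_adherent e0 supA; rewrite opprB addrC subrK => st.
  by apply: Ht; rewrite ss0 ltW.
have Ps : P (sup A).
  have [->//|sn] := eqVneq (sup A) 0.
  by apply: Hc => //; rewrite lt_neqAle eq_sym sn s0.
have le s : 0 <= s <= sup A -> P s.
  move=> /andP[ss0]; rewrite le_eqVlt => /predU1P[->//|ss]; apply: below; by rewrite ss0.
have [s1'|s1'] := ltP (sup A) 1; last first.
  have E : sup A = 1 by apply/eqP; rewrite eq_le s1.
  by move=> t t01; apply: le; rewrite E.
have [|e e0 He] := Ho (sup A) _ le; first by rewrite s0.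
pose t := sup A + Num.min e (1 - sup A) / 2.
have m0 : 0 < Num.min e (1 - sup A) by rewrite lt_min e0 subr_gt0.
have me : Num.min e (1 - sup A) <= e by rewrite ge_min lexx.
have mt : Num.min e (1 - sup A) <= 1 - sup A by rewrite ge_min lexx orbT.
have At : A t.
  split; first by apply/andP; split; rewrite /t; lra.
  move=> s /andP[ss0 st]; have [sl|sl] := leP s (sup A); first by apply: le; rewrite ss0.
  apply: He; last by apply: le_trans st _; rewrite /t; lra.
  by rewrite sl /=; apply: le_lt_trans st _; rewrite /t; lra.
have : t <= sup A by exact: ub_le_sup (proj2 supA) _ At.
by rewrite /t => H; exfalso; lra.
Qed.

Lemma cder_cont (R : realType) (u : R -> R) (t : R) : ui R t ->
  has_dderiv (ui R) (1 : R^o) u t -> forall e : R, 0 < e ->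
  exists2 d : R, 0 < d & forall s, ui R s -> `|s - t| < d -> `|u s - u t| < e.
Proof.
move=> ut du e e0.
have := der_cvg (incr_filter _ _ _) (@punct_incr _ _ _ _ _) (cderP ut du).
rewrite scale0r addr0 => /cvgrPdist_lt/(_ e e0) H.
have H' : \forall h \near (0 : R)^', ui R (t + h *: (1 : R^o)) -> `|u t - u (t + h *: (1 : R^o))| < e := H.
have /nbhs_ballP[d /= d0 dH] := H'; exists d => // s us st.
have [->|sn] := eqVneq s t; first by rewrite subrr normr0.
have E : t + (s - t) *: (1 : R^o) = s by rewrite [_ *: _]mulr1 addrC subrK.
have := dH (s - t); rewrite -ball_normE /= sub0r normrN => /(_ st).
by rewrite subr_eq0 E distrC; apply.
Qed.

Lemma cder_is_derive (R : realType) (u : R -> R) (t : R) : 0 < t < 1 ->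
  has_dderiv (ui R) (1 : R^o) u t -> is_derive t 1 u (dderiv (ui R) (1 : R^o) u t).
Proof.
move=> t01 du; have ut : ui R t by move: t01 => /andP[? ?]; apply/andP; split; exact: ltW.
have H := cderP ut du; rewrite -diffqE /diff_quotient in H.
have nU : \forall h \near (0 : R)^', ui R (t + h *: (1 : R^o)).
  apply: (@near_line R (R^o : normedModType R) t (1 : R^o) (ui R)).
  have : \forall r \near (t : R^o), 0 < r < 1 by apply: (@near_in_itvoo R 0 1); rewrite in_itv.
  by apply: filterS => r /andP[? ?]; apply/andP; split; exact: ltW.
have H2 : (fun h => h^-1 *: (u (h *: 1 + t) - u t)) @ 0^' --> dderiv (ui R) (1 : R^o) u t.
  move=> A /H HA.
  have HA' : \forall h \near (0 : R)^', ui R (t + h *: (1 : R^o)) ->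
    A (h^-1 * (u (t + h *: (1 : R^o)) - u t)) := HA.
  suff : \forall h \near (0 : R)^', A (h^-1 *: (u (h *: 1 + t) - u t)) by [].
  apply: filterS2 HA' nU => h H1 H3; have := H1 H3.
  by rewrite [t + _]addrC.
split; first by apply/cvg_ex; eexists; exact: H2.
by rewrite /derive (cvg_lim _ H2).
Qed.

Lemma ui_cont_within (R : realType) (v : R -> R) (tau : R) : tau <= 1 ->
  (forall t, 0 <= t <= tau -> v s @[s --> within (ui R) (nbhs (t : R^o))] --> v t) ->
  {within `[0, tau], continuous v}.
Proof.
move=> t1 cv; apply/subspace_continuousP => t /=; rewrite in_itv /= => t01 A /(cv t t01) HA.
have HA' : \forall s \near (t : R^o), ui R s -> A (v s) := HA.
suff : \forall s \near t, s \in `[0, tau]%R -> A (v s) by [].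
apply: filterS HA' => s H; rewrite in_itv /= => /andP[s0 s1]; apply: H.
by apply/andP; split => //; exact: le_trans t1.
Qed.

(** The fundamental theorem of calculus on [[0, tau]], estimated by the length of the whole arc.
    This form suits curves known to stay in a chart only up to the time [tau]. *)
Lemma speed_integral_bound (R : realType) (u sp : R -> R) (tau L : R) : 0 < tau <= 1 -> 0 <= L ->
  (forall t, 0 <= t <= tau -> has_dderiv (ui R) (1 : R^o) u t) ->
  (forall t, 0 <= t <= tau ->
    dderiv (ui R) (1 : R^o) u s @[s --> within (ui R) (nbhs (t : R^o))] --> dderiv (ui R) (1 : R^o) u t) ->
  (forall t, 0 <= t <= 1 -> sp s @[s --> within (ui R) (nbhs (t : R^o))] --> sp t) ->
  (forall t, 0 <= sp t) ->
  (forall t, 0 <= t <= tau -> `|dderiv (ui R) (1 : R^o) u t| <= L * sp t) ->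
  (`|u tau - u 0|%:E <= L%:E * \int[lebesgue_measure]_(t in `[0%R, 1%R]) (sp t)%:E)%E.
Proof.
move=> /andP[tau0 tau1] L0 du cv csp sp0 bd.
pose v := dderiv (ui R) (1 : R^o) u.
have inui t : 0 <= t <= tau -> ui R t.
  by move=> /andP[t0 tt0]; apply/andP; split=> //; exact: le_trans tau1.
have cvw : {within `[0, tau], continuous v} by exact: ui_cont_within.
have cspw : {within `[0, 1], continuous sp} by exact: ui_cont_within.
have csptw : {within `[0, tau], continuous sp}.
  by apply: ui_cont_within => // t /inui; exact: csp.
have iv := continuous_compact_integrable (@segment_compact R 0 tau) cvw.
have isp := continuous_compact_integrable (@segment_compact R 0 1) cspw.
have ispt := continuous_compact_integrable (@segment_compact R 0 tau) csptw.
have mv := measurable_int _ iv; have msp := measurable_int _ isp; have mspt := measurable_int _ ispt.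
have FTC : (\int[lebesgue_measure]_(x in `[0%R, tau]) (v x)%:E = (u tau)%:E - (u 0)%:E)%E.
  apply: continuous_FTC2 => //.
    split.
    - move=> t; rewrite in_itv /= => /andP[t0 tt0].
      have H : is_derive t 1 u (v t).
        apply: cder_is_derive; first by rewrite t0 (lt_le_trans tt0).
        by apply: du; rewrite !ltW.
      exact: ex_derive.
    - apply/cvgrPdist_lt => e e0.
      have z0 : 0 <= (0 : R) <= tau by rewrite lexx ltW.
      have [d d0 dH] := cder_cont (inui 0 z0) (du 0 z0) e0.
      have : \forall s \near (0 : R)^'+, 0 < s /\ s < Num.min d tau.
        near=> s; split; first by near: s; exact: nbhs_right_gt.
        by near: s; apply: nbhs_right_lt; rewrite lt_min d0.
      apply: filterS => s [s0]; rewrite lt_min => /andP[sd st]; rewrite distrC; apply: dH.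
        by apply: inui; rewrite !ltW.
      by rewrite subr0 ger0_norm // ltW.
    - apply/cvgrPdist_lt => e e0.
      have z0 : 0 <= tau <= tau by rewrite lexx ltW.
      have [d d0 dH] := cder_cont (inui tau z0) (du tau z0) e0.
      have : \forall s \near tau^'-, s < tau /\ Num.max 0 (tau - d) < s.
        near=> s; split; first by near: s; exact: nbhs_left_lt.
        by near: s; apply: nbhs_left_gt; rewrite gt_max tau0 ltrBlDr ltrDl.
      apply: filterS => s [s0]; rewrite gt_max => /andP[sd st]; rewrite distrC; apply: dH.
        by apply: inui; rewrite !ltW.
      by rewrite distrC ger0_norm ?subr_ge0 ?ltW //; lra.
  move=> t; rewrite in_itv /= => /andP[t0 tt0].
  have H : is_derive t 1 u (v t).
    apply: cder_is_derive; first by rewrite t0 (lt_le_trans tt0).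
    by apply: du; rewrite !ltW.
  by rewrite derive1E; exact: derive_val.
have -> : (`|u tau - u 0|%:E = `| \int[lebesgue_measure]_(x in `[0%R, tau]) (v x)%:E |)%E.
  by rewrite FTC -EFinB abse_EFin.
apply: le_trans (le_abse_integral _ _ mv) _ => //.
apply: (@le_trans _ _ (\int[lebesgue_measure]_(x in `[0%R, tau]) (L%:E * (sp x)%:E))%E).
  apply: ge0_le_integral => //.
  - exact: (measurable_int _ (integrable_abse iv)).
  - by apply: measurable_funeM.

rewrite ge0_integralZl //; last by move=> t _; rewrite lee_fin.
apply: lee_wpmul2l; first by rewrite lee_fin.
apply: ge0_subset_integral => //.
  by move=> t _; rewrite lee_fin.

Unshelve. all: by end_near. Qed.

(** A closed box cut off by the orthant: compact, so its image under a chart is closed, which is how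
    exits from the chart are excluded. *)
Definition clbox {R : realType} {n : nat} (P : pred 'I_n) (v : 'rV[R]_n) (e : R) : set 'rV[R]_n :=
  [set w | orth P w /\ forall k, `|w 0 k - v 0 k| <= e].

Lemma clbox_compact (R : realType) n (P : pred 'I_n) (v : 'rV[R]_n) (e : R) : compact (clbox P v e).
Proof.
pose A (k : 'I_n) : set R := if P k then `[Num.max 0 (v 0 k - e), v 0 k + e]%classic
  else `[v 0 k - e, v 0 k + e]%classic.
have -> : clbox P v e = [set w | forall k, A k (w ord0 k)].
  apply/seteqP; split=> w.
    move=> [Pw bw] k; have := bw k; rewrite ler_norml => /andP[b1 b2].
    rewrite /A; case: ifP => Pk; rewrite /= in_itv /=.
      by rewrite ge_max Pw //=; apply/andP; split; lra.
    by apply/andP; split; lra.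
  move=> H; split.
    by move=> k Pk; have := H k; rewrite /A Pk /= in_itv /= ge_max => /andP[/andP[]].
  move=> k; have := H k; rewrite /A ler_norml; case: ifP => Pk; rewrite /= in_itv /=.
    by rewrite ge_max => /andP[/andP[_ ?] ?]; apply/andP; split; lra.
  by move=> /andP[? ?]; apply/andP; split; lra.
apply: rV_compact => k; rewrite /A; case: ifP => _; exact: segment_compact.
Qed.

Lemma img_closed (R : realType) (T : topologicalType) n (D Q : set 'rV[R]_n) (k : 'rV[R]_n -> T) :
  hausdorff_space T -> {within D, continuous k} -> Q `<=` D -> compact Q -> closed (k @` Q).
Proof.
move=> hT ck QD cQ; apply: compact_closed => //; apply: continuous_compact => //.
exact: continuous_subspaceW ck.
Qed.

(** The Riemannian norm is compared with the maximum norm of the coordinates, which fits the boxes,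
    with one constant for both directions. *)
Definition comparable_metric {R : realType} {T : Type} {n : nat} (M : rmfd R T n) (L : R)
    (D : set 'rV[R]_n) (k : 'rV[R]_n -> T) : Prop :=
  forall z (v : 'rV[R]_n), D z -> (forall a, `|v 0 a| <= L * Num.sqrt (bform (metric_in M D k z) v v)) /\
    (forall B, (forall a, `|v 0 a| <= B) -> Num.sqrt (bform (metric_in M D k z) v v) <= L * B).

(* As long as the curve stays in the chart its coordinates move by at most [L] times its
   length, so that it cannot leave a box of that size. *)
Lemma escape_arc (R : realType) (T : topologicalType) n (M : rmfd R T n.+1) D k g P (L l : R)
    (c : R -> T) (v : 'rV[R]_n.+1) :
  riemannian_manifold M -> dchart M D k g -> comparable_metric M L D k -> 0 <= L ->
  D `<=` orth P -> clbox P v (L * l) `<=` D -> D v -> c 0 = k v -> C1_arc M c ->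
  (\int[lebesgue_measure]_(t in `[0%R, 1%R]) (speed M c t)%:E <= l%:E)%E ->
  exists w, [/\ D w, c 1 = k w & forall a, `|w 0 a - v 0 a| <= L * l].
Proof.
move=> hM dc cm L0 DP boxD Dv c0 C1 len.
have [[hT _] _ _ _ _] := hM; have [[gD ck] _ ok Kg _] := dc; have [cc _] := C1.
pose Q := clbox P v (L * l).
have clQ : closed (k @` Q) by apply: img_closed boxD _ => //; exact: clbox_compact.
have sp0 t : 0 <= speed M c t.
  rewrite /speed; case: xgetP => [s _ [i [_ ->]]|_]; [exact: sqrtr_ge0|exact: lexx].
have QkD x : (k @` Q) x -> (k @` D) x by move=> [w Qw <-]; exists w => //; exact: boxD.
have main tau : 0 <= tau <= 1 -> (forall s, 0 <= s <= tau -> (k @` D) (c s)) -> (k @` Q) (c tau).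
  move=> /andP[t0 t1] H; have tt0 : 0 <= tau <= tau by rewrite lexx t0.
  have [Dg kg] := dchart_ginv dc (H tau tt0).
  exists (g (c tau)) => //; split; first exact: DP.
  move: t0; rewrite le_eqVlt => /predU1P[t0|t0] a.
    rewrite -t0 c0 Kg // subrr normr0.
    have : (0 <= L%:E * \int[lebesgue_measure]_(t in `[0%R, 1%R]) (speed M c t)%:E)%E.
      by apply: mule_ge0; [rewrite lee_fin|apply: integral_ge0 => t _; rewrite lee_fin].
    move=> /le_trans/(_ (lee_wpmul2l _ len)); rewrite -EFinM !lee_fin; exact.
  have hv s : 0 <= s <= tau -> hasvel g c s /\ velcont g c s.
    move=> st; apply: (C1_dchart hM dc C1) => //; last exact: H.
    by move: st => /andP[s0 s1]; apply/andP; split=> //; exact: le_trans t1.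
  have uis s : 0 <= s <= tau -> ui R s.
    by move=> /andP[s0 s1]; apply/andP; split=> //; exact: le_trans t1.
  have vE s : dderiv (ui R) (1 : R^o) (fun s => g (c s) 0 a) s = velc g c s 0 a by rewrite mxE.
  have B : (`|g (c tau) 0 a - g (c 0) 0 a|%:E <=
     L%:E * \int[lebesgue_measure]_(t in `[0%R, 1%R]) (speed M c t)%:E)%E.
    apply: (@speed_integral_bound R (fun s => g (c s) 0 a)) => //.
    - by rewrite t0.
    - by move=> s st; have [h _] := hv s st; exact: h.
    - move=> s st; have [_ /(_ a)] := hv s st; rewrite vE.
      by under eq_fun do rewrite -vE.
    - by move=> s st; exact: speed_cont hM C1 _ st.
    - move=> s st; have [h _] := hv s st; rewrite vE (speedE hM dc (uis s st) cc (H s st) h).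
      have [Dgs _] := dchart_ginv dc (H s st).
      by have [+ _] := cm _ (velc g c s) Dgs; apply.
  rewrite c0 Kg // in B.
  have B2 : (L%:E * \int[lebesgue_measure]_(t in `[0%R, 1%R]) (speed M c t)%:E <= L%:E * l%:E)%E.
    by apply: lee_wpmul2l => //; rewrite lee_fin.
  by have := le_trans B B2; rewrite -EFinM lee_fin.
have : (k @` Q) (c 1).
  (* The image of the chart is open, so the curve stays in it a little longer and [main] puts it
     back into the box; the image of the box is closed, which settles limit times. *)
  apply: (@ui_ind R (fun t => (k @` Q) (c t))); last by rewrite ler01 lexx.
  - apply: main; first by rewrite lexx ler01.
    move=> s s0; have -> : s = 0 by apply/eqP; rewrite eq_le andbC.
    by rewrite c0; exists v.
  - move=> t /andP[t0 t1] H; have ut : ui R t by rewrite /unit_itv /= t0 ltW.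
    have Qt : (k @` Q) (c t) by apply: H; rewrite t0 lexx.
    have /nbhs_ballP[e /= e0 eH] := near_curve cc ut ok (QkD _ Qt).
    exists e => // s /andP[ts se] s1.
    apply: main; first by rewrite s1 (le_trans t0) // ltW.
    move=> r /andP[r0 rs]; have [rt|rt] := leP r t; first by apply/QkD/H; rewrite r0.
    apply: eH; last by rewrite /unit_itv /= r0 (le_trans rs).
    rewrite -ball_normE /= distrC ger0_norm ?subr_ge0 ?ltW //; lra.
  - move=> t /andP[t0 t1] H; apply: clQ => B Bt.
    have ut : ui R t by rewrite /unit_itv /= t1 ltW.
    have /nbhs_ballP[e /= e0 eH] := near_curveN cc ut Bt.
    pose h := Num.min e t / 2.
    have m0 : 0 < Num.min e t by rewrite lt_min e0.
    have me : Num.min e t <= e by rewrite ge_min lexx.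
    have mt : Num.min e t <= t by rewrite ge_min lexx orbT.
    exists (c (t - h)); split; first by apply: H; apply/andP; split; rewrite /h; lra.
    apply: eH; last by apply/andP; split; rewrite /h; lra.
    by rewrite -ball_normE /= opprB addrC subrK ger0_norm /h; lra.
move=> [w Qw E]; exists w; split=> //; first exact: boxD.
by have [] := Qw.
Qed.

Lemma joined_ge0 (R : realType) (T : topologicalType) n (M : rmfd R T n) x y l :
  joined M x y l -> (0 <= l)%E.
Proof.
elim=> // c l' _ IH _; apply: adde_ge0 => //; apply: integral_ge0 => t _; rewrite lee_fin.
rewrite /speed; case: xgetP => [s _ [i [_ ->]]|_]; [exact: sqrtr_ge0|exact: lexx].
Qed.

Lemma joined_trans (R : realType) (T : topologicalType) n (M : rmfd R T n) x y z l l' :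
  joined M x y l -> joined M y z l' -> joined M x z (l + l').
Proof.
move=> j1; elim=> [|c l2 _ IH C1]; first by rewrite adde0.
by rewrite addeA; exact: joined_arc.
Qed.

(** Induction over the arcs of the curve: the admissible length is divided between the initial part
    and the last arc, and the box of the latter, centred where the former ends, lies in the given
    box. *)
Lemma escape (R : realType) (T : topologicalType) n (M : rmfd R T n.+1) D k g P (L l : R)
    (v : 'rV[R]_n.+1) x y l0 :
  riemannian_manifold M -> dchart M D k g -> comparable_metric M L D k -> 0 <= L ->
  D `<=` orth P -> joined M x y l0 -> x = k v -> (l0 <= l%:E)%E -> clbox P v (L * l) `<=` D -> D v ->
  exists w, [/\ D w, y = k w & forall a, `|w 0 a - v 0 a| <= L * l].
Proof.
move=> hM dc cm L0 DP; move: y l0.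
suff H y l0 : joined M x y l0 -> forall l, x = k v -> (l0 <= l%:E)%E -> clbox P v (L * l) `<=` D -> D v ->
  exists w, [/\ D w, y = k w & forall a, `|w 0 a - v 0 a| <= L * l].
  by move=> y l0 J; exact: H.
elim=> [l1 xk l10 _ Dv|c l1 J IH C1 l2 xk ll2 boxD Dv].
  exists v; split=> // a; rewrite subrr normr0 mulr_ge0 //.
have i0 : (0 <= \int[lebesgue_measure]_(t in `[0%R, 1%R]) (speed M c t)%:E)%E.
  apply: integral_ge0 => t _; rewrite lee_fin /speed.
  by case: xgetP => [s _ [i [_ ->]]|_]; [exact: sqrtr_ge0|exact: lexx].
have l10 := joined_ge0 J.
set I := (\int[_]_(t in _) _)%E in ll2 i0.
have fl1 : l1 \is a fin_num.
  by rewrite ge0_fin_numE // (le_lt_trans _ (ltry l2)) // (le_trans _ ll2) // leeDl.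
have fI : I \is a fin_num.
  by rewrite ge0_fin_numE // (le_lt_trans _ (ltry l2)) // (le_trans _ ll2) // leeDr.
have E1 := fineK fl1; have EI := fineK fI.
have ll : fine l1 + fine I <= l2 by rewrite -lee_fin EFinD E1 EI.
have fl0 : 0 <= fine l1 by exact: fine_ge0.
have fI0 : 0 <= fine I by exact: fine_ge0.
have [||w1 [Dw1 c0 bw1]] := IH (fine l1) xk _ _ Dv.
- by rewrite E1.
- move=> w [Pw bw]; apply: boxD; split=> // a; apply: le_trans (bw a) _.
  by rewrite ler_wpM2l //; lra.
have boxD1 : clbox P w1 (L * fine I) `<=` D.
  move=> w [Pw bw]; apply: boxD; split=> // a.
  have -> : w 0 a - v 0 a = (w 0 a - w1 0 a) + (w1 0 a - v 0 a) by ring.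
  apply: le_trans (ler_normD _ _) _; apply: le_trans (lerD (bw a) (bw1 a)) _.
  by rewrite -mulrDr ler_wpM2l //; lra.
have lenI : (\int[lebesgue_measure]_(t in `[0%R, 1%R]) (speed M c t)%:E <= (fine I)%:E)%E by rewrite EI.
have [w [Dw c1 bw]] := escape_arc hM dc cm L0 DP boxD1 Dw1 c0 C1 lenI.
exists w; split=> // a.
have -> : w 0 a - v 0 a = (w 0 a - w1 0 a) + (w1 0 a - v 0 a) by ring.
apply: le_trans (ler_normD _ _) _; apply: le_trans (lerD (bw a) (bw1 a)) _.
by rewrite -mulrDr ler_wpM2l //; lra.
Qed.

(** * Straight segments of charts as curves *)

Lemma affine_vel (R : realType) (a b : R) (t : R) : ui R t ->
  has_dderiv (ui R) (1 : R^o) (fun s => a + s * b) t /\ dderiv (ui R) (1 : R^o) (fun s => a + s * b) t = b.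
Proof.
move=> ut; apply: cder_der => //; have FI := incr_filter (ui R) t (1 : R^o).
have H := derD FI (der_cst (a + t * b) FI)
  (@derZ _ _ b _ _ FI (der_id FI (@punct_incr _ _ (ui R) t (1 : R^o)))).
rewrite add0r mulr1 in H; apply: der_near H => //.
  by apply: nearW => h; rewrite [h *: _]mulr1; ring.
by rewrite scale0r addr0 mulr0 addr0.
Qed.

Definition seg {R : realType} {n : nat} (v w : 'rV[R]_n) (t : R) : 'rV[R]_n := v + t *: (w - v).

Lemma segE (R : realType) n (v w : 'rV[R]_n) t a : seg v w t 0 a = v 0 a + t * (w 0 a - v 0 a).
Proof. by rewrite !mxE. Qed.

Lemma seg_C1 (R : realType) (T : topologicalType) n (M : rmfd R T n.+1) D k g (v w : 'rV[R]_n.+1) :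
  riemannian_manifold M -> dchart M D k g -> (forall t, 0 <= t <= 1 -> D (seg v w t)) ->
  C1_arc M (fun t => k (seg v w t)) /\
  forall t, ui R t -> velc g (fun t => k (seg v w t)) t = w - v /\ hasvel g (fun t => k (seg v w t)) t.
Proof.
move=> hM dc Ds; pose c t := k (seg v w t).
have [[gD ck] sk ok K sg] := dc.
have A s : ui R s -> (k @` D) (c s) by move=> us; exists (seg v w s) => //; exact: Ds.
have cc : {within ui R, continuous c}.
  apply/subspace_continuousP => t ut B Bt.
  move/subspace_continuousP: ck => /(_ _ (Ds t ut)) /(_ B Bt) HB.
  have : \forall y \near seg v w t, D y -> B (k y) := HB.
  move=> /nbhs_bxP[d d0 dH].
  suff : \forall s \near (t : R^o), ui R s -> B (k (seg v w s)) by [].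
  have : forall a, \forall s \near (t : R^o), `|seg v w s 0 a - seg v w t 0 a| < d.
    move=> a; have H : (v 0 a + s * (w 0 a - v 0 a)) @[s --> (t : R)] --> v 0 a + t * (w 0 a - v 0 a).
      by apply: cvgD; [exact: cvg_cst|apply: cvgMr_tmp; exact: cvg_id].
    have /cvgrPdist_lt/(_ d d0) := H; apply: filterS => s; rewrite !segE distrC; exact.
  move=> /filter_forall; apply: filterS => s Hs us; apply: dH; last exact: Ds.
  by move=> a; exact: Hs.
have same a t : ui R t -> same_germ (ui R) (fun s : R^o => v 0 a + s * (w 0 a - v 0 a))
    (ui R) (fun s : R^o => g (c s) 0 a) t.
  move=> ut; apply: (@filterE _ (nbhs t) (nbhs_filter t)) => s; split=> // us.
  by rewrite /c K ?segE //; exact: Ds.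
have hv t : ui R t -> velc g c t = w - v /\ hasvel g c t.
  move=> ut; have H a := affine_vel (v 0 a) (w 0 a - v 0 a) ut.
  split; last first.
    by move=> a; have [h _] := H a; exact: (has_dderiv_germ ut (same a t ut) h).
  apply/rowP => a; rewrite !mxE; have [_ <-] := H a.
  by rewrite /dderiv (dderiv_germ _ ut (same a t ut)).
split=> //; split=> // t ut; split; first by have [_ -> _ _ _] := hM.
move=> i it a; have di := dchart_atlas i hM; have Ai := atlas_img hM it.
have [h1 h2] := hv t ut.
have [h3 _] := vel_trans hM dc di ut cc (A t ut) Ai h2.
split; first exact: h3.
apply: (velcont_trans hM dc di ut cc (A t ut) Ai) => [s us _|b].
  by have [] := hv s us.
rewrite h1 => B /nbhs_singleton HB.
suff : \forall s \near (t : R^o), ui R s -> B (velc g c s 0 b) by [].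
by apply: (@filterE _ (nbhs t) (nbhs_filter t)) => s us; have [-> _] := hv s us.
Qed.

Lemma seg_length (R : realType) (T : topologicalType) n (M : rmfd R T n.+1) D k g (L B : R) (v w : 'rV[R]_n.+1) :
  riemannian_manifold M -> dchart M D k g -> comparable_metric M L D k ->
  (forall t, 0 <= t <= 1 -> D (seg v w t)) -> (forall a, `|w 0 a - v 0 a| <= B) ->
  (\int[lebesgue_measure]_(t in `[0%R, 1%R]) (speed M (fun t => k (seg v w t)) t)%:E
    <= (L * B)%:E)%E.
Proof.
move=> hM dc cm Ds bB; have [C1 hv] := seg_C1 hM dc Ds.
have csp : {within `[0, 1], continuous (speed M (fun t => k (seg v w t)))}.
  by apply: ui_cont_within => // t t01; exact: speed_cont hM C1 _ t01.
have isp := continuous_compact_integrable (@segment_compact R 0 1) csp.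
have B0 : 0 <= B by exact: le_trans (normr_ge0 _) (bB ord0).
have le t : ui R t -> speed M (fun t => k (seg v w t)) t <= L * B.
  move=> ut; have [vE h] := hv t ut; have [cc _] := C1.
  have A : (k @` D) (k (seg v w t)) by exists (seg v w t) => //; exact: Ds.
  rewrite (speedE hM dc ut cc A h) vE.
  have [_ _ _ Kg _] := dc; rewrite Kg; last exact: Ds.
  have [_] := cm (seg v w t) (w - v) (Ds t ut); apply => a; rewrite !mxE; exact: bB.
apply: (@le_trans _ _ (\int[lebesgue_measure]_(t in `[0%R, 1%R]) cst (L * B)%:E t)%E).
  apply: ge0_le_integral => //.
  - move=> t _; rewrite lee_fin /speed.
    by case: xgetP => [s _ [i [_ ->]]|_]; [exact: sqrtr_ge0|exact: lexx].
  - exact: (measurable_int _ isp).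
have mu1 : lebesgue_measure (`[0 : R, 1]%classic : set R) = 1%E.
  by rewrite lebesgue_measure_itv /= lte_fin ltr01 -EFinB subr0.
rewrite integral_cst //.
by apply: le_trans (_ : (L * B)%:E * 1 <= _)%E; [rewrite -mu1; exact: lexx|rewrite mule1; exact: lexx].
Qed.

Lemma seg0 (R : realType) n (v w : 'rV[R]_n) : seg v w 0 = v.
Proof. by rewrite /seg scale0r addr0. Qed.

Lemma seg1 (R : realType) n (v w : 'rV[R]_n) : seg v w 1 = w.
Proof. by rewrite /seg scale1r addrC subrK. Qed.

Lemma seg_joined (R : realType) (T : topologicalType) n (M : rmfd R T n.+1) D k g (L B : R) (v w : 'rV[R]_n.+1) :
  riemannian_manifold M -> dchart M D k g -> comparable_metric M L D k ->
  (forall t, 0 <= t <= 1 -> D (seg v w t)) -> (forall a, `|w 0 a - v 0 a| <= B) ->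
  exists2 l, joined M (k v) (k w) l & (l <= (L * B)%:E)%E.
Proof.
move=> hM dc cm Ds bB; have [C1 _] := seg_C1 hM dc Ds.
have J0 : joined M (k v) ((fun t => k (seg v w t)) 0) 0%E by rewrite /= seg0; exact: joined_refl.
have := joined_arc J0 C1; rewrite add0e /= seg1 => J; exists (\int[lebesgue_measure]_(t in `[0%R, 1%R])
  (speed M (fun t => k (seg v w t)) t)%:E)%E => //.
exact: seg_length dc cm Ds bB.
Qed.

(** * Uniqueness of geodesics *)

Lemma is_derive_der (R : realType) (f : R -> R) (s l : R) :
  is_derive s 1 f l <-> der (dnbhs (0 : R)) (fun h => f (s + h)) l.
Proof.
have E : (fun h => h^-1 *: (f (h *: 1 + s) - f s)) = (fun h => h^-1 * (f (s + h) - f (s + 0))).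
  by apply/funext => h; rewrite addr0 [h *: 1]mulr1 [h + s]addrC.
rewrite /der -E; split=> [[/cvg_ex[m Hm]]|H].
  by rewrite /derive (cvg_lim _ Hm) // => <-.
by split; [apply/cvg_ex; exists l|rewrite /derive (cvg_lim _ H)].
Qed.

(** The sum of the squares of the [w i], damped by an exponential, has a derivative that is nowhere
    positive. It vanishes at [a] and is nonnegative, hence vanishes at [b]. *)
Lemma gronwall_zero (R : realType) (I : finType) (w dw : I -> R -> R) (a b C : R) : a < b -> 0 <= C ->
  (forall i s, a < s < b -> is_derive s 1 (w i) (dw i s)) ->
  (forall i, {within `[a, b], continuous (w i)}) ->
  (forall i, w i a = 0) ->
  (forall i s, a < s < b -> `|dw i s| <= C * \sum_j `|w j s|) ->
  forall i, w i b = 0.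
Proof.
move=> ab C0 dwH cw w0 bd.
(* The derivative of the sum of squares is at most [2 * C] times the square of the sum of the
   absolute values, hence at most [2 * C * N] times the sum of squares; this is the rate of damping
   needed. *)
pose N : R := #|I|%:R; pose K := 2 * C * N.
pose U s := (\sum_i w i s * w i s) * expR (- K * s).
pose dU s := (\sum_i (dw i s * w i s + w i s * dw i s)) * expR (- K * s) +
   (\sum_i w i s * w i s) * (expR (- K * s) * - K).
have FD : Filter (dnbhs (0 : R)) by exact: dnbhs_filter.
have PD : punct (dnbhs (0 : R)) by move=> A.
have D s : s \in `]a, b[%R -> is_derive s 1 U (dU s).
  rewrite in_itv /= => sab; apply/is_derive_der.
  have d1 i : der (dnbhs (0 : R)) (fun h => w i (s + h)) (dw i s) by apply/is_derive_der/dwH.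
  have d2 : der (dnbhs (0 : R)) (fun h => \sum_i w i (s + h) * w i (s + h))
     (\sum_i (dw i s * w i s + w i s * dw i s)).
    apply: der_sum => i; have := derM FD PD (d1 i) (d1 i); rewrite addr0; exact.
  have d3 : der (dnbhs (0 : R)) (fun h => expR (- K * (s + h))) (expR (- K * s) * - K).
    have dl : der (dnbhs (0 : R)) (fun h => - K * (s + h)) (- K).
      have := derD FD (der_cst (- K * s) FD) (@derZ _ _ (- K) _ _ FD (der_id FD PD)).
      rewrite add0r mulr1; apply: der_near; last by rewrite /= !addr0 mulr0 addr0.
      by apply: nearW => h; rewrite mulrDr.
    have := @der_smooth1 R (dnbhs (0 : R)) expR (fun h => - K * (s + h)) (expR (- K * s)) (- K) FD PD.
    by rewrite addr0; apply=> //; exact: is_derive_expR.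
  by have := derM FD PD d2 d3; rewrite !addr0; exact.
have CU : {within `[a, b], continuous U}.
  apply/subspace_continuousP => s sab; apply: cvgM.
    have FW : Filter (within `[a, b] (nbhs s)) by exact: within_filter.
    apply: sum_cvg => i; move/subspace_continuousP: (cw i) => /(_ s sab) ci.
    exact: cvgM.
  apply: cvg_within_filter.
  apply: (@continuous_cvg _ _ _ _ _ (fun s => - K * s) expR); first exact: continuous_expR.
  by apply: cvgMl_tmp; exact: cvg_id.
have [s sab E] := MVT ab D CU.
have Ua : U a = 0 by rewrite /U big1 ?mul0r // => i _; rewrite w0 mul0r.
have U0 t : 0 <= \sum_i w i t * w i t by apply: sumr_ge0 => i _; rewrite -expr2; exact: sqr_ge0.
have dUs : dU s <= 0.
  have -> : dU s = expR (- K * s) * (\sum_i (dw i s * w i s + w i s * dw i s) - K * \sum_i w i s * w i s).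
    by rewrite /dU; ring.
  apply: mulr_ge0_le0; first exact: expR_ge0.
  rewrite subr_le0.
  have H1 : \sum_i (dw i s * w i s + w i s * dw i s) <= \sum_i 2 * (`|w i s| * (C * \sum_j `|w j s|)).
    apply: ler_sum => i _; have -> : dw i s * w i s + w i s * dw i s = 2 * (w i s * dw i s) by ring.
    rewrite ler_wpM2l //; apply: le_trans (ler_norm _) _; rewrite normrM ler_wpM2l //.
    by apply: bd; move: sab; rewrite in_itv.
  apply: le_trans H1 _; rewrite -mulr_sumr -mulr_suml.
  have := sum_sqr_le (fun i => w i s); rewrite -/N => H2.
  have E2 : \sum_i w i s * w i s = \sum_i w i s ^+ 2 by apply: eq_bigr => i _; rewrite expr2.
  rewrite /K E2; set q := \sum_i `|_| in H2 *; set p := \sum_i _ ^+ 2 in H2 *.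
  have -> : 2 * (q * (C * q)) = (2 * C) * q ^+ 2 by ring.
  by rewrite -[2 * C * N * p]mulrA; apply: ler_wpM2l => //; rewrite mulr_ge0.
have Ub : U b <= 0.
  by move: E; rewrite Ua subr0 => ->; apply: mulr_le0_ge0 => //; rewrite subr_ge0 ltW.
have z : \sum_i w i b * w i b <= 0.
  by move: Ub; rewrite /U pmulr_lle0 // expR_gt0.
move=> i; have : w i b * w i b <= \sum_i w i b * w i b.
  by rewrite (bigD1 i) //= lerDl; apply: sumr_ge0 => j _; rewrite -expr2; exact: sqr_ge0.
move=> /le_trans/(_ z); rewrite -expr2 => H; apply/eqP; rewrite -sqrf_eq0.
by rewrite eq_le H sqr_ge0.
Qed.

(* What is needed of a Riemannian manifold for its geodesics to be unique; unlike
   [riemannian_manifold] it is formulated so as to apply to the boundary as well. *)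
Definition geo_charts {R : realType} {T : topologicalType} {n : nat} (M : rmfd R T n) : Prop :=
  [/\ hausdorff_space T,
      (forall i : idx M, rel_open (points (@ch _ _ _ M)) (cdom (ch i))),
      (forall i : idx M, good (coord_set i)),
      (forall i : idx M, (forall x, cdom (ch i) x -> cinv (ch i) (cmap (ch i) x) = x) /\
         {within cdom (ch i), continuous (cmap (ch i))})
    & (forall i : idx M, (forall a b, smooth_on (coord_set i) (fun y => met i y a b)) /\
         forall y, coord_set i y -> met i y \in unitmx)].

Lemma christoffel_smooth (R : realType) (T : topologicalType) n (M : rmfd R T n) (i : idx M) k a b :
  geo_charts M -> smooth_on (coord_set i) (fun y => christoffel i y k a b).
Proof.
move=> [_ _ /(_ i) gS _ /(_ i)[sm um]].
apply: smoothM => //; first exact: smooth_cst.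
apply: smooth_sum => // l; apply: smoothM => //; first exact: smooth_invmx.
apply: (@smooth_eq _ _ _ (fun y => pderiv (coord_set i) a (fun z => met i z b l) y +
   pderiv (coord_set i) b (fun z => met i z a l) y + (-1) * pderiv (coord_set i) l (fun z => met i z a b) y)).
  by move=> y _; rewrite mulN1r.
by apply: smoothD => //; [apply: smoothD => //; exact: smooth_pderiv|apply: smoothM => //; [exact: smooth_cst|exact: smooth_pderiv]].
Qed.

Lemma near_left (R : realType) (t d : R) : 0 < t <= 1 -> 0 < d ->
  exists h : R, [/\ h < 0, `|h| < d & 0 <= t + h < t].
Proof.
move=> /andP[t0 t1] d0; pose h := - (Num.min d t / 2).
have m0 : 0 < Num.min d t by rewrite lt_min d0.
have md : Num.min d t <= d by rewrite ge_min lexx.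
have mt : Num.min d t <= t by rewrite ge_min lexx orbT.
have h0 : h < 0 by rewrite /h; lra.
exists h; split=> //; first by rewrite ltr0_norm // /h; lra.
by apply/andP; split; rewrite /h; lra.
Qed.

(** At [t > 0] increments to the left alone determine the derivative. Two curves that coincide up to
    [t] therefore have the same velocity at [t], the initial condition for continuing beyond [t]. *)
Lemma cder_left (R : realType) (u1 u2 : R -> R) (t : R) : 0 < t <= 1 ->
  has_dderiv (ui R) (1 : R^o) u1 t -> has_dderiv (ui R) (1 : R^o) u2 t ->
  (forall s, 0 <= s <= t -> u1 s = u2 s) ->
  dderiv (ui R) (1 : R^o) u1 t = dderiv (ui R) (1 : R^o) u2 t.
Proof.
move=> t01 d1 d2 E; have ut : ui R t by move: t01 => /andP[? ?]; apply/andP; split=> //; exact: ltW.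
have FI := incr_filter (ui R) t (1 : R^o).
have H := derD FI (cderP ut d1) (@derZ _ _ (-1) _ _ FI (cderP ut d2)).
apply/eqP; rewrite -subr_eq0 -normr_le0; apply/ler_addgt0Pl => e e0; rewrite addr0.
have /cvgrPdist_lt/(_ e e0) H1 := H; set l := _ + -1 * _ in H1.
have -> : dderiv (ui R) (1 : R^o) u1 t - dderiv (ui R) (1 : R^o) u2 t = l by rewrite /l mulN1r.
have H2 : \forall h \near (0 : R)^', ui R (t + h *: (1 : R^o)) ->
  `|l - h^-1 * (u1 (t + h *: (1 : R^o)) + -1 * u2 (t + h *: (1 : R^o)) -
     (u1 (t + 0 *: (1 : R^o)) + -1 * u2 (t + 0 *: (1 : R^o))))| < e := H1.
have /nbhs_ballP[d /= d0 dH] := H2; have [h [h0 hd /andP[th0 th1]]] := near_left t01 d0.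
have t1 : t <= 1 by move: t01 => /andP[].
have := dH h; rewrite -ball_normE /= sub0r normrN => /(_ hd); rewrite lt_eqF // => /(_ isT).
have -> : t + h *: (1 : R^o) = t + h by rewrite [h *: _]mulr1.
have -> : t + 0 *: (1 : R^o) = t by rewrite scale0r addr0.
have uth : ui R (t + h) by apply/andP; split=> //; apply: ltW; exact: lt_le_trans t1.
move=> /(_ uth); rewrite (E (t + h)) ?(E t); last by rewrite th0 ltW.
  have -> : u2 (t + h) + -1 * u2 (t + h) - (u2 t + -1 * u2 t) = 0 by ring.
  by rewrite mulr0 subr0 => /ltW.
by rewrite lexx (le_trans th0) // ltW.
Qed.

(** Continuous partial derivatives are bounded near [x], and the staircase form of the mean value
    theorem turns this bound into a Lipschitz constant, which is also made to dominate the values of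
    [f]. *)
Lemma lipschitz_near (R : realType) n (S : set 'rV[R]_n) f (x : 'rV[R]_n) : good S -> smooth_on S f -> S x ->
  exists L d : R, [/\ 0 <= L, 0 < d, (forall y, S y -> bx x d y -> `|f y| <= L) &
   forall y y', S y -> S y' -> bx x d y -> bx x d y' -> `|f y - f y'| <= L * \sum_k `|y 0 k - y' 0 k|].
Proof.
move=> gS sf Sx; have C1 := smooth_C1 sf; have [cf df cdf] := C1.
have [P [SP gd]] := gS; have [d1 d10 d1S] := gd x Sx.
have [d2 d20 d2H] := @near_forall_fin R n 'I_n S
  (fun k y => `|pderiv S k f y - pderiv S k f x| < 1) x
  (fun k => (within_contP _ _).1 (cdf k) x Sx 1 ltr01).
have [d3 d30 d3H] := (within_contP _ _).1 cf x Sx 1 ltr01.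
pose L := `|f x| + 1 + \sum_k (`|pderiv S k f x| + 1).
have L1 : 0 <= \sum_k (`|pderiv S k f x| + 1) by apply: sumr_ge0 => k _; rewrite addr_ge0.
pose d := Num.min d1 (Num.min d2 d3).
have dd1 : d <= d1 by rewrite /d ge_min lexx.
have dd2 : d <= d2 by rewrite /d !ge_min lexx orbT.
have dd3 : d <= d3 by rewrite /d !ge_min lexx !orbT.
exists L, d; split.
- by rewrite /L addr_ge0 // addr_ge0.
- by rewrite /d !lt_min d10 d20.
- move=> y Sy by_; have := d3H y Sy (bx_le dd3 by_) => H.
  have -> : f y = f x + (f y - f x) by ring.
  apply: le_trans (ler_normD _ _) _; rewrite /L; have := ltW H; lra.
- move=> y y' Sy Sy' by_ by'.
  have dS : orth P `&` bx x d `<=` S by move=> z [Pz bz]; apply: d1S; split=> //; exact: bx_le bz.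
  have [xi [Hxi ->]] := mvt_stair gS C1 dS (SP _ Sy) (SP _ Sy') by_ by'.
  rewrite mulr_sumr; apply: le_trans (ler_norm_sum _ _ _) _; apply: ler_sum => k _.
  rewrite normrM ler_wpM2r //; have [Pk bk] := Hxi k.
  have := d2H (xi k) (dS _ (conj Pk bk)) (bx_le dd2 bk) k => H.
  have -> : pderiv S k f (xi k) = pderiv S k f x + (pderiv S k f (xi k) - pderiv S k f x).
    by rewrite addrC subrK.
  apply: le_trans (ler_normD _ _) _; rewrite /L (bigD1 k) //=.
  have : 0 <= \sum_(i | i != k) (`|pderiv S i f x| + 1) by apply: sumr_ge0 => j _; rewrite addr_ge0.
  have := ltW H; have := normr_ge0 (f x); lra.
Qed.

Lemma near_ui_dist (R : realType) (t : R) (Q : R -> Prop) :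
  (\forall s \near (t : R^o), ui R s -> Q s) ->
  exists2 e : R, 0 < e & forall s, ui R s -> `|s - t| < e -> Q s.
Proof.
move=> /nbhs_ballP[e /= e0 eH]; exists e => // s us st; apply: eH => //.
by rewrite -ball_normE /= distrC.
Qed.

Lemma geo_near (R : realType) (T : topologicalType) n (M : rmfd R T n) (c : R -> T) (i : idx M) (t d : R) :
  geo_charts M -> geodesic M c -> ui R t -> cdom (ch i) (c t) -> 0 < d ->
  exists2 e : R, 0 < e & forall s, ui R s -> `|s - t| < e ->
    [/\ cdom (ch i) (c s), bx (cmap (ch i) (c t)) d (cmap (ch i) (c s)) &
        forall k, `|velocity i c s 0 k - velocity i c t 0 k| < d].
Proof.
move=> [hT ro gS cK _] [cc geo] ut it d0.
have [U oU EU] := ro i.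
have Ut : U (c t) by have := it; rewrite EU => -[].
have [e1 e10 H1] := near_ui_dist (near_curve cc ut oU Ut).
have Hd s : ui R s -> `|s - t| < e1 -> cdom (ch i) (c s).
  by move=> us st; rewrite EU; split; [have [] := geo s us|exact: H1].
have [pt Ht] := geo t ut.
have [dx Hdx] := choice (fun k => let: And3 h _ _ := Ht i it k in
  let: ex_intro2 d' p q := cder_cont ut h d0 in ex_intro _ d' (conj p q)).
have [dv Hdv] := choice (fun k => let: And3 _ h _ := Ht i it k in
  let: ex_intro2 d' p q := cder_cont ut h d0 in ex_intro _ d' (conj p q)).
pose e := Num.min e1 (Num.min (\big[Num.min/1]_k dx k) (\big[Num.min/1]_k dv k)).
have e0 : 0 < e.
  rewrite !lt_min e10 /=; apply/andP; split; apply: lt_bigmin => // k _.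
    by have [] := Hdx k.
  by have [] := Hdv k.
exists e => // s us; rewrite !lt_min => /andP[se1 /andP[sx sv]].
split; first exact: Hd.
  move=> k; have [_ H] := Hdx k; apply: H => //; apply: lt_le_trans sx _; exact: bigmin_le.
move=> k; have [_ H] := Hdv k; apply: H => //; apply: lt_le_trans sv _; exact: bigmin_le.
Qed.

(** The difference of the two products is telescoped over its three factors, so each term contains
    one of the small quantities [L * X] or [U]. *)
Lemma geo_quad_bound (R : realType) n (G1 G2 : 'I_n -> 'I_n -> R) (v1 v2 : 'I_n -> R) (L V X U : R) :
  (forall a b, `|G1 a b - G2 a b| <= L * X) -> (forall a b, `|G2 a b| <= L) ->
  (forall a, `|v1 a| <= V) -> (forall a, `|v2 a| <= V) -> (forall a, `|v1 a - v2 a| <= U) ->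
  0 <= L -> 0 <= V -> 0 <= X -> 0 <= U ->
  `|\sum_a \sum_b G1 a b * v1 a * v1 b - \sum_a \sum_b G2 a b * v2 a * v2 b| <=
   (n%:R * n%:R) * (L * V * V + 2 * L * V) * (X + U).
Proof.
move=> H1 H2 H3 H4 H5 L0 V0 X0 U0.
rewrite -sumrB; apply: le_trans (ler_norm_sum _ _ _) _.
have EY (Y : R) : n%:R * n%:R * Y = \sum_(a < n) \sum_(b < n) Y.
  by rewrite sumr_const sumr_const !card_ord -mulrnA -natrM mulr_natl.
rewrite -[n%:R * n%:R * _ * _]mulrA EY.
apply: ler_sum => a _; rewrite -sumrB; apply: le_trans (ler_norm_sum _ _ _) _.
apply: ler_sum => b _.
have -> : G1 a b * v1 a * v1 b - G2 a b * v2 a * v2 b = (G1 a b - G2 a b) * v1 a * v1 b +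
   (G2 a b * (v1 a - v2 a) * v1 b + G2 a b * v2 a * (v1 b - v2 b)) by ring.
have h1 : `|(G1 a b - G2 a b) * v1 a * v1 b| <= L * X * V * V.
  by rewrite !normrM; do 2 (apply: ler_pM; rewrite ?mulr_ge0 //).
have h2 : `|G2 a b * (v1 a - v2 a) * v1 b| <= L * U * V.
  by rewrite !normrM; do 2 (apply: ler_pM; rewrite ?mulr_ge0 //).
have h3 : `|G2 a b * v2 a * (v1 b - v2 b)| <= L * V * U.
  by rewrite !normrM; do 2 (apply: ler_pM; rewrite ?mulr_ge0 //).
apply: le_trans (ler_normD _ _) _; apply: le_trans (lerD h1 (le_trans (ler_normD _ _) (lerD h2 h3))) _.
have p1 : 0 <= L * V * V * U by rewrite !mulr_ge0.
have p2 : 0 <= L * V * X by rewrite !mulr_ge0.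
lra.
Qed.

Lemma is_derive_subR (R : realType) (u v : R -> R) (s l m : R) :
  is_derive s 1 u l -> is_derive s 1 v m -> is_derive s 1 (fun r => u r - v r) (l - m).
Proof. by move=> du dv; exact: is_deriveB. Qed.

Lemma geo_local (R : realType) (T : topologicalType) n (M : rmfd R T n) (c1 c2 : R -> T) (i : idx M) (t : R) :
  geo_charts M -> geodesic M c1 -> geodesic M c2 -> 0 <= t < 1 -> cdom (ch i) (c1 t) ->
  c1 t = c2 t -> velocity i c1 t = velocity i c2 t ->
  exists2 e : R, 0 < e & forall s, t < s < t + e -> s <= 1 -> c1 s = c2 s.
Proof.
move=> gM g1 g2 /andP[t0 t1] it E Ev; have [hT ro gS cK _] := gM.
have ut : ui R t by rewrite /unit_itv /= t0 ltW.
pose S := coord_set i; pose z0 := cmap (ch i) (c1 t).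
have Sz0 : S z0 by exists (c1 t).
have [L HL] := choice (fun kab : 'I_n * 'I_n * 'I_n =>
  lipschitz_near (gS i) (christoffel_smooth i kab.1.1 kab.1.2 kab.2 gM) Sz0).
have [d Hd] := choice HL.
pose L0 := \big[Num.max/0]_kab L kab; pose d0 := \big[Num.min/1]_kab d kab.
have L00 : 0 <= L0 by exact: bigmax_ge_id.
have d00 : 0 < d0 by apply: lt_bigmin => // kab _; have [] := Hd kab.
have LL kab : L kab <= L0 by exact: le_bigmax.
have dd kab : d0 <= d kab by exact: bigmin_le.
have it2 : cdom (ch i) (c2 t) by rewrite -E.
have [e1 e10 H1] := geo_near gM g1 ut it d00.
have [e2 e20 H2] := geo_near gM g2 ut it2 d00.
pose e := Num.min e1 e2; have e0 : 0 < e by rewrite lt_min e10.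
pose V := \sum_k `|velocity i c1 t 0 k| + d0.
have V0 : 0 <= V by apply: addr_ge0; [exact: sumr_ge0|exact: ltW].
have Vb c s : (forall k, `|velocity i c s 0 k - velocity i c1 t 0 k| < d0) ->
    forall k, `|velocity i c s 0 k| <= V.
  move=> H k; rewrite -[velocity i c s 0 k](subrK (velocity i c1 t 0 k)) addrC.
  apply: le_trans (ler_normD _ _) _; apply: lerD; last exact/ltW/H.
  by rewrite (bigD1 k) //= lerDl sumr_ge0.
exists e => // s1 /andP[ts1 s1e] s11.
(* The geodesic equation as a first-order system: [true] marks the differences of the coordinates,
   [false] those of the velocities. *)
pose w (q : bool * 'I_n) (s : R) := if q.1 then cmap (ch i) (c1 s) 0 q.2 - cmap (ch i) (c2 s) 0 q.2
   else velocity i c1 s 0 q.2 - velocity i c2 s 0 q.2.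
pose dw (q : bool * 'I_n) (s : R) := if q.1 then velocity i c1 s 0 q.2 - velocity i c2 s 0 q.2
   else dderiv (ui R) (1 : R^o) (fun r => velocity i c1 r 0 q.2) s -
        dderiv (ui R) (1 : R^o) (fun r => velocity i c2 r 0 q.2) s.
have near_s s : t <= s <= s1 -> ui R s /\ `|s - t| < e.
  move=> /andP[ts ss1]; split; first by apply/andP; split; [exact: le_trans ts|exact: le_trans s11].
  by rewrite ger0_norm ?subr_ge0 //; lra.
have He1 s : `|s - t| < e -> `|s - t| < e1 by rewrite lt_min => /andP[].
have He2 s : `|s - t| < e -> `|s - t| < e2 by rewrite lt_min => /andP[].
have geoD c s : geodesic M c -> ui R s -> cdom (ch i) (c s) -> forall k,
   [/\ has_dderiv (ui R) (1 : R^o) (fun r => cmap (ch i) (c r) 0 k) s,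
       has_dderiv (ui R) (1 : R^o) (fun r => velocity i c r 0 k) s,
       dderiv (ui R) (1 : R^o) (fun r => cmap (ch i) (c r) 0 k) s = velocity i c s 0 k &
       dderiv (ui R) (1 : R^o) (fun r => velocity i c r 0 k) s =
       - \sum_a \sum_b christoffel i (cmap (ch i) (c s)) k a b * velocity i c s 0 a * velocity i c s 0 b].
  move=> [_ H] us iis k; have [_ /(_ i iis k)[h1 h2 h3]] := H s us; split=> //.
    by rewrite mxE.
  by apply/eqP; rewrite -addr_eq0; apply/eqP.
have key := @gronwall_zero R (bool * 'I_n)%type w dw t s1
  (1 + (n%:R * n%:R) * (L0 * V * V + 2 * L0 * V)) ts1.
have W : forall q, w q s1 = 0.
  apply: key.
  - by rewrite addr_ge0 // !mulr_ge0 // addr_ge0 // !mulr_ge0.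
  - move=> [b k] s /andP[ts ss]; have s01 : 0 < s < 1 by rewrite (le_lt_trans t0) //= (lt_le_trans ss).
    have [us se] : ui R s /\ `|s - t| < e by apply: near_s; rewrite !ltW.
    have [is1 _ _] := H1 s us (He1 s se); have [is2 _ _] := H2 s us (He2 s se).
    have [p1 p2 p3 p4] := geoD c1 s g1 us is1 k; have [q1 q2 q3 q4] := geoD c2 s g2 us is2 k.
    rewrite /w /dw /=; case: b.
      rewrite -p3 -q3; exact: (is_derive_subR (cder_is_derive s01 p1) (cder_is_derive s01 q1)).
    exact: (is_derive_subR (cder_is_derive s01 p2) (cder_is_derive s01 q2)).
  - move=> [b k]; apply/subspace_continuousP => s /=; rewrite in_itv /= => ss.
    have [us se] := near_s s ss.
    have [is1 _ _] := H1 s us (He1 s se); have [is2 _ _] := H2 s us (He2 s se).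
    have [p1 p2 p3 p4] := geoD c1 s g1 us is1 k; have [q1 q2 q3 q4] := geoD c2 s g2 us is2 k.
    have cw u : has_dderiv (ui R) (1 : R^o) u s -> u r @[r --> within `[t, s1] (nbhs s)] --> u s.
      move=> hu; apply/cvgrPdist_lt => e' e'0; have [d' d'0 H] := cder_cont us hu e'0.
      apply/nbhs_ballP; exists d' => //= r; rewrite -ball_normE /= => sr.
      rewrite in_itv /= => rr; rewrite distrC; apply: H; last by rewrite distrC.
      by have [] := near_s r rr.
    by rewrite /w /=; case: b; apply: cvgB; exact: cw.
  - by move=> [b k]; rewrite /w /=; case: b; rewrite ?E ?Ev subrr.
  move=> [b k] s /andP[ts ss].
  have [us se] : ui R s /\ `|s - t| < e by apply: near_s; rewrite !ltW.
  have [is1 bx1 v1] := H1 s us (He1 s se); have [is2 bx2 v2] := H2 s us (He2 s se).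
  rewrite -E in bx2; rewrite -Ev in v2.
  have [p1 p2 p3 p4] := geoD c1 s g1 us is1 k; have [q1 q2 q3 q4] := geoD c2 s g2 us is2 k.
  pose X := \sum_k `|cmap (ch i) (c1 s) 0 k - cmap (ch i) (c2 s) 0 k|.
  pose U := \sum_k `|velocity i c1 s 0 k - velocity i c2 s 0 k|.
  have X0 : 0 <= X by exact: sumr_ge0.
  have U0 : 0 <= U by exact: sumr_ge0.
  have -> : \sum_j `|w j s| = X + U.
    by rewrite /X /U -(pair_bigA _ (fun b k => `|w (b, k) s|)) /= big_bool /= /w /=.
  have Q0 : 0 <= n%:R * n%:R * (L0 * V * V + 2 * L0 * V) by rewrite !mulr_ge0 // addr_ge0 // !mulr_ge0.
  rewrite /dw /=; case: b; last first.
    rewrite p4 q4 opprK addrC -opprB normrN.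
    apply: le_trans (_ : n%:R * n%:R * (L0 * V * V + 2 * L0 * V) * (X + U) <= _); last first.
      by rewrite ler_wpM2r ?addr_ge0 // lerDr.
    apply: geo_quad_bound => //.
    + move=> a b; have [l0 _ _ H] := Hd (k, a, b).
      apply: le_trans (H _ _ _ _ _ _) _; first by exists (c1 s).
      * by exists (c2 s).
      * by apply: bx_le bx1; exact: dd.
      * by apply: bx_le bx2; exact: dd.
      * by rewrite ler_wpM2r.
    + move=> a b; have [l0 _ H _] := Hd (k, a, b).
      apply: le_trans (H _ _ _) (LL (k, a, b)); first by exists (c2 s).
      by apply: bx_le bx2; exact: dd.
    + exact: Vb v1.
    + exact: Vb v2.
    + by move=> a; rewrite /U (bigD1 a) //= lerDl sumr_ge0.
  apply: le_trans (_ : U <= _); first by rewrite /U (bigD1 k) //= lerDl sumr_ge0.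
  rewrite mulrDl mul1r; apply: le_trans (_ : X + U <= _); first by rewrite lerDr.
  by rewrite lerDl mulr_ge0 // addr_ge0.
have [us se] : ui R s1 /\ `|s1 - t| < e by apply: near_s; rewrite ltW //= lexx.
have [is1 _ _] := H1 s1 us (He1 s1 se); have [is2 _ _] := H2 s1 us (He2 s1 se).
have [Ki _] := cK i; rewrite -(Ki _ is1) -(Ki _ is2); congr cinv.
by apply/rowP => k; apply/eqP; rewrite -subr_eq0; apply/eqP; exact: (W (true, k)).
Qed.

(* Hence the exponential map and the normal flow, defined as relations, are functions. *)
Lemma geodesic_unique (R : realType) (T : topologicalType) n (M : rmfd R T n) (c1 c2 : R -> T) (i : idx M) :
  geo_charts M -> geodesic M c1 -> geodesic M c2 -> cdom (ch i) (c1 0) ->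
  c1 0 = c2 0 -> velocity i c1 0 = velocity i c2 0 -> forall t, 0 <= t <= 1 -> c1 t = c2 t.
Proof.
move=> gM g1 g2 i0 E Ev; have [hT _ _ _ _] := gM; have [cc1 G1] := g1; have [cc2 G2] := g2.
apply: ui_ind => //.
  move=> t /andP[t0 t1] H; have ut : ui R t by rewrite /unit_itv /= t0 ltW.
  have Et : c1 t = c2 t by apply: H; rewrite t0 lexx.
  (* At [t = 0] the velocities agree by hypothesis; at later times they agree because the curves
     coincide on the left. *)
  have [tp|tp] := ltP 0 t; last first.
    have -> : t = 0 by apply/eqP; rewrite eq_le tp.
    by apply: (geo_local gM g1 g2 _ i0 E Ev); rewrite lexx ltr01.
  have [[j _ jt] D1] := G1 t ut; have [_ D2] := G2 t ut.
  have jt2 : cdom (ch j) (c2 t) by rewrite -Et.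
  apply: (geo_local gM g1 g2 _ jt Et); first by rewrite t0.
  apply/rowP => k; rewrite !mxE; have [h1 _ _] := D1 j jt k; have [h2 _ _] := D2 j jt2 k.
  by apply: cder_left => //; [rewrite tp ltW|move=> s st; rewrite /coord_curve H].
move=> t t01 H; have ut : ui R t by move: t01 => /andP[? ?]; apply/andP; split=> //; exact: ltW.
(* Neighbourhoods of the two values always meet, namely in a common value of the curves at a
   slightly earlier time. *)
apply: hT => A B At Bt.
have [d1 d10 H1] := near_ui_dist (near_curveN cc1 ut At).
have [d2 d20 H2] := near_ui_dist (near_curveN cc2 ut Bt).
have m0 : 0 < Num.min d1 d2 by rewrite lt_min d10.
have [h [h0]] := near_left t01 m0; rewrite lt_min => /andP[hd1 hd2] th.
have uth : ui R (t + h).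
  rewrite /unit_itv /=; move: t01 th => /andP[_ t1] /andP[-> th] /=.
  by rewrite ltW // (lt_le_trans th).
exists (c1 (t + h)); split; first by apply: H1 => //; rewrite addrC addKr.
by rewrite (H _ th); apply: H2 => //; rewrite addrC addKr.
Qed.

(** * The boundary and the normal flow *)

Lemma baseE (R : realType) n (z : 'rV[R]_n.+1) k : base z 0 k = z 0 (lift ord_max k).
Proof. by rewrite /base mxE. Qed.

Lemma ext_max (R : realType) n (y : 'rV[R]_n) t : ext y t 0 ord_max = t.
Proof. by rewrite /ext mxE unlift_none. Qed.

Lemma ext_lift (R : realType) n (y : 'rV[R]_n) t k : ext y t 0 (lift ord_max k) = y 0 k.
Proof. by rewrite /ext mxE liftK. Qed.

Lemma ext_base (R : realType) n (z : 'rV[R]_n.+1) : ext (base z) (height z) = z.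
Proof. by apply/rowP => j; case: (unliftP ord_max j) => [k ->|->]; rewrite ?ext_max ?ext_lift ?baseE. Qed.

Lemma base_ext (R : realType) n (y : 'rV[R]_n) t : base (ext y t) = y.
Proof. by apply/rowP => j; rewrite baseE ext_lift. Qed.

Lemma height_ext (R : realType) n (y : 'rV[R]_n) t : height (ext y t) = t.
Proof. exact: ext_max. Qed.

Lemma wbxP (R : realType) (T : topologicalType) n (A : set T) (f : T -> 'rV[R]_n) :
  {within A, continuous f} <->
  forall x, A x -> forall d : R, 0 < d -> \forall y \near x, A y -> bx (f x) d (f y).
Proof.
rewrite subspace_continuousP; split=> H x Ax.
  by move=> d d0; have := H x Ax _ (nbhs_bx (f x) d0).
move=> B /nbhs_bxP[d d0 dB]; have H1 := H x Ax d d0.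
by apply: filterS H1 => y H1 Ay; apply: dB; exact: H1.
Qed.

Lemma rel_half_in (R : realType) n (D : set 'rV[R]_n.+1) z :
  rel_open half_space D -> D z -> 0 <= height z.
Proof. by move=> [U oU ->] [H _]. Qed.

Lemma rel_half_near (R : realType) n (D : set 'rV[R]_n.+1) z :
  rel_open half_space D -> D z -> 0 < height z -> \forall y \near z, D y.
Proof.
move=> [U oU ->] [_ Uz] h0.
have N := open_nbhs_nbhs (conj oU Uz).
have N2 := nbhs_bx z h0.
apply: filterS2 N N2 => y Uy yz; split=> //.
have := yz ord_max; rewrite /half_space /= /height => H.
have := ler_norm (z 0 ord_max - y 0 ord_max); rewrite distrC => H2.
by rewrite /height in h0 H *; lra.
Qed.

Lemma rel_half_good (R : realType) n (D : set 'rV[R]_n.+1) : rel_open half_space D -> good D.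
Proof. by rewrite half_spaceE; exact: good_rel_open. Qed.

(* A smooth function with values in [0, +oo[ has zero gradient at an interior zero,
   which would make the last column of an invertible Jacobian vanish. *)
Lemma interior_height (R : realType) (T : topologicalType) n (M : rmfd R T n.+1)
    D k g D' k' g' z :
  riemannian_manifold M -> dchart M D k g -> dchart M D' k' g' ->
  (forall y, D' y -> 0 <= height y) -> trans_dom D k D' k' z ->
  (\forall y \near z, D y) -> 0 < height (g' (k z)).
Proof.
move=> hM dc dc' hD' Sz nz.
set S := trans_dom D k D' k'.
have gS : good S by exact: trans_good dc dc'.
have nS : \forall y \near z, S y.
  by apply: filterS2 nz (trans_near dc dc' Sz) => y Dy [H _]; exact: H.
have in' y : S y -> D' (g' (k y)) by move=> [_ A]; have [] := dchart_ginv dc' A.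
rewrite lt_neqAle (hD' _ (in' _ Sz)) andbT eq_sym; apply/eqP => E0.
have D0 i : pderiv S i (fun y => g' (k y) 0 ord_max) z = 0.
  have [e e0 He] := nbhs_bxP nS.
  have Hs (s : R) : `|s| < e -> S (z + s *: ebase i) by move=> se; apply: He; exact: bx_ebase.
  have sm : smooth_on S (fun y => g' (k y) 0 ord_max) by exact: (dchart_trans ord_max hM dc dc').
  have Hder (t : R) : `|t| < e -> is_derive t 1 (fun s => g' (k (z + s *: ebase i)) 0 ord_max)
     (pderiv S i (fun y => g' (k y) 0 ord_max) (z + t *: ebase i)).
    move=> te; apply: (@is_derive_line R n.+1 S (fun y => g' (k y) 0 ord_max) z i t gS).
      have N0 : \forall s \near t, `|s| < e.
        have : 0 < e - `|t| by rewrite subr_gt0.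
        move=> /(nbhsx_ballx t) N; apply: filterS N => s /=; rewrite /ball /= => H.
        have := ler_normD (s - t) t; rewrite subrK; rewrite distrC in H; lra.
      by apply: filterS N0 => s; exact: Hs.
    by apply: (@smooth_dd _ _ _ _ i _ sm); exact: Hs.
  have inI (t : R) : t \in `](- e), e[ -> `|t| < e by rewrite in_itv /= ltr_norml.
  have e00 : `|0 : R| < e by rewrite normr0.
  have := @derive1_at_min R (fun s => g' (k (z + s *: ebase i)) 0 ord_max) (- e) e 0.
  case.
  - by lra.
  - by move=> t /inI te; have [] := Hder t te.
  - by rewrite in_itv /= oppr_lt0 e0.
  - move=> t /inI te; rewrite scale0r addr0.
    have := hD' _ (in' _ (Hs t te)); rewrite /height in E0 *; by rewrite E0.
  by move=> _ <-; have [_] := Hder 0 e00; rewrite scale0r addr0 => <-.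
have J0 i : jac D (fun y => g' (k y)) z i ord_max = 0.
  rewrite mxE -[RHS](D0 i); apply: pderiv_germ1; first by have [] := Sz.
  apply: filterS (trans_near dc dc' Sz) => y H; split=> //.
have := jac_inv hM dc dc' Sz => /mulmx1C /matrixP/(_ ord_max ord_max).
rewrite !mxE eqxx => /eqP; rewrite big1 ?(eq_sym 0) ?oner_eq0 // => j _.
by rewrite J0 mulr0.
Qed.

Section half_charts.
Context {R : realType} {T : topologicalType} {n : nat} (M : rmfd R T n.+1).
Context (D D' : set 'rV[R]_n.+1) (k k' : 'rV[R]_n.+1 -> T) (g g' : T -> 'rV[R]_n.+1).
Hypotheses (hM : riemannian_manifold M) (dc : dchart M D k g) (dc' : dchart M D' k' g').
Hypotheses (hD : rel_open half_space D) (hD' : rel_open half_space D').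

(** Invariance of the boundary: otherwise the image point is interior to the half-space, and
    [interior_height], applied to the inverse change of coordinates, gives [z] positive height. *)
Lemma height_trans z : trans_dom D k D' k' z -> height z = 0 -> height (g' (k z)) = 0.
Proof.
move=> Sz z0; have Sw := trans_in dc dc' Sz.
have [D'w kw] := dchart_ginv dc' (proj2 Sz).
have := rel_half_in hD' D'w; rewrite le_eqVlt => /orP[/eqP <-//|w0].
have := interior_height hM dc' dc (fun y => @rel_half_in _ _ _ y hD) Sw (rel_half_near hD' D'w w0).
by have [_ _ _ K _] := dc; rewrite kw K ?z0 ?ltxx //; have [] := Sz.
Qed.

Lemma jac_dom z i j : trans_dom D k D' k' z ->
  jac D (fun y => g' (k y)) z i j = pderiv (trans_dom D k D' k') i (fun y => g' (k y) 0 j) z.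
Proof.
move=> Sz; rewrite mxE; apply: pderiv_germ1; first by have [] := Sz.
by apply: filterS (trans_near dc dc' Sz) => y H; split.
Qed.

Lemma jac_der z i j : trans_dom D k D' k' z ->
  der (increments (trans_dom D k D' k') z (ebase i)) (fun h => g' (k (z + h *: ebase i)) 0 j)
    (jac D (fun y => g' (k y)) z i j).
Proof.
move=> Sz; rewrite jac_dom //; have gS := trans_good dc dc'.
apply: (@pderivP _ _ _ (fun y => g' (k y) 0 j)) => //.
apply: (@smooth_dd _ _ _ _ i) => //; exact: (dchart_trans j hM dc dc').
Qed.

(** Moving tangentially from a point of height 0 keeps the height 0, and by [height_trans] the same
    is true of the image. *)
Lemma jac_tangential z l : trans_dom D k D' k' z -> height z = 0 ->
  jac D (fun y => g' (k y)) z (lift ord_max l) ord_max = 0.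
Proof.
move=> Sz z0; set S := trans_dom D k D' k'.
have gS : good S := trans_good dc dc'.
have PF := good_incr_proper (lift ord_max l) gS Sz.
apply: (der_unique PF (@jac_der _ (lift ord_max l) ord_max Sz)).
have FF := incr_filter S z (ebase (lift ord_max l)).
apply: (der_near FF _ _ (der_cst 0 FF)); last first.
  by rewrite scale0r addr0; have := height_trans Sz z0; rewrite /height => ->.
have := incr_in S z (ebase (lift ord_max l)); apply: filterS => h Sh.
have h0 : height (z + h *: ebase (lift ord_max l)) = 0.
  rewrite /height in z0 *; rewrite mxE z0 add0r mxE ebaseE.
  by rewrite (negbTE (neq_lift _ _)) mulr0.
by have := height_trans Sh h0; rewrite /height => ->.
Qed.

(** The entry is a limit of nonnegative quotients, as heights are nonnegative. It cannot vanish,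
    since it is the only possibly nonzero entry in the last column of an invertible matrix. *)
Lemma jac_normal z : trans_dom D k D' k' z -> height z = 0 ->
  0 < jac D (fun y => g' (k y)) z ord_max ord_max.
Proof.
move=> Sz z0; set S := trans_dom D k D' k'.
have gS : good S := trans_good dc dc'.
have PF := good_incr_proper ord_max gS Sz.
rewrite lt_neqAle; apply/andP; split.
  apply/eqP => J0; have := jac_inv hM dc dc' Sz => /mulmx1C /matrixP/(_ ord_max ord_max).
  rewrite !mxE eqxx => /eqP; rewrite big1 ?(eq_sym 0) ?oner_eq0 // => j _.
  case: (unliftP ord_max j) => [l ->|->]; last by rewrite -J0 mulr0.
  by rewrite jac_tangential // mulr0.
apply: (@cvgr_to_ge _ _ PF _ _ _ 0 (@jac_der _ ord_max ord_max Sz)).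
have := incr_in S z (ebase ord_max); apply: filterS => h Sh.
rewrite scale0r addr0; have := height_trans Sz z0; rewrite /height => ->; rewrite subr0.
apply: mulr_ge0; last by apply: rel_half_in hD' _; have [_ A] := Sh; have [] := dchart_ginv dc' A.
have := rel_half_in hD (proj1 Sh); rewrite invr_ge0 /height !mxE /= in z0 *.
by rewrite z0 !eqxx mulr1 add0r.
Qed.

End half_charts.

Lemma bform_tan (R : realType) n (G : 'M[R]_n.+1) nu (u : 'rV[R]_n.+1) :
  (forall j : 'I_n, bform G nu (ebase (lift ord_max j)) = 0) -> u 0 ord_max = 0 ->
  bform G nu u = 0.
Proof.
move=> H u0; have -> : u = \sum_k u 0 k *: ebase k.
  apply/rowP => j; rewrite summxE (bigD1 j) //= big1 => [|i ij]; rewrite !mxE ?eqxx /= ?mulr1 ?addr0 //.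
  by rewrite (eq_sym j) (negbTE ij) mulr0.
have S0 (r : seq 'I_n.+1) : bform G nu (\sum_(k <- r) u 0 k *: ebase k) = 0.
  elim: r => [|k r IH]; first by rewrite big_nil /bform linear0 mulmx0 mxE.
  rewrite big_cons bformDr IH addr0 bformZr.
  by case: (unliftP ord_max k) => [l ->|->]; rewrite ?H ?u0 ?mulr0 ?mul0r.
exact: S0.
Qed.

(** * The inward normal and the charts of the boundary *)

Section normals.
Context {R : realType} {T : topologicalType} {n : nat} (M : rmfd R T n.+1).
Hypothesis hM : riemannian_manifold M.

Definition tjac (i j : idx M) (x : T) : 'M[R]_n.+1 :=
  jac (coord_set i) (fun y => cmap (ch j) (cinv (ch i) y)) (cmap (ch i) x).

Lemma atlas_trans (i j : idx M) x : cdom (ch i) x -> cdom (ch j) x ->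
  trans_dom (coord_set i) (cinv (ch i)) (coord_set j) (cinv (@ch _ _ _ M j)) (cmap (ch i) x).
Proof.
move=> ix jx; split; first by exists x.
by have [_ _ K _ _] := rm_chart i hM; rewrite /= K //; exact: atlas_img.
Qed.

Lemma atlas_half (i : idx M) : rel_open half_space (coord_set i).
Proof. by have [] := rm_chart i hM. Qed.

Lemma cinvK (i : idx M) x : cdom (ch i) x -> cinv (ch i) (cmap (ch i) x) = x.
Proof. by have [_ _ K _ _] := rm_chart i hM; exact: K. Qed.

Lemma tjac_inv i j x : cdom (ch i) x -> cdom (ch j) x -> tjac i j x *m tjac j i x = 1%:M.
Proof.
move=> ix jx; have := jac_inv hM (dchart_atlas i hM) (dchart_atlas j hM) (atlas_trans ix jx).
by rewrite cinvK.
Qed.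

Lemma tjac_met i j x : cdom (ch i) x -> cdom (ch j) x ->
  met_at i x = tjac i j x *m met_at j x *m (tjac i j x)^T.
Proof.
move=> ix jx; have Dz : coord_set i (cmap (ch i) x) by exists x.
have ix' : cdom (ch i) (cinv (ch i) (cmap (ch i) x)) by rewrite cinvK.
have jx' : cdom (ch j) (cinv (ch i) (cmap (ch i) x)) by rewrite cinvK.
have := metric_inE hM (dchart_atlas i hM) Dz jx'.
rewrite (metric_inE hM (dchart_atlas i hM) Dz ix') cinvK // => <-.
suff -> : jac (coord_set i) (fun y => cmap (ch i) (cinv (ch i) y)) (cmap (ch i) x) = 1%:M.
  by rewrite mul1mx trmx1 mulmx1.
rewrite -(jac_id (good_coord i hM) Dz); apply: jac_germ => //.
by apply: (@filterE _ (nbhs (cmap (ch i) x)) (nbhs_filter _)) => y; split=> // -[w iw <-]; rewrite cinvK.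
Qed.

Lemma boundary_height (i : idx M) x : boundary M x -> cdom (ch i) x -> height (cmap (ch i) x) = 0.
Proof.
move=> [j [jx x0]] ix; rewrite -{1}(cinvK jx).
apply: (height_trans hM (dchart_atlas j hM) (dchart_atlas i hM)) => //; try exact: atlas_half.
exact: atlas_trans.
Qed.

(** The Jacobian maps tangent vectors of the boundary to such vectors and respects the metric, which
    preserves orthogonality; its positive last diagonal entry preserves the inward direction. *)
Lemma normal_push i j x nu : unit_inward_normal i x nu -> cdom (ch j) x ->
  unit_inward_normal j x (nu *m tjac i j x).
Proof.
move=> [[ix x0] n1 no np] jx.
have bx0 : boundary M x by exists i.
have tan a b y l : cdom (ch a) y -> cdom (ch b) y -> boundary M y ->
    tjac a b y (lift ord_max l) ord_max = 0.
  move=> ay iy y0; apply: (jac_tangential hM (dchart_atlas a hM) (dchart_atlas b hM)).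
  - exact: atlas_half.
  - exact: atlas_half.
  - exact: atlas_trans.
  - exact: boundary_height.
split.
- by split=> //; exact: boundary_height.
- by rewrite -bform_mul -tjac_met.
- move=> l; have -> : ebase (lift ord_max l) =
      (ebase (lift ord_max l) *m tjac j i x) *m tjac i j x :> 'rV[R]_n.+1.
    by rewrite -mulmxA tjac_inv // mulmx1.
  rewrite -bform_mul -tjac_met //; apply: bform_tan => //.
  by rewrite /ebase -rowE mxE tan.
- rewrite /height mxE (bigD1 ord_max) //= big1 ?addr0.
    apply: mulr_gt0 => //; apply: (jac_normal hM (dchart_atlas i hM) (dchart_atlas j hM)) => //.
    + exact: atlas_half.
    + exact: atlas_half.
    + exact: atlas_trans.
  by move=> a; case: (unliftP ord_max a) => [l ->|->]; rewrite ?eqxx // tan ?mulr0.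
Qed.

Lemma met_at_spd (i : idx M) x : cdom (ch i) x -> spd (met_at i x).
Proof. by move=> ix; apply: met_spd => //; exists x. Qed.

(** Subtracting the multiple of [nu'] with the same height leaves a tangential vector that is
    orthogonal to both normals, hence to itself. *)
Lemma normal_unique (i : idx M) x nu nu' : unit_inward_normal i x nu ->
  unit_inward_normal i x nu' -> nu = nu'.
Proof.
move=> [[ix x0] n1 no np] [_ n1' no' np'].
have [sG pG] := met_at_spd ix; set G := met_at i x in n1 no n1' no' sG pG *.
set c := height nu / height nu'.
have c0 : 0 < c by rewrite divr_gt0.
have w0 : (nu - c *: nu') 0 ord_max = 0.
  by rewrite !mxE /c /height; apply/eqP; rewrite subr_eq0 -mulrA mulVf ?mulr1 // gt_eqF.
have E : nu = c *: nu'.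
  apply/eqP; rewrite -subr_eq0; apply/negPn/negP => /pG.
  have -> : bform G (nu - c *: nu') (nu - c *: nu') = 0; last by rewrite ltxx.
  set w := nu - c *: nu' in w0 *.
  have wE : w = nu + (- c) *: nu' by rewrite scaleNr.
  by rewrite {1}wE bformDl bformZl !bform_tan // mulr0 addr0.
have cc : c * c = 1 by rewrite -n1 E bformZl bformZr n1' mulr1.
have c1 : c = 1.
  apply/eqP; rewrite -(@eqrXn2 _ 2) ?ltW ?ler01 // expr1n expr2 cc //.
by rewrite E c1 scale1r.
Qed.

Lemma geo_charts_rm : geo_charts M.
Proof.
have [[hT _] cov _ _ met] := hM; split=> //.
- by move=> i; have [oi _ _ _ _] := rm_chart i hM; exists (cdom (ch i)) => //; rewrite cov setTI.
- by move=> i; exact: good_coord.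
- by move=> i; have [_ _ K cm _] := rm_chart i hM.
- move=> i; split; first by have [] := met i.
  by move=> y iy; apply: spd_unit; exact: met_spd.
Qed.

Lemma points_bdry : points (@ch _ _ _ (bdry M)) = boundary M.
Proof.
apply/seteqP; split=> x; first by move=> [i _ [ix x0]]; exists i.
by move=> [i [ix x0]]; exists i.
Qed.

Lemma bdry_domE (i : idx M) : cdom (@ch _ _ _ (bdry M) i) = boundary M `&` cdom (ch i).
Proof.
apply/seteqP; split=> x /=; first by move=> [ix x0]; split=> //; exists i.
by move=> [bx ix]; split=> //; exact: boundary_height.
Qed.

Lemma coord_bdry (i : idx M) y : coord_set (M := bdry M) i y <-> coord_set i (ext y 0).
Proof.
split; last by move=> [x ix E]; exists x; rewrite ?/= ?E ?base_ext ?height_ext.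
by move=> [x [ix x0] <-]; exists x => //=; rewrite -[LHS]ext_base x0.
Qed.

Lemma bdry_coord_near (i : idx M) y : coord_set (M := bdry M) i y ->
  \forall z \near y, coord_set (M := bdry M) i z.
Proof.
move=> /coord_bdry Hy; have [U oU E] := atlas_half i.
have [_ Uy] : (half_space `&` U) (ext y 0) by rewrite -E.
have [d d0 dU] := nbhs_bxP (open_nbhs_nbhs (conj oU Uy)).
apply: filterS (nbhs_bx y d0) => z zy; apply/coord_bdry; rewrite E; split.
  by rewrite /half_space /= height_ext.
apply: dU => a; case: (unliftP ord_max a) => [l ->|->]; rewrite ?ext_max ?ext_lift ?subrr ?normr0 //.
Qed.

Lemma bdry_coord_good (i : idx M) : good (coord_set (M := bdry M) i).
Proof.
exists xpred0; split; first by [].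
by move=> y /bdry_coord_near /nbhs_bxP[d d0 H]; exists d => // z [_]; exact: H.
Qed.

Lemma smooth_ext n' (S : set 'rV[R]_n') (t : R) a : good S -> smooth_on S (fun y => ext y t 0 a).
Proof.
move=> gS; case: (unliftP ord_max a) => [l ->|->].
  by apply: (smooth_eq (f := fun y => y 0 l)) => [x _|]; rewrite ?ext_lift //; exact: smooth_coord.
by apply: (smooth_eq (f := fun=> t)) => [x _|]; rewrite ?ext_max //; exact: smooth_cst.
Qed.

Lemma bdry_met_smooth (i : idx M) a b :
  smooth_on (coord_set (M := bdry M) i) (fun y => @met _ _ _ (bdry M) i y a b).
Proof.
have gd := bdry_coord_good i.
apply: (smooth_eq (f := fun y => met i (ext y 0) (lift ord_max a) (lift ord_max b))).
  by move=> y _ /=; rewrite !mxE.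
apply: (@smooth_comp R n n.+1 _ (coord_set i) (fun y => ext y 0)
  (fun z => met i z (lift ord_max a) (lift ord_max b))) => //.
- exact: good_coord.
- by move=> y /coord_bdry.
- by move=> j; exact: smooth_ext.
- by have [_ _ _ _ /(_ i)[]] := hM.
Qed.

Lemma bform_bdry (G : 'M[R]_n.+1) (v w : 'rV[R]_n) :
  bform (row' ord_max (col' ord_max G)) v w = bform G (ext v 0) (ext w 0).
Proof.
rewrite !bformE [RHS](bigD1_ord ord_max) //= [X in _ = X + _]big1 ?add0r; last first.
  by move=> b _; rewrite ext_max !mul0r.
apply: eq_bigr => a _; rewrite [RHS](bigD1_ord ord_max) //= !ext_max mulr0 add0r.
by apply: eq_bigr => b _; rewrite !ext_lift !mxE.
Qed.

Lemma bdry_met_spd (i : idx M) y : coord_set (M := bdry M) i y -> spd (@met _ _ _ (bdry M) i y).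
Proof.
move=> /coord_bdry iy; have [sG pG] := met_spd hM iy; split.
  by apply/matrixP => a b; rewrite !mxE -{1}sG mxE.
move=> v v0; rewrite /= bform_bdry; apply: pG; apply/eqP => E.
case/eqP: v0; apply/rowP => a; have /rowP/(_ (lift ord_max a)) := E.
by rewrite ext_lift !mxE.
Qed.

Lemma geo_charts_bdry : geo_charts (bdry M).
Proof.
have [[hT _] cov _ _ met] := hM; split=> //.
- move=> i; have [oi _ _ _ _] := rm_chart i hM; exists (cdom (@ch _ _ _ M i)) => //.
  by rewrite points_bdry bdry_domE.
- exact: bdry_coord_good.
- move=> i; have [_ _ K cm _] := rm_chart i hM; split.
    by move=> x [ix x0] /=; rewrite -[X in ext _ X]x0 ext_base K.
  apply/wbxP => x [ix x0] d d0; have /wbxP/(_ x ix d d0) := cm.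
  by apply: filterS => y H [iy y0] a; rewrite !baseE; exact: H.
- move=> i; split; first by move=> a b; exact: bdry_met_smooth.
  by move=> y iy; apply: spd_unit; exact: bdry_met_spd.
Qed.

End normals.

(** * Constant geodesics; the exponential map as a function *)

Section constant_geodesics.
Context {R : realType} {T : topologicalType} {n : nat} (M : rmfd R T n).

Lemma cst_dderiv (a t : R) : ui R t -> has_dderiv (ui R) (1 : R^o) (fun=> a) t /\
  dderiv (ui R) (1 : R^o) (fun=> a) t = 0.
Proof. by move=> ut; apply: cder_der => //; apply: der_cst. Qed.

Lemma cst_velocity (i : idx M) (x : T) t : ui R t -> velocity i (fun=> x) t = 0.
Proof. by move=> ut; apply/rowP => k; rewrite !mxE; have [] := cst_dderiv (cmap (ch i) x 0 k) ut. Qed.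

Lemma cst_geodesic (x : T) : points (@ch _ _ _ M) x -> geodesic M (fun=> x).
Proof.
move=> px; split; first by apply: continuous_subspaceT => t; exact: cvg_cst.
move=> t ut; split=> // i ix k vk.
have Hv : der (increments (ui R) t (1 : R^o)) (fun h => vk (t + h *: (1 : R^o))) 0.
  apply: (der_near (incr_filter _ _ _) _ _ (der_cst 0 (incr_filter _ _ _))).
    apply: filterS (incr_in (ui R) t (1 : R^o)) => h uh.
    by rewrite /vk (cst_velocity i x uh) mxE.
  by rewrite scale0r addr0 /vk (cst_velocity i x ut) mxE.
have [D1 D2] := cder_der ut Hv; split=> //.
  by have [] := cst_dderiv (cmap (ch i) x 0 k) ut.
rewrite D2 add0r big1 // => a _; rewrite big1 // => b _.
by rewrite (cst_velocity i x ut) !mxE !mulr0.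
Qed.

Lemma exp_to0 (i : idx M) (x y : T) : geo_charts M -> exp_to i x 0 y -> y = x.
Proof.
move=> gM [ix [c [gc c0 v0 <-]]].
have u0 : ui R 0 by rewrite /unit_itv /= lexx ler01.
have px : points (@ch _ _ _ M) x by exists i.
have := geodesic_unique gM gc (cst_geodesic px); rewrite c0 => /(_ i ix erefl).
by rewrite v0 cst_velocity // => /(_ erefl 1); apply; rewrite ler01 lexx.
Qed.

Lemma exp_to_fun (i : idx M) (x y y' : T) v : geo_charts M -> exp_to i x v y -> exp_to i x v y' -> y = y'.
Proof.
move=> gM [ix [c [gc c0 v0 <-]]] [_ [c' [gc' c0' v0' <-]]].
apply: (geodesic_unique (i := i) gM gc gc'); rewrite ?c0 ?c0' ?v0 ?v0' //.
by rewrite ler01 lexx.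
Qed.

End constant_geodesics.

Section Kflow.
Context {R : realType} {T : topologicalType} {n : nat} (M : rmfd R T n.+1).
Hypothesis hM : riemannian_manifold M.

Lemma exp_to_trans (i j : idx M) x y v : exp_to i x v y -> cdom (ch j) x ->
  exp_to j x (v *m tjac i j x) y.
Proof.
move=> [ix [c [gc c0 v0 c1]]] jx; split=> //; exists c; split=> //.
have u0 : ui R 0 by rewrite /unit_itv /= lexx ler01.
have [cc Hc] := gc; have [_ /(_ i)] := Hc 0 u0; rewrite c0 => /(_ ix) Hi.
have Ai : (cinv (ch i) @` coord_set i) (c 0) by rewrite c0; exact: atlas_img.
have Aj : (cinv (ch j) @` coord_set j) (c 0) by rewrite c0; exact: atlas_img.
have [|_] := vel_trans hM (dchart_atlas i hM) (dchart_atlas j hM) u0 cc Ai Aj.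
  by move=> a; have [] := Hi a.
by rewrite c0 -v0.
Qed.

Lemma Kflow_fun x t y y' : Kflow M x t y -> Kflow M x t y' -> y = y'.
Proof.
move=> [i [nu [Hn He]]] [j [nu' [Hn' He']]].
have [[jx _] _ _ _] := Hn'.
have := exp_to_trans He jx; rewrite -scalemxAl (normal_unique hM (normal_push hM Hn jx) Hn') => He2.
exact: exp_to_fun (geo_charts_rm hM) He2 He'.
Qed.

Lemma Kflow0 x y : Kflow M x 0 y -> y = x.
Proof. by move=> [i [nu [_]]]; rewrite scale0r; apply: exp_to0; exact: geo_charts_rm. Qed.

End Kflow.

(** * Collar charts *)

Lemma within_cont_comp (T1 T2 T3 : topologicalType) (D : set T1) (D' : set T2)
    (f : T1 -> T2) (f' : T2 -> T3) :
  {within D, continuous f} -> {within D', continuous f'} -> (forall x, D x -> D' (f x)) ->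
  {within D, continuous (f' \o f)}.
Proof.
move=> /subspace_continuousP cf /subspace_continuousP cf' H; apply/subspace_continuousP.
move=> x Dx A /(cf' _ (H x Dx)) N1; have := cf x Dx _ N1; rewrite !nbhs_filterE /within /=.
by apply: filterS => y N2 Dy /=; apply: N2 => //; exact: H.
Qed.

Lemma open_within_preim (T1 T2 : topologicalType) (A : set T1) (O : set T2) (f : T1 -> T2) :
  open A -> open O -> {within A, continuous f} -> open (A `&` f @^-1` O).
Proof.
move=> oA oO /subspace_continuousP cf; rewrite openE => x [Ax Ox].
have := cf x Ax _ (open_nbhs_nbhs (conj oO Ox)); rewrite !nbhs_filterE /within /= => H.
by apply: filterS2 H (open_nbhs_nbhs (conj oA Ax)) => y H Ay; split=> //; exact: H.
Qed.

Lemma within_sub (T1 T2 : topologicalType) (A B : set T1) (f : T1 -> T2) :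
  B `<=` A -> {within A, continuous f} -> {within B, continuous f}.
Proof. by move=> BA; exact: continuous_subspaceW. Qed.

Lemma cmap_imgE (R : realType) (T : Type) n (c : chart R T n) (D E : set T) :
  (forall x, cdom c x -> cinv c (cmap c x) = x) ->
  cmap c @` (cdom c `&` D `&` E) = cmap c @` (cdom c `&` D) `&` cinv c @^-1` E.
Proof.
move=> K; apply/seteqP; split=> [_ [x [[cx Dx] Ex] <-]|_ [[x [cx Dx] <-]]].
  by split; [exists x|rewrite /= K].
by rewrite /= K // => Ex; exists x.
Qed.

(* Hypotheses under which the coordinate expressions over [D] have good domains. *)
Definition rsys {R : realType} {T : topologicalType} {n : nat} {J : Type}
    (A : J -> chart R T n) (D : set T) : Prop :=
  forall j, [/\ good (cmap (A j) @` (cdom (A j) `&` D)),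
                (forall x, cdom (A j) x -> cinv (A j) (cmap (A j) x) = x)
              & {within cmap (A j) @` (cdom (A j) `&` D), continuous (cinv (A j))}].

Section smooth_maps.
Context {R : realType} {T1 T2 T3 : topologicalType} {n1 n2 n3 : nat} {J1 J2 J3 : Type}.
Context (A : J1 -> chart R T1 n1) (B : J2 -> chart R T2 n2) (C : J3 -> chart R T3 n3).

Lemma smooth_map_sub D U f : rsys A D -> open U ->
  smooth_map A B D f -> smooth_map A B (D `&` U) f.
Proof.
move=> sA oU [cf sf]; split; first exact: within_sub cf.
move=> i j k; have [_ K ci] := sA i.
have -> : cdom (A i) `&` (D `&` U) `&` f @^-1` cdom (B j) =
   cdom (A i) `&` (D `&` f @^-1` cdom (B j)) `&` U.
  by rewrite -!setIA [U `&` _]setIC.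
rewrite cmap_imgE //; apply: smooth_subset => //.
  by apply: within_sub ci => _ [x [ix [Dx _]] <-]; exists x.
by rewrite setIA; exact: sf.
Qed.

(** Around a given point one chart [b] of the middle space is fixed, and the domain is shrunk to the
    part [S0] that [f] sends into [b] and the composition into the target chart. There the
    coordinate expression factors through [b]. *)
Lemma smooth_map_comp D D' f f' :
  rsys A D -> rsys B D' -> (forall b, rel_open (points B) (cdom (B b))) ->
  (forall l, rel_open (points C) (cdom (C l))) ->
  (forall x, D x -> D' (f x)) -> D' `<=` points B -> (forall y, D' y -> points C (f' y)) ->
  smooth_map A B D f -> smooth_map B C D' f' -> smooth_map A C D (f' \o f).
Proof.
move=> sA sB oB oC DD' D'B f'C [cf sf] [cf' sf'].
split; first exact: within_cont_comp cf cf' DD'.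
move=> j l k; have [gA KA cA] := sA j.
set Sx := cmap (A j) @` (cdom (A j) `&` D) in gA cA.
have SxD y : Sx y -> D (cinv (A j) y) by move=> [x [jx Dx] <-]; rewrite KA.
have cz : {within Sx, continuous (f \o cinv (A j))} by exact: within_cont_comp cA cf SxD.
have cz' : {within Sx, continuous (f' \o (f \o cinv (A j)))}.
  by apply: within_cont_comp cz cf' _ => y /SxD; exact: DD'.
rewrite cmap_imgE // -/Sx; apply: smooth_local => y0 [Sy0 ly0].
have [b _ by0] := D'B _ (DD' _ (SxD _ Sy0)).
have [U oU EU] := oB b; have [V oV EV] := oC l.
have Ub y : Sx y -> (cdom (B b) (f (cinv (A j) y)) <-> U (f (cinv (A j) y))).
  by move=> /SxD Dy; rewrite EU; split=> [[]//|H]; split=> //; exact: D'B (DD' _ Dy).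
have Vl y : D' y -> (cdom (C l) (f' y) <-> V (f' y)).
  by move=> Dy; rewrite EV; split=> [[]//|H]; split=> //; exact: f'C.
set S1 := Sx `&` (f \o cinv (A j)) @^-1` U.
set S0 := S1 `&` (f' \o (f \o cinv (A j))) @^-1` V.
have gS1 : good S1 by exact: good_preim.
have cz1 : {within S1, continuous (f' \o (f \o cinv (A j)))} by apply: within_sub cz' => y [].
have gS0 : good S0 by exact: good_preim.
have [gB KB cB] := sB b; set Sb := cmap (B b) @` (cdom (B b) `&` D') in gB cB.
have SbD w : Sb w -> D' (cinv (B b) w) by move=> [x [bx Dx] <-]; rewrite KB.
have cw : {within Sb, continuous (f' \o cinv (B b))} by exact: within_cont_comp cB cf' SbD.
set S2 := Sb `&` (f' \o cinv (B b)) @^-1` V.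
have gS2 : good S2 by exact: good_preim.
exists S0, (fun y => cmap (C l) (f' (cinv (B b) (cmap (B b) (f (cinv (A j) y))))) 0 k).
split.
- split; first by split=> //; exact/(Ub _ Sy0).
  by apply/(Vl _ (DD' _ (SxD _ Sy0))).
- have N := near_preim cz oU Sy0 ((Ub _ Sy0).1 by0).
  apply: filterS N => y N; split.
    split=> [[[Sy Uy] Vy]|[Sy ly]].
      by split=> //; apply/(Vl _ (DD' _ (SxD _ Sy))).
    by split; [split=> //; exact: N|apply/(Vl _ (DD' _ (SxD _ Sy)))].
  by move=> [[Sy Uy] _] /=; rewrite KB //; apply/Ub.
apply: (@smooth_comp R n1 n2 S0 S2 (fun y => cmap (B b) (f (cinv (A j) y)))
  (fun w => cmap (C l) (f' (cinv (B b) w)) 0 k)) => //.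
- move=> y [[Sy Uy] Vy]; have By : cdom (B b) (f (cinv (A j) y)) by apply/Ub.
  split; first by exists (f (cinv (A j) y)) => //; split=> //; exact: DD' (SxD _ Sy).
  by rewrite /= KB.
- move=> a; apply: smooth_subset => //; have := sf j b a.
  rewrite cmap_imgE // -/Sx; have -> // : Sx `&` cinv (A j) @^-1` (f @^-1` cdom (B b)) = S1.
  by apply/seteqP; split=> y [Sy Hy]; split=> //; apply/Ub.
- have := sf' b l k; rewrite cmap_imgE // -/Sb.
  have -> // : Sb `&` cinv (B b) @^-1` (f' @^-1` cdom (C l)) = S2.
  by apply/seteqP; split=> y [Sy Hy]; split=> //; apply/(Vl _ (SbD _ Sy)).
Qed.

End smooth_maps.

Lemma rsys_euclidean (R : realType) n (D : set 'rV[R]_n) : good D -> rsys (euclidean R n) D.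
Proof.
move=> gD []; split=> //=; first by rewrite setTI image_id.
by apply: continuous_subspaceT => x; exact: cvg_id.
Qed.

Lemma rsys_rm (R : realType) (T : topologicalType) n (M : rmfd R T n.+1) (U : set T) :
  riemannian_manifold M -> open U -> rsys (@ch _ _ _ M) U.
Proof.
move=> hM oU j; have [oj _ K _ cj] := rm_chart j hM; split=> //.
  by rewrite cmap_img //; apply: good_preim => //; exact: good_coord.
by apply: within_sub cj => _ [x [jx _] <-]; exists x.
Qed.

Lemma dchart_diffeo (R : realType) (T : topologicalType) n (M : rmfd R T n.+1) D k :
  riemannian_manifold M -> good D ->
  diffeo_onto_image (euclidean R n.+1) (@ch _ _ _ M) D k -> exists g, dchart M D k g.
Proof.
move=> hM gD [_ [ck sk] op [g [K [cg sg]]]]; exists g.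
have [_ cov _ _ _] := hM.
have ok : open (k @` D) by move: op => [U oU ->]; rewrite cov setTI.
split=> //.
- move=> j a; have := sk (Datatypes.tt) j a.
  by rewrite /= setTI image_id.
- move=> j a; have := sg j (Datatypes.tt) a.
  by rewrite /= preimage_setT setIT cmap_img.
Qed.

(** * Balls, cylinders and coordinates of the product with the half-line *)

Lemma eballE (R : realType) n (r : R) (v : 'rV[R]_n) : 0 < r ->
  (enorm v < r) = (\sum_k v 0 k ^+ 2 < r ^+ 2).
Proof.
move=> r0; rewrite /enorm bform1E -{1}(gtr0_norm r0) -sqrtr_sqr ltr_sqrt //.
by rewrite exprn_gt0.
Qed.

Lemma open_bxP (R : realType) n (A : set 'rV[R]_n) :
  (forall x, A x -> exists2 d : R, 0 < d & bx x d `<=` A) -> open A.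
Proof.
by move=> H; rewrite openE => x /H[d d0 dA]; apply: filterS dA (nbhs_bx x d0).
Qed.

Lemma open_bx (R : realType) n (A : set 'rV[R]_n) x : open A -> A x ->
  exists2 d : R, 0 < d & bx x d `<=` A.
Proof. by move=> oA Ax; apply: nbhs_bxP; exact: open_nbhs_nbhs. Qed.

Lemma eball_open (R : realType) n (r : R) : 0 < r -> open (@eball R n r).
Proof.
move=> r0; have sm : smooth_on setT (fun v : 'rV[R]_n => \sum_k v 0 k * v 0 k).
  by apply: smooth_sum => [|k]; [exact: goodT|apply: smoothM; try apply: smooth_coord; exact: goodT].
apply: open_bxP => v; rewrite /eball /= eballE // => Hv.
have := near_preim (smooth_cont sm) (@open_lt _ (r ^+ 2)) I => /(_ v Hv).
move=> /nbhs_bxP[d d0 dH]; exists d => // w /dH /(_ I) /=.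
by rewrite /eball /= eballE.
Qed.

Lemma eball_good (R : realType) n (r : R) : 0 < r -> good (@eball R n r).
Proof.
move=> r0; exists xpred0; split; first by [].
by move=> x /(open_bx (eball_open r0))[d d0 H]; exists d => // z [_]; exact: H.
Qed.

Lemma eball_coord (R : realType) n (r : R) (v : 'rV[R]_n) k : eball r v -> `|v 0 k| < r.
Proof.
move=> Hv; have r0 : 0 < r by apply: le_lt_trans Hv; rewrite sqrtr_ge0.
move: Hv; rewrite /eball /= eballE // => Hv.
rewrite ltNge; apply/negP => rv.
have : r ^+ 2 <= v 0 k ^+ 2.
  by rewrite -[v 0 k ^+ 2]real_normK ?num_real // !expr2; apply: ler_pM => //; exact: ltW.
apply/negP; rewrite -ltNge; apply: le_lt_trans Hv; rewrite (bigD1 k) //= lerDl.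
by apply: sumr_ge0 => j _; exact: sqr_ge0.
Qed.

Lemma eball_box (R : realType) n (d r : R) (v : 'rV[R]_n) : 0 <= d -> n.+1%:R * d < r ->
  (forall k, `|v 0 k| <= d) -> eball r v.
Proof.
move=> d0 dr H; have r0 : 0 < r by apply: le_lt_trans dr; apply: mulr_ge0.
rewrite /eball /= eballE //.
apply: (@le_lt_trans _ _ (n%:R * d ^+ 2)).
  rewrite mulr_natl -[X in _ *+ X]card_ord -sumr_const; apply: ler_sum => k _.
  by rewrite -[v 0 k ^+ 2]real_normK ?num_real // lerXn2r ?nnegrE.
apply: (@le_lt_trans _ _ ((n.+1%:R * d) ^+ 2)); last by rewrite !expr2; apply: ltr_pM => //; rewrite mulr_ge0.
rewrite exprMn; apply: ler_wpM2r; first exact: sqr_ge0.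
by rewrite -natrX ler_nat expnS expn1; exact: leq_trans (leqnSn n) (leq_pmulr _ _).
Qed.

Lemma cylinder_half (R : realType) n (r1 r2 : R) : 0 < r1 ->
  rel_open half_space (@cylinder R n r1 r2).
Proof.
move=> r10; exists [set z | eball r1 (base z) /\ height z < r2]; last first.
  apply/seteqP; split=> z; first by move=> [zb /andP[h0 hr]].
  by move=> [h0 [zb hr]]; split=> //; apply/andP.
apply: open_bxP => z [/(open_bx (eball_open r10))[d d0 dH] zr].
have e0 : 0 < r2 - height z by rewrite subr_gt0.
exists (Num.min d (r2 - height z)); first by rewrite lt_min d0.
move=> w wz; split.
  by apply: dH => k; rewrite !baseE; apply: lt_le_trans (wz _) _; rewrite ge_min lexx.
have := wz ord_max; rewrite lt_min => /andP[_]; rewrite /height.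
by have := ler_norm (w 0 ord_max - z 0 ord_max); lra.
Qed.

Lemma prod_cont (T1 T2 T3 : topologicalType) (D : set T1) (f : T1 -> T2) (h : T1 -> T3) :
  {within D, continuous f} -> {within D, continuous h} ->
  {within D, continuous (fun x => (f x, h x))}.
Proof.
by move=> cf ch x; apply: cvg_pair; [exact: cf|exact: ch].
Qed.

Lemma base_cont (R : realType) n : continuous (@base R n).
Proof.
move=> z A /nbhs_bxP[d d0 dA]; apply: filterS (nbhs_bx z d0) => w wz; apply: dA => k.
by rewrite !baseE; exact: wz.
Qed.

Lemma height_cont (R : realType) n : continuous (@height R n).
Proof.
move=> z A /nbhs_ballP[d d0 dA]; apply: filterS (nbhs_bx z d0) => w wz; apply: dA.
by rewrite /ball /= distrC; exact: wz.
Qed.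

Lemma smooth_base (R : realType) n (S : set 'rV[R]_n.+1) k : good S ->
  smooth_on S (fun z => base z 0 k).
Proof.
by move=> gS; apply: (smooth_eq (f := fun z => z 0 (lift ord_max k))) => [z _|];
  [rewrite baseE|exact: smooth_coord].
Qed.

Lemma rel_open_sub (T1 T2 : topologicalType) (X A : set T1) (O : set T2) (f : T1 -> T2) :
  rel_open X A -> open O -> {within A, continuous f} -> rel_open X (A `&` f @^-1` O).
Proof.
move=> [U oU EA] oO /subspace_continuousP cf.
exists (U `&` interior [set x | A x -> O (f x)]); first by apply: openI => //; exact: open_interior.
apply/seteqP; split=> x.
  move=> [Ax Ox]; have [Xx Ux] : (X `&` U) x by rewrite -EA.
  by split=> //; split=> //; exact: (cf x Ax _ (open_nbhs_nbhs (conj oO Ox))).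
move=> [Xx [Ux /nbhs_singleton H]]; have Ax : A x by rewrite EA.
by split=> //; exact: H.
Qed.

Lemma ext_near (R : realType) n (y z : 'rV[R]_n) (s t d : R) : bx y d z -> `|t - s| < d ->
  bx (ext y s) d (ext z t).
Proof.
by move=> yz st a; case: (unliftP ord_max a) => [l ->|->]; rewrite ?ext_max ?ext_lift.
Qed.

Lemma ext0_cont (R : realType) n : continuous (fun y : 'rV[R]_n => ext y (0 : R)).
Proof.
move=> y A /nbhs_bxP[d d0 dA]; apply: filterS (nbhs_bx y d0) => z yz; apply: dA.
by apply: ext_near; rewrite ?subrr ?normr0.
Qed.

Section boundary_systems.
Context {R : realType} {T : topologicalType} {n : nat} (M : rmfd R T n.+1).
Hypothesis hM : riemannian_manifold M.

Definition hcyl (i : idx (bdry M)) : chart R (T * R) n.+1 := half_cylinder_chart (ch i).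

Lemma points_hcyl : points hcyl = [set p | boundary M p.1 /\ 0 <= p.2].
Proof.
apply/seteqP; split=> p.
  by move=> [i _ [[ip p0] t0]]; split=> //; exists i.
by move=> [[i ip] t0]; exists i.
Qed.

Lemma hcyl_rel_open b : rel_open (points hcyl) (cdom (hcyl b)).
Proof.
have [ob _ _ _ _] := rm_chart (b : idx M) hM.
exists [set p : T * R | cdom (@ch _ _ _ M b) p.1].
  exact: (open_comp (fun p _ => cvg_fst)).
rewrite points_hcyl; apply/seteqP; split=> p.
  by move=> [[ip p0] t0]; split=> //; split=> //; exists b.
by move=> [[bp t0] ip]; split=> //; split=> //; exact: boundary_height.
Qed.

Lemma bdry_rel_open (b : idx (bdry M)) : rel_open (points (@ch _ _ _ (bdry M))) (cdom (ch b)).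
Proof. by have [_ H _ _ _] := geo_charts_bdry hM; exact: H. Qed.

Lemma bdry_cinvK (b : idx (bdry M)) x : cdom (ch b) x -> cinv (ch b) (cmap (ch b) x) = x.
Proof. by have [_ _ _ H _] := geo_charts_bdry hM; have [K _] := H b; exact: K. Qed.

Lemma bdry_cinv_cont (b : idx (bdry M)) : {within coord_set b, continuous (cinv (ch b))}.
Proof.
have [_ _ _ _ cb] := rm_chart (b : idx M) hM.
apply: (within_cont_comp (f := fun y => ext y 0) (f' := cinv (@ch _ _ _ M b)) _ cb).
  by apply: continuous_subspaceT; exact: ext0_cont.
by move=> y /(coord_bdry b).
Qed.

Lemma bdry_img (b : idx (bdry M)) (V : set T) :
  cmap (ch b) @` (cdom (ch b) `&` (boundary M `&` V)) = coord_set b `&` cinv (ch b) @^-1` V.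
Proof.
rewrite setIA cmap_imgE; last exact: bdry_cinvK.
congr (_ `&` _); apply/seteqP; split=> y [x]; first by move=> [bx _] <-; exists x.
by move=> bx <-; exists x => //; split=> //; rewrite -points_bdry; exists b.
Qed.

Lemma rsys_bdry (V : set T) : open V -> rsys (@ch _ _ _ (bdry M)) (boundary M `&` V).
Proof.
move=> oV b; rewrite bdry_img; split; last by apply: within_sub (@bdry_cinv_cont b) => y [].
  by apply: good_preim => //; [exact: bdry_coord_good|exact: bdry_cinv_cont].
exact: bdry_cinvK.
Qed.

Lemma rsys_hcyl (V : set T) c : open V ->
  rsys hcyl [set p | (boundary M `&` V) p.1 /\ 0 <= p.2 < c].
Proof.
move=> oV b; set S := _ @` _.
have SE z : S z <-> (coord_set b `&` cinv (ch b) @^-1` V) (base z) /\ 0 <= height z < c.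
  rewrite -bdry_img; split.
    move=> [p [[bp t0] [Vp pc]] <-] /=; rewrite base_ext height_ext; split=> //.
    by exists p.1.
  move=> [[x [bx Vx] xz] zc]; exists (x, height z); last by rewrite -[RHS]ext_base -xz.
  by split; split=> //; case/andP: zc.
split.
- exists (pred1 ord_max); split.
    by move=> z /SE[_ /andP[z0 _]] k /eqP ->.
  move=> z /SE[[bz Vz] /andP[z0 zc]].
  have N1 := bdry_coord_near hM bz; have N2 := near_preim (@bdry_cinv_cont b) oV bz Vz.
  have [d d0 dH] := nbhs_bxP (filterI N1 N2).
  have e0 : 0 < c - height z by rewrite subr_gt0.
  exists (Num.min d (c - height z)); first by rewrite lt_min d0.
  move=> w [w0 wz]; apply/SE.
  have [|B1 B2] := dH (base w).
    by move=> k; rewrite !baseE; apply: lt_le_trans (wz _) _; rewrite ge_min lexx.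
  split; first by split=> //; exact: B2.
  apply/andP; split; first by apply: w0 => /=.
  have := wz ord_max; rewrite lt_min => /andP[_]; rewrite /height.
  by have := ler_norm (w 0 ord_max - z 0 ord_max); lra.
- move=> [x t] [bp t0].
  change ((cinv (ch b) (base (ext (cmap (ch b) x) t)), height (ext (cmap (ch b) x) t)) = (x, t)).
  by rewrite base_ext height_ext bdry_cinvK.
- apply: prod_cont; last by apply: continuous_subspaceT; exact: height_cont.
  apply: (within_cont_comp (f := @base R n) _ (@bdry_cinv_cont b)).
    by apply: continuous_subspaceT; exact: base_cont.
  by move=> z /SE[[]].
Qed.

End boundary_systems.

(** * The collar chart built from the boundary exponential map and the flow *)

Section collar.
Context {R : realType} {T : topologicalType} {n : nat} (M : rmfd R T n.+1).
Context (x0 : T) (i0 : idx (bdry M)) (E : 'M[R]_n) (r' a R2 rC : R).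
Context (kb : 'rV[R]_n -> T) (K : T * R -> T).
Hypotheses (hM : riemannian_manifold M) (fE : frame i0 x0 E).
Hypotheses (Hkb : exp_chart i0 x0 E r' kb) (ar : 0 < a < r') (R2C : 0 < R2 <= rC).
Hypothesis HK : forall x t, boundary M x -> 0 <= t < rC -> Kflow M x t (K (x, t)).
Hypothesis DK : diffeo_onto_image (@hcyl R T n M) (@ch _ _ _ M)
  [set p | boundary M p.1 /\ 0 <= p.2 < rC] K.

(** Bounded geometry provides the boundary exponential map and the collar diffeomorphism separately,
    with different domains. A normal collar chart is their composition on a smaller cylinder, and
    its diffeomorphism property has to be derived. *)
Definition kcol (z : 'rV[R]_n.+1) : T := K (kb (base z), height z).

Let B := [set p : T * R | boundary M p.1 /\ 0 <= p.2 < rC].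
Let D := @cylinder R n a R2.

Let a0 : 0 < a. Proof. by case/andP: ar. Qed.
Let sub_ball (v : 'rV[R]_n) : eball a v -> eball r' v.
Proof. by case/andP: ar => _ h H; exact: lt_trans h. Qed.

Lemma kb_boundary v : eball a v -> boundary M (kb v).
Proof.
move=> av; have [_ [H _ _ _]] := Hkb.
by rewrite -points_bdry; apply: H; exists v => //; exact: sub_ball.
Qed.

Lemma kb_img_open : rel_open (boundary M) (kb @` eball a).
Proof.
have [_ [_ _ op [g [Kg [cg _]]]]] := Hkb; rewrite points_bdry in op.
have := rel_open_sub op (eball_open a0) cg; congr (rel_open _ _).
apply/seteqP; split=> [_ [[v rv <-] /=]|_ [v av <-]]; first by rewrite Kg // => av; exists v.
by split; [exists v => //; exact: sub_ball|rewrite /= Kg //; exact: sub_ball].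
Qed.

Lemma kb_smooth : smooth_map (euclidean R n) (@ch _ _ _ (bdry M)) (eball a) kb.
Proof.
have [_ [_ sm _ _]] := Hkb.
have -> : eball a = eball r' `&` eball a :> set 'rV[R]_n.
  by apply/seteqP; split=> v; [move=> av; split=> //; exact: sub_ball|case].
apply: smooth_map_sub => //; last exact: eball_open.
by apply: rsys_euclidean; apply: eball_good; apply: lt_trans a0 _; case/andP: ar.
Qed.

Lemma kb0 : kb 0 = x0.
Proof.
have [H _] := Hkb; apply: (exp_to0 (i := i0) (geo_charts_bdry hM)).
have := H 0; rewrite mul0mx; apply; rewrite /eball /= /enorm bform1E big1 ?sqrtr0.
  by case/andP: ar; exact: lt_trans.
by move=> k _; rewrite mxE expr0n.
Qed.

Lemma cyl_B z : D z -> B (kb (base z), height z).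
Proof.
move=> [bz /andP[h0 hR]]; split; first exact: kb_boundary.
by rewrite /= h0 /=; case/andP: R2C => _; exact: lt_le_trans.
Qed.

Lemma kcol_flow z : D z -> Kflow M (kb (base z)) (height z) (kcol z).
Proof. by move=> /cyl_B[H1 H2]; exact: HK. Qed.

Let gcyl : good D. Proof. by apply: rel_half_good; exact: cylinder_half. Qed.

Lemma lift_smooth : smooth_map (euclidean R n.+1) (@hcyl R T n M) D
  (fun z => (kb (base z), height z)).
Proof.
have [ckb skb] := kb_smooth.
have cz : {within D, continuous (kb \o base)}.
  apply: (within_cont_comp (f := @base R n) _ ckb).
    by apply: continuous_subspaceT; exact: base_cont.
  by move=> z [].
split; first by apply: prod_cont cz _; apply: continuous_subspaceT; exact: height_cont.
move=> [] b k; have [U oU EU] := bdry_rel_open hM b; rewrite points_bdry in EU.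
have EkU v : eball a v -> (cdom (ch b) (kb v) <-> U (kb v)).
  by move=> av; rewrite EU; split=> [[]//|H]; split=> //; exact: kb_boundary.
set S := _ @` _; have ES : S = D `&` (kb \o base) @^-1` U.
  apply/seteqP; split=> z.
    by move=> [w [[_ Dw] [/= bw _]] <-]; split=> //; apply/EkU => //; case: Dw.
  move=> [Dz Uz]; exists z => //; split=> //; split; first by apply/EkU => //; case: Dz.
  by case: Dz => _ /andP[].
have gS : good S by rewrite ES; exact: good_preim.
case: (unliftP ord_max k) => [l ->|->]; last first.
  apply: (smooth_eq (f := fun z => z 0 ord_max)); last exact: smooth_coord.
  by move=> z _ /=; rewrite ext_max.
apply: (smooth_eq (f := fun z => cmap (ch b) (kb (base z)) 0 l)).
  by move=> z _ /=; rewrite ext_lift.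
apply: (@smooth_comp R n.+1 n S (eball a `&` kb @^-1` U) (@base R n)
  (fun y => cmap (ch b) (kb y) 0 l)) => //.
- by apply: good_preim => //; exact: eball_good.
- by move=> z; rewrite ES => -[[az _] Uz].
- by move=> j; exact: smooth_base.
- have := skb Datatypes.tt b l; rewrite /= setTI image_id; congr (smooth_on _ _).
  by apply/seteqP; split=> v [av H]; split=> //; apply/EkU.
Qed.

Lemma kcol_smooth : smooth_map (euclidean R n.+1) (@ch _ _ _ M) D kcol.
Proof.
have [iK sK _ _] := DK; have [_ cov _ _ _] := hM.
apply: (@smooth_map_comp _ _ _ _ _ _ _ _ _ _ (euclidean R n.+1) (@hcyl R T n M) (@ch _ _ _ M)
  D B (fun z => (kb (base z), height z)) K) => //.
- exact: rsys_euclidean.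
- by have := rsys_hcyl hM rC (@openT T); rewrite setIT.
- exact: hcyl_rel_open.
- by move=> l; have [ol _ _ _ _] := rm_chart l hM; exists (cdom (ch l)) => //; rewrite cov setTI.
- exact: cyl_B.
- by move=> p [p1 /andP[p2 _]]; rewrite points_hcyl.
- by move=> p Bp; apply: iK; exists p.
- exact: lift_smooth.
Qed.

Lemma kcol_inj z p t : D z -> boundary M p -> 0 <= t < rC -> Kflow M p t (kcol z) ->
  p = kb (base z) /\ t = height z.
Proof.
move=> Dz bp tC Hf; have [_ _ _ [g [Kg _]]] := DK.
have E1 : K (p, t) = kcol z by apply: Kflow_fun (HK bp tC) Hf.
have := Kg _ (cyl_B Dz); rewrite -/(kcol z) -E1 Kg //.
by case=> -> ->.
Qed.

(** The inverse applies the inverse of the collar diffeomorphism and then that of the boundary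
    exponential map to the foot, keeping the time. *)
Lemma kcol_diffeo : diffeo_onto_image (euclidean R n.+1) (@ch _ _ _ M) D kcol.
Proof.
have [iK sK oK [gK [KgK sgK]]] := DK; have [_ cov _ _ _] := hM.
have [_ [_ _ _ [gb [Kgb [cgb sgb]]]]] := Hkb.
have [V oV EV] := kb_img_open.
have oKB : open (K @` B) by case: oK => U oU ->; rewrite cov setTI.
(* Openness of the image is seen by writing it as a preimage under the continuous inverse [gK]; [V]
   is an open set of the ambient space that cuts out the boundary ball. *)
have EI : kcol @` D = K @` B `&` gK @^-1` [set p | V p.1 /\ p.2 < R2].
  apply/seteqP; split=> y.
    move=> [z Dz <-]; have Bz := cyl_B Dz.
    split; first by exists (kb (base z), height z).
    rewrite /= KgK //=; case: Dz => az /andP[_ hR]; split=> //.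
    by have [] : (boundary M `&` V) (kb (base z)) by rewrite -EV; exists (base z).
  move=> [[p Bp <-]]; rewrite /= KgK // => -[Vp pR]; have [bp /andP[p0 _]] := Bp.
  have [v av vp] : (kb @` eball a) p.1 by rewrite EV.
  exists (ext v p.2); first by split; rewrite ?base_ext ?height_ext //; apply/andP.
  by rewrite /kcol base_ext height_ext vp -surjective_pairing.
have oI : open (kcol @` D).
  rewrite EI; have [cgK _] := sgK; apply: open_within_preim => //.
  apply: openI; first exact: (open_comp (fun p _ => cvg_fst)).
  exact: (open_comp (fun p _ => cvg_snd)) (@open_lt R R2).
have gKz z : D z -> gK (kcol z) = (kb (base z), height z) by move=> /cyl_B; exact: KgK.
split.
- by move=> y _; rewrite cov.
- exact: kcol_smooth.
- by exists (kcol @` D) => //; rewrite cov setTI.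
pose pg (p : T * R) := ext (gb p.1) p.2.
exists (pg \o gK); split.
  move=> z Dz; rewrite /= gKz // /pg /= Kgb ?ext_base //.
  by apply: sub_ball; case: Dz.
pose W := [set p : T * R | (boundary M `&` V) p.1 /\ 0 <= p.2 < R2].
have VA x : (boundary M `&` V) x -> (kb @` eball r') x.
  by rewrite -EV => -[v av <-]; exists v => //; exact: sub_ball.
have cgV : {within boundary M `&` V, continuous gb} by apply: within_sub cgb.
have rW := rsys_hcyl hM R2 oV.
have sV : smooth_map (@ch _ _ _ (bdry M)) (euclidean R n) (boundary M `&` V) gb.
  have [_ [_ smg op _]] := Hkb; rewrite points_bdry in op; have [V' oV' EV'] := op.
  have -> : boundary M `&` V = boundary M `&` V' `&` V.
    rewrite -EV'; apply/seteqP; split=> x; last by rewrite EV' => -[[]].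
    by move=> Vx; split; [exact: VA|case: Vx].
  apply: smooth_map_sub => //; first exact: rsys_bdry.
  by rewrite -EV'.
have spg : smooth_map (@hcyl R T n M) (euclidean R n.+1) W pg.
  split.
    apply/wbxP => p [Vp pc] d d0.
    have /wbxP/(_ p.1 Vp d d0) H := cgV.
    have H1 : \forall q \near p, (boundary M `&` V) q.1 -> bx (gb p.1) d (gb q.1).
      exact: (@cvg_fst _ _ (nbhs p.1) (nbhs p.2) _ _ H).
    have H2 : \forall q \near p, `|q.2 - p.2| < d.
      have : \forall q \near p, ball p.2 d q.2.
        exact: (@cvg_snd _ _ (nbhs p.1) (nbhs p.2) _ _ (nbhsx_ballx p.2 d d0)).
      by apply: filterS => q; rewrite /ball /= distrC.
    by apply: filterS2 H1 H2 => q h1 h2 [Vq _]; apply: ext_near h2; exact: h1.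
  move=> b [] k; have [gS Kb _] := rW b.
  rewrite preimage_setT setIT; set S := _ @` _ in gS *.
  case: (unliftP ord_max k) => [l ->|->]; last first.
    apply: (smooth_eq (f := fun z => z 0 ord_max)); last exact: smooth_coord.
    by move=> z _ /=; rewrite ext_max.
  apply: (smooth_eq (f := fun z => gb (cinv (ch b) (base z)) 0 l)).
    by move=> z _ /=; rewrite ext_lift.
  have [gV _ _] := rsys_bdry hM oV b; have [_ sgV] := sV.
  have := sgV b Datatypes.tt l; rewrite preimage_setT setIT => sgl.
  apply: (@smooth_comp R n.+1 n S _ (@base R n) (fun y => gb (cinv (ch b) y) 0 l) gS gV _ _ sgl).
    by move=> _ [p [[bp _] [Vp _]] <-] /=; rewrite base_ext; exists p.1.
  by move=> j; exact: smooth_base.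
apply: (@smooth_map_comp _ _ _ _ _ _ _ _ _ _ (@ch _ _ _ M) (@hcyl R T n M) (euclidean R n.+1)
  (kcol @` D) W gK pg) => //.
- exact: rsys_rm.
- exact: hcyl_rel_open.
- by move=> l; exists setT; [exact: openT|rewrite setIT; apply/seteqP; split=> // x _; exists Datatypes.tt].
- move=> _ [z Dz <-]; rewrite gKz //; have [az hz] := Dz; split=> //.
  by change ((boundary M `&` V) (kb (base z))); rewrite -EV; exists (base z).
- by move=> p [[bp _] /andP[p0 _]]; rewrite points_hcyl.
- by move=> p _; exists Datatypes.tt.
- have -> : kcol @` D = K @` B `&` kcol @` D.
    by rewrite EI setIA setIid.
  by apply: smooth_map_sub => //; exact: rsys_rm.
Qed.

Lemma kcol_chart : collar_chart M a R2 kcol.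
Proof.
exists x0, i0, E; split=> //; last exact: kcol_diffeo.
move=> z Dz; exists (kb (base z)); split; last exact: kcol_flow.
by have [H _] := Hkb; apply: H; apply: sub_ball; case: Dz.
Qed.

End collar.

(** * Distances in normal charts *)

(** Distances are infima and need not be attained. A strict bound on [rdist] yields a connection of
    that length, and a connection bounds [rdist] weakly; in between only connections are used. *)
Definition linked {R : realType} {T : topologicalType} {n : nat} (M : rmfd R T n)
    (x y : T) (l : R) : Prop := exists2 l', joined M x y l' & (l' <= l%:E)%E.

Section linked.
Context {R : realType} {T : topologicalType} {n : nat} (M : rmfd R T n).

Lemma linked_refl x (l : R) : 0 <= l -> linked M x x l.
Proof. by move=> l0; exists 0%E; [exact: joined_refl|rewrite lee_fin]. Qed.

Lemma linked_trans x y z (l l' : R) : linked M x y l -> linked M y z l' -> linked M x z (l + l').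
Proof.
move=> [a Ja la] [b Jb lb]; exists (a + b)%E; first exact: joined_trans Ja Jb.
by rewrite EFinD leeD.
Qed.

Lemma linked_le x y (l l' : R) : l <= l' -> linked M x y l -> linked M x y l'.
Proof. by move=> ll [a Ja la]; exists a => //; apply: le_trans la _; rewrite lee_fin. Qed.

Lemma rdist_linked x y (s : R) : (rdist M x y < s%:E)%E -> linked M x y s.
Proof. by move=> /ereal_inf_lt[l Jl ls]; exists l => //; exact: ltW. Qed.

Lemma linked_rdist x y (l : R) : linked M x y l -> (rdist M x y <= l%:E)%E.
Proof. by move=> [a Ja la]; apply: le_trans la; exact: ereal_inf_lbound. Qed.

End linked.

(** * Curves in the boundary and their length in the manifold *)

Section boundary_curves.
Context {R : realType} {T : topologicalType} {n : nat} (M : rmfd R T n.+1).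
Hypothesis hM : riemannian_manifold M.

Lemma coord_curve_bdry (i : idx M) (c : R -> T) k :
  coord_curve (M := bdry M) i c k = coord_curve (M := M) i c (lift ord_max k).
Proof. by apply/funext => t; rewrite /coord_curve /= baseE. Qed.

Lemma velocity_bdry (i : idx M) (c : R -> T) t k :
  velocity (M := bdry M) i c t 0 k = velocity (M := M) i c t 0 (lift ord_max k).
Proof. by rewrite !mxE coord_curve_bdry. Qed.

Lemma height_vel (i : idx M) (c : R -> T) t : {within ui R, continuous c} ->
  (forall s, ui R s -> boundary M (c s)) -> ui R t -> cdom (ch i) (c t) ->
  has_dderiv (ui R) (1 : R^o) (coord_curve i c ord_max) t /\
  velocity (M := M) i c t 0 ord_max = 0.
Proof.
move=> cc bc ut it; rewrite mxE; apply: cder_der => //.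
have [oi _ _ _ _] := rm_chart i hM.
have z0 s : ui R s -> cdom (ch i) (c s) -> coord_curve i c ord_max s = 0.
  by move=> us iis; exact: (boundary_height hM (bc s us) iis).
apply: (der_near (incr_filter _ _ _) _ _ (der_cst 0 (incr_filter _ _ _))).
  have N := near_incr (near_curve cc ut oi it).
  apply: filterS2 N (incr_in (ui R) t (1 : R^o)) => h ih uh.
  by rewrite z0.
by rewrite scale0r addr0 z0.
Qed.

Lemma C1_of_bdry (c : R -> T) : C1_arc (bdry M) c -> C1_arc M c.
Proof.
move=> [cc H]; split=> // t ut; have [_ cov _ _ _] := hM.
have bc s : ui R s -> boundary M (c s).
  by move=> us; have [+ _] := H s us; rewrite points_bdry.
split=> [|i it k]; first by rewrite cov.
have it' : cdom (@ch _ _ _ (bdry M) i) (c t) by rewrite bdry_domE //; split=> //; exact: bc.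
case: (unliftP ord_max k) => [l ->|->].
  have [_ /(_ i it' l)] := H t ut; rewrite coord_curve_bdry velocity_bdry => -[h1 h2].
  split=> //; apply: cvg_trans h2; apply: near_eq_cvg.
  by apply: (@filterE _ _ (within_filter _ (nbhs_filter (t : R^o)))) => s; rewrite velocity_bdry.
have [h1 h2] := height_vel cc bc ut it; split=> //; rewrite h2.
have [oi _ _ _ _] := rm_chart i hM.
have h0 : (fun=> 0 : R) @ within (ui R) (nbhs (t : R^o)) --> (0 : R) by exact: cvg_cst.
apply: cvg_trans h0; apply: near_eq_cvg.
have N := near_curve cc ut oi it.
by apply: filterS N => s N us; have [] := height_vel cc bc us (N us).
Qed.

Lemma C1_to_bdry (c : R -> T) : (forall s, ui R s -> boundary M (c s)) ->
  C1_arc M c -> C1_arc (bdry M) c.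
Proof.
move=> bc [cc H]; split=> // t ut; split; first by rewrite points_bdry; exact: bc.
move=> i [it _] k; have [_ /(_ i it (lift ord_max k))[h1 h2]] := H t ut.
rewrite coord_curve_bdry velocity_bdry; split=> //.
apply: cvg_trans h2; apply: near_eq_cvg.
by apply: (@filterE _ _ (within_filter _ (nbhs_filter (t : R^o)))) => s; rewrite velocity_bdry.
Qed.

Lemma speed_bdry (c : R -> T) t : {within ui R, continuous c} ->
  (forall s, ui R s -> boundary M (c s)) -> ui R t -> speed (bdry M) c t = speed M c t.
Proof.
move=> cc bc ut; rewrite /speed; congr (xget 0 _).
have E (i : idx M) : cdom (@ch _ _ _ M i) (c t) -> bform (met_at (M := bdry M) i (c t))
    (velocity (M := bdry M) i c t) (velocity (M := bdry M) i c t) =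
    bform (met_at (M := M) i (c t)) (velocity (M := M) i c t) (velocity (M := M) i c t).
  move=> it; have [_ v0] := height_vel cc bc ut it.
  have Ev : ext (velocity (M := bdry M) i c t) 0 = velocity (M := M) i c t.
    apply/rowP => a; case: (unliftP ord_max a) => [l ->|->]; rewrite ?ext_max ?ext_lift //.
    exact: velocity_bdry.
  rewrite /met_at /= bform_bdry Ev; congr (bform (met i _) _ _).
  by rewrite -[RHS]ext_base (boundary_height hM (bc t ut) it).
apply/seteqP; split=> s [i [it ->]]; exists i.
  by have [it1 _] := it; split=> //; rewrite E.
by split; [rewrite bdry_domE //; split=> //; exact: bc|rewrite E].
Qed.

Lemma speed_int_bdry (c : R -> T) : {within ui R, continuous c} ->
  (forall s, ui R s -> boundary M (c s)) ->
  (\int[lebesgue_measure]_(t in `[0%R, 1%R]) (speed (bdry M) c t)%:E =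
   \int[lebesgue_measure]_(t in `[0%R, 1%R]) (speed M c t)%:E)%E.
Proof.
move=> cc bc; apply: eq_integral => t; rewrite inE /= in_itv /= => t01.
by rewrite speed_bdry.
Qed.

Lemma joined_bdry x y l : joined (bdry M) x y l -> joined M x y l.
Proof.
elim=> [|c l' _ IH Hc]; first exact: joined_refl.
have [cc H] := Hc; rewrite speed_int_bdry //; first by apply: joined_arc IH _; exact: C1_of_bdry.
by move=> s us; have [+ _] := H s us; rewrite points_bdry.
Qed.

Lemma linked_bdry x y (l : R) : linked (bdry M) x y l -> linked M x y l.
Proof. by move=> [a Ja la]; exists a => //; exact: joined_bdry. Qed.

Lemma seg_linked D k g (L B : R) (v w : 'rV[R]_n.+1) :
  dchart M D k g -> comparable_metric M L D k ->
  (forall t, 0 <= t <= 1 -> D (seg v w t)) -> (forall a, `|w 0 a - v 0 a| <= B) ->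
  linked M (k v) (k w) (L * B).
Proof. by move=> dc cm Ds vw; have [l Jl lB] := seg_joined hM dc cm Ds vw; exists l. Qed.

Lemma seg_linked_bdry D k g (L B : R) (v w : 'rV[R]_n.+1) :
  dchart M D k g -> comparable_metric M L D k ->
  (forall t, 0 <= t <= 1 -> D (seg v w t) /\ boundary M (k (seg v w t))) ->
  (forall a, `|w 0 a - v 0 a| <= B) ->
  linked (bdry M) (k v) (k w) (L * B).
Proof.
move=> dc cm Ds vw; have D1 t (h : 0 <= t <= 1) := proj1 (Ds t h).
have bc t (h : ui R t) := proj2 (Ds t h).
have [C1 _] := seg_C1 hM dc D1; have [cc _] := C1.
have J0 : joined (bdry M) (k v) ((fun t => k (seg v w t)) 0) 0%E by rewrite /= seg0; exact: joined_refl.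
have := joined_arc J0 (C1_to_bdry bc C1); rewrite add0e /= seg1 speed_int_bdry // => J.
by exists (\int[lebesgue_measure]_(t in `[0%R, 1%R]) (speed M (fun t => k (seg v w t)) t)%:E)%E => //;
  exact: seg_length dc cm D1 vw.
Qed.

End boundary_curves.

(* The properties of the collar chart [k] at the boundary point [x], expressed without
   reference to the boundary normal coordinates. *)
Record collar_at {R : realType} {T : topologicalType} {n : nat} (M : rmfd R T n.+1)
    (a R2 : R) (x : T) (k : 'rV[R]_n.+1 -> T) : Prop := {
  ca_chart : collar_chart M a R2 k;
  ca_center : k 0 = x;
  ca_bdry : forall v, eball a v -> boundary M (k (ext v 0));
  ca_flow : forall z, cylinder a R2 z -> Kflow M (k (ext (base z) 0)) (height z) (k z);
  ca_inj : forall z p t, cylinder a R2 z -> boundary M p -> 0 <= t < R2 ->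
    Kflow M p t (k z) -> p = k (ext (base z) 0) /\ t = height z }.

Lemma ext00 (R : realType) n : ext 0 0 = 0 :> 'rV[R]_n.+1.
Proof. by apply/rowP => a; case: (unliftP ord_max a) => [l ->|->]; rewrite ?ext_max ?ext_lift !mxE. Qed.

(** * Normal charts and their metrics under bounded geometry *)

Section bounded_geometry.
Context {R : realType} {T : topologicalType} {n : nat} (M : rmfd R T n.+1).
Context (R1 R2 R3 : R) (C' : nat -> R).
Hypotheses (hM : riemannian_manifold M) (bg : bounded_geometry M R1 R2 R3 C').

Lemma bg_pos : [/\ 0 < R1, 0 < R2, 0 < R3 & forall K, 0 < C' K].
Proof. by have [rC [ri [_ _ _ [[? _] /andP[? _] /andP[? _] ?] _]]] := bg. Qed.

Lemma Kflow_refl p : boundary M p -> Kflow M p 0 p.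
Proof.
have [rC [ri [[rC0 [K [HK _]]] _ _ _ _]]] := bg => bp.
have := HK p 0 bp; rewrite lexx rC0 => /(_ isT) H.
by rewrite -{2}(Kflow0 hM H).
Qed.

Lemma Nset_bdry s p : 0 <= s -> boundary M p -> Nset M s p.
Proof. by move=> s0 bp; exists p, 0; split; rewrite ?lexx //; exact: Kflow_refl. Qed.

Lemma collar_exists x : boundary M x -> exists k, collar_at M (R1 / 2) R2 x k.
Proof.
have [R10 R20 _ _] := bg_pos.
have [rC [ri [[rC0 [K [HK DK]]] _ _ [[_ Rinj] R2C _ _] _]]] := bg.
move=> bx; have [i [ix xi]] := bx.
have px : points (@ch _ _ _ (bdry M)) x by rewrite points_bdry.
(* [R1] may equal the injectivity radius, a supremum that is possibly not attained. Half of it lies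
   strictly below, so some larger radius [r'] admits an exponential chart. *)
have lt1 : ((R1 / 2)%:E < inj_radius_at (bdry M) x)%E.
  apply: (@lt_le_trans _ _ R1%:E); first by rewrite lte_fin; lra.
  by apply: le_trans Rinj _; apply: ereal_inf_lbound; exists x.
have [_ [r' [r'0 Hr'] <-]] := ereal_sup_gt lt1; rewrite lte_fin => ar.
have ix' : cdom (@ch _ _ _ (bdry M) i) x by rewrite bdry_domE.
have [E HE] := frame_exists (bdry_met_spd hM (i := i) (y := cmap (@ch _ _ _ (bdry M) i) x) (ex_intro2 _ _ x ix' erefl)).
have fE : frame (M := bdry M) i x E by split.
have [kb Hkb] := Hr' i E fE.
have ar' : 0 < R1 / 2 < r' by rewrite ar andbT; lra.
have kb1 (v : 'rV[R]_n) : eball (R1 / 2) v -> kcol kb K (ext v 0) = kb v.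
  move=> av; rewrite /kcol base_ext height_ext.
  apply: (Kflow0 hM); apply: HK; first exact: kb_boundary Hkb ar' _ av.
  by rewrite lexx rC0.
have e0 : eball (R1 / 2) (0 : 'rV[R]_n).
  by apply: (@eball_box _ _ 0); rewrite ?mulr0 //; [lra|move=> k; rewrite mxE normr0].
exists (kcol kb K); split.
- exact: kcol_chart fE Hkb ar' R2C HK DK.
- by rewrite -ext00 kb1 // (kb0 hM Hkb ar').
- by move=> v av; rewrite kb1 //; exact: kb_boundary Hkb ar' _ av.
- by move=> z Dz; have [bz _] := Dz; rewrite kb1 //; exact: kcol_flow Hkb ar' R2C HK _ Dz.
- move=> z p t Dz bp /andP[t0 tR]; have [bz _] := Dz; rewrite kb1 //.
  apply: (kcol_inj hM Hkb ar' R2C HK DK Dz bp); rewrite t0 /=.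
  by case/andP: R2C => _; exact: lt_le_trans.
Qed.

(** Exponential charts of radius [r] are available off [N(r)] only. Since [x] is known to avoid
    [N(R2 / 2)], the radius is at most [R2 / 2], and at most [R3] so that the metric bounds
    apply. *)
Lemma gaussian_exists x : ~ Nset M (R2 / 2) x ->
  exists k, gaussian_chart M (Num.min (R2 / 2) R3) k /\ k 0 = x.
Proof.
have [R10 R20 R30 _] := bg_pos => Nx.
have [rC [ri [_ _ [ri0 H] [_ _ /andP[_ R3i] _] _]]] := bg.
have r00 : 0 < Num.min (R2 / 2) R3 by rewrite lt_min R30 andbT; lra.
have nb : ~ boundary M x by move=> bx; apply: Nx; apply: Nset_bdry => //; lra.
have [i ix] := rm_cover x hM.
have [E HE] := frame_exists (met_at_spd hM ix).
have [k Hk] : exists k, exp_chart i x E (Num.min (R2 / 2) R3) k.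
  apply: H => //; first by rewrite r00 /= (le_trans _ R3i) // ge_min lexx orbT.
  move=> [p [t [bp /andP[t0 tr] K]]]; apply: Nx; exists p, t; split=> //; rewrite t0 /=.
  by apply: le_trans tr _; rewrite ge_min lexx.
exists k; split; first by exists x, i, E; split.
have [He _] := Hk; apply: (exp_to0 (i := i) (geo_charts_rm hM)).
have := He 0; rewrite mul0mx; apply.
by apply: (@eball_box _ _ 0); rewrite ?mulr0 // => k'; rewrite mxE normr0.
Qed.

Lemma normal_good D k : normal_chart M R1 R2 R3 D k -> good D.
Proof.
case=> [[r1 [r2 [/andP[r10 _] _ -> _]]]|[r3 [/andP[r30 _] -> _]]].
  by apply: rel_half_good; exact: cylinder_half.
exact: eball_good.
Qed.

Lemma normal_dchart D k : normal_chart M R1 R2 R3 D k -> exists g, dchart M D k g.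
Proof.
move=> nc; apply: (dchart_diffeo hM (normal_good nc)).
by case: nc => [[r1 [r2 [_ _ -> [? [? [? []]]]]]]|[r3 [_ -> [? [? [? [_ _ []]]]]]]].
Qed.

Lemma normal_bounded D k : normal_chart M R1 R2 R3 D k -> bounded_metric M C' D k.
Proof.
move=> nc K z a b Dz; have [g dc] := normal_dchart nc; have gD := normal_good nc.
have [rC [ri [_ _ _ _ H]]] := bg.
have sm := fun a b => metric_in_smooth a b hM dc.
split; apply: Dalpha_bnd => //.
- by move=> al al_le; have [] := H D k nc K al al_le z Dz a b.
- by apply: smooth_invmx => // y Dy; apply: spd_unit; exact: (metric_in_spd hM dc Dy).
- by move=> al al_le; have [] := H D k nc K al al_le z Dz a b.
Qed.

(** By [bform_lower] and [bform_upper] the squares of the two ratios of norms are at most [n.+1] and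
    [n.+1 ^ 2] times [C' 0]. This number is above both square roots. *)
Definition metric_cst : R := n.+1%:R * (1 + C' 0%N).

Lemma metric_cst_ge1 : 1 <= metric_cst.
Proof.
have [_ _ _ /(_ 0%N) C0] := bg_pos.
apply: le_trans (_ : 1 * (1 + C' 0%N) <= _); first by lra.
by apply: ler_wpM2r; [lra|rewrite ler1n].
Qed.

Lemma normal_comparable D k : normal_chart M R1 R2 R3 D k -> comparable_metric M metric_cst D k.
Proof.
move=> nc z v Dz; have [g dc] := normal_dchart nc.
have [_ _ _ /(_ 0%N) C0] := bg_pos.
have sG := metric_in_spd hM dc Dz.
have bG a b : `|metric_in M D k z a b| <= C' 0%N.
  by have [B _] := normal_bounded nc 0%N a b Dz; exact: (bnd_pderivs (s := [::]) B).
have bV a b : `|invmx (metric_in M D k z) a b| <= C' 0%N.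
  by have [_ B] := normal_bounded nc 0%N a b Dz; exact: (bnd_pderivs (s := [::]) B).
set G := metric_in M D k z in sG bG bV *.
have L0 : 0 <= metric_cst by apply: le_trans metric_cst_ge1.
have m0 : 0 <= n.+1%:R :> R by [].
have m1 : 1 <= n.+1%:R :> R by rewrite ler1n.
have Lsq : n.+1%:R * C' 0%N <= metric_cst ^+ 2.
  rewrite /metric_cst; set m := n.+1%:R in m0 m1 *; set c := C' 0%N in C0 *.
  have X1 : 1 <= m * (1 + c) by apply: mulr_ege1 => //; lra.
  apply: (@le_trans _ _ (m * (1 + c))); first by apply: ler_wpM2l => //; lra.
  by rewrite expr2 ler_peMr //; apply: le_trans X1.
split=> [a|B vB].
- have -> : metric_cst * Num.sqrt (bform G v v) = Num.sqrt (metric_cst ^+ 2 * bform G v v).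
    by rewrite sqrtrM ?sqr_ge0 // sqrtr_sqr ger0_norm.
  rewrite -sqrtr_sqr.
  apply: ler_wsqrtr; apply: (@le_trans _ _ (\sum_k v 0 k ^+ 2)).
    by rewrite (bigD1 a) //= lerDl; apply: sumr_ge0 => j _; exact: sqr_ge0.
  apply: le_trans (bform_lower v sG bV) _.
  by apply: ler_wpM2r Lsq; exact: spd_ge0.
- have B0 : 0 <= B by apply: le_trans (vB ord0).
  have LB0 : 0 <= metric_cst * B by exact: mulr_ge0.
  rewrite -(ger0_norm LB0) -sqrtr_sqr; apply: ler_wsqrtr.
  apply: le_trans (bform_upper v bG) _.
  have S1 : \sum_k `|v 0 k| <= n.+1%:R * B.
    by rewrite mulr_natl -[X in _ *+ X]card_ord -sumr_const; apply: ler_sum.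
  have S0 : 0 <= \sum_k `|v 0 k| by apply: sumr_ge0.
  apply: (@le_trans _ _ (C' 0%N * (n.+1%:R * B) ^+ 2)).
    apply: ler_wpM2l; first exact: ltW.
    by rewrite !expr2; apply: ler_pM.
  have -> : (metric_cst * B) ^+ 2 = (1 + C' 0%N) ^+ 2 * (n.+1%:R * B) ^+ 2.
    by rewrite /metric_cst; set m := n.+1%:R; set c := C' 0%N; ring.
  by apply: ler_wpM2r; [exact: sqr_ge0|nra].
Qed.

End bounded_geometry.

(** * Separated nets and the covering *)

(** A maximal subset by Zorn's lemma. As [rel] need be neither symmetric nor reflexive, maximality
    yields a relation in one of the two directions or equality. *)
Lemma max_separated (T : Type) (X : set T) (rel : T -> T -> Prop) : exists B : set T,
  [/\ B `<=` X, (forall p q, B p -> B q -> rel p q -> p = q)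
    & forall x, X x -> exists2 q, B q & q = x \/ (rel x q \/ rel q x)].
Proof.
pose P (B : set T) := B `<=` X /\ forall p q, B p -> B q -> rel p q -> p = q.
have [|A [[AX sA] mA]] := @Zorn_bigcup T P.
  move=> F FP tF; split; first by move=> x [B FB Bx]; have [H _] := FP B FB; exact: H.
  move=> p q [B FB Bp] [B' FB' B'q].
  have [BB'|B'B] := tF B B' FB FB'.
    by have [_ H] := FP B' FB'; apply: H => //; exact: BB'.
  by have [_ H] := FP B FB; apply: H => //; exact: B'B.
exists A; split=> // x Xx; apply: contrapT => nx.
have nA : ~ A x by move=> Ax; apply: nx; exists x => //; left.
apply: (mA (A `|` [set x])).
  split; first by move=> y Ay; left.
  by move=> /(_ x) H; apply: nA; apply: H; right.
split; first by move=> y [/AX//|->].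
move=> p q [Ap|->] [Aq|->] // r; first exact: sA.
  by exfalso; apply: nx; exists p => //; right; right.
by exfalso; apply: nx; exists q => //; right; left.
Qed.

(** Each point is isolated by a member of a countable base, and different points get different
    members. So the centres can be numbered by integers. *)
Lemma countable_discrete (T : topologicalType) (B : set T) : @second_countable T ->
  (forall p, B p -> exists2 U, nbhs p U & forall q, B q -> U q -> q = p) -> countable B.
Proof.
move=> [BB cB [oB bB]] H; have [f injf] := countable_injP _ cB.
have ex p : exists b, B p -> [/\ BB b, b p & forall q, B q -> b q -> q = p].
  have [Bp|nBp] := pselect (B p); last by exists set0.
  have [U pU HU] := H p Bp; have [b [Bb bp] bU] := bB p U pU.
  by exists b => _; split=> // q Bq bq; apply: HU => //; exact: bU.
have [b Hb] := choice ex.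
apply/countable_injP; exists (f \o b) => p q; rewrite !inE => Bp Bq.
have [BBp bp Hp] := Hb p Bp; have [BBq bq Hq] := Hb q Bq.
move=> /= /injf; rewrite !inE => /(_ BBp BBq) E.
by apply: Hq => //; rewrite -E.
Qed.

(** At most [m] points of a box of half-width [d] are pairwise more than [eta] apart in the maximum
    norm. The injection into numbers below [m] lets two such counts be put side by side, and [m] is
    independent of the family. *)
Definition packs {R : realType} (N : nat) (d eta : R) (m : nat) : Prop :=
  forall (I : Type) (A : set I) (v : 'rV[R]_N) (w : I -> 'rV[R]_N),
  (forall i, A i -> forall a, `|w i 0 a - v 0 a| <= d) ->
  (forall i j, A i -> A j -> (forall a, `|w i 0 a - w j 0 a| <= eta) -> i = j) ->
  exists f : I -> nat, {in A &, injective f} /\ forall i, A i -> (f i < m)%N.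

Lemma packing (R : realType) (N : nat) (d eta : R) : 0 < eta -> exists m, packs N d eta m.
Proof.
(* Cells of width [eta]: each coordinate, shifted to lie between 0 and [2 * d], falls into one of
   [K.+1] intervals, and points of the same cell are at most [eta] apart. *)
move=> eta0; pose K := Num.truncn (2 * d / eta).
exists #|{ffun 'I_N -> 'I_K.+1}| => I A v w wd sep.
pose cell i a := Num.truncn ((w i 0 a - v 0 a + d) / eta).
exists (fun i => enum_rank [ffun a => inord (cell i a) : 'I_K.+1] : nat); split; last first.
  by move=> i _; exact: ltn_ord.
have cellP i a : A i -> (cell i a)%:R * eta <= w i 0 a - v 0 a + d < (cell i a).+1%:R * eta /\
    (cell i a < K.+1)%N.
  move=> Ai; have := wd i Ai a; rewrite ler_norml => /andP[l1 l2].
  have x0 : 0 <= (w i 0 a - v 0 a + d) / eta by apply: divr_ge0; [lra|exact: ltW].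
  split; first by have := truncn_itv x0; rewrite -/(cell i a) ler_pdivlMr // ltr_pdivrMr.
  rewrite ltnS; apply: le_truncn; rewrite ler_pM2r ?invr_gt0 //; lra.
move=> i j; rewrite !inE => Ai Aj /ord_inj/enum_rank_inj/ffunP E.
apply: sep => // a; have [/andP[a1 a2] ca] := cellP i a Ai; have [/andP[b1 b2] cb] := cellP j a Aj.
have Ec : cell i a = cell j a.
  have := E a; rewrite !ffunE => /(congr1 (@nat_of_ord _)); by rewrite !inordK.
rewrite -Ec in b1 b2; rewrite -[(cell i a).+1]addn1 natrD mulrDl mul1r in a2 b2.
by rewrite ler_norml; apply/andP; split; lra.
Qed.

Lemma card_le_inj (I : Type) (A : set I) (f : I -> nat) m :
  {in A &, injective f} -> (forall i, A i -> (f i < m)%N) -> (A #<= `I_m)%card.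
Proof.
move=> injf fm; have := inj_card_eq injf; rewrite card_eq_le => /andP[_ H]; apply: card_le_trans H _.
by apply: subset_card_le => _ [i Ai <-]; exact: fm.
Qed.

(** * Charts with room around a point *)

Section base_charts.
Context {R : realType} {T : topologicalType} {n : nat} (M : rmfd R T n.+1).

(** The common form of a Gaussian chart centred at [y] and of a collar chart that contains [y] above
    its centre. Hence the coordinates [v] of [y] need not be 0. *)
Record base_chart (L e : R) (y : T) (P : pred 'I_n.+1) (D : set 'rV[R]_n.+1)
    (k : 'rV[R]_n.+1 -> T) (g : T -> 'rV[R]_n.+1) (v : 'rV[R]_n.+1) : Prop := {
  bc_dchart : dchart M D k g;
  bc_comp : comparable_metric M L D k;
  bc_orth : D `<=` orth P;
  bc_center : k v = y;
  bc_in : D v;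
  bc_box : clbox P v e `<=` D }.

Context (L e : R) (y : T) (P : pred 'I_n.+1) (D : set 'rV[R]_n.+1)
  (k : 'rV[R]_n.+1 -> T) (g : T -> 'rV[R]_n.+1) (v : 'rV[R]_n.+1).
Hypotheses (hM : riemannian_manifold M) (L0 : 0 <= L) (bc : base_chart L e y P D k g v).

Lemma clbox_le (d d' : R) (w : 'rV[R]_n.+1) : d <= d' -> clbox P w d `<=` clbox P w d'.
Proof. by move=> dd u [Pu H]; split=> // a; exact: le_trans (H a) dd. Qed.

Lemma clbox_seg (d : R) (w u u' : 'rV[R]_n.+1) (t : R) : clbox P w d u -> clbox P w d u' ->
  0 <= t <= 1 -> clbox P w d (seg u u' t).
Proof.
move=> [Pu Hu] [Pu' Hu'] /andP[t0 t1]; split=> a.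
  move=> Pa; rewrite segE; have := Pu a Pa; have := Pu' a Pa; nra.
rewrite segE ler_norml; have := Hu a; have := Hu' a; rewrite !ler_norml.
by move=> /andP[a1 a2] /andP[b1 b2]; apply/andP; split; nra.
Qed.

Lemma bc_escape z l : linked M y z l -> L * l <= e ->
  exists w, [/\ clbox P v (L * l) w, D w & z = k w].
Proof.
move=> [l0 J l0l] Le; have [dc cm DP kv Dv De] := bc.
have [w [Dw zw wv]] := escape hM dc cm L0 DP J (esym kv) l0l
  (subset_trans (@clbox_le _ _ v Le) De) Dv.
by exists w; split=> //; split=> //; exact: DP.
Qed.

Lemma bc_seg (u u' : 'rV[R]_n.+1) B : clbox P v e u -> clbox P v e u' ->
  (forall a, `|u' 0 a - u 0 a| <= B) -> linked M (k u) (k u') (L * B).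
Proof.
move=> vu vu' uB; have [dc cm DP kv Dv De] := bc.
by apply: (seg_linked hM dc cm _ uB) => t t01; apply: De; exact: clbox_seg.
Qed.

Lemma bc_center_box (d : R) : 0 <= d -> clbox P v d v.
Proof.
move=> d0; split; first exact: (bc_orth bc) (bc_in bc).
by move=> a; rewrite subrr normr0.
Qed.

Lemma bc_linked_sym z l : 0 <= l -> linked M y z l -> L * l <= e -> linked M z y (L * (L * l)).
Proof.
move=> l0 yz Le; have [w [wv Dw ->]] := bc_escape yz Le.
rewrite -(bc_center bc); apply: bc_seg; first exact: clbox_le wv.
  by apply: bc_center_box; apply: le_trans Le; exact: mulr_ge0.
by move=> a; rewrite distrC; case: wv => _; exact.
Qed.

Lemma bc_near (d : R) : 0 < d -> \forall z \near y,
  exists w, [/\ D w, z = k w & forall a, `|w 0 a - v 0 a| < d].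
Proof.
move=> d0; have [dc cm DP kv Dv De] := bc; have [_ _ oD Kg _] := dc.
have Dy : (k @` D) y by exists v.
have N : forall a, \forall z \near y, `|g z 0 a - v 0 a| < d.
  move=> a; have := dchart_gcont (a := a) hM dc Dy.
  rewrite -kv Kg // => /cvgrPdist_lt/(_ d d0); apply: filterS => z; by rewrite distrC.
have N1 : \forall z \near y, forall a, `|g z 0 a - v 0 a| < d by exact: filter_forall N.
apply: filterS2 N1 (open_nbhs_nbhs (conj oD Dy)) => z H Dz.
by have [Dg kg] := dchart_ginv dc Dz; exists (g z).
Qed.

Lemma bc_near_linked (d : R) : 0 < d -> d <= e -> \forall z \near y, linked M y z (L * d).
Proof.
move=> d0 de; apply: filterS (bc_near d0) => z [w [Dw -> wv]].
rewrite -(bc_center bc); apply: bc_seg.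
- by apply: bc_center_box; apply: le_trans de; exact: ltW.
- split; first exact: (bc_orth bc).
  by move=> a; apply: le_trans (ltW (wv a)) de.
- by move=> a; exact: ltW.
Qed.

End base_charts.

Definition rgauss {R : realType} (R2 R3 : R) : R := Num.min (R2 / 2) R3.

(* Boxes of this size around the relevant points fit into all the charts used below. *)
Definition box_size {R : realType} (n : nat) (R1 R2 R3 : R) : R :=
  Num.min (R1 / 2) (Num.min (R2 / 3) (rgauss R2 R3)) / n.+3%:R.

Lemma linked_ge0 (R : realType) (T : topologicalType) n (M : rmfd R T n) x y (l : R) :
  linked M x y l -> 0 <= l.
Proof. by move=> [a /joined_ge0 a0 al]; rewrite -lee_fin; exact: le_trans al. Qed.

Lemma seg_ext (R : realType) n (u u' : 'rV[R]_n) t : seg (ext u 0) (ext u' 0) t = ext (seg u u' t) 0.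
Proof.
apply/rowP => a; rewrite segE; case: (unliftP ord_max a) => [l ->|->].
  by rewrite !ext_lift segE.
by rewrite !ext_max subrr mulr0 addr0.
Qed.

Section normal_base_charts.
Context {R : realType} {T : topologicalType} {n : nat} (M : rmfd R T n.+1).
Context (R1 R2 R3 : R) (C' : nat -> R).
Hypotheses (hM : riemannian_manifold M) (bg : bounded_geometry M R1 R2 R3 C').
Let L : R := @metric_cst R n C'.
Let d : R := box_size n R1 R2 R3.
Let P1 : pred 'I_n.+1 := pred1 ord_max.

Lemma metric_cst_ge0 : 0 <= L. Proof. by apply: le_trans (metric_cst_ge1 bg). Qed.

Lemma box_sizeP : [/\ 0 < d, n.+2%:R * d < R1 / 2, d < R2 / 3 & n.+2%:R * d < rgauss R2 R3].
Proof.
have [R10 R20 R30 _] := bg_pos bg.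
set m := Num.min (R1 / 2) (Num.min (R2 / 3) (rgauss R2 R3)).
have m0 : 0 < m by rewrite !lt_min R30 !divr_gt0.
have n30 : 0 < n.+3%:R :> R by [].
have d0 : 0 < d by rewrite divr_gt0.
have md : n.+3%:R * d = m by rewrite /d /box_size -/m mulrC divfK // gt_eqF.
have d2 : n.+2%:R * d < m.
  by rewrite -md ltr_pM2r // ltr_nat.
have dm : d <= n.+2%:R * d by apply: ler_peMl; [exact: ltW|rewrite ler1n].
split=> //.
- by apply: lt_le_trans d2 _; rewrite ge_min lexx.
- by apply: le_lt_trans dm _; apply: lt_le_trans d2 _; rewrite !ge_min lexx orbT.
- apply: lt_le_trans d2 _; apply: (@le_trans _ _ (Num.min (R2 / 3) (rgauss R2 R3))).
    by rewrite ge_min lexx orbT.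
  by rewrite ge_min lexx orbT.
Qed.

Lemma box_eball (u : 'rV[R]_n) : (forall a, `|u 0 a| <= d) -> eball (R1 / 2) u.
Proof.
have [d0 d1 _ _] := box_sizeP => H; apply: (eball_box _ _ H); first exact: ltW.
by apply: le_lt_trans d1; apply: ler_wpM2r; [exact: ltW|rewrite ler_nat].
Qed.

Lemma collar_normal x k : collar_at M (R1 / 2) R2 x k ->
  normal_chart M R1 R2 R3 (cylinder (R1 / 2) R2) k.
Proof.
have [R10 R20 R30 _] := bg_pos bg => ca; left; exists (R1 / 2), R2.
by split=> //; [apply/andP; split; lra|rewrite R20 lexx|exact: ca_chart ca].
Qed.

Lemma gaussian_normal k : gaussian_chart M (rgauss R2 R3) k ->
  normal_chart M R1 R2 R3 (eball (rgauss R2 R3)) k.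
Proof.
have [R10 R20 R30 _] := bg_pos bg => gc; right; exists (rgauss R2 R3); split=> //.
by rewrite /rgauss lt_min R30 ge_min lexx orbT !andbT divr_gt0.
Qed.

(** The sets [Z] extend up to height [2 * R2 / 3]; above it a margin of [R2 / 3 > d] remains for the
    box. *)
Lemma collar_base x k t g : collar_at M (R1 / 2) R2 x k -> dchart M (cylinder (R1 / 2) R2) k g ->
  0 <= t <= 2 * R2 / 3 ->
  base_chart M L d (k (ext 0 t)) P1 (cylinder (R1 / 2) R2) k g (ext 0 t).
Proof.
have [R10 R20 R30 _] := bg_pos bg; have [d0 d1 d2 d3] := box_sizeP.
move=> ca dc /andP[t0 t1].
have hc : forall z, @cylinder R n (R1 / 2) R2 z -> orth P1 z.
  by move=> z [_ /andP[z0 _]] a /eqP ->.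
have box : clbox P1 (ext 0 t) d `<=` cylinder (R1 / 2) R2.
  move=> w [wP wd]; split.
    by apply: box_eball => a; have := wd (lift ord_max a); rewrite ext_lift mxE subr0 baseE.
  apply/andP; split; first exact: (wP ord_max (eqxx _)).
  by have := wd ord_max; rewrite ext_max /height => /ler_normlP[_]; lra.
split=> //; first exact: normal_comparable (collar_normal ca).
apply: box; split=> a; last by rewrite subrr normr0 ltW.
by move=> /eqP ->; rewrite ext_max.
Qed.

Lemma gaussian_base y k g : gaussian_chart M (rgauss R2 R3) k -> k 0 = y ->
  dchart M (eball (rgauss R2 R3)) k g ->
  base_chart M L d y xpred0 (eball (rgauss R2 R3)) k g 0.
Proof.
have [d0 d1 d2 d3] := box_sizeP => gc k0 dc.
have box : clbox xpred0 (0 : 'rV[R]_n.+1) d `<=` eball (rgauss R2 R3).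
  move=> w [_ wd]; apply: (@eball_box _ _ d); rewrite ?ltW // => a.
  by have := wd a; rewrite mxE subr0.
split=> //; first exact: normal_comparable (gaussian_normal gc).
by apply: box; split=> // a; rewrite subrr normr0 ltW.
Qed.

Lemma Nset_collar y : Nset M (R2 / 2) y -> exists p k t,
  [/\ collar_at M (R1 / 2) R2 p k, 0 <= t <= R2 / 2, Kflow M p t y & y = k (ext 0 t)].
Proof.
have [R10 R20 R30 _] := bg_pos bg.
move=> [p [t [bp tR Kf]]]; have [k ca] := collar_exists hM bg bp.
exists p, k, t; split=> //; apply: (Kflow_fun hM Kf).
have [t0 t1] := andP tR.
have := ca_flow ca (z := ext 0 t); rewrite base_ext height_ext ext00 (ca_center ca); apply.
split; rewrite ?base_ext ?height_ext; last by apply/andP; split=> //; lra.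
by apply: (@eball_box _ _ 0); rewrite ?mulr0 //; [lra|move=> a; rewrite mxE normr0].
Qed.

(** Points of [N(R2 / 2)] are seen in the collar chart centred at a foot of theirs; at all other
    points there is a Gaussian chart. *)
Lemma base_exists y : exists P D k g v, base_chart M L d y P D k g v.
Proof.
have [R10 R20 R30 _] := bg_pos bg.
have [/Nset_collar[p [k [t [ca /andP[t0 t1] _ ->]]]]|Ny] := pselect (Nset M (R2 / 2) y).
  have [g dc] := normal_dchart hM (collar_normal ca).
  exists P1, (cylinder (R1 / 2) R2), k, g, (ext 0 t).
  have t01 : 0 <= t <= 2 * R2 / 3 by rewrite t0 /=; lra.
  exact: collar_base ca dc t01.
have [k [gc k0]] := gaussian_exists hM bg Ny.
have [g dc] := normal_dchart hM (gaussian_normal gc).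
by exists xpred0, (eball (rgauss R2 R3)), k, g, 0; exact: gaussian_base.
Qed.

(* A short connection can be turned around inside a chart: straight segments replace
   the reversal of curves, at the cost of the factor [L ^ 2]. *)
Lemma linked_sym y z l : linked M y z l -> L * l <= d -> linked M z y (L * (L * l)).
Proof.
move=> yz Ll; have [P [D [k [g [v bc]]]]] := base_exists y.
exact: bc_linked_sym hM metric_cst_ge0 bc _ _ (linked_ge0 yz) yz Ll.
Qed.

Lemma collar_height x k z : collar_at M (R1 / 2) R2 x k -> cylinder (R1 / 2) R2 z ->
  boundary M (k z) -> z = ext (base z) 0.
Proof.
have [_ R20 _ _] := bg_pos bg => ca Dz bz; rewrite -{1}[z]ext_base.
have := ca_inj ca Dz bz (t := 0); rewrite lexx R20 => /(_ isT (Kflow_refl hM bg bz))[_ <-].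
by [].
Qed.

Lemma collar_escape x k q l : collar_at M (R1 / 2) R2 x k -> boundary M q -> linked M x q l ->
  L * l <= d -> exists2 u : 'rV[R]_n, q = k (ext u 0) & forall a, `|u 0 a| <= L * l.
Proof.
have [_ R20 _ _] := bg_pos bg => ca bq xq Ll.
have [g dc] := normal_dchart hM (collar_normal ca).
have t01 : 0 <= (0 : R) <= 2 * R2 / 3 by apply/andP; split=> //; lra.
have bc := collar_base ca dc t01; rewrite ext00 (ca_center ca) in bc.
have [w [[_ wl] Dw qw]] := bc_escape hM metric_cst_ge0 bc xq Ll.
rewrite qw in bq; have wE := collar_height ca Dw bq.
exists (base w); first by rewrite -wE.
by move=> a; have := wl (lift ord_max a); rewrite mxE subr0 baseE.
Qed.

Lemma collar_seg x k (u u' : 'rV[R]_n) B : collar_at M (R1 / 2) R2 x k ->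
  (forall a, `|u 0 a| <= d) -> (forall a, `|u' 0 a| <= d) ->
  (forall a, `|u' 0 a - u 0 a| <= B) -> 0 <= B ->
  linked (bdry M) (k (ext u 0)) (k (ext u' 0)) (L * B).
Proof.
have [_ R20 _ _] := bg_pos bg => ca ud u'd uB B0.
have [g dc] := normal_dchart hM (collar_normal ca).
have cm := normal_comparable hM bg (collar_normal ca).
apply: (seg_linked_bdry hM dc cm); last first.
  by move=> a; case: (unliftP ord_max a) => [l ->|->]; rewrite ?ext_lift ?ext_max ?subrr ?normr0.
move=> t /andP[t0 t1]; rewrite seg_ext.
have sb : eball (R1 / 2) (seg u u' t).
  apply: box_eball => a; rewrite segE; have := ud a; have := u'd a; rewrite !ler_norml.
  by move=> /andP[a1 a2] /andP[b1 b2]; apply/andP; split; nra.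
split; last exact: ca_bdry ca _ sb.
by split; rewrite ?base_ext // height_ext lexx.
Qed.

(** A short curve between boundary points may leave the boundary. It is replaced by a segment in the
    bottom face of a collar chart, so at small scale the distances of [M] and of its boundary are
    comparable. *)
Lemma linked_to_bdry p q l : boundary M p -> boundary M q -> linked M p q l -> L * l <= d ->
  linked (bdry M) p q (L * (L * l)) /\ linked (bdry M) q p (L * (L * l)).
Proof.
move=> bp bq pq Ll; have [k ca] := collar_exists hM bg bp.
have [d0 _ _ _] := box_sizeP; have Ll0 : 0 <= L * l := mulr_ge0 metric_cst_ge0 (linked_ge0 pq).
have [u -> ul] := collar_escape ca bq pq Ll.
have kp : p = k (ext 0 0) by rewrite ext00 (ca_center ca).
have z0 a : `|(0 : 'rV[R]_n) 0 a| <= d by rewrite mxE normr0 ltW.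
have ud a : `|u 0 a| <= d by exact: le_trans (ul a) Ll.
rewrite kp; split; apply: (collar_seg ca) => // a.
  by rewrite [X in _ - X]mxE subr0.
by rewrite [X in X - _]mxE sub0r normrN.
Qed.

End normal_base_charts.

(** The sign of the index tells boundary centres from interior ones. Boundary centres are separated
    with respect to the boundary, but both covering conditions use curves of [M], issuing from the
    centre; this orientation is why [e'] is larger than [e]. *)
Record net {R : realType} {T : topologicalType} {n : nat} (M : rmfd R T n.+1) (R2 : R)
    (e e' : R) (I : set int) (x : I -> T) : Prop := {
  net_center : forall i : I, if 0 <= \val i then boundary M (x i) else ~ Nset M (R2 / 2) (x i);
  net_sepb : forall i j : I, 0 <= \val i -> 0 <= \val j -> linked (bdry M) (x i) (x j) e -> i = j;
  net_sepi : forall i j : I, ~~ (0 <= \val i) -> ~~ (0 <= \val j) -> linked M (x i) (x j) e -> i = j;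
  net_covb : forall p, boundary M p -> exists2 i : I, 0 <= \val i & linked M (x i) p e';
  net_covi : forall y, ~ Nset M (R2 / 2) y -> exists2 i : I, ~~ (0 <= \val i) & linked M (x i) y e' }.

(** * Existence of separated nets indexed by integers *)

Section nets.
Context {R : realType} {T : topologicalType} {n : nat} (M : rmfd R T n.+1).
Context (R1 R2 R3 : R) (C' : nat -> R).
Hypotheses (hM : riemannian_manifold M) (bg : bounded_geometry M R1 R2 R3 C').
Local Notation L := (@metric_cst R n C').
Local Notation d := (box_size n R1 R2 R3).
Let L1 : 1 <= L := metric_cst_ge1 bg.
Let L0 : 0 <= L := metric_cst_ge0 bg.
Let Lpos : 0 < L := lt_le_trans ltr01 L1.

Lemma le_LL (x : R) : 0 <= x -> x <= L * (L * x).
Proof. by move=> x0; have : x <= L * x; [rewrite ler_peMl|move=> h; apply: le_trans h _; rewrite ler_wpM2l // ler_peMl]. Qed.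

(** Points near [y] in the topology are joined to [y] by short curves. This isolates the points of a
    net and later makes metric balls neighbourhoods. *)
Lemma near_linked (e : R) y : 0 < e -> \forall z \near y, linked M y z e.
Proof.
move=> e0; have [P [D [k [g [v bc]]]]] := base_exists hM bg y.
have [d0 _ _ _] := box_sizeP bg.
have eL : 0 < e / L by exact: divr_gt0.
have m0 : 0 < Num.min d (e / L) by rewrite lt_min d0.
have := bc_near_linked hM bc m0; rewrite ge_min lexx => /(_ isT).
apply: filterS => z; apply: linked_le.
by rewrite mulrC -ler_pdivlMr // ge_min lexx orbT.
Qed.

Lemma near_linked_bdry (e : R) p : 0 < e -> boundary M p ->
  \forall q \near p, boundary M q -> linked (bdry M) p q e.
Proof.
move=> e0 bp; have [d0 _ _ _] := box_sizeP bg.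
have m0 : 0 < Num.min (d / L) (e / L / L) by rewrite lt_min; apply/andP; split; apply: divr_gt0 => //; exact: divr_gt0.
apply: filterS (near_linked p m0) => q pq bq.
have [|+ _] := linked_to_bdry hM bg bp bq pq.
  by rewrite mulrC -ler_pdivlMr // ge_min lexx.
apply: linked_le.
by rewrite mulrA mulrC mulrA -!ler_pdivlMr // ge_min lexx orbT.
Qed.

Lemma net_exists e : 0 < e -> L * e <= d ->
  exists (I : set int) (x : I -> T), net M R2 e (L * (L * e)) x.
Proof.
move=> e0 Le; have [[_ sc] _ _ _ _] := hM.
have [B [Bb sB mB]] := max_separated (boundary M) (fun p q => linked (bdry M) p q e).
have [B' [Bi sB' mB']] := max_separated (~` Nset M (R2 / 2)) (fun p q => linked M p q e).
have /countable_injP[f injf] : countable B.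
  apply: countable_discrete sc _ => p Bp.
  exists [set q | boundary M q -> linked (bdry M) p q e].
    by apply: near_linked_bdry => //; exact: Bb.
  by move=> q Bq /(_ (Bb _ Bq)) pq; apply/esym; exact: sB.
have /countable_injP[f' injf'] : countable B'.
  apply: countable_discrete sc _ => p Bp.
  exists [set q | linked M p q e]; first exact: near_linked.
  by move=> q Bq pq; apply/esym; exact: sB'.
(* The codes of the boundary net are used as nonnegative integers and those of the interior net as
   negative ones. *)
pose pt (z : int) p := match z with Posz m => B p /\ f p = m | Negz m => B' p /\ f' p = m end.
pose I := [set z : int | exists p, pt z p].
have ex (i : I) : exists p, pt (\val i) p by case: i => z /= /set_mem.
have [x xP] := choice ex.
have memI z p : pt z p -> z \in I by move=> H; rewrite inE; exists p.
have pt_inj z p q : pt z p -> pt z q -> p = q.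
  case: z => m [Bp <-] [Bq E]; [apply: injf|apply: injf']; by rewrite ?inE.
have mkI z p : pt z p -> exists2 i : I, \val i = z & x i = p.
  move=> H; exists (exist _ z (memI z p H)) => //.
  by apply: (pt_inj z) => //; exact: (xP (exist _ z (memI z p H))).
exists I, x; split.
- move=> i; have := xP i; case: (\val i) => m [Bp _] /=; [exact: Bb|exact: Bi].
- move=> i j; have := xP i; have := xP j.
  case Ei : (\val i) => [m|m]; case Ej : (\val j) => [m'|m'] // [Bj fj] [Bx fi] _ _ xx.
  by apply: val_inj; rewrite /= Ei Ej -fi -fj (sB _ _ Bx Bj xx).
- move=> i j; have := xP i; have := xP j.
  case Ei : (\val i) => [m|m]; case Ej : (\val j) => [m'|m'] // [Bj fj] [Bx fi] _ _ xx.
  by apply: val_inj; rewrite /= Ei Ej -fi -fj (sB' _ _ Bx Bj xx).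
- move=> p bp; have [q Bq H] := mB p bp.
  have [i Ei Ex] := mkI (Posz (f q)) q (conj Bq erefl).
  exists i; rewrite ?Ei // Ex.
  case: H => [->|[/linked_bdry pq|/linked_bdry qp]].
  + by apply: linked_refl; apply: mulr_ge0 => //; apply: mulr_ge0 => //; exact: ltW.
  + by apply: (linked_sym hM bg) => //; exact: pq.
  + by apply: linked_le (qp hM); exact/le_LL/ltW.
- move=> p np; have [q Bq H] := mB' p np.
  have [i Ei Ex] := mkI (Negz (f' q)) q (conj Bq erefl).
  exists i; rewrite ?Ei // Ex.
  case: H => [->|[pq|qp]].
  + by apply: linked_refl; apply: mulr_ge0 => //; apply: mulr_ge0 => //; exact: ltW.
  + exact: (linked_sym hM bg).
  + by apply: linked_le qp; exact/le_LL/ltW.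
Qed.

End nets.

Lemma quarters (R : realType) (u a b : R) : 0 < u -> a <= u / 4 -> b <= u / 4 ->
  [/\ a <= u, a + b <= u, 2 * a <= u & 2 * a + b <= u].
Proof. by move=> *; split; lra. Qed.

(** * Counting the sets that meet a ball *)

Section multiplicity.
Context {R : realType} {T : topologicalType} {n : nat} (M : rmfd R T n.+1).
Context (R1 R2 R3 : R) (C' : nat -> R).
Hypotheses (hM : riemannian_manifold M) (bg : bounded_geometry M R1 R2 R3 C').
Local Notation L := (@metric_cst R n C').
Local Notation d := (box_size n R1 R2 R3).
Let L1 : 1 <= L := metric_cst_ge1 bg.
Let L0 : 0 <= L := metric_cst_ge0 bg.
Let Lpos : 0 < L := lt_le_trans ltr01 L1.
Context (e e' r s : R) (I : set int) (x : I -> T) (y : T).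
Hypotheses (hn : net M R2 e e' x) (e0 : 0 < e).
Hypotheses (small_r : forall j, (j <= 5)%N -> L ^+ j * r <= d / 4).
Hypotheses (small_s : forall j, (j <= 5)%N -> L ^+ j * s <= d / 4).
Let A := [set i : I | rball M y s `&` Uset M R2 x r i !=set0].

Let d0 : 0 < d. Proof. by have [] := box_sizeP bg. Qed.

Lemma etaE : L * (e / L) = e.
Proof. by rewrite mulrC divfK // gt_eqF. Qed.

(** A curve of length at most [s + L ^+ 2 * r] leads from [y] through the common point to the
    centre, so all centres lie in one box of the chart around [y]. Being separated by [e], their
    coordinates are separated by [e / L]. *)
Lemma mult_interior m : packs n.+1 d (e / L) m ->
  exists f : I -> nat, {in [set i | A i /\ ~~ (0 <= \val i)] &, injective f} /\
    forall i, A i -> ~~ (0 <= \val i) -> (f i < m)%N.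
Proof.
move=> Hm; have [P [D [k [g [v bc]]]]] := base_exists hM bg y.
have ex (i : I) : exists w, A i -> ~~ (0 <= \val i) -> clbox P v d w /\ x i = k w.
  have [[Ai ni]|no] := pselect (A i /\ ~~ (0 <= \val i)); last by exists 0 => *; case: no.
  have [z [[_ /rdist_linked yz]]] := Ai; rewrite /Uset (negbTE ni) => -[_ /rdist_linked xz].
  have h3 := small_r (j := 3) isT; have h1 := small_r (j := 1) isT.
  have h1s := small_s (j := 1) isT; rewrite expr1 in h1 h1s.
  have zx : linked M z (x i) (L * (L * r)) by apply: (linked_sym hM bg xz); case: (quarters d0 h1 h1).
  have yx := linked_trans yz zx.
  have bnd : L * (s + L * (L * r)) <= d.
    have -> : L * (s + L * (L * r)) = L * s + L ^+ 3 * r by ring.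
    by case: (quarters d0 h1s h3).
  have [w [wb _ xw]] := bc_escape hM L0 bc yx bnd.
  by exists w => _ _; split=> //; exact: clbox_le wb.
have [w Hw] := choice ex.
have [|i j [Ai pi] [Aj pj] wij|f [fi fm]] := Hm I [set i | A i /\ ~~ (0 <= \val i)] v w.
- by move=> i [Ai pi]; have [[_ H] _] := Hw i Ai pi.
- have [wi xi] := Hw i Ai pi; have [wj xj] := Hw j Aj pj.
  apply: (net_sepi hn pi pj); rewrite xi xj -[e]etaE.
  by apply: (bc_seg hM bc wi wj) => a; rewrite distrC.
exists f; split=> // i Ai ni; exact: fm.
Qed.

(* All the flow-out points [z i] near [y] are seen in the collar chart at the foot of one
   of them; there the flow lines are the vertical lines, so the feet are close as well. *)
Lemma mult_boundary m : packs n d (e / L) m ->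
  exists f : I -> nat, {in [set i | A i /\ 0 <= \val i] &, injective f} /\
    forall i, A i -> 0 <= \val i -> (f i < m)%N.
Proof.
have [_ R20 _ _] := bg_pos bg.
move=> Hm; have [[i0 [Ai0 p0]]|no] := pselect (exists i, A i /\ 0 <= \val i); last first.
  exists (fun=> 0%N); split=> [i j|i Ai pi]; last by exfalso; apply: no; exists i.
  by rewrite inE => h; exfalso; apply: no; exists i.
have exA i : A i -> 0 <= \val i -> exists z p t, [/\ linked M y z s, linked (bdry M) (x i) p r,
    boundary M p, 0 <= t < 2 * R2 / 3 & Kflow M p t z].
  move=> [z [[_ /rdist_linked yz]]] + pi; rewrite /Uset pi => -[p [t [[bp /rdist_linked xp] t0 Kf]]].
  by exists z, p, t; split=> //; rewrite -points_bdry.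
have h1s := small_s (j := 1) isT; have h3s := small_s (j := 3) isT; have h5s := small_s (j := 5) isT.
have h1 := small_r (j := 1) isT; have h3 := small_r (j := 3) isT.
rewrite expr1 in h1s h1.
have [z0 [q0 [t0 [yz0 _ bq0 t0R Kf0]]]] := exA i0 Ai0 p0.
have s0 := linked_ge0 yz0.
have [k ca] := collar_exists hM bg bq0.
have [g dc] := normal_dchart hM (collar_normal bg ca).
have t01 : 0 <= t0 <= 2 * R2 / 3 by case/andP: t0R => -> /ltW.
have cb := collar_base hM bg ca dc t01.
have z0E : k (ext 0 t0) = z0.
  apply: (Kflow_fun hM _ Kf0); have := ca_flow ca (z := ext 0 t0).
  rewrite base_ext height_ext ext00 (ca_center ca); apply.
  exact: (bc_in cb).
have [P [D [k1 [g1 [v bc]]]]] := base_exists hM bg y.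
have Ls : L * s <= d by case: (quarters d0 h1s h1s).
have zz z : linked M y z s -> linked M z0 z (L * (2 * (L * s))).
  move=> yz; have [w0 [w0b _ ->]] := bc_escape hM L0 bc yz0 Ls.
  have [w [wb _ ->]] := bc_escape hM L0 bc yz Ls.
  apply: (bc_seg hM bc); try exact: clbox_le Ls _ _.
  move=> a; have := (proj2 w0b) a; have := (proj2 wb) a; rewrite !ler_norml.
  by move=> /andP[a1 a2] /andP[b1 b2]; apply/andP; split; lra.
have ex (i : I) : exists u : 'rV[R]_n, A i -> 0 <= \val i ->
    (forall a, `|u 0 a| <= d) /\ x i = k (ext u 0).
  have [[Ai pi]|no] := pselect (A i /\ (0 <= \val i)); last by exists 0 => *; case: no.
  have [z [q [t [yz xq bq tR Kf]]]] := exA i Ai pi.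
  have b3 : L * (L * (2 * (L * s))) <= d.
    have -> : L * (L * (2 * (L * s))) = 2 * (L ^+ 3 * s) by ring.
    by case: (quarters d0 h3s h3s).
  rewrite -z0E in zz.
  have [w [wb Dw zw]] := bc_escape hM L0 cb (zz z yz) b3.
  rewrite zw in Kf.
  have tR2 : 0 <= t < R2 by case/andP: tR => -> /=; lra.
  have [qE tE] := ca_inj ca Dw bq tR2 Kf.
  have bw a : `|base w 0 a| <= L * (L * (2 * (L * s))).
    by have := (proj2 wb) (lift ord_max a); rewrite ext_lift mxE subr0 baseE.
  have q0q : linked M q0 q (L * (L * (L * (2 * (L * s))))).
    apply: linked_bdry => //; rewrite qE -{1}(ca_center ca) -ext00.
    apply: (collar_seg hM bg ca) => [a|a|a|]; last by do 4! (apply: mulr_ge0 => //).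
    - by rewrite mxE normr0 ltW.
    - exact: le_trans (bw a) b3.
    - by rewrite [X in _ - X]mxE subr0.
  have qx : linked M q (x i) (L * (L * r)).
    by apply: (linked_sym hM bg (linked_bdry hM xq)); case: (quarters d0 h1 h1).
  (* The longest chain: from the foot [q0] to the foot [q], then back along the boundary curve to
     the centre, read in coordinates. Its exponent 5 determines [rmax]. *)
  have b5 : L * (L * (L * (L * (2 * (L * s)))) + L * (L * r)) <= d.
    have -> : L * (L * (L * (L * (2 * (L * s)))) + L * (L * r)) = 2 * (L ^+ 5 * s) + L ^+ 3 * r by ring.
    by case: (quarters d0 h5s h3).
  have bxi : boundary M (x i) by have := net_center hn i; rewrite pi.
  have [u xu ub] := collar_escape hM bg ca bxi (linked_trans q0q qx) b5.
  by exists u => _ _; split=> // a; exact: le_trans (ub a) b5.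
have [u Hu] := choice ex.
have dd := ltW d0.
have [|i j [Ai pi] [Aj pj] uij|f [fi fm]] := Hm I [set i | A i /\ 0 <= \val i] 0 u.
- by move=> i [Ai pi] a; rewrite mxE subr0; exact: (proj1 (Hu i Ai pi)).
- have [ui xi] := Hu i Ai pi; have [uj xj] := Hu j Aj pj.
  apply: (net_sepb hn pi pj); rewrite xi xj -[e]etaE.
  apply: (collar_seg hM bg ca) => [a|a|a|]; try exact: ui; try exact: uj.
    by rewrite distrC.
  by apply: divr_ge0; exact: ltW.
exists f; split=> // i Ai pi; exact: fm.
Qed.

Lemma multiplicity m m' : packs n.+1 d (e / L) m -> packs n d (e / L) m' ->
  (A #<= `I_(m' + m))%card.
Proof.
move=> /mult_interior[f [fi fm]] /mult_boundary[f' [fi' fm']].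
apply: (@card_le_inj _ _ (fun i => if 0 <= \val i then f' i else (m' + f i)%N)).
  move=> i j; rewrite !inE => Ai Aj.
  case: ifPn => pi; case: ifPn => pj.
  - by apply: fi'; rewrite inE.
  - by move=> E; have := fm' i Ai pi; rewrite E ltnNge leq_addr.
  - by move=> E; have := fm' j Aj pj; rewrite -E ltnNge leq_addr.
  - by move=> /addnI; apply: fi; rewrite inE.
move=> i Ai; case: ifPn => pi; first by apply: ltn_addr; exact: fm'.
by rewrite ltn_add2l; exact: fm.
Qed.

End multiplicity.

Section coverings.
Context {R : realType} {T : topologicalType} {n : nat} (M : rmfd R T n.+1).
Context (R1 R2 R3 : R) (C' : nat -> R).
Hypotheses (hM : riemannian_manifold M) (bg : bounded_geometry M R1 R2 R3 C').
Local Notation L := (@metric_cst R n C').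
Local Notation d := (box_size n R1 R2 R3).
Context (e e' r : R) (I : set int) (x : I -> T).
Hypotheses (hn : net M R2 e e' x) (re : L * (L * e') < r) (ed : L * e' <= d).

(** A point of [N(R2 / 2)] flows out of a boundary point close to some boundary centre, with time at
    most [R2 / 2 < 2 * R2 / 3]; the other points are close to an interior centre. The lemma serves
    for the radii [r] and [r / 2]. *)
Lemma net_covers : covers (Uset M R2 x r).
Proof.
have [_ R20 _ _] := bg_pos bg; have L1 := metric_cst_ge1 bg.
apply/seteqP; split=> // y _; have [Ny|Ny] := pselect (Nset M (R2 / 2) y).
  have [p [t [bp /andP[t0 t1] Kf]]] := Ny.
  have [i pi xp] := net_covb hn bp; exists i => //; rewrite /Uset pi.
  have bx : boundary M (x i) by have := net_center hn i; rewrite pi.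
  exists p, t; split=> //; last by rewrite t0 /=; lra.
  split; first by rewrite points_bdry.
  have [H _] := linked_to_bdry hM bg bx bp xp ed.
  by apply: le_lt_trans (linked_rdist H) _; rewrite lte_fin.
have [i pi xy] := net_covi hn Ny; exists i => //; rewrite /Uset (negbTE pi); split.
  by have [_ -> _ _ _] := hM.
apply: le_lt_trans (linked_rdist xy) _; rewrite lte_fin.
by apply: le_lt_trans re; exact: (le_LL bg (linked_ge0 xy)).
Qed.

End coverings.

(** * The partition of unity *)

Definition vbox {R : realType} {n : nat} (P : pred 'I_n) (e : 'I_n -> R) : set 'rV[R]_n :=
  [set w | orth P w /\ forall k, `|w 0 k| <= e k].

Lemma vbox_compact (R : realType) n (P : pred 'I_n) (e : 'I_n -> R) : compact (vbox P e).
Proof.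
pose A (k : 'I_n) : set R := if P k then `[0, e k]%classic else `[- e k, e k]%classic.
have -> : vbox P e = [set w | forall k, A k (w ord0 k)].
  apply/seteqP; split=> w.
    move=> [Pw bw] k; have := bw k; rewrite ler_norml => /andP[b1 b2].
    by rewrite /A; case: ifP => Pk; rewrite /= in_itv /= ?b1 ?b2 ?andbT // Pw.
  move=> H; split=> k; have := H k; rewrite /A.
    by move=> + Pk; rewrite Pk /= in_itv /= => /andP[].
  rewrite ler_norml; case: ifP => Pk; rewrite /= in_itv //= => /andP[w0 we].
  by apply/andP; split=> //; lra.
apply: rV_compact => k; rewrite /A; case: ifP => _; exact: segment_compact.
Qed.

Definition transplant {R : realType} {T : Type} {n : nat} (D : set 'rV[R]_n)
    (k : 'rV[R]_n -> T) (g : T -> 'rV[R]_n) (eta : 'rV[R]_n -> R) (y : T) : R :=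
  if `[< (k @` D) y >] then eta (g y) else 0.

Section transplant.
Context {R : realType} {T : topologicalType} {n : nat} (M : rmfd R T n.+1).
Context (D Q : set 'rV[R]_n.+1) (k : 'rV[R]_n.+1 -> T) (g : T -> 'rV[R]_n.+1).
Context (eta : 'rV[R]_n.+1 -> R).
Hypotheses (hM : riemannian_manifold M) (dc : dchart M D k g).
Hypotheses (cQ : compact Q) (QD : Q `<=` D) (eta_sm : smooth_on setT eta).
Hypothesis eta_supp : forall w, D w -> ~ Q w -> eta w = 0.
Local Notation psi := (transplant D k g eta).

Lemma transplantE w : D w -> psi (k w) = eta w.
Proof.
move=> Dw; rewrite /transplant asboolT; last by exists w.
by have [_ _ _ K _] := dc; rewrite K.
Qed.

Lemma transplant_closed : closed (k @` Q).
Proof. by have [[hT _] _ _ _ _] := hM; have [[_ ck] _ _ _ _] := dc; exact: img_closed hT ck QD cQ. Qed.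

Lemma transplant0 y : ~ (k @` Q) y -> psi y = 0.
Proof.
move=> nQ; rewrite /transplant; case: asboolP => // -[w Dw wy]; rewrite -wy.
have [_ _ _ K _] := dc; rewrite K //; apply: eta_supp => // Qw; apply: nQ.
by exists w.
Qed.

Lemma transplant_supp : closure [set y | psi y != 0] `<=` k @` Q.
Proof.
have H : [set y | psi y != 0] `<=` k @` Q.
  by move=> y /eqP h; apply: contrapT => /transplant0.
by apply: subset_trans (closure_subset H) _; rewrite -(closure_id _).1 //; exact: transplant_closed.
Qed.

(** The image of the compact set [Q] is closed. So in any other chart the extended function is, near
    each point, either the bump in changed coordinates or zero. *)
Lemma transplant_local D' k' g' z : dchart M D' k' g' -> D' z ->
  (trans_dom D' k' D k z /\
   same_germ (trans_dom D' k' D k) (fun w => eta (g (k' w))) D' (psi \o k') z) \/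
  same_germ D' (fun=> 0) D' (psi \o k') z.
Proof.
move=> dc' Dz; have [Az|nAz] := pselect ((k @` D) (k' z)).
  left; split=> //; apply: filterS (trans_near dc' dc (conj Dz Az)) => w H.
  by split; [split=> h; apply/H|move=> [Dw Aw]; rewrite /= /transplant asboolT].
right; have nQ : ~ (k @` Q) (k' z) by move=> [w Qw h]; apply: nAz; exists w => //; exact: QD.
have oQ : open (~` (k @` Q)) by apply: closed_openC; exact: transplant_closed.
have [[_ ck'] _ _ _ _] := dc'.
apply: filterS (near_preim ck' oQ Dz nQ) => w H; split=> // Dw /=.
by rewrite transplant0 //; exact: H.
Qed.

Lemma transplant_smooth D' k' g' : dchart M D' k' g' -> smooth_on D' (psi \o k').
Proof.
move=> dc'; have [[gD' _] _ _ _ _] := dc'.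
apply: smooth_local => z Dz; have [[Sz H]|H] := transplant_local dc' Dz.
  exists (trans_dom D' k' D k), (fun w => eta (g (k' w))); split=> //.
  apply: (@smooth_comp R n.+1 n.+1 _ setT (fun w => g (k' w)) eta) => //.
  - exact: trans_good dc' dc.
  - exact: goodT.
  - by move=> j; exact: (dchart_trans j hM dc' dc).
by exists D', (fun=> 0); split=> //; exact: smooth_cst.
Qed.

End transplant.

(** The bump is bounded with its derivatives on the compact set [B], fixed beforehand and containing
    all domains [D]; the coordinate change adds only constants depending on [C]. Hence the result is
    uniform in the manifold and in both charts. *)
Lemma transplant_bound (R : realType) n (C : nat -> R) (eta : 'rV[R]_n.+1 -> R)
    (B : set 'rV[R]_n.+1) K : compact B -> smooth_on setT eta -> exists A : R,
  forall (T : topologicalType) (M : rmfd R T n.+1) D Q k g D' k' g' z,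
  riemannian_manifold M -> dchart M D k g -> dchart M D' k' g' ->
  bounded_metric M C D k -> bounded_metric M C D' k' ->
  compact Q -> Q `<=` D -> (forall w, D w -> ~ Q w -> eta w = 0) -> D `<=` B -> D' z ->
  bnd D' K A (transplant D k g eta \o k') z.
Proof.
move=> cB se; have [A0 HA0] := bnd_compact K cB se.
have [J HJ] := trans_bound n C K.-1; have [A HA] := bnd_comp n.+1 n.+1 K A0 J.
exists `|A| => T M D Q k g D' k' g' z hM dc dc' bm bm' cQ QD eQ DB Dz.
have [[gD _] _ _ _ _] := dc; have [[gD' _] _ _ _ _] := dc'.
have [[Sz H]|H] := transplant_local hM dc cQ QD eQ dc' Dz.
  apply: (bnd_germ Sz H); apply: bnd_le (ler_norm A) _.
  have [D1 _] := dchart_ginv dc (proj2 Sz).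
  apply: (HA (trans_dom D' k' D k) D (fun w => g (k' w)) eta z) => //.
  - exact: trans_good dc' dc.
  - by move=> w [_ Aw]; have [] := dchart_ginv dc Aw.
  - by move=> j; exact: (dchart_trans j hM dc' dc).
  - exact: smooth_setT.
  - by apply: bnd_setT => //; apply: HA0; exact: DB.
  - by move=> j i; exact: (HJ T M D' k' g' D k g z hM dc' dc bm' bm Sz i j).
apply: (bnd_germ Dz H); have := bnd_cst K (0 : R) gD' Dz; rewrite normr0.
by apply: bnd_le.
Qed.

(** * Dividing a locally finite family by its sum *)

Section normalization.
Context {R : realType} {T : topologicalType} {n : nat} (M : rmfd R T n.+1).
Context (I : choiceType) (U : I -> set T) (psi : I -> T -> R) (Mf : nat).
Hypotheses (hM : riemannian_manifold M).
Hypothesis psi01 : forall i y, 0 <= psi i y <= 1.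
Hypothesis psi_supp : forall i, closure [set y | psi i y != 0] `<=` U i.
Hypothesis psi_sm : forall i D k g, dchart M D k g -> smooth_on D (psi i \o k).
Hypothesis psi_one : forall y, exists i, psi i y = 1.
Hypothesis locfin : forall y : T, exists2 V : set T, nbhs y V &
  ([set i | V `&` U i !=set0] #<= `I_Mf)%card.

Definition total (y : T) : R := \sum_(i \in [set: I]) psi i y.
Definition normalized (i : I) (y : T) : R := psi i y * (total y)^-1.

(** Near [y0] one list of at most [Mf] indices accounts for the whole sum, for every family that
    vanishes wherever the functions [psi i] do. It serves for the bumps and for their normalizations
    alike. *)
Lemma local_sum (y0 : T) : exists (V : set T) (s : seq I),
  [/\ nbhs y0 V, open V, uniq s /\ (size s <= Mf)%N, (forall i y, V y -> psi i y != 0 -> i \in s) &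
  forall (h : I -> R) y, V y -> (forall i, psi i y = 0 -> h i = 0) ->
    \sum_(i \in [set: I]) h i = \sum_(i <- s) h i].
Proof.
have [V nV cV] := locfin y0; set A := [set i | _] in cV.
have fA : finite_set A by apply/finite_set_leP; exists Mf.
have inA i y : V y -> psi i y != 0 -> A i.
  move=> Vy p0; exists y; split=> //; apply: psi_supp; exact: subset_closure.
have VV : interior V `<=` V by exact: interior_subset.
exists (interior V), (finmap.enum_fset (fset_set A)); split.
- by apply: open_nbhs_nbhs; split; [exact: open_interior|exact: nV].
- exact: open_interior.
- by split; [exact: finmap.fset_uniq|exact: geq_card_fset_set].
- move=> i y /VV Vy p0; have := in_fset_set fA i; rewrite (_ : i \in A) //.
  by rewrite inE; exact: inA p0.
- move=> h y /VV Vy h0; rewrite -(fsbig_widen A) //; first exact: fsbig_finite.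
  move=> i [_ nAi] /=; apply: h0; apply/eqP/negPn/negP => p0; apply: nAi; exact: inA p0.
Qed.

Lemma total_sum (y0 : T) : exists (V : set T) (s : seq I),
  [/\ nbhs y0 V /\ open V, (size s <= Mf)%N & forall y, V y -> total y = \sum_(i <- s) psi i y].
Proof.
have [V [s [nV oV [us ss] _ H]]] := local_sum y0; exists V, s; split=> // y Vy.
exact: H Vy _.
Qed.

Lemma psi_le_total i y : psi i y <= total y.
Proof.
have [V [s [nV oV [us ss] iin H]]] := local_sum y; have Vy := nbhs_singleton nV.
have ge0 j : 0 <= psi j y by case/andP: (psi01 j y).
rewrite /total (H (psi^~ y) y Vy) //.
have [->|p0] := eqVneq (psi i y) 0; first by apply: sumr_ge0.
by rewrite (bigD1_seq i) ?(iin i y) //= lerDl; apply: sumr_ge0.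
Qed.

Lemma total_ge1 y : 1 <= total y.
Proof. by have [i <-] := psi_one y; exact: psi_le_total. Qed.

Lemma total_gt0 y : 0 < total y.
Proof. exact: lt_le_trans (total_ge1 y). Qed.

Lemma total_germ D k g z : dchart M D k g -> D z -> exists s : seq I,
  (size s <= Mf)%N /\ same_germ D (fun w => \sum_(i <- s) psi i (k w)) D (total \o k) z.
Proof.
move=> [[_ ck] _ _ _ _] Dz; have [V [s [[nV oV] ss H]]] := total_sum (k z).
exists s; split=> //; apply: filterS (near_preim ck oV Dz (nbhs_singleton nV)) => w Vw.
by split=> // Dw; rewrite /= H //; exact: Vw.
Qed.

Lemma total_smooth D k g : dchart M D k g -> smooth_on D (total \o k).
Proof.
move=> dc; have [[gD _] _ _ _ _] := dc; apply: smooth_local => z Dz.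
have [s [_ H]] := total_germ dc Dz.
exists D, (fun w => \sum_(i <- s) psi i (k w)); split=> //.
by apply: smooth_sum => // i; exact: psi_sm dc.
Qed.

Lemma normalized_smooth i D k g : dchart M D k g -> smooth_on D (normalized i \o k).
Proof.
move=> dc; have [[gD _] _ _ _ _] := dc.
apply: (smoothM (f := psi i \o k) (g := fun w => (total (k w))^-1)) => //; first exact: psi_sm dc.
apply: (smoothV (f := total \o k)) => //; last exact: total_smooth dc.
by move=> w _ /=; rewrite gt_eqF // total_gt0.
Qed.

Lemma normalized_neq0 i y : normalized i y != 0 -> psi i y != 0.
Proof. by apply: contraNneq => p0; rewrite /normalized p0 mul0r. Qed.

Lemma normalized_supp i : closure [set y | normalized i y != 0] `<=` U i.
Proof.
by apply: subset_trans (psi_supp (i := i)); apply: closure_subset => y; exact: normalized_neq0.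
Qed.

Lemma normalized_partition : partition_of_unity M U normalized.
Proof.
split.
- by move=> i j; exact: normalized_smooth (dchart_atlas j hM).
- move=> i y; have /andP[p0 _] := psi01 i y; have t0 := total_gt0 y.
  rewrite /normalized divr_ge0 ?(ltW t0) //= ler_pdivrMr // mul1r; exact: psi_le_total.
- exact: normalized_supp.
- move=> y; have [V nV cV] := locfin y; exists V => //.
  apply: (@sub_finite_set _ _ [set i | V `&` U i !=set0]).
    by move=> i [z [Vz cz]]; exists z; split=> //; exact: normalized_supp cz.
  by apply/finite_set_leP; exists Mf.
- move=> y; have [V [s [nV oV _ _ H]]] := local_sum y; have Vy := nbhs_singleton nV.
  rewrite (H (normalized^~ y) y Vy); last by move=> i p0; rewrite /normalized p0 mul0r.
  rewrite /normalized -mulr_suml -(H (psi^~ y) y Vy) //.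
  by rewrite divff // gt_eqF // total_gt0.
Qed.

End normalization.

(** The sum has locally at most [Mf] terms and is at least 1, which bounds the derivatives of its
    inverse by a constant depending on [Mf], [K] and [A]. *)
Lemma normalized_bound (R : realType) n (Mf K : nat) (A : R) : exists C : R,
  forall (T : topologicalType) (M : rmfd R T n.+1) (I : choiceType) (U : I -> set T)
    (psi : I -> T -> R) D k g i z,
  riemannian_manifold M ->
  (forall i y, 0 <= psi i y <= 1) -> (forall i, closure [set y | psi i y != 0] `<=` U i) ->
  (forall i D k g, dchart M D k g -> smooth_on D (psi i \o k)) ->
  (forall y, exists i, psi i y = 1) ->
  (forall y : T, exists2 V : set T, nbhs y V & ([set i | V `&` U i !=set0] #<= `I_Mf)%card) ->
  dchart M D k g -> D z -> (forall i, bnd D K A (psi i \o k) z) ->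
  bnd D K C (normalized psi i \o k) z.
Proof.
have [B HB] := bndV n.+1 K (A * Mf%:R).
exists (2 ^+ K * (A * B)) => T M I U psi D k g i z hM p01 psupp psm pone lf dc Dz bA.
have [[gD _] _ _ _ _] := dc.
have tsm := total_smooth psupp psm lf dc.
have A0 := bnd_ge0 (bA i).
apply: (bndM gD Dz (psm i D k g dc) (g := fun w => (total psi (k w))^-1)) => //.
  apply: (smoothV (f := total psi \o k)) => //.
  by move=> w _ /=; rewrite gt_eqF // (total_gt0 p01 psupp pone lf).
apply: (HB D (total psi \o k) z) => //; first by move=> w _; exact: (total_ge1 p01 psupp pone lf).
have [s [ss H]] := total_germ psupp lf dc Dz.
apply: (bnd_germ Dz H); apply: (@bnd_le _ _ _ _ (A * (size s)%:R)).
  by apply: ler_wpM2l => //; rewrite ler_nat.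
by apply: bnd_sum => // j; exact: psm dc.
Qed.

Lemma prod_itv01 (R : realType) (I : Type) (s : seq I) (F : I -> R) :
  (forall i, 0 <= F i <= 1) -> 0 <= \prod_(i <- s) F i <= 1.
Proof.
move=> H; elim: s => [|i s /andP[h0 h1]]; first by rewrite big_nil ler01 lexx.
have /andP[f0 f1] := H i; rewrite big_cons mulr_ge0 //=.
by rewrite -[leRHS](mulr1 1); apply: ler_pM.
Qed.

(** * Model bump functions in normal coordinates *)

Section bumps.
Context {R : realType} {n : nat} (rho R2 : R).

(** A cut-off in the square of [t], so that it is smooth and depends on the absolute value only: 1
    up to [rho] and 0 from [2 * rho] on. *)
Definition sqcut (t : R) : R := cut (rho * rho) (4 * (rho * rho)) (t * t).
Definition eta_gauss (w : 'rV[R]_n.+1) : R := \prod_(k < n.+1) sqcut (w 0 k).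
(** The vertical factor is 1 up to [R2 / 2], since the boundary sets must take care of all of
    [N(R2 / 2)], and 0 from [3 * R2 / 5 < 2 * R2 / 3] on, so that the support stays in [Z]. *)
Definition eta_collar (w : 'rV[R]_n.+1) : R :=
  (\prod_(l < n) sqcut (w 0 (lift ord_max l))) * cut (R2 / 2) (3 * R2 / 5) (w 0 ord_max).
Definition Q_gauss : set 'rV[R]_n.+1 := vbox xpred0 (fun=> 2 * rho).
Definition Q_collar : set 'rV[R]_n.+1 :=
  vbox (pred1 ord_max) (fun k => if unlift ord_max k is Some _ then 2 * rho else 3 * R2 / 5).

Hypotheses (rho0 : 0 < rho) (R20 : 0 < R2).

Let rho2 : rho * rho < 4 * (rho * rho).
Proof. by have : 0 < rho * rho; [exact: mulr_gt0|lra]. Qed.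
Let R2h : R2 / 2 < 3 * R2 / 5.
Proof. by move: R20 => h; rewrite ltr_pdivlMr // mulrAC ltr_pdivrMr //; lra. Qed.

Lemma sqcut01 t : 0 <= sqcut t <= 1.
Proof. by rewrite /sqcut cut_ge0 ?cut_le1. Qed.

Lemma sqcut1 t : `|t| <= rho -> sqcut t = 1.
Proof. by move=> H; apply: cut_eq1 => //; move: H; rewrite ler_norml => /andP[a b]; nra. Qed.

Lemma sqcut0 t : 2 * rho < `|t| -> sqcut t = 0.
Proof.
move=> H; apply: cut_eq0; rewrite -[t * t]expr2 -[t ^+ 2]real_normK ?num_real // expr2.
have : 2 * rho * (2 * rho) <= `|t| * `|t| by apply: ler_pM; rewrite ?ltW // mulr_gt0.
lra.
Qed.

Lemma smooth_sqcut k : smooth_on setT (fun w : 'rV[R]_n.+1 => sqcut (w 0 k)).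
Proof.
apply: smooth_cut => //; first exact: goodT.
by apply: smoothM; try apply: smooth_coord; exact: goodT.
Qed.

Lemma eta_gauss_smooth : smooth_on setT eta_gauss.
Proof. by apply: smooth_prod => [|k]; [exact: goodT|exact: smooth_sqcut]. Qed.

Lemma eta_collar_smooth : smooth_on setT eta_collar.
Proof.
apply: smoothM; first exact: goodT.
  by apply: smooth_prod => [|k]; [exact: goodT|exact: smooth_sqcut].
by apply: smooth_cut => //; [exact: goodT|apply: smooth_coord; exact: goodT].
Qed.

Lemma eta_gauss01 w : 0 <= eta_gauss w <= 1.
Proof. by apply: prod_itv01 => k; exact: sqcut01. Qed.

Lemma eta_collar01 w : 0 <= eta_collar w <= 1.
Proof.
have /andP[a0 a1] := prod_itv01 (index_enum 'I_n) (fun l => sqcut01 (w 0 (lift ord_max l))).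
have c0 := cut_ge0 (w 0 ord_max) R2h; have c1 := cut_le1 (w 0 ord_max) R2h.
by rewrite /eta_collar mulr_ge0 //= -[leRHS](mulr1 1); apply: ler_pM.
Qed.

Lemma eta_gauss_out w : ~ Q_gauss w -> eta_gauss w = 0.
Proof.
move=> nQ; have [k Hk] : exists k, 2 * rho < `|w 0 k|.
  apply: contrapT => nk; apply: nQ; split=> // k; rewrite leNgt; apply/negP => h.
  by apply: nk; exists k.
by rewrite /eta_gauss (bigD1 k) //= sqcut0 // mul0r.
Qed.

Lemma eta_collar_out w : orth (pred1 ord_max) w -> ~ Q_collar w -> eta_collar w = 0.
Proof.
move=> Pw nQ; have [k Hk] : exists k, (if unlift ord_max k is Some _ then 2 * rho else 3 * R2 / 5) < `|w 0 k|.
  apply: contrapT => nk; apply: nQ; split=> // k; rewrite leNgt; apply/negP => h.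
  by apply: nk; exists k.
move: Hk; case: (unliftP ord_max k) => [l ->|->] Hk; rewrite /eta_collar.
  by rewrite (bigD1 l) //= sqcut0 // !mul0r.
by rewrite [cut _ _ _]cut_eq0 ?mulr0 // -(ger0_norm (Pw ord_max (eqxx _))) ltW.
Qed.

Lemma eta_gauss1 (w : 'rV[R]_n.+1) : (forall k, `|w 0 k| <= rho) -> eta_gauss w = 1.
Proof. by move=> H; rewrite /eta_gauss big1 // => k _; exact: sqcut1. Qed.

Lemma eta_collar1 (u : 'rV[R]_n) t : (forall l, `|u 0 l| <= rho) -> t <= R2 / 2 ->
  eta_collar (ext u t) = 1.
Proof.
move=> H t2; rewrite /eta_collar ext_max cut_eq1 // mulr1 big1 // => l _.
by rewrite ext_lift; exact: sqcut1.
Qed.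

End bumps.

(** * The bumps attached to a net *)

Section family.
Context {R : realType} {T : Type} {n : nat}.
Context (rho R1 R2 R3 : R) (I : set int) (k : I -> 'rV[R]_n.+1 -> T) (g : I -> T -> 'rV[R]_n.+1).

Definition fam_dom (i : I) : set 'rV[R]_n.+1 :=
  if 0 <= \val i then cylinder (R1 / 2) R2 else eball (rgauss R2 R3).
Definition fam_eta (i : I) : 'rV[R]_n.+1 -> R :=
  if 0 <= \val i then eta_collar rho R2 else eta_gauss rho.
Definition fam_Q (i : I) : set 'rV[R]_n.+1 :=
  if 0 <= \val i then Q_collar rho R2 else Q_gauss rho.
Definition fam (i : I) : T -> R := transplant (fam_dom i) (k i) (g i) (fam_eta i).

End family.

(** Only two model bumps occur, one for each sign of the index, so the maximum of two constants
    serves for the whole family. *)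
Lemma fam_bound (R : realType) n (C : nat -> R) (R1 R2 R3 rho : R) K : 0 < rho -> 0 < R1 -> 0 < R2 ->
  exists A : R, forall (T : topologicalType) (M : rmfd R T n.+1) (I : set int)
    (k : I -> 'rV[R]_n.+1 -> T) (g : I -> T -> 'rV[R]_n.+1) (i : I) D' k' g' z,
  riemannian_manifold M -> dchart M (fam_dom R1 R2 R3 i) (k i) (g i) -> dchart M D' k' g' ->
  bounded_metric M C (fam_dom R1 R2 R3 i) (k i) -> bounded_metric M C D' k' ->
  @fam_Q R n rho R2 I i `<=` fam_dom R1 R2 R3 i -> D' z ->
  bnd D' K A (fam rho R1 R2 R3 k g i \o k') z.
Proof.
move=> rho0 R10 R20.
pose B : set 'rV[R]_n.+1 := clbox xpred0 0 (Num.max (R1 / 2) (Num.max R2 (rgauss R2 R3))).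
have cB : compact B by exact: clbox_compact.
have cylB : @cylinder R n (R1 / 2) R2 `<=` B.
  move=> w [/eball_coord wb /andP[h0 h1]]; split=> // a; rewrite mxE subr0.
  case: (unliftP ord_max a) => [l ->|->].
    by have := ltW (wb l); rewrite baseE => h; apply: le_trans h _; rewrite le_max lexx.
  by rewrite -/(height w) ger0_norm // !le_max (ltW h1) !orbT.
have ebB : @eball R n.+1 (rgauss R2 R3) `<=` B.
  move=> w /eball_coord wb; split=> // a; rewrite mxE subr0; apply: le_trans (ltW (wb a)) _.
  by rewrite !le_max lexx !orbT.
have [Ac Hc] := transplant_bound C K cB (eta_collar_smooth (n := n) rho0 R20).
have [Ag Hg] := transplant_bound C K cB (eta_gauss_smooth (n := n) rho0).
exists (Num.max Ac Ag) => T M I k g i D' k' g' z hM; rewrite /fam /fam_dom /fam_eta /fam_Q.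
case: ifP => _ dc dc' bm bm' QD Dz.
  apply: (@bnd_le _ _ _ _ Ac); first by rewrite le_max lexx.
  apply: (Hc T M _ (Q_collar rho R2) (k i) (g i) D' k' g' z) => //; first exact: vbox_compact.
  move=> w [_ /andP[h0 _]]; apply: eta_collar_out => // a /eqP ->; exact: h0.
apply: (@bnd_le _ _ _ _ Ag); first by rewrite le_max lexx orbT.
apply: (Hg T M _ (Q_gauss rho) (k i) (g i) D' k' g' z) => //; first exact: vbox_compact.
by move=> w _; exact: eta_gauss_out.
Qed.

Section net_family.
Context {R : realType} {T : topologicalType} {n : nat} (M : rmfd R T n.+1).
Context (R1 R2 R3 : R) (C' : nat -> R).
Hypotheses (hM : riemannian_manifold M) (bg : bounded_geometry M R1 R2 R3 C').
Local Notation L := (@metric_cst R n C').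
Local Notation d := (box_size n R1 R2 R3).
Context (e e' r : R) (I : set int) (x : I -> T).
Hypothesis hn : net M R2 e e' x.

Lemma net_charts : exists (k : I -> 'rV[R]_n.+1 -> T) (g : I -> T -> 'rV[R]_n.+1), forall i,
  (if 0 <= \val i then collar_at M (R1 / 2) R2 (x i) (k i)
   else gaussian_chart M (rgauss R2 R3) (k i) /\ k i 0 = x i) /\
  dchart M (fam_dom R1 R2 R3 i) (k i) (g i).
Proof.
have ex (i : I) : exists kg : ('rV[R]_n.+1 -> T) * (T -> 'rV[R]_n.+1),
  (if 0 <= \val i then collar_at M (R1 / 2) R2 (x i) kg.1
   else gaussian_chart M (rgauss R2 R3) kg.1 /\ kg.1 0 = x i) /\
  dchart M (fam_dom R1 R2 R3 i) kg.1 kg.2.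
  have := net_center hn i; rewrite /fam_dom; case: ifP => _ ci.
    have [k ca] := collar_exists hM bg ci.
    by have [g dc] := normal_dchart hM (collar_normal bg ca); exists (k, g).
  have [k gc] := gaussian_exists hM bg ci.
  by have [g dc] := normal_dchart hM (gaussian_normal bg (proj1 gc)); exists (k, g).
have [kg H] := choice ex.
by exists (fun i => (kg i).1), (fun i => (kg i).2).
Qed.

Context (k : I -> 'rV[R]_n.+1 -> T) (g : I -> T -> 'rV[R]_n.+1) (rho : R).
Hypothesis kgP : forall i,
  (if 0 <= \val i then collar_at M (R1 / 2) R2 (x i) (k i)
   else gaussian_chart M (rgauss R2 R3) (k i) /\ k i 0 = x i) /\
  dchart M (fam_dom R1 R2 R3 i) (k i) (g i).
Hypotheses (rho0 : 0 < rho) (rhoE : rho = L * e').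
Hypotheses (rho_d : 2 * rho <= d) (rho_r : L * (2 * rho) < r).

Let R20 : 0 < R2. Proof. by have [] := bg_pos bg. Qed.
Let rho_le : rho <= d. Proof. by apply: le_trans rho_d; move: rho0 => h; lra. Qed.

Lemma Q_collar_box (w : 'rV[R]_n.+1) : Q_collar rho R2 w ->
  (forall l, `|base w 0 l| <= 2 * rho) /\ 0 <= height w <= 3 * R2 / 5.
Proof.
move=> [wP wQ]; split=> [l|]; first by have := wQ (lift ord_max l); rewrite liftK baseE.
have h0 : 0 <= height w := wP ord_max (eqxx _).
by have := wQ ord_max; rewrite unlift_none -/(height w) ger0_norm // h0.
Qed.

Lemma Q_collar_cyl : @Q_collar R n rho R2 `<=` cylinder (R1 / 2) R2.
Proof.
move=> w /Q_collar_box[wb /andP[h0 h1]]; split.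
  by apply: (box_eball bg) => l; exact: le_trans (wb l) rho_d.
by rewrite h0 /=; move: R20 => h; apply: le_lt_trans h1 _; lra.
Qed.

Lemma fam_Q_dom i : @fam_Q R n rho R2 I i `<=` fam_dom R1 R2 R3 i.
Proof.
rewrite /fam_Q /fam_dom; case: ifP => _; first exact: Q_collar_cyl.
have [d0 d1 d2 d3] := box_sizeP bg.
move=> w [_ wQ]; apply: (eball_box (ltW d0) d3) => a; exact: le_trans (wQ a) rho_d.
Qed.

(** Coordinates of size at most [2 * rho] are reached from the centre by a segment of length at most
    [L * (2 * rho) < r]. For boundary centres this is done in the bottom face, and the flow then
    supplies the height. *)
Lemma fam_Q_Uset i : k i @` fam_Q rho R2 i `<=` Uset M R2 x r i.
Proof.
have [] := kgP i; rewrite /fam_Q /Uset /fam_dom; case: ifP => _.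
  move=> ca dc _ [w Qw <-]; have [wb /andP[h0 h1]] := Q_collar_box Qw.
  have wd l : `|base w 0 l| <= d by exact: le_trans (wb l) rho_d.
  exists (k i (ext (base w) 0)), (height w); split.
  - split; first by rewrite points_bdry; apply: (ca_bdry ca); exact: (box_eball bg wd).
    have [d0 _ _ _] := box_sizeP bg.
    have z0 l : `|(0 : 'rV[R]_n) 0 l| <= d by rewrite mxE normr0 ltW.
    have := collar_seg hM bg ca z0 wd (B := 2 * rho); rewrite ext00 (ca_center ca) => H.
    apply: le_lt_trans (linked_rdist (H _ _)) _; last by rewrite lte_fin.
      by move=> a; rewrite [X in _ - X]mxE subr0.
    by apply: mulr_ge0 => //; exact: ltW.
  - by rewrite h0 /=; move: R20 => h; apply: le_lt_trans h1 _; lra.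
  - by apply: (ca_flow ca); exact: Q_collar_cyl.
move=> [gc k0] dc _ [w [_ wQ] <-].
have bc := gaussian_base hM bg gc k0 dc.
have [d0 _ _ _] := box_sizeP bg.
split; first by have [_ -> _ _ _] := hM.
have H : linked M (k i 0) (k i w) (L * (2 * rho)).
  apply: (bc_seg hM bc); first by apply: (bc_center_box bc); exact: ltW.
    by split=> // a; rewrite mxE subr0; exact: le_trans (wQ a) rho_d.
  by move=> a; rewrite [X in _ - X]mxE subr0.
by rewrite -k0; apply: le_lt_trans (linked_rdist H) _; rewrite lte_fin.
Qed.

Local Notation psi := (fam rho R1 R2 R3 k g).

(** Some centre is joined to the point, or to its foot, by a curve of length [e']. Its coordinates
    are then at most [L * e' = rho], where the bump equals 1. *)
Lemma fam_one y : exists i, psi i y = 1.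
Proof.
have [Ny|Ny] := pselect (Nset M (R2 / 2) y).
  have [p [t [bp /andP[t0 t1] Kf]]] := Ny.
  have [i pi xp] := net_covb hn bp; exists i.
  have [] := kgP i; rewrite /fam /fam_dom /fam_eta pi => ca dc.
  have [|u pu ub] := collar_escape hM bg ca bp xp; first by rewrite -rhoE.
  rewrite -rhoE in ub.
  have ud l : `|u 0 l| <= d by exact: le_trans (ub l) rho_le.
  have Du : cylinder (R1 / 2) R2 (ext u t).
    split; rewrite ?base_ext ?height_ext; first exact: (box_eball bg ud).
    by rewrite t0 /=; move: R20 => h; apply: le_lt_trans t1 _; lra.
  have -> : y = k i (ext u t).
    apply: (Kflow_fun hM Kf); have := ca_flow ca Du.
    by rewrite base_ext height_ext -pu.
  rewrite (transplantE _ dc) //; exact: eta_collar1.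
have [i pi xy] := net_covi hn Ny; exists i.
have [] := kgP i; rewrite /fam /fam_dom /fam_eta (negbTE pi) => -[gc k0] dc.
have bc := gaussian_base hM bg gc k0 dc.
have [|w [[_ wb] Dw ->]] := bc_escape hM (metric_cst_ge0 bg) bc xy; first by rewrite -rhoE.
rewrite (transplantE _ dc) //; apply: eta_gauss1 => // a.
by have := wb a; rewrite mxE subr0 rhoE.
Qed.

Lemma fam01 i y : 0 <= psi i y <= 1.
Proof.
rewrite /fam /transplant; case: ifP => _; last by rewrite lexx ler01.
by rewrite /fam_eta; case: ifP => _; [exact: eta_collar01|exact: eta_gauss01].
Qed.

Lemma fam_Q_compact i : compact (@fam_Q R n rho R2 I i).
Proof. by rewrite /fam_Q; case: ifP => _; exact: vbox_compact. Qed.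

Lemma fam_eta_smooth i : smooth_on setT (@fam_eta R n rho R2 I i).
Proof.
by rewrite /fam_eta; case: ifP => _; [exact: eta_collar_smooth|exact: eta_gauss_smooth].
Qed.

Lemma fam_eta_out i w : fam_dom R1 R2 R3 i w -> ~ fam_Q rho R2 i w -> @fam_eta R n rho R2 I i w = 0.
Proof.
rewrite /fam_dom /fam_Q /fam_eta; case: ifP => _; last by move=> _; exact: eta_gauss_out.
by move=> [_ /andP[h0 _]]; apply: eta_collar_out => // a /eqP ->; exact: h0.
Qed.

Lemma fam_supp i : closure [set y | psi i y != 0] `<=` Uset M R2 x r i.
Proof.
have [_ dc] := kgP i; apply: subset_trans (@fam_Q_Uset i).
rewrite /fam; apply: (transplant_supp hM dc (eta := fam_eta rho R2 i)).
- exact: fam_Q_compact.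
- exact: fam_Q_dom.
- exact: fam_eta_out.
Qed.

Lemma fam_smooth i D' k' g' : dchart M D' k' g' -> smooth_on D' (psi i \o k').
Proof.
have [_ dc] := kgP i; move=> dc'.
rewrite /fam; apply: (transplant_smooth hM dc (Q := fam_Q rho R2 i) (eta := fam_eta rho R2 i) _ _ _ _ dc').
- exact: fam_Q_compact.
- exact: fam_Q_dom.
- exact: fam_eta_smooth.
- exact: fam_eta_out.
Qed.

Lemma fam_normal i : normal_chart M R1 R2 R3 (fam_dom R1 R2 R3 i) (k i).
Proof.
have [] := kgP i; rewrite /fam_dom; case: ifP => _; first by move=> ca _; exact: (collar_normal bg ca).
by move=> [gc _] _; exact: (gaussian_normal bg gc).
Qed.

End net_family.

Lemma partition_bound (R : realType) n (C' : nat -> R) (R1 R2 R3 rho : R) (Mf K : nat) :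
  0 < rho -> 0 < R1 -> 0 < R2 -> exists2 C : R, 0 < C &
  forall (T : topologicalType) (M : rmfd R T n.+1) (e e' r : R) (I : set int) (x : I -> T)
    (k : I -> 'rV[R]_n.+1 -> T) (g : I -> T -> 'rV[R]_n.+1) D' k' i z,
  riemannian_manifold M -> bounded_geometry M R1 R2 R3 C' -> net M R2 e e' x ->
  (forall i, (if 0 <= \val i then collar_at M (R1 / 2) R2 (x i) (k i)
     else gaussian_chart M (rgauss R2 R3) (k i) /\ k i 0 = x i) /\
     dchart M (fam_dom R1 R2 R3 i) (k i) (g i)) ->
  rho = @metric_cst R n C' * e' -> 2 * rho <= box_size n R1 R2 R3 -> @metric_cst R n C' * (2 * rho) < r ->
  (forall y : T, exists2 V : set T, nbhs y V &
     ([set i | V `&` Uset M R2 x r i !=set0] #<= `I_Mf)%card) ->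
  normal_chart M R1 R2 R3 D' k' -> D' z ->
  bnd D' K C (normalized (fam rho R1 R2 R3 k g) i \o k') z.
Proof.
move=> rho0 R10 R20; have [A HA] := @fam_bound R n C' R1 R2 R3 rho K rho0 R10 R20.
have [C HC] := normalized_bound n Mf K A.
exists (1 + `|C|); first by apply: ltr_pwDl.
move=> T M e e' r I x k g D' k' i z hM bg hn kgP rhoE rd rr lf nc Dz.
have [g' dc'] := normal_dchart hM nc.
apply: (@bnd_le _ _ _ _ C); first by apply: le_trans (ler_norm C) _; rewrite lerDr.
apply: (HC T M I (Uset M R2 x r) _ D' k' g' i z hM) => //.
- by move=> j y; apply: (fam01 bg).
- by move=> j; exact: (fam_supp hM bg kgP).
- by move=> j D1 k1 g1 dc1; exact: (fam_smooth hM bg kgP rho0 rd j dc1).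
- by move=> y; exact: (fam_one hM bg hn kgP).
- move=> j; have [_ dcj] := kgP j; have ncj := fam_normal bg kgP j.
  apply: (HA T M I k g j D' k' g' z) => //; try exact: (normal_bounded hM bg).
  exact: (fam_Q_dom bg rd).
Qed.

(* The constants: [L] compares the two metrics, [d] is the size of the boxes, and
   [rho = L^3 e = r / (4 L)] is half of the size of the supports of the bumps. *)
Section constants.
Context {R : realType} (n : nat) (R1 R2 R3 : R) (C' : nat -> R).
Local Notation L := (@metric_cst R n C').
Local Notation d := (box_size n R1 R2 R3).

(** [L ^+ 5] is the largest power met in the count of overlapping boundary sets. The factor 4 makes
    each term at most [d / 4], so that sums such as [2 * (L ^+ 5 * s) + L ^+ 3 * r] stay below
    [d]. *)
Definition rmax : R := d / (4 * L ^+ 5).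

Hypotheses (R10 : 0 < R1) (R20 : 0 < R2) (R30 : 0 < R3) (C0 : 0 < C' 0%N).

Lemma box_size_gt0 : 0 < d.
Proof. by rewrite /box_size /rgauss divr_gt0 // !lt_min R30 !divr_gt0. Qed.

Lemma metric_cst_ge1_of_pos : 1 <= L.
Proof. by apply: mulr_ege1; [rewrite ler1n|rewrite lerDl ltW]. Qed.

Lemma metric_cst_gt0 : 0 < L. Proof. by apply: lt_le_trans metric_cst_ge1_of_pos. Qed.

Lemma rmax_gt0 : 0 < rmax.
Proof.
by apply: divr_gt0; [exact: box_size_gt0|apply: mulr_gt0 => //; apply: exprn_gt0; exact: metric_cst_gt0].
Qed.

Lemma small_pow (s : R) j : s < rmax -> (j <= 5)%N -> L ^+ j * s <= d / 4.
Proof.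
move=> sr j5; have L1 := metric_cst_ge1_of_pos; have L0 := metric_cst_gt0; have d0 := box_size_gt0.
have [s0|s0] := leP 0 s; last first.
  apply: (@le_trans _ _ 0); last by apply: divr_ge0 => //; exact: ltW.
  by apply: mulr_ge0_le0; [apply: exprn_ge0; exact: ltW|exact: ltW].
apply: (@le_trans _ _ (L ^+ 5 * s)).
  by apply: ler_wpM2r => //; apply: ler_weXn2l.
have -> : d / 4 = L ^+ 5 * rmax.
  rewrite /rmax; move: (lt0r_neq0 L0); move: (metric_cst C') (d) => l u l0; field.
  by rewrite l0.
by apply: ler_wpM2l; [apply: exprn_ge0; exact: ltW|exact: ltW].
Qed.

End constants.

Theorem proposition3p2 (R : realType) (n : nat) (R1 R2 R3 : R) (C' : nat -> R) :
  exists2 rm : R, 0 < rm & forall r : R, 0 < r < rm ->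
  exists (C : nat -> R) (Mf : nat), (forall K, 0 < C K) /\
  forall (T : topologicalType) (M : rmfd R T n.+1),
    riemannian_manifold M -> bounded_geometry M R1 R2 R3 C' ->
  exists (I : set int) (x : I -> T),
    [/\ covers (Uset M R2 x r),
        (forall i : I, if 0 <= \val i then boundary M (x i)
                       else ~ Nset M (R2 / 2) (x i)),
        (forall (s : R) (y : T), s < rm ->
           ([set i : I | rball M y s `&` Uset M R2 x r i !=set0]%classic #<= `I_Mf)%card),
        covers (Uset M R2 x (r / 2))
      & exists phi : I -> T -> R,
          partition_of_unity M (Uset M R2 x r) phi /\
          forall D kappa, normal_chart M R1 R2 R3 D kappa ->
          forall (i : I) (K : nat) (alpha : 'I_n.+1 -> nat),
            (order_of alpha <= K)%N ->
          forall z, D z -> `|Dalpha D alpha (phi i \o kappa) z| <= C K].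
Proof.
(* The radius has to be chosen before any manifold is given. If one of these numbers is not
   positive, no manifold has bounded geometry with them and every choice will do. *)
have [[R10 R20 R30 C0]|npos] := pselect [/\ 0 < R1, 0 < R2, 0 < R3 & 0 < C' 0%N]; last first.
  exists 1 => // r _; exists (fun=> 1), 0%N; split=> // T M _ /bg_pos[? ? ? ?].
  by exfalso; apply: npos.
set L := @metric_cst R n C'; set d := box_size n R1 R2 R3.
have L1 : 1 <= L by exact: metric_cst_ge1_of_pos.
have L0 : 0 < L by exact: metric_cst_gt0.
have d0 : 0 < d by exact: box_size_gt0.
have rm0 : 0 < rmax n R1 R2 R3 C' by exact: rmax_gt0.
exists (rmax n R1 R2 R3 C') => // r /andP[r0 rr].
(* Chosen so that [L * rho = r / 4]: centres reach every point within [r / 2], and supports, of size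
   [2 * rho] in coordinates, stay within distance [r / 2 < r]. *)
pose e := r / (4 * L ^+ 4); pose e' := L * (L * e); pose rho := L * e'.
have p4 : 0 < 4 * L ^+ 4 by apply: mulr_gt0 => //; exact: exprn_gt0.
have e0 : 0 < e by exact: divr_gt0.
have rho0 : 0 < rho by do 3! (apply: mulr_gt0 => //).
have Lrho : L * rho = r / 4.
  by rewrite /rho /e' /e; move: (lt0r_neq0 L0); move: (L) => l l0; field; rewrite l0.
have sm j : (j <= 5)%N -> L ^+ j * r <= d / 4 by exact: small_pow.
have r4 : r <= d / 4 by have := sm 0%N isT; rewrite expr0 mul1r.
have grow (a : R) : 0 <= a -> a <= L * a by move=> a0; exact: ler_peMl.
have rho_le : rho <= r / 4 by rewrite -Lrho; apply: grow; exact: ltW.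
have e'rho : e' <= rho by apply: grow; do 2! (apply: mulr_ge0; first exact: ltW); exact: ltW.
have Lee' : L * e <= e' by apply: grow; apply: mulr_ge0; exact: ltW.
have Led : L * e <= d by apply: le_trans Lee' _; apply: le_trans e'rho _; lra.
have [m Hm] := packing n.+1 d (divr_gt0 e0 L0).
have [m' Hm'] := packing n d (divr_gt0 e0 L0).
pose Mf := (m' + m)%N.
have exC K := @partition_bound R n C' R1 R2 R3 rho Mf K rho0 R10 R20.
(* The bounds are selected here, before the manifold is introduced, so they depend on the dimension,
   the bounded geometry constants and [r] only. *)
pose C K := sval (cid2 (exC K)).
exists C, Mf; split; first by move=> K; rewrite /C; case: cid2.
move=> T M hM bg.
have [I [x hn]] := net_exists hM bg e0 Led.
have ed : L * e' <= d by apply: le_trans rho_le _; lra.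
have mult (s : R) (y : T) : s < rmax n R1 R2 R3 C' ->
    ([set i : I | rball M y s `&` Uset M R2 x r i !=set0]%classic #<= `I_Mf)%card.
  move=> ss; have sms j : (j <= 5)%N -> L ^+ j * s <= d / 4 by exact: small_pow.
  exact: (multiplicity hM bg y hn e0 sm sms Hm Hm').
have lf (y : T) : exists2 V : set T, nbhs y V &
    ([set i | V `&` Uset M R2 x r i !=set0] #<= `I_Mf)%card.
  (* The multiplicity estimate itself gives local finiteness: a metric ball of radius below [rmax]
     is a neighbourhood of its centre and meets at most [Mf] of the sets. *)
  exists (rball M y (rmax n R1 R2 R3 C' / 2)); last by apply: mult; lra.
  have r40 : 0 < rmax n R1 R2 R3 C' / 4 by apply: divr_gt0.
  apply: filterS (near_linked hM bg y r40) => z yz; split; first by have [_ -> _ _ _] := hM.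
  by apply: le_lt_trans (linked_rdist yz) _; rewrite lte_fin; lra.
have [k [g kgP]] := net_charts hM bg hn.
have rho2 : 2 * rho <= d by lra.
have Lrho2 : L * (2 * rho) < r by rewrite mulrCA Lrho; lra.
exists I, x; split=> //.
- by apply: (net_covers hM bg hn) => //; rewrite -/rho Lrho; lra.
- exact: net_center hn.
- by apply: (net_covers hM bg hn) => //; rewrite -/rho Lrho; lra.
exists (normalized (fam rho R1 R2 R3 k g)); split.
  apply: normalized_partition lf => //.
  - by move=> j y; apply: (fam01 bg).
  - by move=> j; exact: (fam_supp hM bg kgP).
  - by move=> j D1 k1 g1 dc1; exact: (fam_smooth hM bg kgP rho0 rho2 j dc1).
  - by move=> y; exact: (fam_one hM bg hn kgP).
move=> D kappa nc i K alpha aK z Dz; apply: bnd_Dalpha aK.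
rewrite /C; case: cid2 => c c0 /= Hc.
by apply: (Hc T M e e' r I x k g D kappa i z).
Qed.
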